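(* Let $\mathcal{C}$ be the class of graphs that do not contain a cycle with a unique chord. If $G\in\mathcal{C}$ then either $G$ is basic or $G$ can be obtained starting from basic graphs by repeated applications of the operations $\mathcal{O}_0,\mathcal{O}_1,\mathcal{O}_2,\mathcal{O}_3$. Conversely, every graph obtained in this way is in $\mathcal{C}$.
   Context: All graphs are finite and simple. A cycle in $G$ is a sequence of nodes $v_1v_2\ldots v_nv_1$ ($n\ge3$), distinct except for the first and last, with consecutive nodes adjacent; an edge of $G$ with both ends in the cycle that is not an edge of the cycle is a chord. $G$ does not contain a cycle with a unique chord if no cycle of $G$ has exactly one chord. A hole is a chordless cycle of length at least 4; a square is a hole of length 4. A 1-cutset of a connected graph is a node whose removal disconnects the graph. $N_G(v)$ and $d_G(v)$ denote neighborhood and degree of $v$ in $G$. A graph is basic if it is connected and is either a clique (complete graph), a hole of length at least 7, a strongly 2-bipartite graph, or (isomorphic to) an induced subgraph of the Petersen graph or of the Heawood graph. Strongly 2-bipartite: square-free and bipartite with bipartition $(X,Y)$ where $X$ is the set of all degree-2 nodes and $Y$ is the set of all nodes of degree at least 3. Petersen graph: nodes $a_1,\dots,a_5,b_1,\dots,b_5$, where $\{a_1,\dots,a_5\}$ and $\{b_1,\dots,b_5\}$ each induce a chordless 5-cycle in the natural order, and the only edges between the $a_i$'s and $b_i$'s are $a_1b_1,a_2b_4,a_3b_2,a_4b_5,a_5b_3$. Heawood graph: nodes $a_1,\dots,a_{14}$ forming a Hamiltonian cycle in the natural order, the only other edges being $a_1a_{10},a_2a_7,a_3a_{12},a_4a_9,a_5a_{14},a_6a_{11},a_8a_{13}$.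 Each operation takes two node-disjoint graphs $G_1,G_2$ and outputs a graph $G$: $\mathcal{O}_0$: $G$ is the disjoint union of $G_1$ and $G_2$. $\mathcal{O}_1$: for some node $u$ of $G_1$ and some node $w$ of $G_2$, $G$ is obtained from the disjoint union of $G_1\setminus\{u\}$ and $G_2\setminus\{w\}$ by adding a new node $v$ and all edges between $v$ and $N_{G_1}(u)\cup N_{G_2}(w)$. $\mathcal{O}_2$: for some node $u$ of $G_1$ and some node $v$ of $G_2$ such that $N_{G_1}(u)$ and $N_{G_2}(v)$ are stable sets of size at least 2, $G$ is obtained from the disjoint union of $G_1\setminus\{u\}$ and $G_2\setminus\{v\}$ by adding all edges between $N_{G_1}(u)$ and $N_{G_2}(v)$. $\mathcal{O}_3$: for some degree-2 node $u$ of $G_1$ and some degree-2 node $v$ of $G_2$, neither of which is a 1-cutset, where $u$ has neighbors $u_1,u_2$ that are nonadjacent and $v$ has neighbors $v_1,v_2$ that are nonadjacent, and such that $(d_{G_1}(u_1)-1)+(d_{G_2}(v_1)-1)\ge 3$ and $(d_{G_1}(u_2)-1)+(d_{G_2}(v_2)-1)\ge 3$, $G$ is obtained from the disjoint union of $G_1\setminus\{u,u_1,u_2\}$ and $G_2\setminus\{v,v_1,v_2\}$ by adding new nodes $w_1,w_2$, all edges between $w_1$ and $(N_{G_1}(u_1)\setminus\{u\})\cup(N_{G_2}(v_1)\setminus\{v\})$, and all edges between $w_2$ and $(N_{G_1}(u_2)\setminus\{u\})\cup(N_{G_2}(v_2)\setminus\{v\})$. *)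

(* Defs.v *)
From HB Require Import structures.
From mathcomp Require Import all_boot.

Set Implicit Arguments.
Unset Strict Implicit.
Unset Printing Implicit Defensive.

(* The node set may be empty; the null graph counts as connected. *)
Record sgraph := SGraph {
  node :> finType;
  adj : rel node;
  adj_sym : symmetric adj;
  adj_irr : irreflexive adj }.

Definition iso (G H : sgraph) : Prop :=
  exists2 f : G -> H, bijective f & forall x y, adj (f x) (f y) = adj x y.

(* The graph whose edges are the pairs {x, y} with x <> y and r x y or r y x. *)
Section SymGraph.
Variables (T : finType) (r : rel T).
Definition sym_adj : rel T := fun x y => (x != y) && (r x y || r y x).
Fact sym_adj_sym : symmetric sym_adj.
Proof. by move=> x y; rewrite /sym_adj eq_sym orbC. Qed.
Fact sym_adj_irr : irreflexive sym_adj.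
Proof. by move=> x; rewrite /sym_adj eqxx. Qed.
Definition sym_graph : sgraph := SGraph sym_adj_sym sym_adj_irr.
End SymGraph.

Section Induced.
Variables (G : sgraph) (A : {set G}).
Definition induced_adj : rel {x : G | x \in A} := fun x y => adj (val x) (val y).
Fact induced_adj_sym : symmetric induced_adj.
Proof. by move=> x y; exact: adj_sym. Qed.
Fact induced_adj_irr : irreflexive induced_adj.
Proof. by move=> x; exact: adj_irr. Qed.
Definition induced : sgraph := SGraph induced_adj_sym induced_adj_irr.
End Induced.

Definition delete (G : sgraph) (S : {set G}) : sgraph := induced (~: S).

Definition connected (G : sgraph) : Prop :=
  forall x y : G, connect (@adj G) x y.

Section Basics.
Variable G : sgraph.

Definition nbh (x : G) : {set G} := [set y | adj x y].
Definition deg (x : G) : nat := #|nbh x|.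
Definition stable (S : {set G}) : Prop := {in S &, forall x y, ~~ adj x y}.

Definition one_cutset (x : G) : Prop :=
  connected G /\ ~ connected (delete [set x]).

(* The cycle v_1 v_2 ... v_n v_1 is given by the sequence v_1, ..., v_n. *)
Definition is_cycle (c : seq G) : Prop := ucycle (@adj G) c /\ 3 <= size c.

Definition chordal_pair (c : seq G) (x y : G) : bool :=
  [&& x \in c, y \in c, adj x y, y != next c x & x != next c y].

(* A chord is an undirected edge, hence a two-element set of nodes. *)
Definition chords (c : seq G) : {set {set G}} :=
  [set [set p.1; p.2] | p : G * G & chordal_pair c p.1 p.2].

Definition cycle_with_unique_chord (c : seq G) : Prop :=
  is_cycle c /\ #|chords c| = 1.

Definition hole (c : seq G) : Prop :=
  [/\ is_cycle c, chords c = set0 & 4 <= size c].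

Definition square (c : seq G) : Prop := hole c /\ size c = 4.
Definition square_free : Prop := forall c : seq G, ~ square c.

Definition bipartition (X Y : {set G}) : Prop :=
  [/\ X :|: Y = setT, X :&: Y = set0, stable X & stable Y].

Definition is_clique : Prop := forall x y : G, x != y -> adj x y.

Definition is_long_hole : Prop :=
  exists c : seq G, [/\ hole c, forall x, x \in c & 7 <= size c].

Definition strongly_2_bipartite : Prop :=
  square_free /\ bipartition [set x | deg x == 2] [set x | 3 <= deg x].

Definition induced_subgraph_of (H : sgraph) : Prop :=
  exists A : {set H}, iso G (induced A).

End Basics.
Arguments square_free G : clear implicits.
Arguments is_clique G : clear implicits.
Arguments is_long_hole G : clear implicits.
Arguments strongly_2_bipartite G : clear implicits.

Definition no_cycle_with_unique_chord (G : sgraph) : Prop :=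
  forall c : seq G, ~ cycle_with_unique_chord c.

(* inl i stands for a_(i+1) and inr j for b_(j+1); ordS is the cyclic
   successor. *)
Definition petersen : sgraph :=
  sym_graph (fun x y : 'I_5 + 'I_5 =>
    match x, y with
    | inl i, inl j => j == ordS i
    | inr i, inr j => j == ordS i
    | inl i, inr j =>
        (i.+1, j.+1) \in [:: (1, 1); (2, 4); (3, 2); (4, 5); (5, 3)]
    | inr _, inl _ => false
    end).

(* i stands for a_(i+1). *)
Definition heawood : sgraph :=
  sym_graph (fun i j : 'I_14 =>
    (j == ordS i) ||
    ((i.+1, j.+1) \in [:: (1, 10); (2, 7); (3, 12); (4, 9); (5, 14);
                          (6, 11); (8, 13)])).

Definition basic (G : sgraph) : Prop :=
  connected G /\
  [\/ is_clique G, is_long_hole G, strongly_2_bipartite G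
    | induced_subgraph_of G petersen \/ induced_subgraph_of G heawood].

Definition disjoint_union (G1 G2 : sgraph) : sgraph :=
  sym_graph (fun x y : G1 + G2 =>
    match x, y with
    | inl a, inl b => adj a b
    | inr a, inr b => adj a b
    | _, _ => false
    end).

(* None is the new node. *)
Definition add_node (G : sgraph) (S : {set G}) : sgraph :=
  sym_graph (fun x y : option G =>
    match x, y with
    | Some a, Some b => adj a b
    | None, Some b => b \in S
    | _, None => false
    end).

Definition add_all_edges (G : sgraph) (A B : {set G}) : sgraph :=
  sym_graph (fun x y : G => adj x y || (x \in A) && (y \in B)).

Section Remainder.
Variables (G1 G2 : sgraph) (S1 : {set G1}) (S2 : {set G2}).

Definition remainder : sgraph := disjoint_union (delete S1) (delete S2).

Definition fromL (A : {set G1}) : {set remainder} :=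
  [set z : remainder | if z is inl x then val x \in A else false].
Definition fromR (B : {set G2}) : {set remainder} :=
  [set z : remainder | if z is inr y then val y \in B else false].
End Remainder.

Definition O0 (G1 G2 G : sgraph) : Prop := iso G (disjoint_union G1 G2).

Definition O1 (G1 G2 G : sgraph) : Prop :=
  exists (u : G1) (w : G2),
    iso G (add_node (fromL [set u] [set w] (nbh u) :|:
                     fromR [set u] [set w] (nbh w))).

Definition O2 (G1 G2 G : sgraph) : Prop :=
  exists (u : G1) (v : G2),
    [/\ stable (nbh u) /\ 2 <= #|nbh u|,
        stable (nbh v) /\ 2 <= #|nbh v|
      & iso G (add_all_edges (fromL [set u] [set v] (nbh u))
                             (fromR [set u] [set v] (nbh v)))].

Section O3Graph.
Variables (G1 G2 : sgraph) (u u1 u2 : G1) (v v1 v2 : G2).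

Let S1 : {set G1} := [set u; u1; u2].
Let S2 : {set G2} := [set v; v1; v2].

Definition O3_nbh (x : G1) (y : G2) : {set remainder S1 S2} :=
  fromL S1 S2 (nbh x :\ u) :|: fromR S1 S2 (nbh y :\ v).

(* The inner new node is w_1, the outer one w_2; they are not adjacent. *)
Definition O3_graph : sgraph :=
  @add_node (add_node (O3_nbh u1 v1)) (Some @: O3_nbh u2 v2).
End O3Graph.

Definition O3 (G1 G2 G : sgraph) : Prop :=
  exists (u u1 u2 : G1) (v v1 v2 : G2),
    [/\ [/\ deg u = 2, nbh u = [set u1; u2], ~~ adj u1 u2 & ~ one_cutset u],
        [/\ deg v = 2, nbh v = [set v1; v2], ~~ adj v1 v2 & ~ one_cutset v],
        3 <= (deg u1 - 1) + (deg v1 - 1),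
        3 <= (deg u2 - 1) + (deg v2 - 1)
      & iso G (O3_graph u u1 u2 v v1 v2)].

Inductive obtained_from_basic : sgraph -> Prop :=
| obtained_basic G : basic G -> obtained_from_basic G
| obtained_O0 G1 G2 G : obtained_from_basic G1 -> obtained_from_basic G2 ->
    O0 G1 G2 G -> obtained_from_basic G
| obtained_O1 G1 G2 G : obtained_from_basic G1 -> obtained_from_basic G2 ->
    O1 G1 G2 G -> obtained_from_basic G
| obtained_O2 G1 G2 G : obtained_from_basic G1 -> obtained_from_basic G2 ->
    O2 G1 G2 G -> obtained_from_basic G
| obtained_O3 G1 G2 G : obtained_from_basic G1 -> obtained_from_basic G2 ->
    O3 G1 G2 G -> obtained_from_basic G.

(* Main.v *)
Require Import Defs.
From mathcomp Require Import all_boot.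
From mathcomp Require Import zify.

(* A graph has no cycle with a unique chord iff it is good: whenever xy is an
   edge and A, B are disjoint connected sets of nodes avoiding x and y, each
   adjacent to both x and y, there is an edge between A and B.  In this form the
   property passes to contractions, so the four operations preserve it and the
   blocks of a decomposition inherit it.  A good graph without a decomposition
   (disconnection, cutnode, triangle, square, proper 2-cutset) and with two
   adjacent nodes of degree at least 3 has a cycle with a chord, by Menger's
   theorem.  A shortest one has exactly two chords ac and bd; how the rest of the
   graph can attach to it is limited by minimality and by the absence of
   2-cutsets, until only induced subgraphs of the Petersen and Heawood graphs are
   left.  The finitely many attachments to a fixed pattern are excluded by listed
   certificates: an edge xy with two anticomplete sets A and B as above. *)

Set Implicit Arguments.
Unset Strict Implicit.
Unset Printing Implicit Defensive.

(** * Connected sets of nodes *)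

(** In the structural part a chordless path is a minimal connected set linking two sets. Cutting it
    at a node gives two pieces, either possibly empty, whose adjacencies are all known, so
    attachment arguments become Boolean evaluations over unions of pieces. [theta] by itself only
    says that there is a cycle with a chord; hence minimising over [theta] finds the shortest such
    cycle, and goodness supplies its second, crossing chord.

    Triangles and squares go first because a shortcut through one new node that does not shorten the
    cycle closes one of them. Both sides of a 2-cutset need two nodes because the block of a side
    gains a marker node and must still be smaller than the graph.

    The exceptional graphs arise from a node seeing two opposite rims of the cycle. Counting lengths
    leaves either four rims of one node, the Petersen graph less one node, or two opposite rims of
    two nodes, the Heawood graph less three nodes. If no node sees opposite rims, the Petersen graph
    less two adjacent nodes remains. *)

Section ConnectedSets.
Variable G : sgraph.
Implicit Types (A B C K S X Y : {set G}) (x y u v : G).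

Definition adj_in S : rel G := fun x y => [&& adj x y, x \in S & y \in S].

(** Boolean, so that [minset] and [maxset] apply. The empty set counts as connected, which lets the
    pieces of a cut path be empty. *)
Definition conn S := [forall x in S, forall y in S, connect (adj_in S) x y].

Definition touch A B := [exists x in A, exists y in B, adj x y].

Lemma connP S :
  reflect {in S &, forall x y, connect (adj_in S) x y} (conn S).
Proof.
apply: (iffP forall_inP) => [H x y xS yS|H x xS].
  by move/forall_inP: (H x xS) => /(_ y yS).
by apply/forall_inP => y yS; apply: H.
Qed.

Lemma touchP A B :
  reflect (exists x y, [/\ x \in A, y \in B & adj x y]) (touch A B).
Proof.
apply: (iffP exists_inP) => [[x xA /exists_inP[y yB xy]]|[x [y [xA yB xy]]]].
  by exists x, y.
by exists x => //; apply/exists_inP; exists y.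
Qed.

Lemma touchPn A B :
  reflect (forall x y, x \in A -> y \in B -> adj x y = false) (~~ touch A B).
Proof.
apply: (iffP negP) => [H x y xA yB|H /touchP[x [y [xA yB]]]].
  by apply/negP => xy; apply: H; apply/touchP; exists x, y.
by rewrite H.
Qed.

Lemma touch1 x y : touch [set x] [set y] = adj x y.
Proof.
apply/touchP/idP => [[? [? [/set1P-> /set1P-> ]]]//|xy].
by exists x, y; rewrite !inE.
Qed.

Lemma touchC A B : touch A B = touch B A.
Proof.
by apply/touchP/touchP => -[x [y [xA yB xy]]]; exists y, x; rewrite adj_sym.
Qed.

Lemma touchUl A B C : touch (A :|: B) C = touch A C || touch B C.
Proof.
apply/touchP/orP => [[x [y [/setUP[xA|xA] yB xy]]]|].
- by left; apply/touchP; exists x, y.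
- by right; apply/touchP; exists x, y.
by case=> /touchP[x [y [xA yB xy]]]; exists x, y; rewrite inE xA ?orbT.
Qed.

Lemma touchUr A B C : touch C (A :|: B) = touch C A || touch C B.
Proof. by rewrite touchC touchUl !(touchC C). Qed.

Lemma touch0l A : touch set0 A = false.
Proof. by apply/negbTE/touchPn => x y; rewrite inE. Qed.

Lemma touch0r A : touch A set0 = false.
Proof. by rewrite touchC touch0l. Qed.

Definition touchE := (touchUl, touchUr, touch0l, touch0r, touch1).

Lemma touchS A A' B B' :
  A \subset A' -> B \subset B' -> touch A B -> touch A' B'.
Proof.
move=> /subsetP sA /subsetP sB /touchP[x [y [xA yB xy]]].
by apply/touchP; exists x, y; rewrite sA ?sB.
Qed.

Lemma ntouchS A A' B B' :
  A \subset A' -> B \subset B' -> touch A' B' = false -> touch A B = false.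
Proof.
by move=> sA sB; apply: contraFF; apply: touchS.
Qed.

Lemma touch_neq0 A B : touch A B -> A != set0.
Proof. by move=> /touchP[x [_ [xA _ _]]]; apply/set0Pn; exists x. Qed.

Lemma touch1P x A : reflect (exists2 y, y \in A & adj x y) (touch [set x] A).
Proof.
apply: (iffP (touchP _ _)) => [[z [y [/set1P-> yA xy]]]|[y yA xy]].
  by exists y.
by exists x, y; rewrite !inE.
Qed.

Lemma adj_in_sym S : connect_sym (adj_in S).
Proof.
by apply: sym_connect_sym => x y; rewrite /adj_in adj_sym (andbC (x \in S)).
Qed.

Lemma connect_inS S S' x y :
  S \subset S' -> connect (adj_in S) x y -> connect (adj_in S') x y.
Proof.
move=> /subsetP sS; apply: connect_sub => u v /and3P[uv uS vS].
by apply: connect1; rewrite /adj_in uv !sS.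
Qed.

Lemma connect_in_mem S x y : connect (adj_in S) x y -> x \in S -> y \in S.
Proof.
move=> /connectP[p]; elim: p x => [x _ -> //|z p IH x /= /andP[xz zp] ylast xS].
by apply: IH zp ylast _; case/and3P: xz.
Qed.

Lemma conn_hub S x :
  x \in S -> {in S, forall y, connect (adj_in S) x y} -> conn S.
Proof.
move=> xS H; apply/connP => y z yS zS.
by apply: connect_trans (H z zS); rewrite adj_in_sym; apply: H.
Qed.

Lemma conn0 : conn set0.
Proof. by apply/connP => x y; rewrite inE. Qed.

Lemma conn1 x : conn [set x].
Proof. by apply/connP => y z /set1P-> /set1P->. Qed.

Lemma conn_touch A B : conn A -> conn B -> touch A B -> conn (A :|: B).
Proof.
move=> /connP cA /connP cB /touchP[x [y [xA yB xy]]].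
apply: (@conn_hub _ x); first by rewrite inE xA.
move=> z /setUP[zA|zB]; first exact: connect_inS (subsetUl _ _) (cA _ _ xA zA).
apply: (@connect_trans _ _ y); last exact: connect_inS (subsetUr _ _) (cB _ _ yB zB).
by apply: connect1; rewrite /adj_in xy !inE xA yB orbT.
Qed.

Lemma conn_meet A B x : conn A -> conn B -> x \in A -> x \in B -> conn (A :|: B).
Proof.
move=> /connP cA /connP cB xA xB.
apply: (@conn_hub _ x); first by rewrite inE xA.
move=> z /setUP[zA|zB]; first exact: connect_inS (subsetUl _ _) (cA _ _ xA zA).
exact: connect_inS (subsetUr _ _) (cB _ _ xB zB).
Qed.

(** The Boolean premise is vacuous as soon as one set is empty, so unions of possibly empty pieces
    need no case analysis. *)
Lemma conn_touch0 A B :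
  conn A -> conn B -> (A != set0) && (B != set0) ==> touch A B -> conn (A :|: B).
Proof.
have [->|A0] := eqVneq A set0; first by rewrite set0U.
have [->|B0] := eqVneq B set0; first by rewrite setU0.
exact: conn_touch.
Qed.

Lemma conn_cross A B x y :
  conn A -> x \in A -> y \in A -> x \in B -> y \notin B ->
  touch (A :&: B) (A :\: B).
Proof.
move=> /connP cA xA yA xB yB.
have /connectP[p] := cA _ _ xA yA.
elim: p x xA xB => [|z p IH] x xA xB /=.
  by move=> _ yx; move: yB; rewrite yx xB.
move=> /andP[/and3P[xz _ zA] zp] ylast.
have [zB|zB] := boolP (z \in B); first exact: IH zp ylast.
by apply/touchP; exists x, z; rewrite !inE xA xB zA zB.
Qed.

Definition comp S x : {set G} := [set y | connect (adj_in S) x y].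

Lemma comp_refl S x : x \in comp S x.
Proof. by rewrite inE. Qed.

Lemma comp_sub S x : x \in S -> comp S x \subset S.
Proof. by move=> xS; apply/subsetP => y; rewrite inE => /connect_in_mem; apply. Qed.

Lemma comp_closed S x y z :
  x \in S -> y \in comp S x -> z \in S -> adj y z -> z \in comp S x.
Proof.
move=> xS yC zS yz; move: (yC); rewrite !inE => /connect_trans; apply.
by apply: connect1; rewrite /adj_in yz zS (subsetP (comp_sub xS) _ yC).
Qed.

Lemma comp_conn S x : x \in S -> conn (comp S x).
Proof.
move=> xS; apply: (conn_hub (comp_refl S x)) => y; rewrite inE => /connectP[p].
elim/last_ind: p y => [y _ -> //|p z IH y]; rewrite rcons_path last_rcons.
move=> /andP[xp lz] ->; apply: connect_trans (IH _ xp erefl) (connect1 _).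
have lC : last x p \in comp S x by rewrite inE; apply/connectP; exists p.
case/and3P: lz => lz lS zS; rewrite /adj_in lz lC.
exact: comp_closed lC zS lz.
Qed.

Lemma comp_anti S x : x \in S -> touch (comp S x) (S :\: comp S x) = false.
Proof.
move=> xS; apply/negbTE/touchPn => y z yC /setDP[zS zC].
by apply: contraNF zC; apply: comp_closed.
Qed.

Lemma conn_comp S x y A :
  conn A -> A \subset S -> y \in A -> y \in comp S x -> A \subset comp S x.
Proof.
move=> /connP cA AS yA; rewrite inE => xy; apply/subsetP => z zA; rewrite inE.
apply: connect_trans xy _; exact: connect_inS AS (cA _ _ yA zA).
Qed.

Lemma comp_eq S x y : x \in S -> y \in comp S x -> comp S x = comp S y.
Proof.
move=> xS yC; apply/setP => z; rewrite !inE.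
apply: same_connect; first exact: adj_in_sym.
by move: yC; rewrite inE.
Qed.

Lemma comps_anti S x y :
  x \in S -> y \in S -> y \notin comp S x -> touch (comp S x) (comp S y) = false.
Proof.
move=> xS yS yC; apply: ntouchS (subxx _) _ (comp_anti xS).
apply/subsetP => z zC; rewrite inE (subsetP (comp_sub yS) _ zC) andbT.
apply: contra yC => zC'; rewrite (comp_eq xS zC') -(comp_eq yS zC).
exact: comp_refl.
Qed.

(** * Minimal connections *)

Definition links X Y A := [&& conn A, touch A X & touch A Y].

(** For single nodes [x] and [y] outside [A] this is the interior of a path from [x] to [y] that has
    no chord except possibly [xy]. No order of the nodes has to be carried along. *)
Definition minlink X Y A := minset (links X Y) A.

Lemma minlink_exists X Y A :
  conn A -> touch A X -> touch A Y -> exists2 B, minlink X Y B & B \subset A.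
Proof.
move=> cA AX AY.
have lA : links X Y A by rewrite /links cA AX AY.
by have [B mB BA] := minset_exists lA; exists B.
Qed.

Lemma minlink_links X Y A : minlink X Y A -> links X Y A.
Proof. exact: minsetp. Qed.

Lemma minlink_min X Y A B :
  minlink X Y A -> conn B -> touch B X -> touch B Y -> B \subset A -> B = A.
Proof. by move=> /minsetP[_ H] cB BX BY; apply: H; rewrite /links cB BX BY. Qed.

Lemma minlinkC X Y A : minlink X Y A -> minlink Y X A.
Proof.
move=> m; apply/minsetP; split.
  by have /and3P[? ? ?] := minlink_links m; apply/and3P.
by move=> B /and3P[cB BX BY]; apply: minlink_min m cB BY BX.
Qed.

(** A minimal link cut at the node [u]: [A1] is the side of [X], [A2] the side of [Y]. Equations
    such as [touch A1 X = (A1 != set0)] together with [split_uX] say that an empty side means that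
    [u] itself meets the target, so the ends of the path need no separate statement. *)
Record split_at X Y A u A1 A2 : Prop := SplitAt {
  split_eq : A = A1 :|: [set u] :|: A2;
  split_u1 : u \notin A1;
  split_u2 : u \notin A2;
  split_dis : [disjoint A1 & A2];
  split_c1 : conn A1;
  split_c2 : conn A2;
  split_12 : touch A1 A2 = false;
  split_X1 : touch A1 X = (A1 != set0);
  split_Y2 : touch A2 Y = (A2 != set0);
  split_Y1 : touch A1 Y = false;
  split_X2 : touch A2 X = false;
  split_u1t : touch [set u] A1 = (A1 != set0);
  split_u2t : touch [set u] A2 = (A2 != set0);
  split_uX : touch [set u] X = (A1 == set0);
  split_uY : touch [set u] Y = (A2 == set0);
  split_m1 : A1 != set0 -> minlink X [set u] A1;
  split_m2 : A2 != set0 -> minlink [set u] Y A2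
}.

(* The part of [A] on the side of [Z]: empty if [u] itself touches [Z], and
   otherwise a component of [A :\ u]. *)
Lemma side_exists A u Z : conn A -> u \in A -> touch A Z ->
  exists2 K : {set G}, K \subset A :\ u &
  [/\ conn K, touch K Z = (K != set0), touch [set u] K = (K != set0),
      touch [set u] Z = (K == set0) &
      K != set0 -> exists2 x, x \in A :\ u & K = comp (A :\ u) x].
Proof.
move=> cA uA AZ.
have [uZ|uZ] := boolP (touch [set u] Z).
  exists set0; first exact: sub0set.
  by rewrite eqxx touch0l touch0r; split; rewrite ?conn0.
have /touchP[x [z [xA zZ xz]]] := AZ.
have xu : x \in A :\ u.
  rewrite !inE xA andbT; apply: contraNneq uZ => <-.
  by apply/touch1P; exists z.
exists (comp (A :\ u) x); first exact: comp_sub.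
have K0 : comp (A :\ u) x != set0.
  by apply/set0Pn; exists x; apply: comp_refl.
rewrite K0 (negbTE K0); split => //.
- exact: comp_conn.
- by apply/touchP; exists x, z; rewrite comp_refl.
- have uK : u \notin comp (A :\ u) x.
    by apply/negP => /(subsetP (comp_sub xu)); rewrite !inE eqxx.
  have /touchP[s [t [/setIP[sA sK] /setDP[tA tK] st]]] :=
    conn_cross cA xA uA (comp_refl _ x) uK.
  apply/touch1P; exists s => //; rewrite adj_sym.
  suff /eqP<- : t == u by [].
  apply: contraNT tK => tu; apply: comp_closed sK _ st => //.
  by rewrite !inE tu.
- by exists x.
Qed.

(** The two sides with [u] already link [X] and [Y], so by minimality they exhaust [A]. If a side
    met both targets, in particular if both sides were the same component, it would be a link
    missing [u]. A smaller link inside one side would give, with [u] and the other side, a smaller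
    link inside [A]. *)
Lemma split_minlink X Y A u :
  minlink X Y A -> u \in A -> exists A1 A2, split_at X Y A u A1 A2.
Proof.
move=> m uA; have /and3P[cA AX AY] := minlink_links m.
have [A1 s1 [c1 tX1 tu1 tuX E1]] := side_exists cA uA AX.
have [A2 s2 [c2 tY2 tu2 tuY E2]] := side_exists cA uA AY.
have u1 : u \notin A1 by apply/negP => /(subsetP s1); rewrite !inE eqxx.
have u2 : u \notin A2 by apply/negP => /(subsetP s2); rewrite !inE eqxx.
have sA1 : A1 \subset A by apply: subset_trans s1 (subD1set _ _).
have sA2 : A2 \subset A by apply: subset_trans s2 (subD1set _ _).
have c1u : conn (A1 :|: [set u]).
  by apply: conn_touch0 (conn1 u) _ => //; rewrite touchC tu1; apply/implyP=> /andP[].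
have cu2 : conn ([set u] :|: A2).
  by apply: conn_touch0 (conn1 u) _ _ => //; rewrite tu2; apply/implyP=> /andP[].
have cU : conn (A1 :|: [set u] :|: A2).
  by apply: conn_touch0 => //; rewrite touchUl tu2; apply/implyP => /andP[_ ->]; rewrite orbT.
have AE : A = A1 :|: [set u] :|: A2.
  apply/esym/(minlink_min m) => //.
  - by rewrite !touchUl tX1 tuX; case: (A1 == set0).
  - by rewrite !touchUl tY2 tuY; case: (A2 == set0); rewrite ?orbT.
  - by rewrite !subUset sA1 sA2 sub1set uA.
have Y1 : touch A1 Y = false.
  apply/negbTE/negP => t1; have A10 := touch_neq0 t1.
  have /setP/(_ u) : A1 = A by apply: (minlink_min m) => //; rewrite tX1.
  by rewrite uA (negbTE u1).
have X2 : touch A2 X = false.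
  apply/negbTE/negP => t2; have A20 := touch_neq0 t2.
  have /setP/(_ u) : A2 = A by apply: (minlink_min m) => //; rewrite tY2.
  by rewrite uA (negbTE u2).
have D12 : A1 != set0 -> A2 != set0 -> [disjoint A1 & A2] /\ touch A1 A2 = false.
  move=> A10 A20; have [x xA x1] := E1 A10; have [y yA y2] := E2 A20.
  have yn : y \notin comp (A :\ u) x.
    apply/negP => yx; move: X2; rewrite y2 -(comp_eq xA yx) -x1 tX1 A10.
    by [].
  split; last by rewrite x1 y2 comps_anti.
  rewrite -setI_eq0 x1 y2; apply/eqP/setP => z; rewrite !in_setI in_set0.
  apply/negP => /andP[zx zy]; case/negP: yn.
  by rewrite (comp_eq xA zx) -(comp_eq yA zy) comp_refl.
exists A1, A2; split => //.
- have [->|A10] := eqVneq A1 set0; first by rewrite -setI_eq0 set0I.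
  have [->|A20] := eqVneq A2 set0; first by rewrite -setI_eq0 setI0.
  by case: (D12 A10 A20).
- have [->|A10] := eqVneq A1 set0; first by rewrite touch0l.
  have [->|A20] := eqVneq A2 set0; first by rewrite touch0r.
  by case: (D12 A10 A20).
- move=> A10; apply/minsetP; split; first by rewrite /links c1 tX1 A10 touchC tu1.
  move=> B /and3P[cB BX Bu] BA; apply/eqP; rewrite eqEsubset BA /=.
  have cB2 : conn (B :|: ([set u] :|: A2)).
    by apply: conn_touch => //; rewrite touchUr Bu.
  have := @minlink_min _ _ _ (B :|: ([set u] :|: A2)) m cB2.
  rewrite !touchUl BX tuY tY2 /=.
  have -> : touch B Y || ((A2 == set0) || (A2 != set0)) by case: eqP; rewrite ?orbT.
  rewrite !subUset (subset_trans BA sA1) sub1set uA sA2 => /(_ erefl erefl erefl) E.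
  have [d _] : [disjoint A1 & A2] /\ touch A1 A2 = false.
    have [->|A20] := eqVneq A2 set0; first by rewrite -setI_eq0 setI0 touch0r; split.
    exact: D12.
  apply/subsetP => z z1; have := subsetP sA1 z z1; rewrite -E !inE.
  case/or3P => // [/eqP zu|z2]; first by rewrite -zu z1 in u1.
  by move: (disjointFr d z1); rewrite z2.
- move=> A20; apply/minsetP; split; first by rewrite /links c2 tY2 touchC tu2 A20.
  move=> B /and3P[cB Bu BY] BA; apply/eqP; rewrite eqEsubset BA /=.
  have cB2 : conn (B :|: (A1 :|: [set u])).
    by apply: conn_touch => //; rewrite touchUr Bu orbT.
  have := @minlink_min _ _ _ (B :|: (A1 :|: [set u])) m cB2.
  rewrite !touchUl BY tuX tX1 /=.
  have -> : touch B X || ((A1 != set0) || (A1 == set0)) by case: eqP; rewrite ?orbT.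
  rewrite !subUset (subset_trans BA sA2) sub1set uA sA1 => /(_ erefl erefl erefl) E.
  have [d _] : [disjoint A1 & A2] /\ touch A1 A2 = false.
    have [->|A10] := eqVneq A1 set0; first by rewrite -setI_eq0 set0I touch0l; split.
    exact: D12.
  apply/subsetP => z z2; have := subsetP sA2 z z2; rewrite -E !inE.
  case/or3P => // [z1|/eqP zu]; last by rewrite -zu z2 in u2.
  by move: (disjointFr d z1); rewrite z2.
Qed.

End ConnectedSets.

(** * Unique chords in terms of connected sets *)

Section Theta.
Variable G : sgraph.
Implicit Types (A B C K S X Y : {set G}) (x y u v : G).

(** A cycle with the chord [xy]: shrinking [A] and [B] to minimal links gives its two arcs. Edges
    between [A] and [B] are not excluded, so there may be further chords. *)
Definition theta x y A B :=
  [&& adj x y, [&& conn A, conn B & [disjoint A & B]],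
      [&& x \notin A, y \notin A, x \notin B & y \notin B],
      touch [set x] A && touch [set y] A & touch [set x] B && touch [set y] B].

Definition good := forall x y A B, theta x y A B -> touch A B.

Definition consec (l : seq G) s t := exists l1 l2, l = l1 ++ s :: t :: l2.

Lemma consec_cons l z s t : consec l s t -> consec (z :: l) s t.
Proof. by case=> l1 [l2 ->]; exists (z :: l1), l2. Qed.

Lemma consec_next l s t : uniq l -> consec l s t -> next l s = t.
Proof.
move=> ul [l1 [l2 E]]; rewrite -(next_rot (size l1) ul) E rot_size_cat /=.
by rewrite eqxx.
Qed.

(** Induction peels off the node of [A] next to [x]. The last conjunct says that the path has no
    chord except possibly [xy]; both orientations of an edge occur, hence the two [consec]
    alternatives. *)
Lemma minlink_path x y A : minlink [set x] [set y] A -> x \notin A -> y \notin A ->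
  exists p, [/\ uniq p, p =i A, path (@adj G) x (rcons p y)
    & forall s t, s \in x :: p -> t \in rcons p y -> adj s t ->
      [\/ s = x /\ t = y, consec (x :: rcons p y) s t | consec (x :: rcons p y) t s]].
Proof.
have [n] := ubnP #|A|; elim: n x A => // n IH x A An m xA yA.
have /and3P[cA Ax Ay] := minlink_links m.
have /touchP[u [x' [uA /set1P-> ux]]] := Ax.
(* As [u] sees [x], its first side is empty and [A] is [u] followed by [A2]. *)
have [A1 [A2 sp]] := split_minlink m uA.
have A10 : A1 = set0 by apply/eqP; rewrite -(split_uX sp) touch1.
have AE := split_eq sp; rewrite A10 set0U in AE.
have xA2 z : z \in A2 -> adj x z = false.
  move=> zA; have /negbT/touchPn H := split_X2 sp.
  by rewrite adj_sym; apply: H; rewrite ?inE.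
have [A20|A20] := eqVneq A2 set0.
  have uy : adj u y by rewrite -touch1 (split_uY sp) A20 eqxx.
  exists [:: u]; split => //=.
  - by move=> z; rewrite AE A20 setU0 !inE.
  - by rewrite adj_sym ux uy.
  move=> s t; rewrite !inE => /orP[]/eqP-> /orP[]/eqP-> // st.
  - by constructor 2; exists [::], [:: y].
  - by constructor 1.
  - by move: st; rewrite adj_irr.
  by constructor 2; exists [:: x], [::].
have u2 := split_u2 sp.
have y2 : y \notin A2 by apply: contra yA => yA2; rewrite AE inE yA2 orbT.
have lt : #|A2| < n.
  rewrite -ltnS; apply: leq_trans An; rewrite ltnS.
  apply: proper_card; rewrite AE setUC; apply/properP.
  by split; [exact: subsetUl | exists u; rewrite ?inE ?eqxx ?orbT].
have [p [up pA2 path_p chp]] := IH u A2 lt (split_m2 sp A20) u2 y2.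
exists (u :: p); split.
- by rewrite /= up pA2 u2.
- by move=> z; rewrite AE !inE pA2.
- by rewrite /= adj_sym ux.
move=> s t; rewrite inE => /orP[/eqP->|sp'].
  rewrite rcons_cons inE => /orP[/eqP->|tp] st.
    by constructor 2; exists [::], (rcons p y).
  move: tp; rewrite mem_rcons inE => /orP[/eqP->|tp]; first by constructor 1.
  by move: st; rewrite xA2 // -pA2.
rewrite rcons_cons inE => /orP[/eqP->|tp] st.
  move: sp'; rewrite inE => /orP[/eqP su|sp'].
    by move: st; rewrite su adj_irr.
  have sr : s \in rcons p y by rewrite mem_rcons inE sp' orbT.
  rewrite adj_sym in st.
  case: (chp u s (mem_head _ _) sr st) => [[_ sy]|H|H].
  - by move: sp'; rewrite sy pA2 (negbTE y2).
  - by constructor 3; apply: consec_cons.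
  - by constructor 2; apply: consec_cons.
case: (chp s t sp' tp st) => [[su ty]|H|H].
- move: st; rewrite su ty -touch1 (split_uY sp) (negbTE A20) //.
- by constructor 2; apply: consec_cons.
- by constructor 3; apply: consec_cons.
Qed.

Lemma next_in_cat (l1 l2 : seq G) s z :
  uniq (l1 ++ z :: l2) -> s \in l1 -> next (l1 ++ z :: l2) s \in rcons l1 z.
Proof.
move=> ul sl; case/splitPr: sl ul => q1 [|t q2] ul.
  rewrite (@consec_next _ _ z) //; first by rewrite mem_rcons mem_head.
  by exists q1, l2; rewrite -catA.
rewrite (@consec_next _ _ t) //; last by exists q1, (q2 ++ z :: l2); rewrite -catA.
by rewrite mem_rcons !(inE, mem_cat) eqxx !orbT.
Qed.

Lemma cycle_split (x y : G) p q :
  uniq (x :: p ++ y :: q) -> [/\ uniq p, uniq q, [disjoint p & q] &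
   [&& x \notin p, x \notin q, y \notin p, y \notin q & x != y]].
Proof.
rewrite cons_uniq cat_uniq cons_uniq mem_cat inE !negb_or /=.
case/and4P => /and3P[xp xy xq] up /andP[yp /hasPn pq] /andP[yq uq].
split=> //; last by rewrite xp xq yp yq xy.
by rewrite disjoint_sym disjoint_has; apply/hasPn => z /pq.
Qed.

Lemma conn_path x p : path (@adj G) x p -> conn [set z in x :: p].
Proof.
elim: p x => [|y p IH] x /=.
  by move=> _; rewrite (_ : [set _ in _] = [set x]) ?conn1 //; apply/setP => z; rewrite !inE.
move=> /andP[xy yp].
rewrite (_ : [set _ in _] = [set x] :|: [set z in y :: p]); last first.
  by apply/setP => z; rewrite !inE.
apply: conn_touch (conn1 x) (IH _ yp) _.
by apply/touch1P; exists y; rewrite // !inE eqxx.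
Qed.

(** Without an edge between [A] and [B], minimal links inside them would be arcs with no edge
    across, and together with [x] and [y] they would form a cycle whose only chord is [xy]. *)
Lemma good_of_C : no_cycle_with_unique_chord G -> good.
Proof.
move=> H x y A B /and5P[xy /and3P[cA cB dAB] /and4P[xA yA xB yB]].
move=> /andP[tx ty] /andP[sx sy]; apply: contraT => nAB.
have [A' mA sA] : exists2 A', minlink [set x] [set y] A' & A' \subset A.
  by apply: minlink_exists cA _ _; rewrite touchC.
have [B' mB sB] : exists2 B', minlink [set y] [set x] B' & B' \subset B.
  by apply: minlink_exists cB _ _; rewrite touchC.
have xA' : x \notin A' by apply: contra xA; apply: (subsetP sA).
have yA' : y \notin A' by apply: contra yA; apply: (subsetP sA).
have xB' : x \notin B' by apply: contra xB; apply: (subsetP sB).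
have yB' : y \notin B' by apply: contra yB; apply: (subsetP sB).
have [p [up pA pp chp]] := minlink_path mA xA' yA'.
have [q [uq qB pq chq]] := minlink_path mB yB' xB'.
have pqD z : z \in p -> z \notin q.
  rewrite pA qB => /(subsetP sA) zA; apply/negP => /(subsetP sB).
  by rewrite (disjointFr dAB zA).
have pqN s t : s \in p -> t \in q -> adj s t = false.
  rewrite pA qB => /(subsetP sA) zA /(subsetP sB) zB.
  by move/touchPn: nAB; apply.
have nxy : x != y by apply: contraTneq xy => ->; rewrite adj_irr.
pose c := x :: p ++ y :: q.
have uc : uniq c.
  rewrite /c cons_uniq cat_uniq cons_uniq mem_cat inE !negb_or !pA xA' !qB xB' /=.
  rewrite nxy up uq yB' /= andbT yA' /=.
    by apply/hasPn => z zq; apply/negP => /pqD; rewrite zq.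
have cc : cycle (@adj G) c.
  rewrite /c /= rcons_cat /= cat_path; move: pp pq; rewrite /= !rcons_path.
  by move=> /andP[-> ->] /andP[-> ->].
have sc : 3 <= size c.
  rewrite /c /= size_cat /= addnS !ltnS.
  have : 0 < #|A'| by rewrite card_gt0 (@touch_neq0 _ _ [set x]) //; case/and3P: (minlink_links mA).
  rewrite -(eq_card pA) (card_uniqP up) => /leq_trans; apply; exact: leq_addr.
have conA s t : consec (x :: rcons p y) s t -> consec c s t.
  move=> [l1 [l2 E]]; exists l1, (l2 ++ q).
  by rewrite /c -(cat_rcons y p q) -(cat_cons x (rcons p y)) E -catA.
(* The second arc is read after rotating the cycle to start at [y], because its last successor wraps
   around to [x]. *)
have conB s t : consec (y :: rcons q x) s t -> t = next c s.
  move=> [l1 [l2 E]]; have ur : uniq (rot (size p).+1 c) by rewrite rot_uniq.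
  have Er : rot (size p).+1 c = y :: q ++ x :: p.
    by rewrite /c -cat_cons (rot_size_cat (x :: p)).
  rewrite -(next_rot (size p).+1 uc) Er; rewrite Er in ur; apply/esym/consec_next => //.
  by exists l1, (l2 ++ p); rewrite -(cat_rcons x q p) -(cat_cons y (rcons q x)) E -catA.
have mc z : (z \in c) = [|| z == x, z \in p, z == y | z \in q].
  by rewrite /c !inE mem_cat inE.
(* There are no edges between [p] and [q], so an edge has both ends on the path [x p y] or both on
   [y q x]; there only consecutive nodes and the two ends are adjacent. *)
have chE s t : chordal_pair c s t = ((s, t) == (x, y)) || ((s, t) == (y, x)).
  apply/idP/idP.
    move=> /and5P[sc1 tc st nst nts].
    have NA s' t' : consec (x :: rcons p y) s' t' -> next c s' = t'.
      by move=> h; apply: consec_next uc (conA _ _ h).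
    have KA s' t' : s' \in x :: p -> t' \in rcons p y -> adj s' t' ->
        [|| ((s', t') == (x, y)), t' == next c s' | s' == next c t'].
      move=> h1 h2 h3; case: (chp s' t' h1 h2 h3) => [[-> ->]|/NA->|/NA->].
      - by rewrite eqxx.
      - by rewrite eqxx orbT.
      - by rewrite eqxx !orbT.
    have KB s' t' : s' \in y :: q -> t' \in rcons q x -> adj s' t' ->
        [|| ((s', t') == (y, x)), t' == next c s' | s' == next c t'].
      move=> h1 h2 h3; case: (chq s' t' h1 h2 h3) => [[-> ->]|/conB->|/conB->].
      - by rewrite eqxx.
      - by rewrite eqxx orbT.
      - by rewrite eqxx !orbT.
    have ts := st; rewrite adj_sym in ts.
    have fin s' t' : [|| ((s', t') == (x, y)), t' == next c s' | s' == next c t'] || 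
        [|| ((s', t') == (y, x)), t' == next c s' | s' == next c t'] ->
        t' != next c s' -> s' != next c t' -> ((s', t') == (x, y)) || ((s', t') == (y, x)).
      by move=> h /negbTE n1 /negbTE n2; move: h; rewrite n1 n2 !orbF.
    have swap : ((t, s) == (x, y)) || ((t, s) == (y, x)) ->
       ((s, t) == (x, y)) || ((s, t) == (y, x)).
      by rewrite !xpair_eqE orbC ![(t == _) && _]andbC.
    have mr z r : (z \in rcons r y) = (z == y) || (z \in r) by rewrite mem_rcons inE.
    have mr' z r : (z \in rcons r x) = (z == x) || (z \in r) by rewrite mem_rcons inE.
    move: sc1 tc; rewrite !mc => /or4P[sx'|sx'|sx'|sx'] /or4P[tx'|tx'|tx'|tx'].
    - by move: st; rewrite (eqP sx') (eqP tx') adj_irr.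
    - by apply: fin => //; rewrite KA // ?mr ?inE ?sx' ?tx' ?orbT.
    - by rewrite (eqP sx') (eqP tx') eqxx.
    - by apply: swap; apply: fin => //; rewrite KB ?orbT // ?mr' ?inE ?sx' ?tx' ?orbT.
    - by apply: swap; apply: fin => //; rewrite KA // ?mr ?inE ?sx' ?tx' ?orbT.
    - by apply: fin => //; rewrite KA // ?mr ?inE ?sx' ?tx' ?orbT.
    - by apply: fin => //; rewrite KA // ?mr ?inE ?sx' ?tx' ?orbT.
    - by move: st; rewrite pqN.
    - by rewrite (eqP sx') (eqP tx') eqxx orbT.
    - by apply: swap; apply: fin => //; rewrite KA // ?mr ?inE ?sx' ?tx' ?orbT.
    - by move: st; rewrite (eqP sx') (eqP tx') adj_irr.
    - by apply: fin => //; rewrite KB ?orbT // ?mr' ?inE ?sx' ?tx' ?orbT.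
    - by apply: fin => //; rewrite KB ?orbT // ?mr' ?inE ?sx' ?tx' ?orbT.
    - by move: ts; rewrite pqN.
    - by apply: swap; apply: fin => //; rewrite KB ?orbT // ?mr' ?inE ?sx' ?tx' ?orbT.
    - by apply: fin => //; rewrite KB ?orbT // ?mr' ?inE ?sx' ?tx' ?orbT.
  (* A nonempty arc keeps [x] and [y] from being consecutive, so that [xy] is indeed a chord. *)
  have pn0 : next c x != y.
    have -> : next c x = head y p by rewrite /c /=; case: (p) => [|z p'] /=; rewrite eqxx.
    case E: p => [|z p'].
      have : 0 < #|A'| by rewrite card_gt0 (@touch_neq0 _ _ [set x]) //; case/and3P: (minlink_links mA).
      by rewrite -(eq_card pA) E card0.
    by apply: contraNneq yA' => <-; rewrite -pA E mem_head.
  have qn0 : next c y != x.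
    have -> : next c y = head x q.
      apply/esym/conB; case: (q) => [|z q']; first by exists [::], [::].
      by exists [::], (rcons q' x).
    case E: q => [|z q'].
      have : 0 < #|B'| by rewrite card_gt0 (@touch_neq0 _ _ [set x]) //; case/and3P: (minlink_links mB).
      by rewrite -(eq_card qB) E card0.
    by apply: contraNneq xB' => <-; rewrite -qB E mem_head.
  have yx := xy; rewrite adj_sym in yx.
  case/orP => /eqP[-> ->]; rewrite /chordal_pair !mc !eqxx !orbT /= ?xy ?yx /=.
    by rewrite eq_sym pn0 eq_sym qn0.
  by rewrite eq_sym qn0 eq_sym pn0.
case: (H c); split; first by split => //; rewrite /ucycle cc.
suff -> : chords c = [set [set x; y]] by rewrite cards1.
apply/setP => E; rewrite in_set1; apply/imsetP/eqP => [[[s t]]|->].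
  rewrite inE chE => /orP[]/eqP[-> ->] -> //=; exact: setUC.
by exists (x, y) => //; rewrite inE chE eqxx.
Qed.

(** The unique chord cuts the cycle into two nonempty arcs. The edge between them provided by [good]
    is a second chord, since the successor of a node of one arc stays in that arc or is an end of
    the first chord. *)
Lemma C_of_good : good -> no_cycle_with_unique_chord G.
Proof.
move=> gG c [[/andP[cc uc] _] /eqP/cards1P[E chE]].
have /imsetP[[x y]] : E \in chords c by rewrite chE set11.
rewrite inE /= => /and5P[xc yc xy nxy nyx] EE; subst E.
have chordE s t : chordal_pair c s t -> s \in [set x; y].
  move=> ch; have : [set s; t] \in chords c by apply/imsetP; exists (s, t); rewrite ?inE.
  by rewrite chE => /set1P <-; rewrite !inE eqxx.
have [i c' rc] := rot_to xc.
have yx : y != x by apply: contraTneq xy => ->; rewrite adj_irr.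
have : y \in c' by move: yc; rewrite -(mem_rot i) rc inE (negbTE yx).
move=> /splitPr yc'; case: yc' rc => p q rc.
have ur : uniq (x :: p ++ y :: q) by rewrite -rc rot_uniq.
have nr s : next c s = next (x :: p ++ y :: q) s by rewrite -rc next_rot.
have mr s : (s \in c) = (s \in x :: p ++ y :: q) by rewrite -rc mem_rot.
have cr : cycle (@adj G) (x :: p ++ y :: q) by rewrite -rc rot_cycle.
have [up uq dpq /and5P[xp xq yp yq _]] := cycle_split ur.
have ur2 : uniq (y :: q ++ x :: p).
  have := ur; rewrite -cat_cons -(rot_uniq (size (x :: p))) rot_size_cat.
  by [].
have nr2 s : next c s = next (y :: q ++ x :: p) s.
  rewrite nr -(next_rot (size (x :: p))) // -cat_cons rot_size_cat.
  by [].
have p0 : p != [::].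
  apply: contraNneq nxy => p0; rewrite nr p0 /= eqxx //.
have q0 : q != [::].
  apply: contraNneq nyx => q0; rewrite nr2 q0 /= eqxx //.
move: cr; rewrite /= rcons_cat cat_path /= => /and3P[px ly qx].
have cp : conn [set z in p].
  by case: p px {p0 rc ur nr mr up dpq xp yp ur2 nr2 ly} => [|z p] /= => [_|/andP[_ /conn_path]];
     rewrite // (_ : [set _ in _] = set0) ?conn0 //; apply/setP=> ?; rewrite !inE.
have cq : conn [set z in q].
  move: qx; rewrite rcons_path => /andP[qy _].
  by case: q qy {q0 rc ur nr mr uq dpq xq yq ur2 nr2} => [|z q] /= => [_|/andP[_ /conn_path]];
     rewrite // (_ : [set _ in _] = set0) ?conn0 //; apply/setP=> ?; rewrite !inE.
have : touch [set z in p] [set z in q].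
  apply: (gG x y); rewrite /theta xy cp cq !inE xp xq yp yq /=.
  have -> : [disjoint [set z in p] & [set z in q]].
    by rewrite -setI_eq0; apply/eqP/setP => z; rewrite !inE; apply/negP => /andP[/(disjointFr dpq)->].
  rewrite /=; apply/andP; split; apply/andP; split; apply/touch1P.
  - by case: p px {rc ur nr mr up dpq xp yp ur2 nr2 ly cp} p0 => // z p /= /andP[xz _] _; exists z; rewrite ?inE ?eqxx.
  - exists (last x p); last by rewrite adj_sym.
    by rewrite inE; case: (p) p0 => //= z p' _; rewrite mem_last.
  - move: qx; rewrite rcons_path => /andP[_ lx]; exists (last y q); last by rewrite adj_sym.
    by rewrite inE; case: (q) q0 => //= z p' _; rewrite mem_last.
  - by case: q qx {rc ur nr mr uq dpq xq yq ur2 nr2 cq} q0 => // z q /= /andP[xz _] _; exists z; rewrite ?inE ?eqxx.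
case/touchP => s [t []]; rewrite !inE => sp tq st.
have : s \in [set x; y].
  apply: (@chordE s t); rewrite /chordal_pair !mr !inE !mem_cat !inE sp tq st !orbT /=.
  apply/andP; split.
    have : next c s \in rcons (x :: p) y by rewrite nr; apply: (@next_in_cat (x :: p)); rewrite ?inE ?sp ?orbT.
    apply: contraTneq => <-; rewrite mem_rcons !inE (negbTE (memPn yq t tq)) (negbTE (memPn xq t tq)) /=.
    by rewrite (disjointFl dpq).
  have : next c t \in rcons (y :: q) x by rewrite nr2; apply: (@next_in_cat (y :: q)); rewrite ?inE ?tq ?orbT.
  apply: contraTneq => <-; rewrite mem_rcons !inE (negbTE (memPn yp s sp)) (negbTE (memPn xp s sp)) /=.
  by rewrite (disjointFr dpq).
by rewrite !inE (negbTE (memPn yp s sp)) (negbTE (memPn xp s sp)).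
Qed.

End Theta.

(** * Two disjoint connections *)

Section Menger.
Variable G : sgraph.
Implicit Types (A B C K L M S X Y : {set G}) (x y u v w : G).

Lemma adj_neq x y : adj x y -> x != y.
Proof. by apply: contraTneq => ->; rewrite adj_irr. Qed.

Lemma subset_notin A B x : A \subset B -> x \notin B -> x \notin A.
Proof. by move=> sAB; apply: contra; apply: (subsetP sAB). Qed.

Lemma disjointI A B : (forall z, z \in A -> z \notin B) -> [disjoint A & B].
Proof. by move=> H; rewrite disjoint_subset; apply/subsetP => z /H. Qed.

Lemma disjointN A B x : [disjoint A & B] -> x \in A -> x \notin B.
Proof. by move=> d xA; rewrite (disjointFr d xA). Qed.

Lemma comp_touch M u z :
  conn M -> u \in M -> z \in M :\ u -> touch (comp (M :\ u) z) [set u].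
Proof.
move=> cM uM zM.
have uK : u \notin comp (M :\ u) z.
  by apply/negP => /(subsetP (comp_sub zM)); rewrite !inE eqxx.
have zM' : z \in M by case/setD1P: zM.
have /touchP[s [t [/setIP[sA sK] /setDP[tA tK] st]]] :=
  conn_cross cM zM' uM (comp_refl _ z) uK.
rewrite touchC; apply/touch1P; exists s => //; rewrite adj_sym.
suff /eqP<- : t == u by [].
apply: contraNT tK => tu; apply: comp_closed sK _ st => //.
by rewrite !inE tu.
Qed.

Lemma conn_minlink M x w : conn M -> x \in M -> w \in M -> x != w -> ~~ adj x w ->
  exists2 L, minlink [set x] [set w] L & L \subset M :\: [set x; w].
Proof.
move=> cM xM wM xw nxw.
have xMw : x \in M :\ w by rewrite !inE xw.
have /touchP[y [w' [yC /set1P-> yw]]] := comp_touch cM wM xMw.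
have yx : y != x by apply: contraNneq nxw => <-.
have yCx : y \in comp (M :\ w) x :\ x by rewrite in_setD1 yx.
have tx := comp_touch (comp_conn xMw) (comp_refl _ x) yCx.
have [L mL sL] : exists2 L, minlink [set x] [set w] L &
    L \subset comp (comp (M :\ w) x :\ x) y.
  apply: minlink_exists => //; first exact: comp_conn.
  by apply/touchP; exists y, w; rewrite comp_refl set11.
exists L => //; apply: subset_trans sL _; apply/subsetP => z.
move=> /(subsetP (comp_sub yCx)) /setD1P[zx] /(subsetP (comp_sub xMw)).
by move=> /setD1P[zw zM]; rewrite !inE negb_or zx zw.
Qed.

(** Two internally disjoint paths from [x] to [w], each with an inner node. *)
Definition fan x w := exists A B,
  [/\ conn A, conn B, [disjoint A & B], [&& x \notin A, w \notin A, x \notin B & w \notin B]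
    & [&& touch A [set x], touch A [set w], touch B [set x] & touch B [set w]]].

Lemma fanI x w A B :
  conn A -> conn B -> [disjoint A & B] ->
  [&& x \notin A, w \notin A, x \notin B & w \notin B] ->
  [&& touch A [set x], touch A [set w], touch B [set x] & touch B [set w]] ->
  fan x w.
Proof. by move=> *; exists A, B. Qed.

(* [w] is hit by the first of the two connections to [v]. *)
Lemma fan_step_hit x v w A B :
  minlink [set x] [set v] A -> conn B -> [disjoint A & B] ->
  [&& x \notin A, v \notin A, x \notin B & v \notin B] ->
  touch B [set x] -> touch B [set v] -> adj v w -> v != x ->
  w \in A -> adj x w \/ fan x w.
Proof.
move=> mA cB dAB /and4P[xA vA xB vB] tBx tBv vw vx wA.
have [A1 [A2 sp]] := split_minlink mA wA.
have [A10|A10] := eqVneq A1 set0.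
  by left; rewrite adj_sym -touch1 (split_uX sp) A10 eqxx.
have sA1 : A1 \subset A by rewrite (split_eq sp) -setUA subsetUl.
right; apply: (@fanI _ _ A1 (B :|: [set v])).
- exact: split_c1 sp.
- exact: conn_touch (conn1 v) tBv.
- apply: disjointI => z zA1; rewrite !inE negb_or.
  have zA := subsetP sA1 z zA1; rewrite (disjointN dAB zA).
  by apply: contraTneq zA => ->.
- rewrite (subset_notin sA1) // (split_u1 sp) !inE !negb_or xB eq_sym vx.
  rewrite (disjointN dAB wA) eq_sym; exact: adj_neq.
- rewrite (split_X1 sp) A10 touchC (split_u1t sp) A10 !touchE tBx vw.
  by rewrite orbT.
Qed.

(** [L] connects [w] to [A]; it is empty when [w] itself meets [A], hence the conditional set. From
    the meeting point [t] one path follows [A] back to [x], while the other runs through [B] and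
    [v]. *)
Lemma fan_step_attach x v w A B L :
  minlink [set x] [set v] A -> conn B -> [disjoint A & B] ->
  [&& x \notin A, v \notin A, x \notin B & v \notin B] ->
  touch B [set x] -> touch B [set v] -> adj v w -> v != x -> x != w ->
  w \notin A :|: B ->
  conn L -> (L != set0) ==> touch L [set w] -> [disjoint L & A :|: B :|: [set x; v; w]] ->
  touch (L :|: (if L == set0 then [set w] else set0)) A -> fan x w.
Proof.
move=> mA cB dAB /and4P[xA vA xB vB] tBx tBv vw vx xw; rewrite inE negb_or => /andP[wA wB].
move=> cL Lw dL tA.
have [t tA' tt] : exists2 t, t \in A & if L == set0 then adj w t else touch L [set t].
  case: eqP tA => [->|_]; first by rewrite set0U => /touch1P[t]; exists t.
  rewrite setU0 => /touchP[l [t [lL tA lt]]]; exists t => //.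
  by apply/touchP; exists l, t; rewrite set11.
have [A1 [A2 sp]] := split_minlink mA tA'.
have sA1 : A1 :|: [set t] \subset A by rewrite (split_eq sp) subsetUl.
have c1 : conn (A1 :|: [set t]).
  apply: conn_touch0 (split_c1 sp) (conn1 t) _.
  by rewrite touchC (split_u1t sp); apply/implyP => /andP[].
have LD z : z \in A :|: B :|: [set x; v; w] -> z \notin L.
  by apply: disjointN; rewrite disjoint_sym.
apply: (@fanI _ _ (A1 :|: [set t] :|: L) (B :|: [set v])).
- apply: conn_touch0 => //; apply/implyP => /andP[_ L0].
  by rewrite touchUl [touch [set t] L]touchC orbC; move: tt; rewrite (negbTE L0) => ->.
- exact: conn_touch (conn1 v) tBv.
- rewrite -setI_eq0; apply/eqP/setP => z; rewrite in_set0 in_setI; apply/negP.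
  move=> /andP[/setUP[/(subsetP sA1) zA|zL] /setUP[zB|/set1P zv]].
  + by rewrite (disjointFr dAB zA) in zB.
  + by rewrite -zv zA in vA.
  + by move: (LD z); rewrite !inE zB zL orbT => /(_ isT).
  + by move: (LD z); rewrite !inE zv -zv zL !eqxx !orbT => /(_ isT).
- rewrite [x \in _ :|: L]in_setU [w \in _ :|: L]in_setU !negb_or.
  rewrite (subset_notin sA1 xA) (subset_notin sA1 wA).
  rewrite !LD ?inE ?eqxx ?orbT //= !negb_or xB wB eq_sym vx eq_sym; exact: adj_neq.
- rewrite !touchUl (split_X1 sp) (split_uX sp) tBx [touch [set v] [set w]]touch1 vw !orbT /=.
  have -> : ((A1 != set0) || (A1 == set0)) || touch L [set x] by case: eqP.
  rewrite andbT /=; case: eqP tt Lw => [-> wt _|_ _ /= ->].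
    by rewrite touch1 adj_sym wt !orbT.
  by rewrite orbT.
Qed.

(** The induction step of Whitney's proof for two paths: paths to [v] are rerouted to its neighbour
    [w] with the help of a connected set that joins [x] to [w] without [v]. *)
Lemma fan_step x v w M :
  v != x -> x != w -> adj x v \/ fan x v -> adj v w ->
  conn M -> v \notin M -> x \in M -> w \in M -> adj x w \/ fan x w.
Proof.
move=> vx xw Pv vw cM vM xM wM.
case nxw: (adj x w); [by left | move/negbT in nxw].
have [L mL sL] := conn_minlink cM xM wM xw nxw.
have /and3P[cL Lx Lw] := minlink_links mL.
have LN z : z \notin M :\: [set x; w] -> z \notin L by apply: subset_notin.
have vL : v \notin L by apply: LN; rewrite inE negb_and vM orbT.
have xL : x \notin L by apply: LN; rewrite !inE eqxx.
have wL : w \notin L by apply: LN; rewrite !inE eqxx orbT.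
have wv : w != v by rewrite eq_sym; apply: adj_neq.
case: Pv => [xv|[A0 [B0 [cA0 cB0 dAB0 nAB0 tAB0]]]].
  right; apply: (@fanI _ _ [set v] L) => //; first exact: conn1.
  - by rewrite disjoints1.
  - by rewrite !inE eq_sym vx wv xL wL.
  - by rewrite !touch1 adj_sym xv vw Lx Lw.
have [xA0 vA0 xB0 vB0] := and4P nAB0; have [Ax Av Bx Bv] := and4P tAB0.
have [A mA sA] := minlink_exists cA0 Ax Av.
have [B mB sB] := minlink_exists cB0 Bx Bv.
have dAB : [disjoint A & B] := disjointW sA sB dAB0.
have nAB : [&& x \notin A, v \notin A, x \notin B & v \notin B].
  by rewrite !(subset_notin sA) ?(subset_notin sB).
have nBA : [&& x \notin B, v \notin B, x \notin A & v \notin A].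
  by case/and4P: nAB => -> -> -> ->.
have dBA : [disjoint B & A] by rewrite disjoint_sym.
have /and3P[cA tAx tAv] := minlink_links mA.
have /and3P[cB tBx tBv] := minlink_links mB.
have [wA|wA] := boolP (w \in A); first by case: (fan_step_hit mA cB dAB nAB tBx tBv vw vx wA) => [xw'|]; [rewrite xw' in nxw | right].
have [wB|wB] := boolP (w \in B); first by case: (fan_step_hit mB cA dBA nBA tAx tAv vw vx wB) => [xw'|]; [rewrite xw' in nxw | right].
have wAB : w \notin A :|: B by rewrite inE negb_or wA.
have wBA : w \notin B :|: A by rewrite setUC.
have d0 S : [disjoint set0 & S] by rewrite -setI_eq0 set0I.
have [wtA|wtA] := boolP (touch [set w] A).
  right; apply: (fan_step_attach mA cB dAB nAB tBx tBv vw vx xw wAB (conn0 _)) => //.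
    by rewrite eqxx.
  by rewrite eqxx set0U.
have [wtB|wtB] := boolP (touch [set w] B).
  right; apply: (fan_step_attach mB cA dBA nBA tAx tAv vw vx xw wBA (conn0 _)) => //.
    by rewrite eqxx.
  by rewrite eqxx set0U.
(* A shortest way from [w] back to the two paths or to [x]. Which of the three it meets decides the
   rerouting. *)
have [L' mL' sL'] : exists2 L', minlink [set w] (A :|: B :|: [set x]) L' & L' \subset L.
  by apply: minlink_exists; rewrite // touchUr Lx orbT.
have /and3P[cL' L'w L'S] := minlink_links mL'.
have L'0 := touch_neq0 L'w.
have dL' : [disjoint L' & A :|: B].
  rewrite -setI_eq0; apply/eqP/setP => z; rewrite in_set0 in_setI; apply/negP.
  move=> /andP[zL zAB]; have [L1 [L2 sp]] := split_minlink mL' zL.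
  have [L10|L10] := eqVneq L1 set0.
    have : touch [set w] (A :|: B).
      by rewrite touchC; apply/touchP; exists z, w; rewrite set11 -touch1 (split_uX sp) L10 eqxx.
    by rewrite touchUr (negbTE wtA) (negbTE wtB).
  have : touch L1 (A :|: B :|: [set x]).
    rewrite touchUr; apply/orP; left.
    apply: (@touchS _ L1 L1 [set z] (A :|: B)); rewrite ?sub1set //.
    by rewrite touchC (split_u1t sp).
  by rewrite (split_Y1 sp).
have dis : [disjoint L' & A :|: B :|: [set x; v; w]].
  rewrite -setI_eq0 setIUr setU_eq0 setI_eq0 dL' setI_eq0 disjoint_sym.
  rewrite disjoint_subset; apply/subsetP => z; rewrite !inE => /orP[/orP[]|]/eqP->;
  exact: subset_notin sL' _.
have dis' : [disjoint L' & B :|: A :|: [set x; v; w]] by rewrite [B :|: A]setUC.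
right; move: L'S; rewrite !touchUr => /orP[/orP[tA|tB]|tx].
- apply: (fan_step_attach mA cB dAB nAB tBx tBv vw vx xw wAB cL') => //.
    by rewrite L'w implybT.
  by rewrite touchUl tA.
- apply: (fan_step_attach mB cA dBA nBA tAx tAv vw vx xw wBA cL') => //.
    by rewrite L'w implybT.
  by rewrite touchUl tB.
apply: (@fanI _ _ L' (A :|: [set v])) => //.
- exact: conn_touch (conn1 v) tAv.
- apply: disjointWr dis; rewrite subUset sub1set !inE eqxx !orbT andbT.
  by rewrite -setUA subsetUl.
- rewrite !(subset_notin sL') // !inE !negb_or wA wv eq_sym vx.
  by case/and4P: nAB => -> _ _ _.
- by rewrite tx L'w !touchUl tAx [touch [set v] [set w]]touch1 vw orbT.
Qed.

(** Walk along a chordless path [Q] from [x] to [y]; every node on the way is adjacent to [x] or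
    joined to it by a fan. For the step from [v] to [w], the rest of [Q] leads from [w] to [y], and
    by [sep] from [y] to [x], without [v]. *)
Lemma menger2 x y : x != y -> ~~ adj x y ->
  conn [set: G] ->
  (forall v, v != x -> v != y -> y \in comp (~: [set v]) x) -> fan x y.
Proof.
move=> xy nxy cG sep.
have [Q mQ sQ] := conn_minlink cG (in_setT x) (in_setT y) xy nxy.
have QN z : z \in Q -> (z != x) && (z != y).
  by move=> /(subsetP sQ); rewrite !inE negb_or andbT.
suff P : forall w, (w \in Q) || (w == y) -> adj x w \/ fan x w.
  by case: (P y); rewrite ?eqxx ?orbT // (negbTE nxy).
have step v w M : v \in Q -> adj x v \/ fan x v -> adj v w -> w != x ->
    conn M -> v \notin M -> y \in M -> w \in M -> adj x w \/ fan x w.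
  move=> vQ Pv vw wx cM vM yM wM; have /andP[vx vy] := QN v vQ.
  have vN z : z \in ~: [set v] -> comp (~: [set v]) x \subset ~: [set v].
    by move=> _; apply: comp_sub; rewrite !inE eq_sym.
  have xv : x \in ~: [set v] by rewrite !inE eq_sym.
  apply: (fan_step (M := comp (~: [set v]) x :|: M) vx _ Pv vw); rewrite 1?eq_sym //.
  - exact: conn_meet (comp_conn xv) cM (sep v vx vy) yM.
  - rewrite inE negb_or vM andbT; apply/negP => /(subsetP (comp_sub xv)).
    by rewrite !inE eqxx.
  - by rewrite inE comp_refl.
  - by rewrite inE wM orbT.
have PQ w : w \in Q -> adj x w \/ fan x w.
  move=> wQ; have [A1 [A2 sp]] := split_minlink mQ wQ.
  have [n] := ubnP #|A1|; elim: n w A1 A2 wQ sp => // n IH w A1 A2 wQ sp An.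
  have /andP[wx wy] := QN w wQ.
  have [A10|A10] := eqVneq A1 set0.
    by left; rewrite adj_sym -touch1 (split_uX sp) A10 eqxx.
  have m1 := split_m1 sp A10.
  have /touchP[v [w' [vA1 /set1P-> vw]]] : touch A1 [set w] by rewrite touchC (split_u1t sp).
  have vQ : v \in Q by rewrite (split_eq sp) !inE vA1.
  have [B1 [B2 sp1]] := split_minlink mQ vQ.
  have vB1 : v \notin B1 := split_u1 sp1.
  have cR : conn ([set w] :|: A2).
    apply: conn_touch0 (conn1 w) (split_c2 sp) _.
    by rewrite (split_u2t sp); apply/implyP => /andP[].
  (* A node of [B1] at or beyond [w] would let [B1] and the tail of [Q] from [w] on link [x] to [y]
     without [v]. *)
  have sub : B1 \subset A1.
    apply/subsetP => z zB.
    have zQ : z \in Q by rewrite (split_eq sp1) !inE zB.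
    apply: contraT => zA1.
    have zR : z \in [set w] :|: A2 by move: zQ; rewrite {1}(split_eq sp) -setUA inE (negbTE zA1).
    have EE : B1 :|: ([set w] :|: A2) = Q.
      apply: (minlink_min mQ).
      - exact: conn_meet (split_c1 sp1) cR zB zR.
      - by rewrite touchUl (split_X1 sp1); case: eqP zB => [->|]; rewrite ?inE.
      - by rewrite !touchUl (split_uY sp) (split_Y2 sp); case: eqP; rewrite ?orbT.
      - by rewrite subUset {1}(split_eq sp1) -setUA subsetUl {1}(split_eq sp) -setUA subsetUr.
    have := vQ; rewrite -EE !inE (negbTE vB1) (negbTE (adj_neq vw)) /=.
    by rewrite (disjointFr (split_dis sp) vA1).
  apply: (step v w ([set y] :|: ([set w] :|: A2)) vQ _ vw wx).
  - apply: IH sp1 _ => //; rewrite -ltnS; apply: leq_trans An; rewrite ltnS.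
    apply: proper_card; apply/properP; split => //; by exists v.
  - apply: conn_touch => //; first exact: conn1.
    by rewrite touchC touchUl (split_uY sp) (split_Y2 sp); case: eqP.
  - rewrite !inE !negb_or; have /andP[_ ->] := QN v vQ.
    by rewrite (adj_neq vw) (disjointFr (split_dis sp) vA1).
  - by rewrite !inE eqxx.
  - by rewrite !inE eqxx orbT.
move=> w /orP[/PQ//|/eqP->].
have /and3P[_ _ /touchP[v [y' [vQ /set1P-> vy]]]] := minlink_links mQ.
apply: (step v y [set y] vQ (PQ v vQ) vy); rewrite ?inE // 1?eq_sym //.
- exact: conn1.
- by rewrite eq_sym; apply: adj_neq.
Qed.

End Menger.

(** * Undecomposable graphs *)

(* Good graphs to which no decomposition applies. *)
Record core (G : sgraph) : Prop := Core {
  core_good : good G;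
  core_conn : conn [set: G];
  core_conn1 : forall v : G, conn (~: [set v]);
  core_c3 : forall x y z : G, adj x y -> adj y z -> adj z x -> False;
  core_c4 : forall x y z w : G, adj x y -> adj y z -> adj z w -> adj w x ->
    x != z -> y != w -> False;
  core_no2 : forall (s t : G) (X : {set G}), s != t -> ~~ adj s t ->
    3 <= deg s -> 3 <= deg t -> s \notin X -> t \notin X ->
    touch X (~: (X :|: [set s; t])) = false ->
    2 <= #|X| -> 2 <= #|~: (X :|: [set s; t])| -> False
}.

(** * Deleting an edge *)

Section DelEdge.
Variables (G : sgraph) (x y : G).

Definition del_adj : rel G := fun u v => adj u v && ([set u; v] != [set x; y]).
Fact del_adj_sym : symmetric del_adj.
Proof. by move=> u v; rewrite /del_adj adj_sym setUC. Qed.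
Fact del_adj_irr : irreflexive del_adj.
Proof. by move=> u; rewrite /del_adj adj_irr. Qed.
(** Makes the ends of a prospective chord nonadjacent, as [menger2] requires. *)
Definition del_edge : sgraph := SGraph del_adj_sym del_adj_irr.

Lemma set2_eq (T : finType) (u v s t : T) : [set u; v] = [set s; t] ->
  (u = s /\ v = t) \/ (u = t /\ v = s).
Proof.
move=> /setP E; have := E u; have := E v; have := E s; have := E t.
rewrite !inE !eqxx ?orbT /= => /orP[]/eqP T0 /orP[]/eqP S0 /esym/orP[]/eqP V0 /esym/orP[]/eqP U0;
  by subst; auto.
Qed.

Lemma del_adjE u v : u \notin [set x; y] -> @adj del_edge u v = adj u v.
Proof.
move=> nu; rewrite /= /del_adj (_ : _ != _) ?andbT //.
by apply: contraNneq nu => <-; rewrite !inE eqxx.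
Qed.

Lemma del_touch (A B : {set G}) : x \notin A -> y \notin A ->
  @touch del_edge A B = @touch G A B.
Proof.
move=> xA yA; apply/touchP/touchP => -[u [v [uA vB uv]]]; exists u, v; split => //.
  by case/andP: uv.
rewrite del_adjE // !inE negb_or.
by rewrite (memPn xA) ?(memPn yA).
Qed.

Lemma del_conn (A : {set G}) : @conn del_edge A -> @conn G A.
Proof.
move=> /connP H; apply/connP => u v uA vA; apply: connect_sub (H u v uA vA) => s t.
by move=> /and3P[/andP[st _] sA tA]; apply: connect1; rewrite /adj_in st sA.
Qed.
End DelEdge.

(** * Small cuts of undecomposable graphs and the existence of a cycle with a chord *)

Section Core.
Variable G : sgraph.
Hypothesis cG : core G.
Implicit Types (A B C D K L M S X Y : {set G}) (x y u v w s t : G).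

Let gG := core_good cG.
Let c3 := core_c3 cG.

Lemma deg_sub x S : (forall y, adj x y -> y \in S) -> deg x <= #|S|.
Proof. by move=> H; apply: subset_leq_card; apply/subsetP => y; rewrite inE; apply: H. Qed.

(** Otherwise [v] would separate [S] from [z]. This is the form in which the absence of cutnodes is
    applied to sets with a single exit. *)
Lemma exit1 S v z : v \notin S -> z \notin S -> z != v ->
  (forall u w, u \in S -> w \notin S -> adj u w -> w = v) -> S = set0.
Proof.
move=> vS zS zv H; apply/eqP; apply: contraT => /set0Pn[u uS].
have uv : u \in ~: [set v] by rewrite !inE; apply: contraNneq vS => <-.
have zv' : z \in ~: [set v] by rewrite !inE.
have /touchP[s [t [/setIP[_ sS] /setDP[tv tS] st]]] := conn_cross (core_conn1 cG v) uv zv' uS zS.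
by move: tv; rewrite !inE (H s t sS tS st) eqxx.
Qed.

Lemma exists_other S (u : G) : 2 <= #|S| -> exists2 z, z \in S & z != u.
Proof.
move=> h; have : 0 < #|S :\ u| by rewrite (cardsD1 u S) in h; case: (u \in S) h => /=; lia.
by rewrite card_gt0 => /set0Pn[z]; rewrite !inE => /andP[zu zS]; exists z.
Qed.

(** If [v] has degree at least 3, then [x] and [v] form a proper 2-cutset separating [X :\ x] from
    the rest. If it has degree 2, it has one neighbour on each side; [v] is moved into [X] and its
    outer neighbour [b] takes its place, whence the induction on the complement of [X]. When
    [b = y], the node [y] would be a cutnode. *)
Lemma no_cut_edge x y v X : 3 <= deg x -> 3 <= deg y -> adj x y ->
  v \notin X -> x \in X -> y \notin X -> y != v -> ~~ adj x v ->
  (forall s t, s \in X -> t \notin X -> t != v -> adj s t -> s = x /\ t = y) -> False.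
Proof.
move=> dx dy xy; have [n] := ubnP #|~: X|; elim: n v X => // n IH v X Xn vX xX yX yv nxv H.
have xv : x != v by apply: contraNneq vX => <-.
have X2 : 2 <= #|X :\ x|.
  have : deg x <= #|y |: X :\ x|.
    apply: deg_sub => z xz; rewrite !inE; case: eqVneq => //= zy.
    rewrite eq_sym (adj_neq xz) /=; apply: contraNT zy => zX; apply/eqP.
    by apply: (proj2 (H x z _ _ _ xz)) => //; apply: contraNneq nxv => <-.
  by rewrite cardsU1 !inE (negbTE yX) andbF; lia.
have nY : ~: (X :\ x :|: [set x; v]) = ~: X :\ v.
  apply/setP => z; rewrite !inE !negb_or negb_and negbK.
  case: (eqVneq z x) => [->|_] /=; first by rewrite xX andbF.
  by rewrite andbC.
have Y2 : 2 <= #|~: X :\ v|.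
  have : deg y <= #|x |: (v |: (~: X :\ v :\ y))|.
    apply: deg_sub => z yz; rewrite !inE; case: eqVneq => //= zx; case: eqVneq => //= zv.
    rewrite eq_sym (adj_neq yz) /=; apply: contraNN zx => zX; apply/eqP.
    by apply: (proj1 (H z y _ _ _ _)) => //; rewrite adj_sym.
  move=> /(leq_trans dy); rewrite !cardsU1 (cardsD1 y (~: X :\ v)) !inE yv yX /=.
  by case: (_ || _); case: (_ && _); lia.
have Xx0 : X :\ x != set0 by rewrite -card_gt0; lia.
have tXv : touch (X :\ x) [set v].
  apply: contraT => /touchPn nt; case/negP: Xx0; apply/eqP.
  apply: (@exit1 _ x y); rewrite ?inE ?eqxx ?(negbTE yX) ?andbF //.
    by rewrite eq_sym; apply: adj_neq.
  move=> u w; rewrite !inE => /andP[ux uX] nw uw; apply/eqP.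
  apply: contraNT nw => wx; rewrite wx /=; apply: contraT => wX.
  have wv : w != v by apply: contraTneq uw => ->; rewrite nt ?inE ?ux ?eqxx.
  by case: (H u w uX wX wv uw) => E; rewrite E eqxx in ux.
have tYv : touch (~: X :\ v) [set v].
  apply: contraT => /touchPn nt; have : ~: X :\ v != set0 by rewrite -card_gt0; lia.
  have [z zY zy] := exists_other y Y2.
  have /negP[] : ~: X :\ v :\ y != set0 by apply/set0Pn; exists z; rewrite in_setD1 zy.
  apply/eqP/(@exit1 _ y x); rewrite ?inE ?eqxx ?xX ?andbF //; first exact: adj_neq.
  move=> u w; rewrite !inE => /and3P[uy uv uX] nw uw; apply/eqP.
  apply: contraNT nw => wy; rewrite wy /=.
  have wv : w != v by apply: contraTneq uw => ->; rewrite nt ?inE ?uv ?eqxx.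
  rewrite wv /=; apply/negP => wX; rewrite adj_sym in uw.
  by case: (H w u wX uX uv uw) => _ E; rewrite E eqxx in uy.
have [dv|dv] := leqP 3 (deg v).
  apply: (core_no2 cG xv nxv dx dv (X := X :\ x)); rewrite ?nY ?inE ?eqxx ?(negbTE vX) ?andbF //.
  apply/negbTE/touchPn => s t; rewrite !inE => /andP[sx sX] /andP[tv tX].
  by apply: contraNF sx => st; case: (H s t sX tX tv st) => ->.
have /touchP[a [v1 [aX /set1P-> av]]] := tXv.
have /touchP[b [v2 [bY /set1P-> bv]]] := tYv.
have [ax aXX] : a != x /\ a \in X by move: aX; rewrite !inE => /andP[].
have [bv' bXX] : b != v /\ b \notin X by move: bY; rewrite !inE => /andP[].
have ab : a != b by apply: contraNneq bXX => <-.
have vE z : adj v z -> z = a \/ z = b.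
  move=> vz; have [->|za] := eqVneq z a; first by left.
  have [->|zb] := eqVneq z b; [by right | exfalso].
  have : #|[set a; b; z]| <= deg v.
    apply: subset_leq_card; apply/subsetP => c; rewrite !inE.
    by case/orP => [/orP[]|] /eqP->; rewrite 1?adj_sym // adj_sym.
  rewrite [[set a; b; z]]setUC cardsU1 cards2 !inE (negbTE za) (negbTE zb) ab.
  by rewrite leqNgt ltnS -ltnS dv.
have [bx|by'] := eqVneq b y.
  have [z zY zy] := exists_other y Y2.
  have /negP[] : ~: X :\ v :\ y != set0 by apply/set0Pn; exists z; rewrite in_setD1 zy.
  apply/eqP/(@exit1 _ y x); rewrite ?inE ?eqxx ?xX ?andbF //; first exact: adj_neq.
  move=> u w; rewrite !inE => /and3P[uy uv uX] nw uw; apply/eqP.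
  apply: contraNT nw => wy; rewrite wy /=.
  have wv : w != v.
    apply: contraTneq uw => ->; apply/negP; rewrite adj_sym => /vE[E|E].
      by move: uX; rewrite E aXX.
    by move: uy; rewrite E bx eqxx.
  rewrite wv /=; apply/negP => wX; rewrite adj_sym in uw.
  by case: (H w u wX uX uv uw) => _ E; rewrite E eqxx in uy.
have nxb : ~~ adj x b.
  by apply: contraNN by' => xb; case: (H x b xX bXX bv' xb) => _ ->.
apply: (IH b (v |: X)); rewrite ?inE ?negb_or ?(eq_sym b) ?(eq_sym y) ?(negbTE bXX) ?xX ?orbT //.
- have : #|~: (v |: X)| < #|~: X|.
    apply: proper_card; rewrite properEneq setCS subsetUr andbT.
    apply/eqP => /setP/(_ v); rewrite !inE eqxx (negbTE vX) //.
  by move=> lt; rewrite -ltnS; apply: leq_trans Xn; rewrite ltnS.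
- by rewrite eq_sym bv'.
- by rewrite eq_sym yv.
move=> s t /setU1P[->|sX]; rewrite !inE negb_or => /andP[tv tX] tb st.
  case: (vE t st) => E; first by rewrite E aXX in tX.
  by rewrite E eqxx in tb.
exact: H.
Qed.

(** Menger's theorem in the graph without the edge [xy]. If a node [v] separated [x] from [y] there,
    [xy] would be the only way past [v]. As there are no triangles, one of [x], [y] is not adjacent
    to [v], and [no_cut_edge] applies from its side. *)
Lemma theta_exists x y : adj x y -> 3 <= deg x -> 3 <= deg y ->
  exists A B, theta x y A B.
Proof.
move=> xy dx dy; pose G' := del_edge x y.
have nxy : ~~ @adj G' x y by rewrite /= /del_adj eqxx andbF.
have cut v : v != x -> v != y -> y \in @comp G' (~: [set v]) x.
  move=> vx vy; apply: contraT => yX; exfalso.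
  set X := @comp G' _ _ in yX.
  have xv : x \in ~: [set v] by rewrite !inE eq_sym.
  have vX : v \notin X.
    by apply/negP => /(subsetP (@comp_sub G' (~: [set v]) x xv)); rewrite !inE eqxx.
  have xX : x \in X := @comp_refl G' _ _.
  have H s t : s \in X -> t \notin X -> t != v -> adj s t -> s = x /\ t = y.
    move=> sX tX tv st; have [E|E] := eqVneq [set s; t] [set x; y].
      by case: (set2_eq E) => [//|[_ tx]]; rewrite tx xX in tX.
    case/negP: tX; apply: (@comp_closed G' _ _ s) => //; first by rewrite !inE.
    by rewrite /= /del_adj st.
  clearbody X.
  have [xv'|xv'] := boolP (adj x v).
    have nyv : ~~ adj y v by apply/negP => yv; apply: (c3 xy yv); rewrite adj_sym.
    apply: (@no_cut_edge y x v (~: X :\ v)) => //; rewrite ?inE ?eqxx ?yX ?xX ?andbF //.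
    - by rewrite adj_sym.
    - by rewrite eq_sym vy.
    - by rewrite eq_sym.
    move=> s t; rewrite !inE => /andP[sv sX]; rewrite negb_and !negbK => /orP[->//|tX] tv st.
    by rewrite adj_sym in st; case: (H t s tX sX sv st).
  by apply: (@no_cut_edge x y v X) => //; rewrite eq_sym.
have cG' : @conn G' [set: G].
  apply/connP; suff Hx z : connect (@adj_in G' [set: G]) x z.
    by move=> u w _ _; apply: connect_trans (Hx w); rewrite adj_in_sym.
  have [vy|] := boolP [exists v, (v != x) && (v != y)].
    have [v /andP[vx vy']] := existsP vy.
    have Hy : connect (@adj_in G' [set: G]) x y.
      have := cut v vx vy'; rewrite inE; apply: connect_inS; exact: subsetT.
    have [->|zx] := eqVneq z x; first exact: connect0.
    have : connect (@adj_in G [set: G]) x z by apply: (connP _ (core_conn cG)); rewrite inE.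
    apply: (@connect_sub _ _ (@adj_in G' [set: G])) => s t.
    move=> /and3P[st _ _].
    have [E|E] := eqVneq [set s; t] [set x; y].
      by case: (set2_eq E) => [[-> ->]|[-> ->]] //; rewrite adj_in_sym.
    by apply: connect1; rewrite /adj_in !inE /= /del_adj st E.
  move=> /existsPn nv; have : deg x <= #|[set y]|.
    apply: deg_sub => t xt; have := nv t; rewrite negb_and !negbK inE.
    by rewrite eq_sym (negbTE (adj_neq xt)).
  by rewrite cards1; lia.
have [A [B [cA cB dAB /and4P[xA yA xB yB] /and4P[Ax Ay Bx By]]]] :=
  @menger2 G' x y (adj_neq xy) nxy cG' cut.
exists A, B; rewrite /theta xy xA yA xB yB (del_conn cA) (del_conn cB) dAB /=.
move: Ax Ay Bx By; rewrite !(@del_touch G x y) // => Ax Ay Bx By.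
by rewrite ![touch [set _] _]touchC Ax Ay Bx By.
Qed.

End Core.

(** * The shortest cycle with a chord *)

Lemma disjUl (T : finType) (A B C : {set T}) :
  [disjoint A :|: B & C] = [disjoint A & C] && [disjoint B & C].
Proof. by rewrite -!setI_eq0 setIUl setU_eq0. Qed.

Lemma disjUr (T : finType) (A B C : {set T}) :
  [disjoint C & A :|: B] = [disjoint C & A] && [disjoint C & B].
Proof. by rewrite -!setI_eq0 setIUr setU_eq0. Qed.

Lemma disj1l (T : finType) (x : T) (A : {set T}) : [disjoint [set x] & A] = (x \notin A).
Proof. by rewrite disjoints1. Qed.

Lemma disj1r (T : finType) (x : T) (A : {set T}) : [disjoint A & [set x]] = (x \notin A).
Proof. by rewrite disjoint_sym disjoints1. Qed.

Lemma orF (a b : bool) : (a || b) = false -> a = false /\ b = false.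
Proof. by case: a; case: b. Qed.

Lemma andT (a b : bool) : (a && b) = true -> a = true /\ b = true.
Proof. by case: a; case: b. Qed.

Definition disjE := (disjUl, disjUr, disj1l, disj1r).

(* Brings hypotheses to the form [atom = true] or [atom = false]. *)
Ltac atoms :=
  repeat match goal with
  | H : is_true (~~ ?a) |- _ => apply negbTE in H
  | H : is_true ?a |- _ => change (a = true) in H
  | H : (~~ ?a) = true |- _ => apply negbTE in H
  | H : (~~ ?a) = false |- _ => apply negbFE in H
  | H : (_ || _) = false |- _ => apply orF in H; destruct H
  | H : (_ && _) = true |- _ => apply andT in H; destruct H
  | H : context [touch (_ :|: _) _] |- _ => rewrite touchUl in H
  | H : context [touch _ (_ :|: _)] |- _ => rewrite touchUr in H
  | H : context [touch [set _] [set _]] |- _ => rewrite touch1 in H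
  | H : context [in_mem _ _] |- _ => rewrite in_setU in H
  | H : context [in_mem _ _] |- _ => rewrite in_set1 in H
  | H : context [disjoint _ _] |- _ => rewrite disjUl in H
  | H : context [disjoint _ _] |- _ => rewrite disjUr in H
  | H : context [disjoint _ _] |- _ => rewrite disj1l in H
  | H : context [disjoint _ _] |- _ => rewrite disj1r in H
  | H : _ /\ _ |- _ => destruct H
  end.

Ltac subst_bool a H := pattern a; refine (eq_ind_r _ _ H); cbv beta.

(** Each atom of a goal about pieces of a cycle is replaced by its value from the hypotheses, up to
    symmetry of the relation. Values such as [A1 != set0] survive, and [emp] splits on them. *)
Ltac evalb :=
  rewrite ?touchE ?disjE ?in_setU ?in_set1 ?negb_or;
  repeat match goal with
  | |- context [touch ?a ?b] => first
    [ match goal with H : touch a b = _ |- _ => subst_bool (touch a b) H end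
    | match goal with H : touch b a = _ |- _ => subst_bool (touch a b) (etrans (touchC a b) H) end ]
  | |- context [adj ?a ?b] => first
    [ match goal with H : adj a b = _ |- _ => subst_bool (adj a b) H end
    | match goal with H : adj b a = _ |- _ => subst_bool (adj a b) (etrans (adj_sym a b) H) end ]
  | |- context [adj ?a ?a] => rewrite adj_irr
  | |- context [?a == ?a] => rewrite eqxx
  | |- context [in_mem ?x ?m] =>
    match goal with H : in_mem x m = _ |- _ => subst_bool (in_mem x m) H end
  | |- context [?a == ?b] => first
    [ match goal with H : (a == b) = _ |- _ => subst_bool (a == b) H end
    | match goal with H : (b == a) = _ |- _ => subst_bool (a == b) (etrans (eq_sym a b) H) end ]
  | |- context [disjoint ?a ?b] => first
    [ match goal with H : disjoint a b = _ |- _ => subst_bool (disjoint a b) H end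
    | match goal with H : disjoint b a = _ |- _ => rewrite [disjoint a b]disjoint_sym H end ]
  | H : conn ?a = _ |- context [conn ?a] => subst_bool (conn a) H
  end; rewrite ?negb_or ?orbT ?andbT ?orbF ?andbF /=.

Ltac emp := repeat match goal with
  | |- context [?a == set0] => case: (a == set0)
  | |- context [touch ?a ?b] => case: (touch a b)
  | |- context [adj ?a ?b] => case: (adj a b)
  end.

Ltac solveb := evalb; try done; emp; done.

Ltac connb := lazymatch goal with
  | |- is_true (conn set0) => exact (conn0 _)
  | |- is_true (conn [set _]) => exact (conn1 _)
  | |- is_true (conn ?A) => first
    [ match goal with H : conn A = true |- _ => exact H | H : is_true (conn A) |- _ => exact H end
    | apply conn_touch0; [connb | connb | evalb; try done; emp; done] ]
  end.

Ltac thetab := rewrite /theta; apply/and5P; split;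
  [ solveb | apply/and3P; split; [connb | connb | solveb]
  | solveb | apply/andP; split; solveb | apply/andP; split; solveb ].

Lemma cardU_le (T : finType) (A B : {set T}) : #|A :|: B| <= #|A| + #|B|.
Proof. by rewrite cardsU leq_subr. Qed.

Ltac card_lia le := move: le;
  repeat match goal with |- context [@setU ?T ?X ?Y] =>
    move: (@cardU_le T X Y); generalize #|X :|: Y| end;
  rewrite ?cards1; clear; lia.

Section Cores.
Variable G : sgraph.
Hypothesis cG : core G.
Implicit Types (A B C D K L M S X Y P : {set G}) (a b c d x y u v w s t : G).

Let gG := core_good cG.
Let c3 := core_c3 cG.
Let c4 := core_c4 cG.

(** A lower bound on the length of cycles with a chord, the two ends of the chord not being
    counted. *)
Definition minsize n := forall x y A B, theta x y A B -> n <= #|A| + #|B|.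

Lemma thetaC x y A B : theta x y A B -> theta y x A B.
Proof. by move=> h; rewrite /theta in h *; atoms; solveb. Qed.

Lemma thetaX x y A B : theta x y A B -> theta x y B A.
Proof. by move=> h; rewrite /theta in h *; atoms; solveb. Qed.

Lemma theta_minlink x y A B : theta x y A B -> minsize (#|A| + #|B|) ->
  minlink [set x] [set y] A /\ minlink [set y] [set x] B.
Proof.
suff H A' B' : theta x y A' B' -> minsize (#|A'| + #|B'|) -> minlink [set x] [set y] A'.
  move=> h m; split; first exact: H h m.
  by apply/minlinkC/(H B A); [apply: thetaX | rewrite addnC].
move=> h m; have h' := h; rewrite /theta in h'; atoms.
have [C mC sC] : exists2 C, minlink [set x] [set y] C & C \subset A'.
  by apply: minlink_exists; rewrite // touchC.
have /and3P[? ? ?] := minlink_links mC.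
suff -> : A' = C by [].
apply/eqP; rewrite eq_sym eqEcard sC.
have /m : theta x y C B'; last by rewrite leq_add2r.
have xC : x \notin C by apply: subset_notin sC _; solveb.
have yC : y \notin C by apply: subset_notin sC _; solveb.
have dC : [disjoint C & B'] by apply: disjointWl sC _; solveb.
by atoms; thetab.
Qed.

Lemma split_card X Y A u A1 A2 : split_at X Y A u A1 A2 -> #|A| = #|A1| + #|A2| + 1.
Proof.
move=> sp; have := split_u1 sp; have := split_u2 sp; have := split_dis sp.
rewrite (split_eq sp) -setUA setUCA cardsU1 inE negb_or => d -> -> /=.
by rewrite cardsU (_ : A1 :&: A2 = set0) ?cards0 //; [lia | apply/eqP; rewrite setI_eq0].
Qed.

(** If [u] saw [x], the edge [xu] would be a chord of the cycle [x B1 v u A2 y], which leaves out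
    the part of [B] between [v] and [y]. Minimality makes that part empty, and then [x], [u], [v],
    [y] form a square. *)
Lemma theta_far x y A B u v : theta x y A B -> minsize (#|A| + #|B|) ->
  u \in A -> v \in B -> adj u v -> adj u x = false.
Proof.
move=> h m uA vB uv; apply/negP => ux; have [mA mB] := theta_minlink h m.
have [A1 [A2 sA]] := split_minlink mA uA; have [B1 [B2 sB]] := split_minlink (minlinkC mB) vB.
have A10 : A1 == set0 by rewrite -(split_uX sA) touch1.
have xy : adj x y by case/and5P: h.
have nvx : adj v x = false by apply/negP => vx; apply: (c3 ux _ (_ : adj v u)); rewrite adj_sym.
have B10 : (B1 == set0) = false by rewrite -(split_uX sB) touch1.
have nuy : adj u y = false.
  by apply/negP => uy; apply: (c3 ux xy); rewrite adj_sym.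
have A20 : (A2 == set0) = false by rewrite -(split_uY sA) touch1.
have cA := split_card sA; have cB := split_card sB.
have th : theta x u (B1 :|: [set v]) (A2 :|: [set y]).
  have := adj_neq xy; have := adj_neq ux; have := adj_neq uv => ? ? ?.
  rewrite /theta in h; destruct sA, sB; clear m cA cB mA mB; subst A B; atoms.
  thetab.
have := m _ _ _ _ th.
have c1 : #|B1 :|: [set v]| = #|B1| + 1 by rewrite setUC cardsU1 (split_u1 sB) addnC.
have c2 : #|A2 :|: [set y]| = #|A2| + 1.
  rewrite setUC cardsU1 addnC; congr (_ + _); move: h; rewrite /theta (split_eq sA) => h'.
  by atoms; evalb.
have z1 : #|A1| = 0 by rewrite (eqP A10) cards0.
rewrite c1 c2 cA cB z1 => le.
have B20 : B2 == set0 by rewrite -cards_eq0; clear -le; lia.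
have yv : adj y v by have := split_uY sB; rewrite touch1 B20 adj_sym.
have vu : adj v u by rewrite adj_sym.
apply: (c4 ux xy yv vu).
  by apply: contraTneq uA => ->; case/and5P: h => _ _ /and4P[].
by rewrite eq_sym; apply: contraTneq vB => ->; case/and5P: h => _ _ /and4P[].
Qed.

Lemma split_atC X Y A u A1 A2 : split_at X Y A u A1 A2 -> split_at Y X A u A2 A1.
Proof.
case=> E ? ? ? ? ? ? ? ? ? ? ? ? ? ? m1 m2; split => //.
- by rewrite setUC setUA setUAC.
- by rewrite disjoint_sym.
- by rewrite touchC.
- by move/m2/minlinkC.
- by move/m1/minlinkC.
Qed.

(** The cycle [u P1 x D2 v' D1 v] with chord [uv'] would be shorter. *)
Lemma no_edge_same x y u v A B P1 P2 P3 P4 v' :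
  theta x y A B -> minsize (#|A| + #|B|) -> adj u v ->
  split_at [set x] [set y] A u P1 P2 -> split_at [set x] [set y] B v P4 P3 ->
  v' \in P4 -> adj u v' -> False.
Proof.
move=> h m uv sA sB vP uv'; have cA := split_card sA; have cB := split_card sB.
have P40 : P4 != set0 by apply/set0Pn; exists v'.
have [D2 [D1 sD]] := split_minlink (split_m1 sB P40) vP; have cD := split_card sD.
have th : theta u v' (P1 :|: [set x] :|: D2) (D1 :|: [set v]).
  have := adj_neq uv' => ?.
  rewrite /theta in h; clear m cA cB cD; destruct sA, sB, sD; subst A B; subst P4; atoms.
  thetab.
have := m _ _ _ _ th; rewrite cA cB cD => le; card_lia le.
Qed.

(** The cycle [u' C2 x D2 v' D1 v u C1] with chord [u'v'] would be shorter, since it avoids [y]. *)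
Lemma no_edge_parallel x y u v A B P1 P2 P3 P4 u' v' :
  theta x y A B -> minsize (#|A| + #|B|) -> adj u v ->
  split_at [set x] [set y] A u P1 P2 -> split_at [set x] [set y] B v P4 P3 ->
  u' \in P1 -> v' \in P4 -> adj u' v' -> False.
Proof.
move=> h m uv sA sB uP vP uv'; have cA := split_card sA; have cB := split_card sB.
have P10 : P1 != set0 by apply/set0Pn; exists u'.
have P40 : P4 != set0 by apply/set0Pn; exists v'.
have [C2 [C1 sC]] := split_minlink (split_m1 sA P10) uP; have cC := split_card sC.
have [D2 [D1 sD]] := split_minlink (split_m1 sB P40) vP; have cD := split_card sD.
have th : theta u' v' (C2 :|: [set x] :|: D2) (C1 :|: [set u] :|: [set v] :|: D1).
  have := adj_neq uv' => ?.
  rewrite /theta in h; clear m cA cB cD cC; destruct sA, sB, sD, sC; subst A B; subst P4 P1; atoms.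
  thetab.
have := m _ _ _ _ th; rewrite cA cB cD cC => le; card_lia le.
Qed.

(** Exchanging the tails of the two arcs along [uv] and [u'v'] gives another cycle with chord [xy],
    which leaves out [C1] and [D1]. By minimality both are empty, and [u'], [u], [v], [v'] form a
    square. *)
Lemma no_edge_cross x y u v A B P1 P2 P3 P4 u' v' :
  theta x y A B -> minsize (#|A| + #|B|) -> adj u v ->
  split_at [set x] [set y] A u P1 P2 -> split_at [set x] [set y] B v P4 P3 ->
  u' \in P1 -> v' \in P3 -> adj u' v' -> False.
Proof.
move=> h m uv sA sB uP vP uv'; have cA := split_card sA; have cB := split_card sB.
have P10 : P1 != set0 by apply/set0Pn; exists u'.
have P30 : P3 != set0 by apply/set0Pn; exists v'.
have [C2 [C1 sC]] := split_minlink (split_m1 sA P10) uP; have cC := split_card sC.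
have [D1 [D2 sD]] := split_minlink (split_m2 sB P30) vP; have cD := split_card sD.
have th : theta x y (C2 :|: [set u'] :|: [set v'] :|: D2) (P4 :|: [set v] :|: [set u] :|: P2).
  have := adj_neq uv' => ?.
  rewrite /theta in h; clear m cA cB cD cC; destruct sA, sB, sD, sC; subst A B; subst P3 P1; atoms.
  thetab.
have := m _ _ _ _ th; rewrite cA cB cD cC => le.
have C10 : C1 == set0 by rewrite -cards_eq0; card_lia le.
have D10 : D1 == set0 by rewrite -cards_eq0; card_lia le.
apply: (c4 (x := u') (y := u) (z := v) (w := v')) => //.
- by rewrite -touch1 (split_uY sC).
- by rewrite -touch1 touchC (split_uX sD).
- by rewrite adj_sym.
- apply: contraTneq uP => ->; clear m cA cB cC cD le sC sD uv'.
  by rewrite /theta in h; destruct sA, sB; subst A B; atoms; evalb.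
apply: contraTneq vP => <-; clear m cA cB cC cD le sC sD uv'.
by rewrite /theta in h; destruct sA, sB; subst A B; atoms; evalb.
Qed.

(* [a P1 b P2 c P3 d P4] is a cycle whose only chords are [ac] and [bd]. *)
Record k4 a b c d P1 P2 P3 P4 : Prop := K4 {
  k4_adj : [&& adj a c, adj b d, ~~ adj a b, ~~ adj b c, ~~ adj c d & ~~ adj d a];
  k4_ne : [&& a != b, a != c, a != d, b != c, b != d & c != d];
  k4_m1 : minlink [set a] [set b] P1;
  k4_m2 : minlink [set b] [set c] P2;
  k4_m3 : minlink [set c] [set d] P3;
  k4_m4 : minlink [set d] [set a] P4;
  k4_in1 : [&& a \notin P1, b \notin P1, c \notin P1 & d \notin P1];
  k4_in2 : [&& a \notin P2, b \notin P2, c \notin P2 & d \notin P2];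
  k4_in3 : [&& a \notin P3, b \notin P3, c \notin P3 & d \notin P3];
  k4_in4 : [&& a \notin P4, b \notin P4, c \notin P4 & d \notin P4];
  k4_dis : [&& [disjoint P1 & P2], [disjoint P1 & P3], [disjoint P1 & P4],
               [disjoint P2 & P3], [disjoint P2 & P4] & [disjoint P3 & P4]];
  k4_tc : [&& ~~ touch P1 [set c], ~~ touch P1 [set d], ~~ touch P2 [set d], ~~ touch P2 [set a],
              ~~ touch P3 [set a], ~~ touch P3 [set b], ~~ touch P4 [set b] & ~~ touch P4 [set c]];
  k4_tp : [&& ~~ touch P1 P2, ~~ touch P1 P3, ~~ touch P1 P4,
              ~~ touch P2 P3, ~~ touch P2 P4 & ~~ touch P3 P4]
}.

Lemma minlink_facts X Y A : minlink X Y A ->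
  [&& conn A, touch A X, touch A Y & A != set0].
Proof.
by move=> /minlink_links/and3P[-> AX ->]; rewrite AX (touch_neq0 AX).
Qed.

Lemma k4_links a b c d P1 P2 P3 P4 : k4 a b c d P1 P2 P3 P4 ->
  [&& [&& conn P1, touch P1 [set a], touch P1 [set b] & P1 != set0],
      [&& conn P2, touch P2 [set b], touch P2 [set c] & P2 != set0],
      [&& conn P3, touch P3 [set c], touch P3 [set d] & P3 != set0] &
      [&& conn P4, touch P4 [set d], touch P4 [set a] & P4 != set0]].
Proof. by case=> _ _ m1 m2 m3 m4 *; rewrite !minlink_facts. Qed.

(** This rotation and the reflection below generate the symmetries of the cycle that preserve the
    pair of chords; facts are proved at [a] and [P1] and then transported. *)
Lemma k4_rot a b c d P1 P2 P3 P4 : k4 a b c d P1 P2 P3 P4 -> k4 b c d a P2 P3 P4 P1.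
Proof. by case=> *; split => //; atoms; solveb. Qed.

Lemma k4_flip a b c d P1 P2 P3 P4 : k4 a b c d P1 P2 P3 P4 -> k4 b a d c P1 P4 P3 P2.
Proof. by case=> ? ? m1 m2 m3 m4 *; split; try exact: minlinkC; atoms; solveb. Qed.

(** The edge [bd] is the further chord supplied by goodness. The preceding lemmas, in all their
    symmetric positions, show that no other edge joins the two arcs. *)
Lemma theta_k4 x y A B : theta x y A B -> minsize (#|A| + #|B|) ->
  exists b d P1 P2 P3 P4, k4 x b y d P1 P2 P3 P4 /\
    #|A| + #|B| = #|P1| + #|P2| + #|P3| + #|P4| + 2.
Proof.
move=> h m; have [mA mB] := theta_minlink h m.
have m' : minsize (#|B| + #|A|) by rewrite addnC.
have /touchP[b [d [bA dB bd]]] := gG h; have db : adj d b by rewrite adj_sym.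
have nb1 := theta_far h m bA dB bd; have nb2 := theta_far (thetaC h) m bA dB bd.
have nd1 := theta_far (thetaX h) m' dB bA db.
have nd2 := theta_far (thetaC (thetaX h)) m' dB bA db.
have [P1 [P2 sA]] := split_minlink mA bA.
have [P4 [P3 sB]] := split_minlink (minlinkC mB) dB.
have cA := split_card sA; have cB := split_card sB.
have sA' := split_atC sA; have sB' := split_atC sB.
have hC := thetaC h; have hX := thetaX h; have hXC := thetaC hX.
exists b, d, P1, P2, P3, P4; split; last by rewrite cA cB; clear; lia.
have n1 : (P1 == set0) = false by rewrite -(split_uX sA) touch1.
have n2 : (P2 == set0) = false by rewrite -(split_uY sA) touch1.
have n4 : (P4 == set0) = false by rewrite -(split_uX sB) touch1.
have n3 : (P3 == set0) = false by rewrite -(split_uY sB) touch1.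
have b4 : touch P4 [set b] = false.
  apply/negbTE/touchPn => v ? vP /set1P->; apply/negP; rewrite adj_sym.
  exact: no_edge_same h m bd sA sB vP.
have b3 : touch P3 [set b] = false.
  apply/negbTE/touchPn => v ? vP /set1P->; apply/negP; rewrite adj_sym.
  exact: no_edge_same hC m bd sA' sB' vP.
have d1 : touch P1 [set d] = false.
  apply/negbTE/touchPn => v ? vP /set1P->; apply/negP; rewrite adj_sym.
  exact: no_edge_same hX m' db sB sA vP.
have d2 : touch P2 [set d] = false.
  apply/negbTE/touchPn => v ? vP /set1P->; apply/negP; rewrite adj_sym.
  exact: no_edge_same hXC m' db sB' sA' vP.
have t14 : touch P1 P4 = false.
  by apply/negbTE/touchPn => u v uP vP; apply/negP; apply: no_edge_parallel h m bd sA sB uP vP.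
have t23 : touch P2 P3 = false.
  by apply/negbTE/touchPn => u v uP vP; apply/negP; apply: no_edge_parallel hC m bd sA' sB' uP vP.
have t13 : touch P1 P3 = false.
  by apply/negbTE/touchPn => u v uP vP; apply/negP; apply: no_edge_cross h m bd sA sB uP vP.
have t24 : touch P2 P4 = false.
  by apply/negbTE/touchPn => u v uP vP; apply/negP; apply: no_edge_cross hC m bd sA' sB' uP vP.
have xy : adj x y by case/and5P: h.
have := adj_neq xy; have := adj_neq bd => bd' xy'.
have k1 := split_m1 sA (negbT n1). have k2 := split_m2 sA (negbT n2).
have k4 := split_m1 sB (negbT n4). have k3 := split_m2 sB (negbT n3).
rewrite /theta in h; clear m m' cA cB sA' sB' mA mB hC hX hXC.
destruct sA, sB; subst A B; atoms.
by split; first [exact: minlinkC | done | solveb].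
Qed.

Lemma k4_exists : (exists x y A B, theta x y A B) ->
  exists a b c d P1 P2 P3 P4,
    k4 a b c d P1 P2 P3 P4 /\ minsize (#|P1| + #|P2| + #|P3| + #|P4| + 2).
Proof.
move=> [x [y [A [B h]]]].
have [n] := ubnP (#|A| + #|B|); elim: n x y A B h => // n IH x y A B h lt.
have [/existsP[[[[x' y'] A'] B']] /andP[/= h' lt']|H] := boolP [exists q : G * G * {set G} * {set G},
   theta q.1.1.1 q.1.1.2 q.1.2 q.2 && (#|q.1.2| + #|q.2| < #|A| + #|B|)].
  by apply: IH h' _; rewrite -ltnS; apply: leq_trans lt; rewrite ltnS.
have m : minsize (#|A| + #|B|).
  move=> x' y' A' B' h'; rewrite leqNgt; apply: contra H => lt'.
  by apply/existsP; exists (x', y', A', B'); rewrite /= h'.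
have [b [d [P1 [P2 [P3 [P4 [k E]]]]]]] := theta_k4 h m.
by exists x, b, y, d, P1, P2, P3, P4; rewrite -E.
Qed.

End Cores.

(** * Finite patterns of connected sets *)

(* A pattern is a finite graph on a list of indices; in a graph each index [i]
   stands for a connected set [phi i], a single node if [i] is listed in [sg]. *)
Section Witness.
Variables (sg : seq nat) (e : rel nat).

(** Every entry but the last has to see a later one, so the order of the lists in certificates
    matters. *)
Fixpoint conn_list (l : seq nat) : bool :=
  if l is i :: l' then (l' == [::]) || has (e i) l' && conn_list l' else true.

Definition touch_list (l l' : seq nat) := has (fun i => has (e i) l') l.

(* In a pattern, [A] and [B] span with the edge [xy] a cycle whose only chord
   is [xy]. *)
Definition witness (x y : nat) (A B : seq nat) :=
  [&& [&& x \in sg, y \in sg, x != y & e x y],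
      [&& conn_list A, conn_list B & ~~ has (mem A) B],
      [&& x \notin A, y \notin A, x \notin B & y \notin B],
      [&& has (e x) A, has (e y) A, has (e x) B & has (e y) B] &
      ~~ touch_list A B].

End Witness.

Definition extend (e : rel nat) (k : nat) (T : seq nat) : rel nat :=
  fun i j => if i == k then (j != k) && (j \in T)
             else if j == k then i \in T else e i j.

Fixpoint sublists (l : seq nat) : seq (seq nat) :=
  if l is i :: l' then
    let s := sublists l' in s ++ [seq i :: t | t <- s]
  else [:: [::]].

Lemma filter_sublists (p : pred nat) l : [seq i <- l | p i] \in sublists l.
Proof.
elim: l => //= i l IH; rewrite mem_cat; case: ifP => _; rewrite ?IH //.
by apply/orP; right; apply/mapP; exists [seq i <- l | p i].
Qed.

Fixpoint pairs (l : seq nat) : seq (nat * nat) :=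
  if l is i :: l' then [seq (i, j) | j <- l'] ++ pairs l' else [::].

Lemma pairsP l x y : x \in l -> y \in l -> x != y ->
  (x, y) \in pairs l \/ (y, x) \in pairs l.
Proof.
elim: l => //= i l IH; rewrite !inE => /orP[/eqP->|xl] /orP[/eqP->|yl] xy.
- by rewrite eqxx in xy.
- by left; rewrite mem_cat map_f.
- by right; rewrite mem_cat map_f.
by case: (IH xl yl xy) => H; [left | right]; rewrite mem_cat H orbT.
Qed.

Definition certificate := (nat * nat * seq nat * seq nat)%type.

Section Check.
Variables (I sg : seq nat) (e : rel nat) (k : nat) (oks : seq (nat * nat)).

Definition refutes (T : seq nat) (c : certificate) : bool :=
  let: (x, y, A, B) := c in
  [&& all (mem (k :: I)) A, all (mem (k :: I)) B & witness sg (extend e k T) x y A B].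

Definition compatible i j := ((i, j) \in oks) || ((j, i) \in oks).

(* The ways to attach a connected set with [x] and [y] as only incompatible
   pair. *)
Definition conflicts_at (x y : nat) : seq (seq nat) :=
  [seq x :: y :: Z | Z <- sublists [seq z <- I | compatible x z && compatible y z]
                   & all (fun i => all (fun j => (i == j) || compatible i j) Z) Z].

Definition conflicts : seq (seq nat) :=
  flatten [seq conflicts_at p.1 p.2 | p <- pairs I & ~~ compatible p.1 p.2].

(** Positional matching keeps the check linear, so a certificate list is tied to the order of the
    node list that generates the conflicts. *)
Definition conflicts_refuted (exs : seq (seq nat)) (cs : seq certificate) : bool :=
  all2 refutes [seq T <- conflicts | T \notin exs] cs.

End Check.

Lemma all2_mem (S T : eqType) (r : S -> T -> bool) (s : seq S) (t : seq T) x :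
  all2 r s t -> x \in s -> exists2 y, y \in t & r x y.
Proof.
elim: s t => [|a s IH] [|b t] //= /andP[ab st]; rewrite inE => /orP[/eqP->|xs].
  by exists b; rewrite ?mem_head.
by have [y yt xy] := IH t st xs; exists y; rewrite // inE yt orbT.
Qed.

Section Model.
Variable G : sgraph.
Hypothesis gG : good G.
Implicit Types (D : {set G}) (I sg l : seq nat) (e : rel nat) (phi : nat -> {set G}).

Record model (I : seq nat) (e : rel nat) (phi : nat -> {set G}) : Prop := Model {
  model_conn : {in I, forall i, conn (phi i)};
  model_dis : {in I &, forall i j, i != j -> [disjoint phi i & phi j]};
  model_touch : {in I &, forall i j, i != j -> touch (phi i) (phi j) = e i j}
}.

Definition is_single (phi : nat -> {set G}) (sg : seq nat) :=
  {in sg, forall i, exists x, phi i = [set x]}.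

Definition cup (phi : nat -> {set G}) (l : seq nat) : {set G} := \bigcup_(i <- l) phi i.

Lemma cupP phi l (x : G) : reflect (exists2 i, i \in l & x \in phi i) (x \in cup phi l).
Proof.
rewrite /cup; elim: l => [|i l IH].
  by rewrite big_nil inE; constructor => -[].
rewrite big_cons inE; apply: (iffP orP) => [[xi|/IH[j jl xj]]|[j]].
- by exists i; rewrite ?mem_head.
- by exists j; rewrite // inE jl orbT.
by rewrite inE => /orP[/eqP->|jl xj]; [left | right; apply/IH; exists j].
Qed.

Lemma model_conn_list I e phi l : model I e phi -> all (mem I) l ->
  uniq l -> conn_list e l -> conn (cup phi l).
Proof.
move=> m; rewrite /cup; elim: l => [|i l IH] /=; first by rewrite big_nil conn0.
move=> /andP[iI lI] /andP[il ul] /orP[/eqP->|/andP[/hasP[j jl ij] cl]].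
  by rewrite big_seq1; apply: (model_conn m).
rewrite big_cons; apply: conn_touch; first exact: (model_conn m).
  exact: IH.
have : touch (phi i) (phi j).
  rewrite (model_touch m) //; first exact: (allP lI).
  by apply: contraNneq il => ->.
apply: touchS => //; apply/subsetP => x xj; apply/cupP; by exists j.
Qed.

Lemma model_has I e phi x l : model I e phi -> x \in I -> all (mem I) l -> x \notin l ->
  has (e x) l -> touch (phi x) (cup phi l).
Proof.
move=> m xI lI xl /hasP[j jl xj].
have : touch (phi x) (phi j).
  rewrite (model_touch m) //; first exact: (allP lI).
  by apply: contraNneq xl => ->.
by apply: touchS => //; apply/subsetP => z zj; apply/cupP; exists j.
Qed.

Lemma conn_list_undup e l : conn_list e l -> conn_list e (undup l).
Proof.
elim: l => //= i l IH /orP[/eqP-> //|/andP[hi cl]].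
case: ifP => _; first exact: IH.
by rewrite /= IH // andbT has_undup hi orbT.
Qed.

Lemma cup_undup phi l : cup phi (undup l) = cup phi l.
Proof.
apply/setP => x; apply/cupP/cupP => -[i il xi]; exists i => //.
  by rewrite -mem_undup.
by rewrite mem_undup.
Qed.

Lemma witness_false I sg e phi x y A B : model I e phi -> is_single phi sg ->
  {subset sg <= I} -> all (mem I) A -> all (mem I) B -> witness sg e x y A B -> False.
Proof.
move=> m sgl sI AI BI /and5P[/and4P[xs ys xy exy] /and3P[cA cB dAB]].
move=> /and4P[xA yA xB yB] /and4P[tx ty sx sy] nt.
have [x' Ex] := sgl x xs; have [y' Ey] := sgl y ys.
have xI := sI _ xs; have yI := sI _ ys.
have und l : all (mem I) l -> all (mem I) (undup l).
  by move=> /allP h; apply/allP => i; rewrite mem_undup => /h.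
have cl l : all (mem I) l -> conn_list e l -> conn (cup phi l).
  move=> lI cl; rewrite -cup_undup; apply: (model_conn_list m (und l lI)).
    exact: undup_uniq.
  exact: conn_list_undup.
have nin z z' l : z \in I -> phi z = [set z'] -> all (mem I) l -> z \notin l -> z' \notin cup phi l.
  move=> zI Ez lI zl; apply/cupP => -[j jl zj].
  have zj' : z != j by apply: contraNneq zl => ->.
  have := model_dis m zI (allP lI _ jl) zj'.
  by rewrite Ez disjoints1 zj.
have : touch (cup phi A) (cup phi B).
  apply: (gG (x := x') (y := y')); rewrite /theta -touch1 -Ex -Ey (model_touch m) // exy.
  rewrite !cl // (nin x) // (nin y) // (nin x) // (nin y) //.
  rewrite !(model_has m) // !andbT /=.
  apply: disjointI => z /cupP[i iA zi]; apply/cupP => -[j jB zj].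
  have ij : i != j by apply: contraNneq dAB => E; apply/hasP; exists j; rewrite //= -E.
  by have := model_dis m (allP AI _ iA) (allP BI _ jB) ij => /disjointFr/(_ zi); rewrite zj.
move=> /touchP[s [t [/cupP[i iA si] /cupP[j jB tj] st]]]; case/negP: nt.
apply/hasP; exists i => //; apply/hasP; exists j => //.
have ij : i != j by apply: contraNneq dAB => E; apply/hasP; exists j; rewrite //= -E.
have iI : i \in I := allP AI _ iA; have jI : j \in I := allP BI _ jB.
have : touch (phi i) (phi j) by apply/touchP; exists s, t.
by rewrite (model_touch m iI jI ij).
Qed.

Definition outside (I : seq nat) (phi : nat -> {set G}) D :=
  {in I, forall i, [disjoint D & phi i]}.

Lemma model_extend I e phi k D T : model I e phi -> k \notin I -> conn D -> outside I phi D ->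
  (forall i, i \in I -> touch D (phi i) = (i \in T)) ->
  model (k :: I) (extend e k T) (fun i => if i == k then D else phi i).
Proof.
move=> m kI cD oD HT.
have nk i : i \in I -> (i == k) = false by move=> iI; apply: contraNF kI => /eqP<-.
split.
- by move=> i; rewrite inE => /orP[/eqP->|iI]; rewrite ?eqxx // nk //; apply: (model_conn m).
- move=> i j; rewrite !inE => /orP[/eqP->|iI] /orP[/eqP->|jI]; rewrite ?eqxx // ?nk // => ij.
  + exact: oD.
  + by rewrite disjoint_sym; apply: oD.
  + exact: (model_dis m).
- move=> i j; rewrite !inE /extend => /orP[/eqP->|iI] /orP[/eqP->|jI]; rewrite ?eqxx // ?nk //= => ij.
  + exact: HT.
  + by rewrite touchC HT.
  + exact: (model_touch m).
Qed.

Lemma attach_false I sg e phi k D T : model I e phi -> is_single phi sg ->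
  {subset sg <= I} -> k \notin I -> conn D -> outside I phi D ->
  {in I, forall i, touch D (phi i) = (i \in T)} ->
  (exists c, refutes I sg e k T c) -> False.
Proof.
move=> m s1 s2 kI cD oD HT [[[[x0 y0] A] B] /and3P[AI BI]].
apply: (witness_false (model_extend m kI cD oD HT)) => //.
- move=> i isg; have [x Ex] := s1 i isg; exists x; rewrite ifF //.
  by apply: contraNF kI => /eqP<-; apply: s2.
- by move=> i /s2; rewrite inE orbC => ->.
Qed.

(** Unlike in [attach_false] the attached part is a single node, so a certificate may use it as an
    end of the chord. *)
Lemma attach_node_false I sg e phi k w T : model I e phi -> is_single phi sg ->
  {subset sg <= I} -> k \notin I -> outside I phi [set w] ->
  {in I, forall i, touch [set w] (phi i) = (i \in T)} ->
  (exists c, refutes I (k :: sg) e k T c) -> False.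
Proof.
move=> m s1 s2 kI oD HT [[[[x0 y0] A] B] /and3P[AI BI]].
apply: (witness_false (model_extend m kI (conn1 w) oD HT)) => //.
- move=> i; rewrite inE => /orP[/eqP->|isg]; first by exists w; rewrite eqxx.
  have [x Ex] := s1 i isg; exists x; rewrite ifF //.
  by apply: contraNF kI => /eqP<-; apply: s2.
- by move=> i; rewrite !inE => /orP[->|/s2->]; rewrite ?orbT.
Qed.

(* A connected set none of whose nodes touches two parts of the pattern can only
   touch pairwise compatible parts: in a smallest counterexample the only
   incompatible pair would be the ends of a minimal connection. *)
Lemma attached_compatible I sg e phi k oks exs cs D : model I e phi -> is_single phi sg ->
  {subset sg <= I} -> k \notin I -> conflicts_refuted I sg e k oks exs cs ->
  conn D -> outside I phi D ->
  {in D, forall w, {in I &, forall i j, touch [set w] (phi i) -> touch [set w] (phi j) -> i = j}} ->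
  (exists x y T E, [/\ [/\ x \in I, y \in I & x :: y :: T \in exs],
      minlink (phi x) (phi y) E, E \subset D &
      {in I, forall i, touch E (phi i) = (i \in x :: y :: T)}]) \/
  {in I &, forall i j, touch D (phi i) -> touch D (phi j) -> i != j -> compatible oks i j}.
Proof.
move=> m s1 s2 kI chk cD0 oD0 one0.
pose bad E := has (fun i => has (fun j =>
  [&& touch E (phi i), touch E (phi j), i != j & ~~ compatible oks i j]) I) I.
case bD0: (bad D); last first.
  right=> i j iI jI Di Dj ij; apply: contraFT bD0 => nij.
  by apply/hasP; exists i => //; apply/hasP; exists j; rewrite // Di Dj ij.
left; rename D into D0.
have [D mD' sD] : {D | minset (fun E => conn E && bad E) D & D \subset D0}.
  by apply: minset_exists; rewrite cD0.
have /andP[cD /hasP[x xI /hasP[y yI /and4P[Dx Dy xy nok]]]] := minsetp mD'.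
have oD : outside I phi D by move=> l lI; apply: disjointWl sD (oD0 l lI).
have one : {in D, forall w, {in I &, forall i j,
    touch [set w] (phi i) -> touch [set w] (phi j) -> i = j}}.
  by move=> w /(subsetP sD); apply: one0.
have sub_ok E i j : conn E -> E \proper D -> i \in I -> j \in I ->
    touch E (phi i) -> touch E (phi j) -> i != j -> compatible oks i j.
  move=> cE pE iI jI Ei Ej ij; apply: contraT => nij.
  have /minsetP[_ /(_ E)] := mD'; rewrite cE (proper_sub pE) => H.
  suff E' : E = D by move: pE; rewrite E' properxx.
  apply: H => //; apply/hasP; exists i => //; apply/hasP; exists j => //.
  by rewrite Ei Ej ij.
have mD : minlink (phi x) (phi y) D.
  apply/minsetP; split; first by rewrite /links cD Dx Dy.
  move=> E /and3P[cE Ex Ey] sE; apply: contraNeq nok => nE.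
  by apply: sub_ok Ex Ey _ => //; rewrite properEneq nE.
(* Cut [D] at a node [u] meeting [phi i]. Since [u] meets neither [phi x] nor [phi y], both sides
   are nonempty; the side with a node meeting [phi j] is, together with [u], a proper connected
   subset, to which minimality applies. *)
have other i j : i \in I -> j \in I -> touch D (phi i) -> touch D (phi j) -> i != j ->
    i != x -> i != y -> compatible oks i j /\ compatible oks j i.
  move=> iI jI /touchP[u [u' [uD u'i uu']]] /touchP[v [v' [vD v'j vv']]] ij ix iy.
  have ti : touch [set u] (phi i) by apply/touch1P; exists u'.
  have tj : touch [set v] (phi j) by apply/touch1P; exists v'.
  have [D1 [D2 sp]] := split_minlink mD uD.
  have uv : u != v by apply: contraNneq ij => uv; apply/eqP/(one u uD) => //; rewrite uv.
  have D10 : D1 != set0.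
    apply: contra_neq ix => D10; apply: (one u uD) => //; by rewrite (split_uX sp) D10 eqxx.
  have D20 : D2 != set0.
    apply: contra_neq iy => D20; apply: (one u uD) => //; by rewrite (split_uY sp) D20 eqxx.
  have c1 : conn (D1 :|: [set u]).
    by apply: conn_touch (split_c1 sp) (conn1 u) _; rewrite touchC (split_u1t sp).
  have c2 : conn ([set u] :|: D2).
    by apply: conn_touch (conn1 u) (split_c2 sp) _; rewrite (split_u2t sp).
  have p1 : D1 :|: [set u] \proper D.
    rewrite (split_eq sp); apply/properP; split; first exact: subsetUl.
    have [z z2] := set0Pn _ D20; exists z; first by rewrite inE z2 orbT.
    rewrite !inE negb_or (disjointFl (split_dis sp) z2) /=.
    by apply: contraTneq z2 => ->; apply: split_u2 sp.
  have p2 : [set u] :|: D2 \proper D.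
    rewrite (split_eq sp) -setUA; apply/properP; split; first exact: subsetUr.
    have [z z1] := set0Pn _ D10; exists z; first by rewrite inE z1.
    rewrite !inE negb_or (disjointFr (split_dis sp) z1) andbT.
    by apply: contraTneq z1 => ->; apply: split_u1 sp.
  have tiU (E : {set G}) : u \in E -> touch E (phi i) by move=> uE; apply/touchP; exists u, u'.
  have tjU (E : {set G}) : v \in E -> touch E (phi j) by move=> vE; apply/touchP; exists v, v'.
  move: vD; rewrite {1}(split_eq sp) !inE => /orP[/orP[v1|/eqP vu]|v2].
  - have [t1 t2] : touch (D1 :|: [set u]) (phi i) /\ touch (D1 :|: [set u]) (phi j).
      by split; [apply: tiU | apply: tjU]; rewrite !inE ?eqxx ?v1 ?orbT.
    by split; apply: sub_ok c1 p1 _ _ _ _ _ => //; rewrite eq_sym.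
  - by rewrite vu eqxx in uv.
  - have [t1 t2] : touch ([set u] :|: D2) (phi i) /\ touch ([set u] :|: D2) (phi j).
      by split; [apply: tiU | apply: tjU]; rewrite !inE ?eqxx ?v2 ?orbT.
    by split; apply: sub_ok c2 p2 _ _ _ _ _ => //; rewrite eq_sym.
have okC i j : compatible oks i j = compatible oks j i by rewrite /compatible orbC.
(* [conflicts] lists each pair only in the order of [I], so [x] and [y] may have to change roles. *)
suff main x' y' : (x' = x /\ y' = y) \/ (x' = y /\ y' = x) -> (x', y') \in pairs I ->
    exists x y T E, [/\ [/\ x \in I, y \in I & x :: y :: T \in exs],
      minlink (phi x) (phi y) E, E \subset D0 &
      {in I, forall i, touch E (phi i) = (i \in x :: y :: T)}].
  by case: (pairsP xI yI xy) => h; apply: main h; auto.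
move=> xyE pI; have [Dx' Dy'] : touch D (phi x') /\ touch D (phi y') by case: xyE => [[-> ->]|[-> ->]].
have nok' : ~~ compatible oks x' y' by case: xyE => [[-> ->]|[-> ->]] //; rewrite okC.
have other' i j : i \in I -> j \in I -> touch D (phi i) -> touch D (phi j) -> i != j ->
    i != x' -> i != y' -> compatible oks i j.
  move=> iI jI Di Dj ij ix iy.
  have [ix' iy'] : i != x /\ i != y by case: xyE ix iy => -[-> ->].
  exact: proj1 (other i j iI jI Di Dj ij ix' iy').
have [x'I y'I] : x' \in I /\ y' \in I by case: xyE => [[-> ->]|[-> ->]].
set C := [seq z <- I | compatible oks x' z && compatible oks y' z].
pose Z := [seq z <- C | touch D (phi z) && ((z != x') && (z != y'))].
have ZI i : i \in Z -> [/\ i \in I, touch D (phi i), i != x' & i != y'].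
  by rewrite !mem_filter => /andP[/and3P[Di ix iy] /andP[_ iI]].
have HT : {in I, forall i, touch D (phi i) = (i \in x' :: y' :: Z)}.
  move=> i iI; rewrite !inE; have [->|ix] := eqVneq i x'; first by rewrite Dx'.
  have [->|iy] := eqVneq i y'; first by rewrite Dy'.
  rewrite !mem_filter iI ix iy !andbT /=; case Di: (touch D (phi i)) => //=.
  by rewrite (okC x') (okC y') !other'.
have mD2 : minlink (phi x') (phi y') D.
  by case: xyE => -[-> ->] //; apply: minlinkC.
have inC : x' :: y' :: Z \in conflicts I oks.
  apply/flattenP; exists (conflicts_at I oks x' y').
    by apply/mapP; exists (x', y'); rewrite // mem_filter nok'.
  apply/mapP; exists Z => //; rewrite mem_filter filter_sublists andbT.
  apply/allP => i /ZI[iI Di ix iy]; apply/allP => j /ZI[jI Dj _ _].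
  by have [//|ij] := eqVneq i j; apply: other'.
have [ex|nex] := boolP (x' :: y' :: Z \in exs); first by exists x', y', Z, D.
have : x' :: y' :: Z \in [seq T <- conflicts I oks | T \notin exs] by rewrite mem_filter nex.
move=> /(all2_mem chk)[c _ Hc]; exfalso.
by apply: (attach_false m s1 s2 kI cD oD HT); exists (c : certificate).
Qed.

End Model.

(** * Growing copies of induced subgraphs of the Petersen and Heawood graphs *)

Lemma leq_size_card (T : finType) (s : seq T) (S : {set T}) :
  uniq s -> {subset s <= S} -> size s <= #|S|.
Proof. by move=> us sS; rewrite cardE; apply: uniq_leq_size => // x /sS; rewrite mem_enum. Qed.

Section Stage.
Variables (e : rel nat) (k : nat).
Implicit Types (A T : seq nat).

(** The pairs that one new node may see: adjacent nodes would close a triangle, nodes with a common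
    neighbour a square. *)
Definition far A i j := ~~ e i j && ~~ has (fun z => e z i && e z j) A.

Fixpoint far_sets A (l : seq nat) : seq (seq nat) :=
  if l is i :: l' then
    let s := far_sets A l' in s ++ [seq i :: t | t <- s & all (far A i) t]
  else [:: [::]].

Lemma filter_far_sets A (p : pred nat) l : uniq l ->
  {in [seq i <- l | p i] &, forall i j, i != j -> far A i j} ->
  [seq i <- l | p i] \in far_sets A l.
Proof.
elim: l => //= i l IH /andP[il ul]; rewrite mem_cat; case: ifP => pi H; last by rewrite IH.
apply/orP; right; apply/mapP; exists [seq i <- l | p i] => //; rewrite mem_filter IH //.
  rewrite andbT; apply/allP => j jl; apply: H; rewrite ?mem_head ?inE ?jl ?orbT //.
  by apply: contraNneq il => ->; move: jl; rewrite mem_filter => /andP[].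
by move=> a b al bl; apply: H; rewrite inE ?al ?bl orbT.
Qed.

(** Two neighbours inside the pattern make the degree at least 3 once something is attached.
    Compatible pairs are nonadjacent and no three nodes are pairwise compatible, so a component
    outside meets at most two nodes; with four nodes in the pattern, two more remain on the other
    side. [exts] holds the traces of the new nodes that are allowed. *)
Definition stage_ok A (oks : seq (nat * nat)) (cs : seq certificate)
    (exts : seq (seq nat)) (ncs : seq certificate) : bool :=
  [&& [&& uniq A, k \notin A, 4 <= size A & all (fun x => 2 <= count (e x) A) A],
      all (fun x => all (fun y => [|| x == y, ~~ compatible oks x y |
        ~~ e x y && all (fun z => [|| z == x, z == y |
            ~~ (compatible oks x z && compatible oks y z)]) A]) A) A,
      conflicts_refuted A A e k oks [::] cs &
      all2 (refutes A (k :: A) e k)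
        [seq T <- far_sets A A | (2 <= size T) && (T \notin exts)] ncs].

Variable G : sgraph.
Hypothesis cG : core G.

Definition embed A (f : nat -> G) :=
  {in A &, forall i j, i != j -> f i != f j} /\
  {in A &, forall i j, adj (f i) (f j) = e i j}.

Definition onto A (f : nat -> G) := forall v, exists2 i, i \in A & v = f i.

Lemma embed_model A f : embed A f -> model A e (fun i => [set f i]).
Proof.
case=> fI fe; split=> [i _|i j iA jA ij|i j iA jA ij]; first exact: conn1.
  by rewrite disj1l inE fI.
by rewrite touch1 fe.
Qed.

(** A node outside the copy with two neighbours in it must have its trace in [exts]. If there is no
    such node, a component outside meets at most two nodes of the copy, which yields a cutnode or a
    proper 2-cutset. *)
Lemma embed_step A f oks cs exts ncs : embed A f -> stage_ok A oks cs exts ncs ->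
  onto A f \/ exists T w, [/\ T \in exts, {in A, forall i, w != f i} &
    {in A, forall i, adj w (f i) = (i \in T)}].
Proof.
move=> ef; have m := embed_model ef; have [fI fe] := ef.
move=> /and4P[/and4P[uA kA sA dA] okA cA nA].
have sgl : is_single (fun i => [set f i]) A by move=> i _; exists (f i).
pose im := [set v in [seq f i | i <- A]].
have imP v : reflect (exists2 i, i \in A & v = f i) (v \in im).
  by rewrite inE; apply: mapP.
have [/forallP H|/forallPn[v0 v0n]] := boolP [forall v, v \in im].
  by left=> v; apply/imP.
right; pose att w := [seq i <- A | adj w (f i)].
have attE w i : i \in A -> (i \in att w) = adj w (f i) by move=> iA; rewrite mem_filter iA andbT.
have wneq w i : w \notin im -> i \in A -> w != f i.
  by move=> wn iA; apply: contraNneq wn => ->; apply/imP; exists i.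
have [[w wn w2]|none] : (exists2 w, w \notin im & 2 <= size (att w)) \/
    forall w, w \notin im -> size (att w) <= 1.
  have [/existsP[w /andP[wn w2]]|/existsPn H] := boolP [exists w, (w \notin im) && (2 <= size (att w))].
    by left; exists w.
  by right=> w wn; have := H w; rewrite wn -leqNgt.
- have [ex|nex] := boolP (att w \in exts).
    exists (att w), w; split=> // i iA; [exact: wneq | by rewrite attE].
  have farw : {in att w &, forall i j, i != j -> far A i j}.
    move=> i j; rewrite !mem_filter => /andP[wi iA] /andP[wj jA] ij.
    apply/andP; split; first by apply/negP; rewrite -fe // => /(core_c3 cG wi); apply; rewrite adj_sym.
    apply/hasPn => z zA; apply/negP => /andP[]; rewrite -!fe // => zi zj.
    apply: (core_c4 cG wi _ zj); rewrite 1?adj_sym //; [exact: wneq | exact: fI].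
  exfalso; have fs : att w \in [seq T <- far_sets A A | (2 <= size T) && (T \notin exts)].
    by rewrite mem_filter w2 nex; apply: filter_far_sets.
  have [c _ Hc] := all2_mem nA fs.
  apply: (attach_node_false (core_good cG) m sgl (fun i h => h) kA (w := w) (T := att w)).
  - by move=> i iA; rewrite disj1l inE wneq.
  - by move=> i iA; rewrite touch1 attE.
  - by exists (c : certificate).
exfalso; have v0S : v0 \in ~: im by rewrite inE.
set D := comp (~: im) v0; have cD : conn D := comp_conn v0S.
have DS : D \subset ~: im := comp_sub v0S.
have Dn w : w \in D -> w \notin im by move=> /(subsetP DS); rewrite inE.
have oD : outside A (fun i => [set f i]) D.
  by move=> i iA; rewrite disj1r; apply/negP => /Dn/imP[]; exists i.
have one : {in D, forall w, {in A &, forall i j,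
    touch [set w] [set f i] -> touch [set w] [set f j] -> i = j}}.
  move=> w wD i j iA jA; rewrite !touch1 => wi wj; apply/eqP; apply: contraT => ij.
  have := none w (Dn w wD); rewrite leqNgt => /negP[].
  by apply: (@uniq_leq_size _ [:: i; j]); rewrite /= ?inE ?ij // => l;
     rewrite !inE => /orP[]/eqP->; rewrite attE.
have [[x [y [T [E [[_ _ //]]]]]]|ok] :=
  attached_compatible (core_good cG) m sgl (fun i h => h) kA cA cD oD one.
have exit u w : u \in D -> w \notin D -> adj u w -> exists2 i, i \in A & w = f i.
  move=> uD wD uw; apply/imP; apply: contraR wD => wn; apply: comp_closed uD _ uw => //.
  by rewrite inE.
have vD : v0 \in D := comp_refl _ v0.
have D0 : D <> set0 by move=> D0; move: vD; rewrite D0 inE.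
clearbody D.
have no1 x : x \in A -> (forall i, i \in A -> touch D [set f i] -> i = x) -> False.
  move=> xA H; have [y yA yx] : exists2 y, y \in A & y != x.
    apply/hasP; apply: contraT => /hasPn nh.
    have : size A <= size [:: x] by apply: uniq_leq_size uA _ => y /nh; rewrite negbK inE.
    by move=> /(leq_trans sA).
  apply: D0; apply: (exit1 cG (v := f x) (z := f y)).
  - by apply/negP => /Dn/imP[]; exists x.
  - by apply/negP => /Dn/imP[]; exists y.
  - exact: fI.
  move=> u w uD wD uw; have [i iA wi] := exit u w uD wD uw.
  rewrite wi in uw; rewrite wi (H i) //; apply/touchP; exists u, (f i).
  by rewrite inE.
have [a0 a0A] : exists a0, a0 \in A.
  by case: (A) sA => // a0 A' _; exists a0; rewrite mem_head.
have [x xA Dx] : exists2 x, x \in A & touch D [set f x].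
  apply/hasP; apply: contraT => /hasPn nh; exfalso; apply: (no1 a0) => // i /nh.
  by move=> /negbTE->.
have [y yA /andP[yx Dy]] : exists2 y, y \in A & (y != x) && touch D [set f y].
  apply/hasP; apply: contraT => /hasPn nh; exfalso; apply: (no1 x) => // i /nh.
  by rewrite negb_and negbK => /orP[/eqP//|/negbTE->].
have xy : x != y by rewrite eq_sym.
move: (allP (allP okA x xA) y yA); rewrite (negbTE xy) (ok x y) //= => /andP[nexy /allP zok].
have only i : i \in A -> touch D [set f i] -> i = x \/ i = y.
  move=> iA Di; have [->|ix] := eqVneq i x; first by left.
  have [->|iy] := eqVneq i y; [by right | exfalso].
  by move: (zok i iA); rewrite (negbTE ix) (negbTE iy) /= (ok x i) ?(ok y i) 1?eq_sym.
have [/touchP[dx [fx [dxD /set1P-> adx]]] /touchP[dy [fy [dyD /set1P-> ady]]]] := (Dx, Dy).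
have deg3 z d : z \in A -> d \in D -> adj d (f z) -> 3 <= deg (f z).
  move=> zA dD dz; apply: leq_trans (_ : size (d :: [seq f i | i <- A & e z i]) <= _).
    by rewrite /= size_map size_filter ltnS (allP dA).
  apply: leq_size_card => /=.
    apply/andP; split.
      apply/mapP => -[i]; rewrite mem_filter => /andP[_ iA] di.
      by move: (Dn d dD) => /imP[]; exists i.
    rewrite map_inj_in_uniq ?filter_uniq // => i j; rewrite !mem_filter => /andP[_ iA] /andP[_ jA].
    by move=> fij; apply/eqP; apply: contraTT isT => ij; move: (fI i j iA jA ij); rewrite fij eqxx.
  move=> w; rewrite !inE => /orP[/eqP->|/mapP[i]]; first by rewrite adj_sym.
  by rewrite mem_filter => /andP[zi iA] ->; rewrite fe.
have nfD i : i \in A -> f i \notin D by move=> iA; apply/negP => /Dn/imP[]; exists i.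
apply: (core_no2 cG (s := f x) (t := f y) (X := D)); rewrite ?nfD ?fI ?fe //.
- exact: deg3 adx.
- exact: deg3 ady.
- apply/negbTE/touchPn => u w uD; rewrite !inE !negb_or => /and3P[wD wx wy].
  apply/negP => uw; have [i iA wi] := exit u w uD wD uw.
  have : touch D [set f i] by apply/touchP; exists u, w; rewrite inE wi eqxx -wi.
  by case/(only i iA) => E; move: wx wy; rewrite wi E eqxx.
- apply: (@leq_size_card _ [:: dx; dy]); last first.
    by move=> w; rewrite !inE => /orP[]/eqP->.
  rewrite /= inE andbT; apply: contraNneq xy => dxy; apply/eqP/(one dx) => //.
    by rewrite touch1.
  by rewrite touch1 dxy.
apply: leq_trans (_ : size [seq f i | i <- A & (i != x) && (i != y)] <= _).
  have : size A <= size (x :: y :: [seq i <- A | (i != x) && (i != y)]).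
    apply: uniq_leq_size => // i iA; rewrite !inE mem_filter iA andbT.
    by case: eqP => //=; case: eqP.
  by rewrite size_map => /(leq_trans sA).
apply: leq_size_card.
  rewrite map_inj_in_uniq ?filter_uniq // => i j; rewrite !mem_filter => /andP[_ iA] /andP[_ jA].
  by move=> fij; apply/eqP; apply: contraTT isT => ij; move: (fI i j iA jA ij); rewrite fij eqxx.
move=> w /mapP[i]; rewrite mem_filter => /andP[/andP[ix iy] iA] ->.
by rewrite in_setC in_setU negb_or nfD // !inE negb_or !fI.
Qed.
End Stage.

(** * The Petersen and Heawood graphs *)

Definition nbs_adj (nbs : seq (seq nat)) : rel nat := fun i j => j \in nth [::] nbs i.

Definition petersen_adj : rel nat := nbs_adj
  [:: [:: 1; 4; 5]; [:: 0; 2; 8]; [:: 1; 3; 6]; [:: 2; 4; 9]; [:: 0; 3; 7];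
      [:: 6; 9; 0]; [:: 5; 7; 2]; [:: 6; 8; 4]; [:: 7; 9; 1]; [:: 5; 8; 3] ].

Definition heawood_adj : rel nat := nbs_adj
  [:: [:: 1; 13; 9]; [:: 0; 2; 6]; [:: 1; 3; 11]; [:: 2; 4; 8]; [:: 3; 5; 13];
      [:: 4; 6; 10]; [:: 5; 7; 1]; [:: 6; 8; 12]; [:: 7; 9; 3]; [:: 8; 10; 0];
      [:: 9; 11; 5]; [:: 10; 12; 2]; [:: 11; 13; 7]; [:: 12; 0; 4] ].

Definition petersen_num (x : petersen) : nat :=
  match x with inl i => i | inr j => 5 + j end.

Lemma petersen_numE (x y : petersen) :
  adj x y = petersen_adj (petersen_num x) (petersen_num y).
Proof.
case: x => -[[|[|[|[|[|i]]]]] // Hi]; case: y => -[[|[|[|[|[|j]]]]] // Hj];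
  by vm_compute.
Qed.

Lemma petersen_num_inj : injective petersen_num.
Proof.
move=> [i|i] [j|j] /= E.
- by congr inl; apply: val_inj.
- by have := ltn_ord i; rewrite E ltnNge leq_addr.
- by have := ltn_ord j; rewrite -E ltnNge leq_addr.
- by congr inr; apply: val_inj; apply: addnI E.
Qed.

Lemma petersen_num_onto i : i < 10 -> exists x, petersen_num x = i.
Proof.
case: (ltnP i 5) => [i5 _|i5 i10]; first by exists (inl (Ordinal i5)).
have Hi : i - 5 < 5 by rewrite ltn_subLR.
by exists (inr (Ordinal Hi)); rewrite /= subnKC.
Qed.

Lemma heawood_numE (x y : heawood) : adj x y = heawood_adj x y.
Proof.
case: x => -[|[|[|[|[|[|[|[|[|[|[|[|[|[|i]]]]]]]]]]]]]] // Hi;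
case: y => -[|[|[|[|[|[|[|[|[|[|[|[|[|[|j]]]]]]]]]]]]]] // Hj; by vm_compute.
Qed.

Section Embeddings.
Variable G : sgraph.

Lemma embed_induced (H : sgraph) (num : H -> nat) (e : rel nat) n A (f : nat -> G) :
  (forall x y, adj x y = e (num x) (num y)) -> injective num ->
  (forall i, i < n -> exists x, num x = i) -> all (fun i => i < n) A ->
  embed e A f -> onto A f -> induced_subgraph_of G H.
Proof.
move=> numE numI numO An [fI fe] fO; exists [set x | num x \in A].
pose g (x : induced [set x | num x \in A]) := f (num (val x)).
have xA (x : induced [set x | num x \in A]) : num (val x) \in A.
  by have := valP x; rewrite inE.
have gI : injective g.
  move=> x y gxy; apply/val_inj/numI/eqP; apply: contraT => nxy.
  by have := fI _ _ (xA x) (xA y) nxy; rewrite -/(g x) gxy eqxx.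
have gO v : exists x, g x = v.
  have [i iA ->] := fO v; have [x xi] := numO i (allP An i iA).
  have xS : x \in [set x | num x \in A] by rewrite inE xi.
  by exists (exist _ x xS); rewrite /g /= xi.
have gE x y : adj (g x) (g y) = adj x y by rewrite fe // -numE.
have h v : {x | g x = v}.
  have : exists x, g x == v by have [x xv] := gO v; exists x; apply/eqP.
  by move=> ex; exists (xchoose ex); apply/eqP/(xchooseP ex).
have hK : cancel (fun v => sval (h v)) g by move=> v; case: (h v).
exists (fun v => sval (h v)).
  by exists g => // x; apply: gI; rewrite hK.
by move=> x y; rewrite -gE !hK.
Qed.

(* [A'] is, up to the isomorphism [s], the trace of the graph on [A] together
   with a new node [z] seeing [T]. *)
Definition reembeds (e : rel nat) (A A' : seq nat) z (s : seq nat) (T : seq nat) : bool :=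
  let sg i := nth 0 s i in
  all (fun i => all (fun j => if i == z then (if j == z then ~~ e i j else
                       (sg j \in A) && (e i j == (sg j \in T)) && (e j i == (sg j \in T)))
                     else if j == z then true
                     else [|| i == j | sg i != sg j] && (e (sg i) (sg j) == e i j)) A') A'.

Lemma reembed e A A' z s T f w : embed e A f -> z \in A' -> reembeds e A A' z s T ->
  {in A, forall i, w != f i} -> {in A, forall i, adj w (f i) = (i \in T)} ->
  embed e A' (fun i => if i == z then w else f (nth 0 s i)) (G := G).
Proof.
move=> [fI fe] zA' H wn wa.
have zz : e z z = false.
  by have := allP (allP H z zA') z zA'; rewrite eqxx => /negbTE.
have Hz j : j \in A' -> j != z -> [/\ nth 0 s j \in A, e z j = (nth 0 s j \in T) &
    e j z = (nth 0 s j \in T)].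
  move=> jA jz; have := allP (allP H z zA') j jA.
  by rewrite eqxx (negbTE jz) => /andP[/andP[-> /eqP->] /eqP->].
have Hij i j : i \in A' -> j \in A' -> i != z -> j != z ->
    (i == j) || (nth 0 s i != nth 0 s j) /\ e (nth 0 s i) (nth 0 s j) = e i j.
  move=> iA jA iz jz; have := allP (allP H i iA) j jA.
  by rewrite (negbTE iz) (negbTE jz) => /andP[-> /eqP].
split=> i j iA jA; case: (eqVneq i z) => [iz|iz]; case: (eqVneq j z) => [jz|jz].
- by rewrite iz jz eqxx.
- by move=> _; apply: wn; case: (Hz j jA jz).
- by move=> _; rewrite eq_sym; apply: wn; case: (Hz i iA iz).
- move=> ij; have [si _ _] := Hz i iA iz; have [sj _ _] := Hz j jA jz.
  by apply: fI => //; case: (Hij i j iA jA iz jz); rewrite (negbTE ij).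
- by rewrite iz jz adj_irr zz.
- by have [sj E _] := Hz j jA jz; rewrite iz E wa.
- by have [si _ E] := Hz i iA iz; rewrite jz E adj_sym wa.
have [si _ _] := Hz i iA iz; have [sj _ _] := Hz j jA jz.
by rewrite fe //; case: (Hij i j iA jA iz jz).
Qed.

End Embeddings.

(** The Petersen graph without node 6, whose neighbours 2, 5 and 7 now have degree 2. The compatible
    pairs are the neighbours of each of these three: a path parallel to the one through such a node
    creates no unique chord, and only the absence of 2-cutsets excludes it. *)
Definition pet9_nodes := [:: 0; 3; 1; 9; 4; 8; 2; 5; 7].

Definition pet9_ok : seq (nat * nat) := [:: (0, 9); (3, 1); (4, 8)].

Definition pet9_certs : seq certificate := [::
  (0, 4, [:: 7; 8; 1], [:: 3; 10]); (0, 1, [:: 2; 3; 4], [:: 10]); (0, 4, [:: 7; 8; 1], [:: 10]);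
  (0, 1, [:: 2; 3; 4], [:: 8; 10]); (0, 1, [:: 8; 7; 4], [:: 2; 10]);
  (0, 5, [:: 9; 8; 1], [:: 10]); (0, 4, [:: 3; 2; 1], [:: 7; 10]); (3, 9, [:: 8; 1; 2], [:: 10]);
  (3, 4, [:: 0; 1; 2], [:: 10]); (3, 9, [:: 5; 0; 4], [:: 8; 10]); (2, 3, [:: 4; 0; 1], [:: 10]);
  (3, 9, [:: 8; 1; 2], [:: 5; 10]); (3, 4, [:: 0; 1; 2], [:: 7; 10]);
  (1, 8, [:: 7; 4; 0], [:: 9; 10]); (0, 1, [:: 10; 4], [:: 8; 9; 5]);
  (1, 8, [:: 7; 4; 0], [:: 10]); (1, 2, [:: 3; 4; 0], [:: 10]); (0, 1, [:: 2; 3; 4], [:: 10; 5]);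
  (1, 8, [:: 9; 5; 0], [:: 7; 10]); (3, 9, [:: 8; 1; 2], [:: 10; 4]);
  (8, 9, [:: 5; 0; 1], [:: 10]); (3, 9, [:: 10; 2], [:: 5; 0; 4]); (5, 9, [:: 8; 1; 0], [:: 10]);
  (8, 9, [:: 5; 0; 1], [:: 10; 7]); (3, 4, [:: 10; 2], [:: 7; 8; 9]);
  (0, 4, [:: 7; 8; 1], [:: 10; 5]); (4, 7, [:: 8; 1; 0], [:: 10]);
  (1, 8, [:: 7; 4; 0], [:: 10; 2]); (8, 9, [:: 3; 2; 1], [:: 5; 10]);
  (7, 8, [:: 1; 0; 4], [:: 10]); (0, 1, [:: 8; 7; 4], [:: 2; 10; 5]);
  (3, 4, [:: 7; 10; 2], [:: 0; 5; 9]); (0, 4, [:: 3; 2; 1], [:: 7; 10; 5])].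

Definition pet9_node_certs : seq certificate := [::
  (0, 4, [:: 3; 2; 1], [:: 7; 10; 5]); (3, 4, [:: 7; 10; 2], [:: 0; 5; 9]);
  (0, 1, [:: 8; 7; 4], [:: 2; 10; 5])].

Definition pet9_ext : seq (seq nat) := [:: [:: 2; 5; 7]].

Definition pet10_nodes := [:: 0; 3; 1; 9; 4; 8; 2; 5; 7; 6].

Definition pet10_ok : seq (nat * nat) := [::].

Definition pet10_certs : seq certificate := [::
  (0, 4, [:: 7; 8; 1], [:: 3; 10]); (0, 1, [:: 2; 3; 4], [:: 10]);
  (0, 5, [:: 6; 2; 1], [:: 9; 10]); (0, 4, [:: 7; 8; 1], [:: 10]);
  (0, 1, [:: 2; 3; 4], [:: 8; 10]); (0, 1, [:: 8; 7; 4], [:: 2; 10]);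
  (0, 5, [:: 9; 8; 1], [:: 10]); (0, 4, [:: 3; 2; 1], [:: 7; 10]);
  (0, 5, [:: 9; 8; 1], [:: 6; 10]); (1, 2, [:: 6; 5; 0], [:: 3; 10]);
  (3, 9, [:: 8; 1; 2], [:: 10]); (3, 4, [:: 0; 1; 2], [:: 10]); (3, 9, [:: 5; 6; 2], [:: 8; 10]);
  (2, 3, [:: 4; 0; 1], [:: 10]); (3, 9, [:: 8; 1; 2], [:: 5; 10]);
  (3, 4, [:: 0; 1; 2], [:: 7; 10]); (2, 3, [:: 4; 0; 1], [:: 10; 6]);
  (1, 8, [:: 7; 4; 0], [:: 9; 10]); (0, 1, [:: 10; 4], [:: 8; 9; 5]);
  (1, 8, [:: 7; 4; 0], [:: 10]); (1, 2, [:: 3; 4; 0], [:: 10]); (0, 1, [:: 2; 3; 4], [:: 10; 5]);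
  (1, 8, [:: 9; 5; 0], [:: 7; 10]); (1, 2, [:: 3; 4; 0], [:: 6; 10]);
  (3, 9, [:: 8; 1; 2], [:: 10; 4]); (8, 9, [:: 5; 0; 1], [:: 10]);
  (3, 9, [:: 10; 2], [:: 5; 0; 4]); (5, 9, [:: 8; 1; 0], [:: 10]);
  (8, 9, [:: 5; 0; 1], [:: 10; 7]); (5, 9, [:: 8; 1; 0], [:: 10; 6]);
  (4, 7, [:: 6; 5; 0], [:: 8; 10]); (3, 4, [:: 10; 2], [:: 7; 8; 9]);
  (0, 4, [:: 7; 8; 1], [:: 10; 5]); (4, 7, [:: 8; 1; 0], [:: 10]);
  (4, 7, [:: 8; 1; 0], [:: 6; 10]); (1, 8, [:: 7; 4; 0], [:: 10; 2]);
  (8, 9, [:: 3; 2; 1], [:: 5; 10]); (7, 8, [:: 1; 0; 4], [:: 10]);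
  (7, 8, [:: 1; 0; 4], [:: 10; 6]); (2, 6, [:: 7; 8; 1], [:: 5; 10]);
  (2, 6, [:: 5; 0; 1], [:: 7; 10]); (2, 6, [:: 5; 0; 1], [:: 10]);
  (5, 6, [:: 2; 1; 0], [:: 7; 10]); (5, 6, [:: 2; 1; 0], [:: 10]); (6, 7, [:: 8; 1; 2], [:: 10])].

Definition pet10_node_certs : seq certificate := [::].

Definition pet10_ext : seq (seq nat) := [::].

(** The Heawood graph without the path 7, 12, 11. Compatible are the two neighbours of a node of
    degree 2, and the pairs [(6, 8)] and [(2, 10)], which are linked through the missing nodes 7 and
    11. *)
Definition hea11_nodes := [:: 0; 1; 2; 3; 4; 5; 6; 8; 9; 10; 13].

Definition hea11_ok : seq (nat * nat) := [:: (0, 4); (1, 3); (1, 5); (2, 10); (3, 9); (5, 9); (6, 8)].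

Definition hea11_certs : seq certificate := [::
  (0, 1, [:: 2; 3; 8; 9], [:: 14]); (0, 1, [:: 6; 5; 10; 9], [:: 2; 14]);
  (0, 1, [:: 6; 5; 10; 9], [:: 2; 3; 14]); (0, 1, [:: 2; 3; 8; 9], [:: 6; 5; 14]);
  (0, 1, [:: 2; 3; 8; 9], [:: 6; 14]); (0, 9, [:: 10; 5; 6; 1], [:: 8; 14]);
  (0, 9, [:: 8; 3; 2; 1], [:: 14]); (0, 9, [:: 8; 3; 2; 1], [:: 10; 14]);
  (0, 13, [:: 4; 3; 2; 1], [:: 14]); (1, 2, [:: 3; 4; 13; 0], [:: 14]);
  (3, 4, [:: 14; 1; 2], [:: 5; 10; 9; 8]); (1, 6, [:: 5; 4; 13; 0], [:: 14]);
  (0, 1, [:: 14; 8; 9], [:: 6; 5; 4; 13]); (0, 1, [:: 14; 9], [:: 6; 5; 4; 13]);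
  (0, 1, [:: 14; 9], [:: 2; 3; 4; 13]); (0, 1, [:: 14; 9], [:: 6; 5; 4; 13]);
  (0, 1, [:: 14; 10; 9], [:: 2; 3; 4; 13]); (0, 1, [:: 2; 3; 8; 9], [:: 14; 13]);
  (2, 3, [:: 4; 13; 0; 1], [:: 14]); (2, 3, [:: 8; 9; 0; 1], [:: 4; 14]);
  (1, 2, [:: 3; 8; 9; 0], [:: 14; 5; 6]); (1, 2, [:: 3; 4; 13; 0], [:: 14; 6]);
  (2, 3, [:: 4; 13; 0; 1], [:: 8; 14]); (0, 1, [:: 2; 14; 9], [:: 6; 5; 4; 13]);
  (0, 1, [:: 6; 5; 10; 9], [:: 2; 14; 13]); (3, 4, [:: 13; 0; 1; 2], [:: 14]);
  (3, 4, [:: 13; 0; 1; 2], [:: 5; 14]); (3, 4, [:: 13; 0; 1; 2], [:: 5; 14]);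
  (3, 4, [:: 13; 0; 9; 8], [:: 5; 14]); (1, 6, [:: 5; 10; 9; 0], [:: 14; 3; 2]);
  (3, 8, [:: 9; 0; 1; 2], [:: 14]); (3, 4, [:: 13; 0; 1; 2], [:: 5; 10; 14]);
  (3, 4, [:: 5; 6; 1; 2], [:: 13; 14]); (4, 5, [:: 10; 9; 8; 3], [:: 14]);
  (4, 5, [:: 10; 9; 8; 3], [:: 6; 14]); (3, 8, [:: 9; 0; 1; 2], [:: 14; 4]);
  (3, 4, [:: 5; 6; 1; 2], [:: 14; 9; 8]); (4, 5, [:: 6; 1; 2; 3], [:: 10; 14]);
  (4, 13, [:: 0; 9; 8; 3], [:: 14]); (5, 6, [:: 1; 0; 13; 4], [:: 14]);
  (3, 8, [:: 9; 0; 1; 2], [:: 14; 5; 4]); (5, 10, [:: 9; 0; 13; 4], [:: 14]);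
  (4, 13, [:: 0; 9; 8; 3], [:: 14; 5]); (0, 1, [:: 6; 14; 9], [:: 2; 3; 4; 13]);
  (5, 10, [:: 9; 0; 13; 4], [:: 14; 6]); (0, 1, [:: 2; 3; 8; 9], [:: 6; 14; 13]);
  (8, 9, [:: 0; 1; 2; 3], [:: 14]); (8, 9, [:: 0; 1; 2; 3], [:: 10; 14]);
  (0, 13, [:: 4; 5; 6; 1], [:: 14; 8; 9]); (9, 10, [:: 5; 6; 1; 0], [:: 14]);
  (0, 13, [:: 4; 3; 2; 1], [:: 14; 9]); (0, 13, [:: 4; 3; 2; 1], [:: 14; 10; 9])].

Definition hea11_node_certs : seq certificate := [::
  (0, 13, [:: 4; 3; 2; 1], [:: 14; 10; 9]); (0, 13, [:: 4; 5; 6; 1], [:: 14; 8; 9]);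
  (0, 1, [:: 2; 3; 8; 9], [:: 6; 14; 13]); (0, 1, [:: 6; 14; 9], [:: 2; 3; 4; 13]);
  (13, 14, [:: 6; 1; 0], [:: 8; 3; 4]); (3, 8, [:: 9; 0; 1; 2], [:: 14; 5; 4]);
  (3, 4, [:: 5; 6; 1; 2], [:: 14; 9; 8]); (3, 4, [:: 13; 0; 1; 2], [:: 5; 10; 14]);
  (1, 6, [:: 5; 10; 9; 0], [:: 14; 3; 2]); (0, 1, [:: 6; 5; 10; 9], [:: 2; 14; 13]);
  (13, 14, [:: 2; 1; 0], [:: 10; 5; 4]); (0, 1, [:: 2; 14; 9], [:: 6; 5; 4; 13]);
  (1, 2, [:: 3; 8; 9; 0], [:: 14; 5; 6]); (0, 1, [:: 14; 10; 9], [:: 2; 3; 4; 13]);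
  (0, 1, [:: 14; 8; 9], [:: 6; 5; 4; 13]); (3, 4, [:: 14; 1; 2], [:: 5; 10; 9; 8]);
  (0, 1, [:: 2; 3; 8; 9], [:: 6; 5; 14]); (0, 1, [:: 6; 5; 10; 9], [:: 2; 3; 14])].

(** The traces of the missing nodes 7 and 11; the node 12 sees only 13 in the pattern and so cannot
    come next. *)
Definition hea11_ext : seq (seq nat) := [:: [:: 6; 8]; [:: 2; 10]].

Definition hea12_nodes := [:: 0; 1; 2; 3; 4; 5; 6; 8; 9; 10; 13; 7].

Definition hea12_ok : seq (nat * nat) := [:: (0, 4); (1, 3); (2, 10); (5, 9); (6, 8); (13, 7)].

Definition hea12_certs : seq certificate := [::
  (0, 1, [:: 2; 3; 8; 9], [:: 14]); (0, 1, [:: 6; 7; 8; 9], [:: 2; 14]);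
  (0, 1, [:: 6; 5; 10; 9], [:: 2; 3; 14]); (0, 1, [:: 2; 3; 8; 9], [:: 6; 5; 14]);
  (0, 1, [:: 2; 3; 8; 9], [:: 6; 14]); (0, 9, [:: 10; 5; 6; 1], [:: 8; 14]);
  (0, 9, [:: 8; 3; 2; 1], [:: 14]); (0, 9, [:: 8; 3; 2; 1], [:: 10; 14]);
  (0, 13, [:: 4; 3; 2; 1], [:: 14]); (0, 1, [:: 2; 3; 4; 13], [:: 6; 7; 14]);
  (1, 2, [:: 3; 4; 13; 0], [:: 14]); (0, 1, [:: 6; 7; 8; 9], [:: 14; 4; 13]);
  (1, 6, [:: 7; 8; 9; 0], [:: 5; 14]); (1, 6, [:: 5; 4; 13; 0], [:: 14]);
  (0, 1, [:: 14; 8; 9], [:: 6; 5; 4; 13]); (0, 1, [:: 14; 9], [:: 6; 5; 4; 13]);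
  (0, 1, [:: 14; 10; 9], [:: 2; 3; 4; 13]); (0, 1, [:: 2; 3; 8; 9], [:: 14; 13]);
  (1, 6, [:: 5; 4; 13; 0], [:: 7; 14]); (2, 3, [:: 4; 13; 0; 1], [:: 14]);
  (2, 3, [:: 8; 9; 0; 1], [:: 4; 14]); (1, 2, [:: 3; 8; 9; 0], [:: 14; 5; 6]);
  (1, 2, [:: 3; 4; 13; 0], [:: 14; 6]); (2, 3, [:: 4; 13; 0; 1], [:: 8; 14]);
  (0, 1, [:: 2; 14; 9], [:: 6; 5; 4; 13]); (0, 1, [:: 6; 7; 8; 9], [:: 2; 14; 13]);
  (1, 2, [:: 3; 4; 13; 0], [:: 14; 7; 6]); (3, 4, [:: 13; 0; 1; 2], [:: 14]);
  (3, 4, [:: 13; 0; 1; 2], [:: 5; 14]); (1, 6, [:: 5; 10; 9; 0], [:: 14; 3; 2]);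
  (3, 8, [:: 9; 0; 1; 2], [:: 14]); (3, 8, [:: 7; 6; 1; 2], [:: 9; 14]);
  (3, 8, [:: 7; 6; 1; 2], [:: 9; 10; 14]); (3, 4, [:: 5; 6; 1; 2], [:: 13; 14]);
  (3, 8, [:: 9; 0; 1; 2], [:: 7; 14]); (4, 5, [:: 10; 9; 8; 3], [:: 14]);
  (4, 5, [:: 10; 9; 8; 3], [:: 6; 14]); (3, 8, [:: 9; 0; 1; 2], [:: 14; 4]);
  (0, 9, [:: 8; 7; 6; 1], [:: 14; 4; 13]); (4, 5, [:: 6; 7; 8; 3], [:: 10; 14]);
  (4, 13, [:: 0; 9; 8; 3], [:: 14]); (3, 8, [:: 9; 0; 1; 2], [:: 7; 14; 4]);
  (5, 6, [:: 1; 0; 13; 4], [:: 14]); (3, 8, [:: 9; 0; 1; 2], [:: 14; 5; 4]);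
  (5, 10, [:: 9; 0; 13; 4], [:: 14]); (4, 13, [:: 0; 9; 8; 3], [:: 14; 5]);
  (5, 6, [:: 1; 0; 13; 4], [:: 7; 14]); (0, 1, [:: 6; 14; 9], [:: 2; 3; 4; 13]);
  (5, 10, [:: 9; 0; 13; 4], [:: 14; 6]); (0, 1, [:: 2; 3; 8; 9], [:: 6; 14; 13]);
  (6, 7, [:: 8; 9; 0; 1], [:: 14]); (8, 9, [:: 0; 1; 2; 3], [:: 14]);
  (8, 9, [:: 0; 1; 2; 3], [:: 10; 14]); (0, 13, [:: 4; 5; 6; 1], [:: 14; 8; 9]);
  (7, 8, [:: 9; 0; 1; 6], [:: 14]); (9, 10, [:: 5; 6; 1; 0], [:: 14]);
  (0, 13, [:: 4; 3; 2; 1], [:: 14; 9]); (8, 9, [:: 0; 1; 2; 3], [:: 14; 7]);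
  (0, 13, [:: 4; 3; 2; 1], [:: 14; 10; 9]); (5, 10, [:: 9; 0; 13; 4], [:: 14; 7; 6])].

Definition hea12_node_certs : seq certificate := [::
  (5, 10, [:: 9; 0; 13; 4], [:: 14; 7; 6]); (0, 13, [:: 4; 3; 2; 1], [:: 14; 10; 9]);
  (10, 14, [:: 13; 4; 5], [:: 7; 8; 9]); (0, 13, [:: 4; 5; 6; 1], [:: 14; 8; 9]);
  (0, 1, [:: 2; 3; 8; 9], [:: 6; 14; 13]); (0, 1, [:: 6; 14; 9], [:: 2; 3; 4; 13]);
  (3, 8, [:: 9; 0; 1; 2], [:: 14; 5; 4]); (3, 8, [:: 9; 0; 1; 2], [:: 7; 14; 4]);
  (0, 9, [:: 8; 7; 6; 1], [:: 14; 4; 13]); (3, 8, [:: 7; 6; 1; 2], [:: 9; 10; 14]);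
  (1, 6, [:: 5; 10; 9; 0], [:: 14; 3; 2]); (1, 2, [:: 3; 4; 13; 0], [:: 14; 7; 6]);
  (0, 1, [:: 6; 7; 8; 9], [:: 2; 14; 13]); (2, 14, [:: 13; 0; 1], [:: 7; 8; 3]);
  (7, 14, [:: 2; 1; 6], [:: 10; 9; 8]); (13, 14, [:: 2; 1; 0], [:: 10; 5; 4]);
  (2, 14, [:: 13; 0; 1], [:: 7; 8; 3]); (0, 1, [:: 2; 14; 9], [:: 6; 5; 4; 13]);
  (1, 2, [:: 3; 8; 9; 0], [:: 14; 5; 6]); (0, 1, [:: 14; 10; 9], [:: 2; 3; 4; 13]);
  (0, 1, [:: 14; 8; 9], [:: 6; 5; 4; 13]); (0, 1, [:: 6; 7; 8; 9], [:: 14; 4; 13]);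
  (0, 1, [:: 2; 3; 4; 13], [:: 6; 7; 14]); (0, 1, [:: 2; 3; 8; 9], [:: 6; 5; 14]);
  (0, 1, [:: 6; 5; 10; 9], [:: 2; 3; 14])].

Definition hea12_ext : seq (seq nat) := [:: [:: 13; 7]; [:: 2; 10]].

Definition hea13_nodes := [:: 0; 1; 2; 3; 4; 5; 6; 8; 9; 10; 13; 7; 11].

Definition hea13_ok : seq (nat * nat) := [:: (0, 4); (2, 10); (6, 8)].

Definition hea13_certs : seq certificate := [::
  (0, 1, [:: 2; 3; 8; 9], [:: 14]); (0, 1, [:: 6; 7; 8; 9], [:: 2; 14]);
  (0, 1, [:: 6; 5; 10; 9], [:: 2; 3; 14]); (0, 1, [:: 2; 3; 8; 9], [:: 6; 5; 14]);
  (0, 1, [:: 2; 3; 8; 9], [:: 6; 14]); (0, 9, [:: 10; 11; 2; 1], [:: 8; 14]);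
  (0, 9, [:: 10; 11; 2; 1], [:: 14]); (0, 9, [:: 8; 3; 2; 1], [:: 10; 14]);
  (0, 13, [:: 4; 3; 2; 1], [:: 14]); (0, 1, [:: 2; 11; 10; 9], [:: 6; 7; 14]);
  (0, 1, [:: 6; 7; 8; 9], [:: 2; 11; 14]); (1, 2, [:: 3; 4; 13; 0], [:: 14]);
  (1, 2, [:: 11; 10; 9; 0], [:: 3; 14]); (0, 1, [:: 6; 7; 8; 9], [:: 14; 4; 13]);
  (1, 6, [:: 7; 8; 9; 0], [:: 5; 14]); (1, 6, [:: 5; 4; 13; 0], [:: 14]);
  (0, 1, [:: 14; 8; 9], [:: 6; 5; 4; 13]); (0, 1, [:: 14; 9], [:: 6; 5; 4; 13]);
  (0, 1, [:: 14; 10; 9], [:: 2; 3; 4; 13]); (0, 1, [:: 2; 3; 8; 9], [:: 14; 13]);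
  (1, 6, [:: 5; 4; 13; 0], [:: 7; 14]); (1, 2, [:: 3; 4; 13; 0], [:: 11; 14]);
  (2, 3, [:: 4; 13; 0; 1], [:: 14]); (2, 3, [:: 8; 9; 0; 1], [:: 4; 14]);
  (1, 2, [:: 3; 8; 9; 0], [:: 14; 5; 6]); (1, 2, [:: 3; 4; 13; 0], [:: 14; 6]);
  (2, 3, [:: 4; 13; 0; 1], [:: 8; 14]); (0, 1, [:: 2; 14; 9], [:: 6; 5; 4; 13]);
  (0, 1, [:: 6; 7; 8; 9], [:: 2; 14; 13]); (1, 2, [:: 3; 4; 13; 0], [:: 14; 7; 6]);
  (2, 11, [:: 10; 9; 0; 1], [:: 14]); (3, 4, [:: 5; 10; 11; 2], [:: 14]);
  (3, 4, [:: 13; 0; 1; 2], [:: 5; 14]); (1, 2, [:: 11; 10; 9; 0], [:: 3; 14; 6]);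
  (3, 8, [:: 9; 10; 11; 2], [:: 14]); (3, 8, [:: 7; 6; 1; 2], [:: 9; 14]);
  (2, 3, [:: 4; 13; 0; 1], [:: 14; 10; 11]); (3, 4, [:: 5; 10; 11; 2], [:: 13; 14]);
  (3, 8, [:: 9; 10; 11; 2], [:: 7; 14]); (2, 11, [:: 10; 9; 0; 1], [:: 14; 3]);
  (4, 5, [:: 10; 9; 8; 3], [:: 14]); (4, 5, [:: 10; 9; 8; 3], [:: 6; 14]);
  (3, 8, [:: 9; 10; 11; 2], [:: 14; 4]); (0, 9, [:: 10; 11; 2; 1], [:: 14; 4; 13]);
  (4, 5, [:: 6; 7; 8; 3], [:: 10; 14]); (4, 13, [:: 0; 9; 8; 3], [:: 14]);
  (3, 8, [:: 9; 10; 11; 2], [:: 7; 14; 4]); (2, 11, [:: 10; 9; 0; 1], [:: 14; 4; 3]);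
  (5, 6, [:: 1; 0; 13; 4], [:: 14]); (3, 8, [:: 9; 0; 1; 2], [:: 14; 5; 4]);
  (5, 10, [:: 11; 2; 3; 4], [:: 9; 14]); (5, 10, [:: 9; 0; 13; 4], [:: 14]);
  (4, 13, [:: 0; 9; 8; 3], [:: 14; 5]); (5, 6, [:: 1; 0; 13; 4], [:: 7; 14]);
  (5, 10, [:: 9; 0; 13; 4], [:: 11; 14]); (0, 1, [:: 6; 14; 9], [:: 2; 3; 4; 13]);
  (5, 10, [:: 9; 0; 13; 4], [:: 14; 6]); (0, 1, [:: 2; 3; 8; 9], [:: 6; 14; 13]);
  (6, 7, [:: 8; 9; 0; 1], [:: 14]); (1, 2, [:: 3; 4; 13; 0], [:: 11; 14; 6]);
  (8, 9, [:: 10; 11; 2; 3], [:: 14]); (8, 9, [:: 0; 1; 2; 3], [:: 10; 14]);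
  (0, 13, [:: 4; 5; 6; 1], [:: 14; 8; 9]); (7, 8, [:: 9; 0; 1; 6], [:: 14]);
  (2, 11, [:: 10; 5; 6; 1], [:: 14; 8; 3]); (9, 10, [:: 11; 2; 1; 0], [:: 14]);
  (0, 13, [:: 4; 3; 2; 1], [:: 14; 9]); (8, 9, [:: 10; 11; 2; 3], [:: 14; 7]);
  (9, 10, [:: 5; 6; 1; 0], [:: 11; 14]); (0, 13, [:: 4; 3; 2; 1], [:: 14; 10; 9]);
  (5, 10, [:: 9; 0; 13; 4], [:: 14; 7; 6]); (10, 11, [:: 2; 3; 4; 5], [:: 14]);
  (0, 1, [:: 2; 11; 10; 9], [:: 6; 7; 14; 13]); (0, 1, [:: 6; 7; 8; 9], [:: 2; 11; 14; 13]);
  (1, 2, [:: 3; 4; 13; 0], [:: 11; 14; 7; 6])].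

Definition hea13_node_certs : seq certificate := [::
  (1, 2, [:: 3; 4; 13; 0], [:: 11; 14; 7; 6]); (0, 1, [:: 6; 7; 8; 9], [:: 2; 11; 14; 13]);
  (0, 1, [:: 2; 11; 10; 9], [:: 6; 7; 14; 13]); (5, 10, [:: 9; 0; 13; 4], [:: 14; 7; 6]);
  (0, 13, [:: 4; 3; 2; 1], [:: 14; 10; 9]); (10, 14, [:: 13; 4; 5], [:: 7; 8; 9]);
  (2, 11, [:: 10; 5; 6; 1], [:: 14; 8; 3]); (0, 13, [:: 4; 5; 6; 1], [:: 14; 8; 9]);
  (8, 14, [:: 11; 2; 3], [:: 13; 0; 9]); (1, 2, [:: 3; 4; 13; 0], [:: 11; 14; 6]);
  (0, 1, [:: 2; 3; 8; 9], [:: 6; 14; 13]); (6, 14, [:: 13; 0; 1], [:: 11; 10; 5]);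
  (0, 1, [:: 6; 14; 9], [:: 2; 3; 4; 13]); (3, 8, [:: 9; 0; 1; 2], [:: 14; 5; 4]);
  (2, 11, [:: 10; 9; 0; 1], [:: 14; 4; 3]); (3, 8, [:: 9; 10; 11; 2], [:: 7; 14; 4]);
  (4, 14, [:: 7; 8; 3], [:: 11; 10; 5]); (0, 9, [:: 10; 11; 2; 1], [:: 14; 4; 13]);
  (2, 3, [:: 4; 13; 0; 1], [:: 14; 10; 11]); (1, 2, [:: 11; 10; 9; 0], [:: 3; 14; 6]);
  (1, 2, [:: 3; 4; 13; 0], [:: 14; 7; 6]); (0, 1, [:: 6; 7; 8; 9], [:: 2; 14; 13]);
  (2, 14, [:: 13; 0; 1], [:: 7; 8; 3]); (0, 1, [:: 2; 14; 9], [:: 6; 5; 4; 13]);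
  (1, 2, [:: 3; 8; 9; 0], [:: 14; 5; 6]); (0, 1, [:: 14; 10; 9], [:: 2; 3; 4; 13]);
  (0, 1, [:: 14; 8; 9], [:: 6; 5; 4; 13]); (0, 1, [:: 6; 7; 8; 9], [:: 14; 4; 13]);
  (0, 1, [:: 6; 7; 8; 9], [:: 2; 11; 14]); (0, 1, [:: 2; 11; 10; 9], [:: 6; 7; 14]);
  (0, 14, [:: 11; 2; 1], [:: 7; 8; 9]); (0, 1, [:: 2; 3; 8; 9], [:: 6; 5; 14]);
  (0, 1, [:: 6; 5; 10; 9], [:: 2; 3; 14])].

Definition hea13_ext : seq (seq nat) := [:: [:: 13; 7; 11]].

Definition hea14_nodes := [:: 0; 1; 2; 3; 4; 5; 6; 8; 9; 10; 13; 7; 11; 12].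

Definition hea14_ok : seq (nat * nat) := [::].

Definition hea14_certs : seq certificate := [::
  (0, 1, [:: 2; 3; 8; 9], [:: 14]); (0, 1, [:: 6; 7; 8; 9], [:: 2; 14]);
  (0, 1, [:: 6; 5; 10; 9], [:: 2; 3; 14]); (0, 13, [:: 12; 11; 2; 1], [:: 4; 14]);
  (0, 1, [:: 2; 3; 8; 9], [:: 6; 5; 14]); (0, 1, [:: 2; 3; 8; 9], [:: 6; 14]);
  (0, 9, [:: 10; 11; 2; 1], [:: 8; 14]); (0, 9, [:: 10; 11; 2; 1], [:: 14]);
  (0, 9, [:: 8; 3; 2; 1], [:: 10; 14]); (0, 13, [:: 12; 11; 2; 1], [:: 14]);
  (0, 1, [:: 2; 11; 10; 9], [:: 6; 7; 14]); (0, 1, [:: 6; 7; 8; 9], [:: 2; 11; 14]);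
  (0, 13, [:: 4; 3; 2; 1], [:: 12; 14]); (1, 2, [:: 11; 12; 13; 0], [:: 14]);
  (1, 2, [:: 11; 12; 13; 0], [:: 3; 14]); (0, 1, [:: 6; 7; 8; 9], [:: 14; 4; 13]);
  (1, 6, [:: 7; 12; 13; 0], [:: 5; 14]); (1, 6, [:: 7; 12; 13; 0], [:: 14]);
  (0, 1, [:: 14; 8; 9], [:: 2; 11; 12; 13]); (0, 1, [:: 14; 9], [:: 2; 11; 12; 13]);
  (0, 1, [:: 14; 10; 9], [:: 6; 7; 12; 13]); (0, 1, [:: 2; 3; 8; 9], [:: 14; 13]);
  (1, 6, [:: 5; 4; 13; 0], [:: 7; 14]); (1, 2, [:: 3; 4; 13; 0], [:: 11; 14]);
  (0, 1, [:: 2; 3; 8; 9], [:: 14; 12; 13]); (2, 3, [:: 4; 13; 0; 1], [:: 14]);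
  (2, 3, [:: 8; 9; 0; 1], [:: 4; 14]); (1, 2, [:: 11; 12; 13; 0], [:: 14; 5; 6]);
  (1, 2, [:: 11; 12; 13; 0], [:: 14; 6]); (2, 3, [:: 4; 13; 0; 1], [:: 8; 14]);
  (0, 1, [:: 2; 14; 9], [:: 6; 7; 12; 13]); (2, 11, [:: 12; 13; 0; 1], [:: 10; 14]);
  (0, 1, [:: 6; 7; 8; 9], [:: 2; 14; 13]); (1, 2, [:: 3; 4; 13; 0], [:: 14; 7; 6]);
  (2, 11, [:: 12; 13; 0; 1], [:: 14]); (2, 11, [:: 10; 9; 0; 1], [:: 12; 14]);
  (3, 4, [:: 5; 10; 11; 2], [:: 14]); (3, 4, [:: 13; 12; 11; 2], [:: 5; 14]);
  (1, 2, [:: 11; 12; 13; 0], [:: 3; 14; 6]); (3, 8, [:: 9; 10; 11; 2], [:: 14]);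
  (3, 8, [:: 7; 12; 11; 2], [:: 9; 14]); (2, 11, [:: 12; 13; 0; 1], [:: 10; 14; 3]);
  (3, 4, [:: 5; 10; 11; 2], [:: 13; 14]); (3, 8, [:: 9; 10; 11; 2], [:: 7; 14]);
  (2, 11, [:: 12; 13; 0; 1], [:: 14; 3]); (2, 11, [:: 10; 9; 0; 1], [:: 12; 14; 3]);
  (4, 5, [:: 10; 9; 8; 3], [:: 14]); (4, 5, [:: 10; 9; 8; 3], [:: 6; 14]);
  (3, 8, [:: 9; 10; 11; 2], [:: 14; 4]); (0, 13, [:: 12; 11; 2; 1], [:: 4; 14; 9]);
  (4, 5, [:: 6; 7; 8; 3], [:: 10; 14]); (4, 13, [:: 0; 9; 8; 3], [:: 14]);
  (3, 8, [:: 9; 10; 11; 2], [:: 7; 14; 4]); (2, 11, [:: 10; 9; 0; 1], [:: 14; 4; 3]);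
  (4, 13, [:: 0; 9; 8; 3], [:: 12; 14]); (5, 6, [:: 1; 0; 13; 4], [:: 14]);
  (3, 8, [:: 7; 12; 11; 2], [:: 14; 5; 4]); (5, 10, [:: 11; 12; 13; 4], [:: 9; 14]);
  (5, 10, [:: 9; 0; 13; 4], [:: 14]); (4, 13, [:: 0; 9; 8; 3], [:: 14; 5]);
  (5, 6, [:: 1; 0; 13; 4], [:: 7; 14]); (5, 10, [:: 9; 0; 13; 4], [:: 11; 14]);
  (4, 13, [:: 0; 9; 8; 3], [:: 12; 14; 5]); (6, 7, [:: 12; 13; 0; 1], [:: 8; 14]);
  (0, 1, [:: 6; 14; 9], [:: 2; 11; 12; 13]); (5, 10, [:: 9; 0; 13; 4], [:: 14; 6]);
  (0, 1, [:: 2; 3; 8; 9], [:: 6; 14; 13]); (6, 7, [:: 12; 13; 0; 1], [:: 14]);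
  (1, 2, [:: 3; 4; 13; 0], [:: 11; 14; 6]); (6, 7, [:: 8; 9; 0; 1], [:: 12; 14]);
  (8, 9, [:: 10; 11; 2; 3], [:: 14]); (8, 9, [:: 0; 1; 2; 3], [:: 10; 14]);
  (0, 13, [:: 12; 11; 2; 1], [:: 14; 8; 9]); (7, 8, [:: 9; 0; 1; 6], [:: 14]);
  (2, 11, [:: 12; 13; 0; 1], [:: 14; 8; 3]); (7, 8, [:: 9; 0; 1; 6], [:: 14; 12]);
  (9, 10, [:: 11; 2; 1; 0], [:: 14]); (0, 13, [:: 12; 11; 2; 1], [:: 14; 9]);
  (8, 9, [:: 10; 11; 2; 3], [:: 14; 7]); (9, 10, [:: 5; 6; 1; 0], [:: 11; 14]);
  (0, 13, [:: 4; 3; 2; 1], [:: 12; 14; 9]); (0, 13, [:: 4; 3; 2; 1], [:: 14; 10; 9]);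
  (5, 10, [:: 9; 0; 13; 4], [:: 14; 7; 6]); (10, 11, [:: 12; 13; 4; 5], [:: 14]);
  (10, 11, [:: 2; 3; 4; 5], [:: 12; 14]); (7, 12, [:: 11; 2; 1; 6], [:: 13; 14]);
  (11, 12, [:: 7; 6; 1; 2], [:: 13; 14]); (12, 13, [:: 0; 9; 8; 7], [:: 14]);
  (7, 12, [:: 13; 0; 1; 6], [:: 11; 14]); (7, 12, [:: 13; 0; 1; 6], [:: 14]);
  (11, 12, [:: 13; 0; 1; 2], [:: 14])].

Definition hea14_node_certs : seq certificate := [::
  (5, 10, [:: 9; 0; 13; 4], [:: 14; 7; 6]); (0, 13, [:: 4; 3; 2; 1], [:: 14; 10; 9]);
  (0, 13, [:: 4; 3; 2; 1], [:: 12; 14; 9]); (2, 11, [:: 12; 13; 0; 1], [:: 14; 8; 3]);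
  (0, 13, [:: 12; 11; 2; 1], [:: 14; 8; 9]); (1, 2, [:: 3; 4; 13; 0], [:: 11; 14; 6]);
  (0, 1, [:: 2; 3; 8; 9], [:: 6; 14; 13]); (0, 1, [:: 6; 14; 9], [:: 2; 11; 12; 13]);
  (4, 13, [:: 0; 9; 8; 3], [:: 12; 14; 5]); (3, 8, [:: 7; 12; 11; 2], [:: 14; 5; 4]);
  (2, 11, [:: 10; 9; 0; 1], [:: 14; 4; 3]); (3, 8, [:: 9; 10; 11; 2], [:: 7; 14; 4]);
  (0, 13, [:: 12; 11; 2; 1], [:: 4; 14; 9]); (2, 11, [:: 10; 9; 0; 1], [:: 12; 14; 3]);
  (2, 11, [:: 12; 13; 0; 1], [:: 10; 14; 3]); (1, 2, [:: 11; 12; 13; 0], [:: 3; 14; 6]);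
  (1, 2, [:: 3; 4; 13; 0], [:: 14; 7; 6]); (0, 1, [:: 6; 7; 8; 9], [:: 2; 14; 13]);
  (0, 1, [:: 2; 14; 9], [:: 6; 7; 12; 13]); (1, 2, [:: 11; 12; 13; 0], [:: 14; 5; 6]);
  (0, 1, [:: 2; 3; 8; 9], [:: 14; 12; 13]); (0, 1, [:: 14; 10; 9], [:: 6; 7; 12; 13]);
  (0, 1, [:: 14; 8; 9], [:: 2; 11; 12; 13]); (0, 1, [:: 6; 7; 8; 9], [:: 14; 4; 13]);
  (0, 1, [:: 6; 7; 8; 9], [:: 2; 11; 14]); (0, 1, [:: 2; 11; 10; 9], [:: 6; 7; 14]);
  (0, 1, [:: 2; 3; 8; 9], [:: 6; 5; 14]); (0, 1, [:: 6; 5; 10; 9], [:: 2; 3; 14])].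

Definition hea14_ext : seq (seq nat) := [::].

(** The indices 0 to 3 are the corners [a], [b], [c], [d]; 4 to 7 are the rims [P1] to [P4]. The
    compatible pairs are those within a rim and its two ends. *)
Definition k4_nodes := [:: 0; 1; 2; 3; 4; 5; 6; 7].

Definition k4_ok : seq (nat * nat) := [:: (0, 1); (0, 3); (0, 4); (0, 7); (1, 2); (1, 4); (1, 5); (2, 3); (2, 5); (2, 6); (3, 6); (3, 7)].

Definition k4_certs : seq certificate := [::
  (0, 2, [:: 5; 1; 4], [:: 8]); (0, 2, [:: 5; 1; 4], [:: 8]); (0, 2, [:: 6; 3; 7], [:: 8]);
  (0, 2, [:: 6; 3; 7], [:: 5; 8]); (0, 2, [:: 6; 3; 7], [:: 5; 8]);
  (0, 2, [:: 5; 1; 4], [:: 6; 8]); (0, 2, [:: 5; 1; 4], [:: 6; 8]); (1, 3, [:: 7; 0; 4], [:: 8]);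
  (1, 3, [:: 7; 0; 4], [:: 8]); (1, 3, [:: 6; 2; 5], [:: 8]); (1, 3, [:: 7; 0; 4], [:: 6; 8]);
  (1, 3, [:: 7; 0; 4], [:: 6; 8]); (1, 3, [:: 6; 2; 5], [:: 7; 8]);
  (1, 3, [:: 6; 2; 5], [:: 7; 8]); (0, 2, [:: 8; 4], [:: 6; 3; 7]);
  (0, 2, [:: 8; 4], [:: 6; 3; 7]); (0, 2, [:: 5; 1; 4], [:: 8; 7]);
  (0, 2, [:: 5; 1; 4], [:: 8; 7]); (1, 3, [:: 8; 4], [:: 6; 2; 5]);
  (1, 3, [:: 8; 4], [:: 6; 2; 5]); (1, 3, [:: 7; 0; 4], [:: 8; 5]);
  (1, 3, [:: 7; 0; 4], [:: 8; 5]); (0, 2, [:: 5; 8; 4], [:: 6; 3; 7]);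
  (0, 2, [:: 5; 8; 4], [:: 6; 3; 7]); (1, 3, [:: 7; 8; 4], [:: 6; 2; 5]);
  (1, 3, [:: 7; 8; 4], [:: 6; 2; 5]); (1, 3, [:: 7; 0; 4], [:: 6; 8; 5]);
  (1, 3, [:: 7; 0; 4], [:: 6; 8; 5]); (0, 2, [:: 5; 1; 4], [:: 6; 8; 7]);
  (0, 2, [:: 5; 1; 4], [:: 6; 8; 7])].

(** [hea11_ok] with two more pairs: 13 now stands for a path, and a component may meet that path
    together with either of its ends 0 and 4. *)
Definition hea0_ok : seq (nat * nat) := [:: (0, 4); (0, 13); (1, 3); (1, 5); (2, 10); (3, 9); (4, 13); (5, 9); (6, 8)].

Definition hea0_certs : seq certificate := [::
  (0, 1, [:: 2; 3; 8; 9], [:: 14]); (0, 1, [:: 6; 5; 10; 9], [:: 2; 14]);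
  (0, 1, [:: 6; 5; 10; 9], [:: 2; 3; 14]); (0, 1, [:: 2; 3; 8; 9], [:: 6; 5; 14]);
  (0, 1, [:: 2; 3; 8; 9], [:: 6; 14]); (0, 9, [:: 10; 5; 6; 1], [:: 8; 14]);
  (0, 9, [:: 8; 3; 2; 1], [:: 14]); (0, 9, [:: 8; 3; 2; 1], [:: 10; 14]);
  (1, 2, [:: 3; 4; 13; 0], [:: 14]); (3, 4, [:: 14; 1; 2], [:: 5; 10; 9; 8]);
  (1, 6, [:: 5; 4; 13; 0], [:: 14]); (0, 1, [:: 14; 8; 9], [:: 6; 5; 4; 13]);
  (0, 1, [:: 14; 9], [:: 6; 5; 4; 13]); (0, 1, [:: 14; 9], [:: 2; 3; 4; 13]);
  (0, 1, [:: 14; 9], [:: 6; 5; 4; 13]); (0, 1, [:: 14; 10; 9], [:: 2; 3; 4; 13]);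
  (0, 1, [:: 2; 3; 8; 9], [:: 14; 13]); (2, 3, [:: 4; 13; 0; 1], [:: 14]);
  (2, 3, [:: 8; 9; 0; 1], [:: 4; 14]); (1, 2, [:: 3; 8; 9; 0], [:: 14; 5; 6]);
  (1, 2, [:: 3; 4; 13; 0], [:: 14; 6]); (2, 3, [:: 4; 13; 0; 1], [:: 8; 14]);
  (0, 1, [:: 2; 14; 9], [:: 6; 5; 4; 13]); (0, 1, [:: 6; 5; 10; 9], [:: 2; 14; 13]);
  (3, 4, [:: 13; 0; 1; 2], [:: 14]); (3, 4, [:: 13; 0; 1; 2], [:: 5; 14]);
  (3, 4, [:: 13; 0; 1; 2], [:: 5; 14]); (3, 4, [:: 13; 0; 9; 8], [:: 5; 14]);
  (1, 6, [:: 5; 10; 9; 0], [:: 14; 3; 2]); (3, 8, [:: 9; 0; 1; 2], [:: 14]);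
  (3, 4, [:: 13; 0; 1; 2], [:: 5; 10; 14]); (3, 4, [:: 5; 6; 1; 2], [:: 13; 14]);
  (4, 5, [:: 10; 9; 8; 3], [:: 14]); (4, 5, [:: 10; 9; 8; 3], [:: 6; 14]);
  (3, 8, [:: 9; 0; 1; 2], [:: 14; 4]); (3, 4, [:: 5; 6; 1; 2], [:: 14; 9; 8]);
  (4, 5, [:: 6; 1; 2; 3], [:: 10; 14]); (5, 6, [:: 1; 0; 13; 4], [:: 14]);
  (3, 8, [:: 9; 0; 1; 2], [:: 14; 5; 4]); (5, 10, [:: 9; 0; 13; 4], [:: 14]);
  (4, 5, [:: 10; 9; 8; 3], [:: 14; 13]); (0, 1, [:: 6; 14; 9], [:: 2; 3; 4; 13]);
  (5, 10, [:: 9; 0; 13; 4], [:: 14; 6]); (0, 1, [:: 2; 3; 8; 9], [:: 6; 14; 13]);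
  (8, 9, [:: 0; 1; 2; 3], [:: 14]); (8, 9, [:: 0; 1; 2; 3], [:: 10; 14]);
  (0, 9, [:: 10; 5; 6; 1], [:: 8; 14; 13]); (9, 10, [:: 5; 6; 1; 0], [:: 14]);
  (0, 9, [:: 8; 3; 2; 1], [:: 14; 13]); (0, 9, [:: 8; 3; 2; 1], [:: 10; 14; 13])].

(** For a node that sees 10, the node [v] of the pattern, and one further part other than 2. *)
Definition hea0_node_certs : seq certificate := [::
  (0, 9, [:: 8; 3; 2; 1], [:: 10; 14]); (0, 1, [:: 14; 10; 9], [:: 2; 3; 4; 13]);
  (3, 4, [:: 13; 0; 1; 2], [:: 5; 10; 14]); (4, 5, [:: 6; 1; 2; 3], [:: 10; 14]);
  (5, 10, [:: 9; 0; 13; 4], [:: 14]); (5, 10, [:: 9; 0; 13; 4], [:: 14; 6]);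
  (8, 9, [:: 0; 1; 2; 3], [:: 10; 14]); (9, 10, [:: 5; 6; 1; 0], [:: 14]);
  (0, 9, [:: 8; 3; 2; 1], [:: 10; 14; 13])].

Section Grow.
Variable G : sgraph.
Hypothesis cG : core G.

Lemma pet9_induced (f : nat -> G) : embed petersen_adj pet9_nodes f -> induced_subgraph_of G petersen.
Proof.
have fin A (g : nat -> G) : all (fun i => i < 10) A -> embed petersen_adj A g -> onto A g ->
    induced_subgraph_of G petersen.
  exact: embed_induced petersen_numE petersen_num_inj petersen_num_onto.
move=> ef; have s9 : stage_ok petersen_adj 10 pet9_nodes pet9_ok pet9_certs pet9_ext pet9_node_certs.
  by vm_compute.
have s10 : stage_ok petersen_adj 10 pet10_nodes pet10_ok pet10_certs pet10_ext pet10_node_certs.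
  by vm_compute.
case: (embed_step cG ef s9) => [|[T [w []]]]; first exact: fin.
rewrite inE => /eqP-> wn wa.
have e10 := @reembed G petersen_adj pet9_nodes pet10_nodes 6 (iota 0 10) [:: 2; 5; 7] f w
  ef isT isT wn wa.
by case: (embed_step cG e10 s10) => [|[T' [w' []]]]; [apply: fin|].
Qed.
Lemma hea11_induced (f : nat -> G) : embed heawood_adj hea11_nodes f -> induced_subgraph_of G heawood.
Proof.
have fin A (g : nat -> G) : all (fun i => i < 14) A -> embed heawood_adj A g -> onto A g ->
    induced_subgraph_of G heawood.
  apply: embed_induced heawood_numE val_inj _ => i i14.
  by exists (Ordinal i14).
have s11 : stage_ok heawood_adj 14 hea11_nodes hea11_ok hea11_certs hea11_ext hea11_node_certs.
  by vm_compute.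
have s12 : stage_ok heawood_adj 14 hea12_nodes hea12_ok hea12_certs hea12_ext hea12_node_certs.
  by vm_compute.
have s13 : stage_ok heawood_adj 14 hea13_nodes hea13_ok hea13_certs hea13_ext hea13_node_certs.
  by vm_compute.
have s14 : stage_ok heawood_adj 14 hea14_nodes hea14_ok hea14_certs hea14_ext hea14_node_certs.
  by vm_compute.
have h14 (g : nat -> G) : embed heawood_adj hea14_nodes g -> induced_subgraph_of G heawood.
  by move=> eg; case: (embed_step cG eg s14) => [|[T [w []]]]; [apply: fin|].
have h13 (g : nat -> G) : embed heawood_adj hea13_nodes g -> induced_subgraph_of G heawood.
  move=> eg; case: (embed_step cG eg s13) => [|[T [w [TE wn wa]]]]; first exact: fin.
  move: TE wa; rewrite inE => /eqP-> wa.
  exact: h14 _ (@reembed G heawood_adj hea13_nodes hea14_nodes 12 (iota 0 14) [:: 13; 7; 11] g w eg isT isT wn wa).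
have h12 (g : nat -> G) : embed heawood_adj hea12_nodes g -> induced_subgraph_of G heawood.
  move=> eg; case: (embed_step cG eg s12) => [|[T [w [TE wn wa]]]]; first exact: fin.
  move: TE wa; rewrite !inE => /orP[]/eqP-> wa.
    (* The new node is really 12. An automorphism of the Heawood graph exchanges the roles of 11 and
       12, so the copy is renumbered as if 11 had been added. The entries at the new node and at the
       absent node 12 are placeholders. *)
    exact: h13 _ (@reembed G heawood_adj hea12_nodes hea13_nodes 11
      [:: 1; 0; 13; 4; 3; 8; 9; 10; 5; 6; 7; 12; 0; 2] [:: 13; 7] g w eg isT isT wn wa).
  exact: h13 _ (@reembed G heawood_adj hea12_nodes hea13_nodes 11 (iota 0 14) [:: 2; 10] g w eg isT isT wn wa).
move=> eg; case: (embed_step cG eg s11) => [|[T [w [TE wn wa]]]]; first exact: fin.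
move: TE wa; rewrite !inE => /orP[]/eqP-> wa.
  exact: h12 _ (@reembed G heawood_adj hea11_nodes hea12_nodes 7 (iota 0 14) [:: 6; 8] f w eg isT isT wn wa).
(* Here 11 was added instead of 7. The list is a reflection fixing 0, 1, 4, 9 and 13 that brings the
   new node to position 7; the entries 7, 11 and 12 are placeholders. *)
exact: h12 _ (@reembed G heawood_adj hea11_nodes hea12_nodes 7
  [:: 0; 1; 6; 5; 4; 3; 2; 11; 10; 9; 8; 0; 0; 13] [:: 2; 10] f w eg isT isT wn wa).
Qed.

End Grow.

(** * Attachments to a shortest cycle with a chord *)

Section Attach.
Variable G : sgraph.
Hypothesis cG : core G.
Implicit Types (A B C D E K L M S X Y Z P : {set G}) (a b c d p q r x y u v w s t : G).

Let gG := core_good cG.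
Let c3 := core_c3 cG.
Let c4 := core_c4 cG.

(** The summand 2 counts [b] and [d]; the ends [a] and [c] of the chord are left out, as in
    [minsize]. *)
Definition k4m a b c d P1 P2 P3 P4 :=
  k4 a b c d P1 P2 P3 P4 /\ minsize G (#|P1| + #|P2| + #|P3| + #|P4| + 2).

Definition out4 a b c d P1 P2 P3 P4 D :=
  [&& [&& a \notin D, b \notin D, c \notin D & d \notin D],
      [disjoint D & P1], [disjoint D & P2], [disjoint D & P3] & [disjoint D & P4]].

Lemma k4m_rot a b c d P1 P2 P3 P4 : k4m a b c d P1 P2 P3 P4 -> k4m b c d a P2 P3 P4 P1.
Proof.
case=> k m; split; first exact: k4_rot.
by have -> : #|P2| + #|P3| + #|P4| + #|P1| + 2 = #|P1| + #|P2| + #|P3| + #|P4| + 2 by clear; lia.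
Qed.

Lemma k4m_flip a b c d P1 P2 P3 P4 : k4m a b c d P1 P2 P3 P4 -> k4m b a d c P1 P4 P3 P2.
Proof.
case=> k m; split; first exact: k4_flip.
by have -> : #|P1| + #|P4| + #|P3| + #|P2| + 2 = #|P1| + #|P2| + #|P3| + #|P4| + 2 by clear; lia.
Qed.

Lemma out4_rot a b c d P1 P2 P3 P4 D :
  out4 a b c d P1 P2 P3 P4 D -> out4 b c d a P2 P3 P4 P1 D.
Proof. by move=> o; rewrite /out4 in o *; atoms; solveb. Qed.

Lemma out4_flip a b c d P1 P2 P3 P4 D :
  out4 a b c d P1 P2 P3 P4 D -> out4 b a d c P1 P4 P3 P2 D.
Proof. by move=> o; rewrite /out4 in o *; atoms; solveb. Qed.

Lemma card1_set1 (T : finType) (A : {set T}) : A != set0 -> #|A| <= 1 -> exists z : T, A = [set z].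
Proof. by move=> A0 A1; apply/cards1P; rewrite eqn_leq A1 card_gt0. Qed.

Ltac k4open k := let k' := fresh in
  have k' := k4_links k; have := k; case; unfold out4 in *; intros; clear k; atoms.

(** Putting [w] in place of [P1] keeps a cycle with chord [ac], so [P1] has only one node, and that
    node closes a square with [a], [b] and [w]. The same count recurs below: a one-node shortcut
    cannot bypass more than one node. *)
Lemma vtx_ab a b c d P1 P2 P3 P4 w : k4m a b c d P1 P2 P3 P4 ->
  out4 a b c d P1 P2 P3 P4 [set w] -> adj w a -> adj w b -> False.
Proof.
case=> k m o wa wb.
have th : theta a c ([set w] :|: [set b] :|: P2) (P3 :|: [set d] :|: P4).
  by clear m; k4open k; thetab.
have := m _ _ _ _ th => le.
have P11 : #|P1| <= 1 by card_lia le.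
have k' := k4_links k; have [x xE] : exists x, P1 = [set x].
  by apply: card1_set1 P11; case/and4P: k' => /and4P[].
have nw : x != w by move: o; rewrite xE /out4; case/and5P => _; rewrite disjoints1 inE eq_sym.
have ab : a != b by case/and5P: (k4_ne k).
move: k'; rewrite xE !touch1 => /and4P[/and4P[_ xa xb _] _ _ _].
by apply: (c4 (x := a) (y := x) (z := b) (w := w)); rewrite // adj_sym.
Qed.

Lemma vtx_aP1 a b c d P1 P2 P3 P4 w q : k4m a b c d P1 P2 P3 P4 ->
  out4 a b c d P1 P2 P3 P4 [set w] -> adj w a -> q \in P1 -> adj w q -> False.
Proof.
case=> k m o wa qP wq.
have [C1 [C2 sp]] := split_minlink (k4_m1 k) qP; have cP := split_card sp.
have th : theta a c ([set w] :|: [set q] :|: C2 :|: [set b] :|: P2) (P3 :|: [set d] :|: P4).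
  by clear m cP; k4open k; destruct sp; subst P1; atoms; thetab.
have := m _ _ _ _ th; rewrite cP => le.
have C11 : #|C1| <= 1 by card_lia le.
have [C10|C10] := eqVneq C1 set0.
  have qa : adj q a by rewrite -touch1 (split_uX sp) C10 eqxx.
  by apply: (c3 wq qa); rewrite adj_sym.
have [x xE] := card1_set1 C10 C11.
have xa : adj x a by rewrite -touch1 -xE (split_X1 sp).
have qx : adj q x by rewrite -touch1 -xE (split_u1t sp).
have nw : x != w.
  move: o; rewrite /out4 => /and5P[_]; rewrite (split_eq sp) disjoints1 !inE xE !inE !negb_or.
  by rewrite (eq_sym x) => /andP[/andP[-> _] _].
have aq : a != q by apply: contraTneq qP => <-; case/and4P: (k4_in1 k).
by apply: (c4 (x := a) (y := x) (z := q) (w := w)); rewrite // adj_sym.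
Qed.

Lemma vtx_P1C2 a b c d P1 P2 P3 P4 w p q C1 C2 : k4m a b c d P1 P2 P3 P4 ->
  out4 a b c d P1 P2 P3 P4 [set w] -> p \in P1 -> split_at [set a] [set b] P1 p C1 C2 ->
  q \in C2 -> adj w p -> adj w q -> False.
Proof.
case=> k m o pP sp qC wp wq; have cP := split_card sp.
have C20 : C2 != set0 by apply/set0Pn; exists q.
have [E1 [E2 sq]] := split_minlink (split_m2 sp C20) qC; have cC := split_card sq.
have th : theta a c (C1 :|: [set p] :|: [set w] :|: [set q] :|: E2 :|: [set b] :|: P2)
    (P3 :|: [set d] :|: P4).
  clear m cP cC; k4open k; destruct sp; subst P1; destruct sq; subst C2; atoms; thetab.
have := m _ _ _ _ th; rewrite cP cC => le.
have E11 : #|E1| <= 1 by card_lia le.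
have [E10|E10] := eqVneq E1 set0.
  have qp : adj q p by rewrite -touch1 (split_uX sq) E10 eqxx.
  by apply: (c3 wq qp); rewrite adj_sym.
have [x xE] := card1_set1 E10 E11.
have xp : adj x p by rewrite -touch1 -xE (split_X1 sq).
have qx : adj q x by rewrite -touch1 -xE (split_u1t sq).
have nw : x != w.
  move: o; rewrite /out4 => /and5P[_]; rewrite (split_eq sp) (split_eq sq) disjoints1 !inE xE !inE !negb_or.
  by rewrite (eq_sym x) => /andP[_ /andP[/andP[-> _] _]].
have pq : p != q by apply: contraTneq qC => <-; apply: split_u2 sp.
by apply: (c4 (x := p) (y := x) (z := q) (w := w)); rewrite // adj_sym.
Qed.

Lemma vtx_P1P1 a b c d P1 P2 P3 P4 w p q : k4m a b c d P1 P2 P3 P4 ->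
  out4 a b c d P1 P2 P3 P4 [set w] -> p \in P1 -> q \in P1 -> adj w p -> adj w q -> p = q.
Proof.
move=> k o pP qP wp wq; have [C1 [C2 sp]] := split_minlink (k4_m1 (proj1 k)) pP.
apply/eqP; apply: contraT => pq; exfalso; move: qP; rewrite (split_eq sp) !inE eq_sym.
rewrite (negbTE pq) orbF => /orP[q1|q2].
  exact: (vtx_P1C2 (k4m_flip k) (out4_flip o) pP (split_atC sp) q1 wp wq).
exact: (vtx_P1C2 k o pP sp q2 wp wq).
Qed.

(** The shortcut would bypass [b] and all of the nonempty [P1], at least two nodes. *)
Lemma vtx_aP2 a b c d P1 P2 P3 P4 w q : k4m a b c d P1 P2 P3 P4 ->
  out4 a b c d P1 P2 P3 P4 [set w] -> adj w a -> q \in P2 -> adj w q -> False.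
Proof.
case=> k m o wa qP wq.
have [E1 [E2 sp]] := split_minlink (k4_m2 k) qP; have cP := split_card sp.
have th : theta a c ([set w] :|: [set q] :|: E2) (P3 :|: [set d] :|: P4).
  by clear m cP; k4open k; destruct sp; subst P2; atoms; thetab.
have := m _ _ _ _ th; rewrite cP => le.
have P10 : #|P1| = 0 by card_lia le.
by case/and4P: (k4_links k) => /and4P[_ _ _ /negP[]]; rewrite -cards_eq0 P10.
Qed.

(** By minimality the shortcut bypasses [b] alone, and [p], [b], [q], [w] form a square. *)
Lemma vtx_P1P2 a b c d P1 P2 P3 P4 w p q : k4m a b c d P1 P2 P3 P4 ->
  out4 a b c d P1 P2 P3 P4 [set w] -> p \in P1 -> q \in P2 -> adj w p -> adj w q -> False.
Proof.
case=> k m o pP qP wp wq.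
have [C1 [C2 sp]] := split_minlink (k4_m1 k) pP; have cP := split_card sp.
have [E1 [E2 sq]] := split_minlink (k4_m2 k) qP; have cQ := split_card sq.
have th : theta a c (C1 :|: [set p] :|: [set w] :|: [set q] :|: E2) (P3 :|: [set d] :|: P4).
  clear m cP cQ; k4open k; destruct sp; subst P1; destruct sq; subst P2; atoms; thetab.
have := m _ _ _ _ th; rewrite cP cQ => le.
have C20 : C2 == set0 by rewrite -cards_eq0; card_lia le.
have E10 : E1 == set0 by rewrite -cards_eq0; card_lia le.
have pb : adj p b by rewrite -touch1 (split_uY sp).
have qb : adj q b by rewrite -touch1 (split_uX sq).
have pq : p != q by apply: contraTneq qP => <-; case/and5P: (k4_dis k) => /disjointN->.
have bw : b != w.
  by case/and5P: o => /and4P[_ + _ _] _ _ _ _; rewrite inE.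
by apply: (c4 (x := p) (y := b) (z := q) (w := w)); rewrite // adj_sym.
Qed.

Lemma vtx_a a b c d P1 P2 P3 P4 w : k4m a b c d P1 P2 P3 P4 ->
  out4 a b c d P1 P2 P3 P4 [set w] -> adj w a ->
  [&& ~~ adj w b, ~~ adj w c, ~~ adj w d, ~~ touch [set w] P1, ~~ touch [set w] P2,
      ~~ touch [set w] P3 & ~~ touch [set w] P4].
Proof.
move=> k o wa.
have kf := k4m_flip k; have kfr := k4m_rot kf; have of_ := out4_flip o; have ofr := out4_rot of_.
apply/and4P; split; last (apply/and4P; split).
- by apply/negP => wb; apply: vtx_ab k o wa wb.
- apply/negP => wc; case/and5P: (k4_adj (proj1 k)) => ac _ _ _ _.
  by apply: (c3 wa ac); rewrite adj_sym.
- by apply/negP => wd; apply: vtx_ab kfr ofr wa wd.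
- by apply/touchPn => u q /set1P-> qP; apply/negP; apply: vtx_aP1 k o wa qP.
- by apply/touchPn => u q /set1P-> qP; apply/negP; apply: vtx_aP2 k o wa qP.
- by apply/touchPn => u q /set1P-> qP; apply/negP; apply: vtx_aP2 kfr ofr wa qP.
- by apply/touchPn => u q /set1P-> qP; apply/negP; apply: vtx_aP1 kfr ofr wa qP.
Qed.

(** [P3] is left out on purpose. Together with [vtx_a] and [vtx_P1P1], a node outside the cycle sees
    at most one node of it, or one on each of two opposite rims. *)
Lemma vtx_P1 a b c d P1 P2 P3 P4 w : k4m a b c d P1 P2 P3 P4 ->
  out4 a b c d P1 P2 P3 P4 [set w] -> touch [set w] P1 ->
  [&& ~~ adj w a, ~~ adj w b, ~~ adj w c, ~~ adj w d, ~~ touch [set w] P2 & ~~ touch [set w] P4].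
Proof.
move=> k o wP; have /touch1P[p pP wp] := wP.
have k1 := k4m_rot k; have k2 := k4m_rot k1; have k3 := k4m_rot k2.
have o1 := out4_rot o; have o2 := out4_rot o1; have o3 := out4_rot o2.
have na : adj w a = false by apply/negP => wa; case/and5P: (vtx_a k o wa); rewrite wP.
have nb : adj w b = false.
  by apply/negP => wa; case/and5P: (vtx_a k1 o1 wa) => _ _ _ _ /and3P[_ _]; rewrite wP.
have nc : adj w c = false.
  by apply/negP => wa; case/and5P: (vtx_a k2 o2 wa) => _ _ _ _ /and3P[_]; rewrite wP.
have nd : adj w d = false.
  by apply/negP => wa; case/and5P: (vtx_a k3 o3 wa) => _ _ _ _ /and3P[]; rewrite wP.
rewrite na nb nc nd /=; apply/andP; split.
  by apply/touchPn => u q /set1P-> qP; apply/negP; apply: vtx_P1P2 k o pP qP wp.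
by apply/touchPn => u q /set1P-> qP; apply/negP => wq; apply: vtx_P1P2 k3 o3 qP pP wq wp.
Qed.

End Attach.

Ltac k4open k := let k' := fresh in
  have k' := k4_links k; have := k; case; unfold out4 in *; intros; clear k; atoms.

(** * Crossings between opposite rims *)

Section Cross.
Variable G : sgraph.
Hypothesis cG : core G.
Implicit Types (A B C D E K L M S X Y Z P : {set G}) (a b c d p q r x y u v w s t : G).

Let gG := core_good cG.
Let c3 := core_c3 cG.
Let c4 := core_c4 cG.

(** Covers both a single node seeing two opposite rims and a longer minimal connection between
    them. *)
Record cross a b c d P1 P2 P3 P4 p q D : Prop := Cross {
  cr_conn : conn D;
  cr_out : out4 a b c d P1 P2 P3 P4 D;
  cr_p : p \in P1;
  cr_q : q \in P3;
  cr_t : touch D [set p] && touch D [set q];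
  cr_n : [&& [&& ~~ touch D [set a], ~~ touch D [set b], ~~ touch D [set c] & ~~ touch D [set d]],
             ~~ touch D P2, ~~ touch D P4, ~~ touch D (P1 :\ p) & ~~ touch D (P3 :\ q)]
}.

Lemma cross_flip a b c d P1 P2 P3 P4 p q D :
  cross a b c d P1 P2 P3 P4 p q D -> cross b a d c P1 P4 P3 P2 p q D.
Proof. by case=> ? /out4_flip ? ? ? ? ?; split => //; atoms; solveb. Qed.

Lemma cross_rot2 a b c d P1 P2 P3 P4 p q D :
  cross a b c d P1 P2 P3 P4 p q D -> cross c d a b P3 P4 P1 P2 q p D.
Proof. by case=> ? /out4_rot/out4_rot ? ? ? ? ?; split => //; atoms; solveb. Qed.

Lemma split_D1 X Y A u A1 A2 : split_at X Y A u A1 A2 -> A :\ u = A1 :|: A2.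
Proof.
move=> sp; apply/setP => z; rewrite (split_eq sp) !inE.
case: eqVneq => [->|_] /=; last by rewrite orbF.
by rewrite (negbTE (split_u1 sp)) (negbTE (split_u2 sp)).
Qed.

Lemma goodF x y A B : theta x y A B -> touch A B = false -> False.
Proof. by move=> /gG->. Qed.

(** Otherwise [C2] and [E2] are nonempty and separate [P4 d b P2] from [C1 p D q E1], which makes
    [ac] a unique chord. *)
Lemma cross_pb_qd a b c d P1 P2 P3 P4 p q D : k4 a b c d P1 P2 P3 P4 ->
  cross a b c d P1 P2 P3 P4 p q D -> adj p b || adj q d.
Proof.
move=> k cr; apply: contraT; rewrite negb_or => /andP[pb qd].
have [C1 [C2 sp]] := split_minlink (k4_m1 k) (cr_p cr).
have [E1 [E2 sq]] := split_minlink (k4_m3 k) (cr_q cr).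
have C20 : (C2 == set0) = false by rewrite -(split_uY sp) touch1; apply: negbTE.
have E20 : (E2 == set0) = false by rewrite -(split_uY sq) touch1; apply: negbTE.
exfalso; apply: (@goodF a c (P4 :|: [set d] :|: [set b] :|: P2) (C1 :|: [set p] :|: D :|: [set q] :|: E1)).
all: case: cr => cD oD pP qP tD nD; rewrite (split_D1 sp) (split_D1 sq) in nD.
all: k4open k; destruct sp; subst P1; destruct sq; subst P3; atoms.
  by thetab.
solveb.
Qed.

(** Otherwise [pa] is a unique chord between [C2 b d P4] and [D q E1 c]. *)
Lemma cross_ad a b c d P1 P2 P3 P4 p q D : k4 a b c d P1 P2 P3 P4 ->
  cross a b c d P1 P2 P3 P4 p q D -> adj p a -> adj q d.
Proof.
move=> k cr pa; apply: contraT => qd.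
have [C1 [C2 sp]] := split_minlink (k4_m1 k) (cr_p cr).
have [E1 [E2 sq]] := split_minlink (k4_m3 k) (cr_q cr).
have C10 : (C1 == set0) = true by rewrite -(split_uX sp) touch1.
have E20 : (E2 == set0) = false by rewrite -(split_uY sq) touch1; apply: negbTE.
exfalso; apply: (@goodF p a (C2 :|: [set b] :|: [set d] :|: P4) (D :|: [set q] :|: E1 :|: [set c])).
all: case: cr => cD oD pP qP tD nD; rewrite (split_D1 sp) (split_D1 sq) in nD.
all: k4open k; destruct sp; subst P1; destruct sq; subst P3; atoms.
  by thetab.
solveb.
Qed.

(** After a reflection, if necessary, [p] sees [a] and [q] sees [d]; later arguments treat only this
    position. *)
Lemma cross_type a b c d P1 P2 P3 P4 p q D : k4 a b c d P1 P2 P3 P4 ->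
  cross a b c d P1 P2 P3 P4 p q D ->
  [&& adj p b || adj q d, adj p a == adj q d & adj p b == adj q c].
Proof.
move=> k cr; have k' := k4_flip k; have cr' := cross_flip cr.
have k2 := k4_rot (k4_rot k); have cr2 := cross_rot2 cr.
have k2' := k4_rot (k4_rot k'); have cr2' := cross_rot2 cr'.
rewrite (cross_pb_qd k cr) /=; apply/andP; split; apply/eqP; apply/idP/idP.
- exact: cross_ad k cr.
- exact: cross_ad k2' cr2'.
- exact: cross_ad k' cr'.
- exact: cross_ad k2 cr2.
Qed.

End Cross.

(** * Sets attached to the cycle when every outside node sees at most one node of it *)

Section Body.
Variable G : sgraph.
Hypothesis cG : core G.
Implicit Types (A B C D E K L M S X Y Z P U : {set G}) (a b c d p q r x y z u v w s t : G).

Let gG := core_good cG.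
Let c3 := core_c3 cG.
Let c4 := core_c4 cG.

(** No node of [D] sees both [x] and [y], so [D] contains two nodes, as a proper 2-cutset
    requires. *)
Lemma two_attach D x y : x != y -> ~~ adj x y -> 3 <= deg x -> 3 <= deg y ->
  x \notin D -> y \notin D ->
  (forall u w, u \in D -> w \notin D -> adj u w -> w = x \/ w = y) ->
  touch D [set x] -> touch D [set y] ->
  (forall u, u \in D -> adj u x -> adj u y -> False) ->
  2 <= #|~: (D :|: [set x; y])| -> False.
Proof.
move=> xy nxy dx dy xD yD exit /touchP[u [x' [uD /set1P-> ux]]] /touchP[v [y' [vD /set1P-> vy]]] no.
apply: (core_no2 cG xy nxy dx dy xD yD).
  apply/negbTE/touchPn => s t sD; rewrite !inE !negb_or => /and3P[tD tx ty].
  by apply/negP => /(exit s t sD tD)[E|E]; [move: tx | move: ty]; rewrite E eqxx.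
apply: (@leq_size_card _ [:: u; v]); last by move=> w; rewrite !inE => /orP[]/eqP->.
by rewrite /= inE andbT; apply: contraTneq ux => ->; apply/negP => /(no v vD); apply.
Qed.

Definition body a b c d P1 P2 P3 P4 :=
  [set a] :|: [set b] :|: [set c] :|: [set d] :|: P1 :|: P2 :|: P3 :|: P4.

Lemma out4_body a b c d P1 P2 P3 P4 D :
  out4 a b c d P1 P2 P3 P4 D = [disjoint D & body a b c d P1 P2 P3 P4].
Proof. by rewrite /out4 /body !disjE !andbA. Qed.

Definition k4_rel : rel nat := nbs_adj
  [:: [:: 2; 4; 7]; [:: 3; 4; 5]; [:: 0; 5; 6]; [:: 1; 6; 7]; [:: 0; 1]; [:: 1; 2]; [:: 2; 3]; [:: 3; 0]].

Definition k4_phi a b c d P1 P2 P3 P4 : nat -> {set G} :=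
  nth set0 [:: [set a]; [set b]; [set c]; [set d]; P1; P2; P3; P4].

Lemma k4_model a b c d P1 P2 P3 P4 : k4 a b c d P1 P2 P3 P4 ->
  model k4_nodes k4_rel (k4_phi a b c d P1 P2 P3 P4).
Proof.
move=> k; k4open k; split.
- by move=> i; do 8 (case: i => [|i]; first by rewrite /k4_phi /= ?conn1).
- by move=> i j; do 8 (case: i => [|i]; first by do 8 (case: j => [|j];
    first by rewrite /k4_phi //= => *; solveb)).
- by move=> i j; do 8 (case: i => [|i]; first by do 8 (case: j => [|j];
    first by rewrite /k4_phi //= => *; solveb)).
Qed.

Lemma k4_single a b c d P1 P2 P3 P4 : is_single (k4_phi a b c d P1 P2 P3 P4) [:: 0; 1; 2; 3].
Proof. by move=> i; do 4 (case: i => [|i]; first by eexists). Qed.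

Lemma bodyP a b c d P1 P2 P3 P4 x :
  reflect (exists2 i, i \in k4_nodes & x \in k4_phi a b c d P1 P2 P3 P4 i)
    (x \in body a b c d P1 P2 P3 P4).
Proof.
rewrite /body !in_setU; apply: (iffP idP).
  move=> /orP[/orP[/orP[/orP[/orP[/orP[/orP[|]|]|]|]|]|]|] H;
  by [exists 0 | exists 1 | exists 2 | exists 3 | exists 4 | exists 5 | exists 6 | exists 7].
case=> i; do 8 (case: i => [|i]; first by rewrite /k4_phi /= => _ ->; rewrite ?orbT).
by [].
Qed.

(** The condition under which [attached_compatible] applies to the cycle. For a shortest one it can
    fail only because some node sees two opposite rims. *)
Definition lonely a b c d P1 P2 P3 P4 := forall u z z',
  u \notin body a b c d P1 P2 P3 P4 -> z \in body a b c d P1 P2 P3 P4 ->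
  z' \in body a b c d P1 P2 P3 P4 -> adj u z -> adj u z' -> z = z'.

Lemma body_rot a b c d P1 P2 P3 P4 : body b c d a P2 P3 P4 P1 = body a b c d P1 P2 P3 P4.
Proof. by apply/setP => x; rewrite /body !in_setU !in_set1; do !case: (_ == _); do !case: (_ \in _). Qed.

Lemma body_flip a b c d P1 P2 P3 P4 : body b a d c P1 P4 P3 P2 = body a b c d P1 P2 P3 P4.
Proof. by apply/setP => x; rewrite /body !in_setU !in_set1; do !case: (_ == _); do !case: (_ \in _). Qed.

Lemma lonely_rot a b c d P1 P2 P3 P4 :
  lonely a b c d P1 P2 P3 P4 -> lonely b c d a P2 P3 P4 P1.
Proof. by rewrite /lonely (body_rot a b c d). Qed.

Lemma lonely_flip a b c d P1 P2 P3 P4 :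
  lonely a b c d P1 P2 P3 P4 -> lonely b a d c P1 P4 P3 P2.
Proof. by rewrite /lonely (body_flip a b c d). Qed.

(** The two exceptions in the certificate check are the pairs of opposite rims: no certificate
    refutes a connection between those alone, and it is treated as a crossing instead. *)
Lemma k4_attached a b c d P1 P2 P3 P4 D i j : k4 a b c d P1 P2 P3 P4 ->
  lonely a b c d P1 P2 P3 P4 -> conn D -> out4 a b c d P1 P2 P3 P4 D ->
  i \in k4_nodes -> j \in k4_nodes -> i != j -> ~~ compatible k4_ok i j ->
  touch D (k4_phi a b c d P1 P2 P3 P4 i) -> touch D (k4_phi a b c d P1 P2 P3 P4 j) ->
  exists (m n : nat) E, [/\ [:: m; n] = [:: 4; 6] \/ [:: m; n] = [:: 5; 7],
    minlink (k4_phi a b c d P1 P2 P3 P4 m) (k4_phi a b c d P1 P2 P3 P4 n) E, E \subset D &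
    {in k4_nodes, forall l, touch E (k4_phi a b c d P1 P2 P3 P4 l) = (l \in [:: m; n])}].
Proof.
move=> k lo cD oD iI jI ij nc Di Dj.
have chk : conflicts_refuted k4_nodes [:: 0; 1; 2; 3] k4_rel 8 k4_ok
  [:: [:: 4; 6]; [:: 5; 7]] k4_certs by vm_compute.
have m := k4_model k; have nI : 8 \notin k4_nodes by [].
have sub : {subset [:: 0; 1; 2; 3] <= k4_nodes}.
  by move=> l; rewrite !inE => /or4P[]/eqP->.
have bI l z : l \in k4_nodes -> z \in k4_phi a b c d P1 P2 P3 P4 l -> z \in body a b c d P1 P2 P3 P4.
  by move=> lI zl; apply/bodyP; exists l.
have oD' : outside k4_nodes (k4_phi a b c d P1 P2 P3 P4) D.
  move=> l lI; rewrite out4_body in oD; apply: disjointWr oD.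
  by apply/subsetP => z; apply: bI.
have one : {in D, forall w, {in k4_nodes &, forall i j,
    touch [set w] (k4_phi a b c d P1 P2 P3 P4 i) -> touch [set w] (k4_phi a b c d P1 P2 P3 P4 j) -> i = j}}.
  move=> w wD l l' lI l'I /touch1P[z zl wz] /touch1P[z' zl' wz'].
  have wb : w \notin body a b c d P1 P2 P3 P4 by apply: disjointN wD; rewrite -out4_body.
  have E := lo w z z' wb (bI _ _ lI zl) (bI _ _ l'I zl') wz wz'.
  apply/eqP; apply: contraT => ll'; have := model_dis m lI l'I ll' => /disjointFr/(_ zl).
  by rewrite E zl'.
have [[x [y [T [E [[xI yI xyT] mE sE HE]]]]]|H] :=
  attached_compatible gG m (@k4_single _ _ _ _ _ _ _ _) sub nI chk cD oD' one.
  exists x, y, E; case: T xyT HE => [|? ?] xyT HE; last first.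
    by move: xyT; rewrite !inE => /orP[]/eqP.
  by split => //; move: xyT; rewrite !inE => /orP[]/eqP->; [left | right].
by rewrite (H i j) in nc.
Qed.

End Body.

(** * Crossings with a further contact *)

Section Extra.
Variable G : sgraph.
Hypothesis cG : core G.
Implicit Types (A B C D E K L M S T U V X Y Z P : {set G}) (a b c d p q r x y z u v w s t : G).

Let gG := core_good cG.

Definition only B V (l : seq G) := forall z, z \in B -> touch V [set z] -> z \in l.

Lemma only_touch B V l S : only B V l -> S \subset B -> ~~ has (mem S) l -> touch V S = false.
Proof.
move=> o SB nl; apply/negbTE/touchPn => v z vV zS; apply: contraNF nl => vz.
apply/hasP; exists z => //; apply: o; first exact: (subsetP SB).
by apply/touchP; exists v, z; rewrite inE.
Qed.

Lemma onlyS B V (W : {set G}) l : V \subset W -> only B W l -> only B V l.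
Proof. by move=> VW o z zB t; apply: o => //; apply: touchS t. Qed.

Lemma body_sub a b c d P1 P2 P3 P4 :
  [/\ [/\ [set a] \subset body a b c d P1 P2 P3 P4, [set b] \subset body a b c d P1 P2 P3 P4,
          [set c] \subset body a b c d P1 P2 P3 P4 & [set d] \subset body a b c d P1 P2 P3 P4],
      P1 \subset body a b c d P1 P2 P3 P4, P2 \subset body a b c d P1 P2 P3 P4,
      P3 \subset body a b c d P1 P2 P3 P4 & P4 \subset body a b c d P1 P2 P3 P4].
Proof.
split; [split| | | |].
all: by apply/subsetP => z zS; rewrite /body !in_setU zS ?orbT.
Qed.

Lemma k4_cross a b c d P1 P2 P3 P4 D i j : k4 a b c d P1 P2 P3 P4 ->
  lonely a b c d P1 P2 P3 P4 -> conn D -> out4 a b c d P1 P2 P3 P4 D ->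
  i \in k4_nodes -> j \in k4_nodes -> i != j -> ~~ compatible k4_ok i j ->
  touch D (k4_phi a b c d P1 P2 P3 P4 i) -> touch D (k4_phi a b c d P1 P2 P3 P4 j) ->
  (touch D P1 && touch D P3) || (touch D P2 && touch D P4).
Proof.
move=> k lo cD oD iI jI ij nc Di Dj.
have [m [n [E [mn mE sE _]]]] := k4_attached cG k lo cD oD iI jI ij nc Di Dj.
have /and3P[_ Em En] := minlink_links mE.
have {}Em := touchS sE (subxx _) Em; have {}En := touchS sE (subxx _) En.
by case: mn => -[mE' nE']; move: Em En; rewrite mE' nE' /k4_phi /= => -> ->; rewrite ?orbT.
Qed.

(* [x] attaches by [Z1] to [delta], and [delta] to the far rim by [Z2]. *)
Lemma attach_delta a b c d P1 P2 P3 P4 p q x Z delta Z1 Z2 C1 C2 E1 E2 :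
  k4 a b c d P1 P2 P3 P4 -> lonely a b c d P1 P2 P3 P4 ->
  p \in P1 -> q \in P3 -> adj p a -> adj q d ->
  split_at [set a] [set b] P1 p C1 C2 -> split_at [set c] [set d] P3 q E1 E2 ->
  minlink [set x] P3 Z -> out4 a b c d P1 P2 P3 P4 Z ->
  only (body a b c d P1 P2 P3 P4) Z [:: p; q; x] ->
  touch Z [set q] -> x \in C2 :|: [set b] -> x != p -> x != q ->
  split_at [set x] P3 Z delta Z1 Z2 -> delta \in Z -> adj delta p -> False.
Proof.
set B := body a b c d P1 P2 P3 P4.
move=> k lo pP qP pa qd sp sq mZ oZ oB Zq xC xp xq sZ dZ dp.
have C10 : (C1 == set0) = true by rewrite -(split_uX sp) touch1.
have E20 : (E2 == set0) = true by rewrite -(split_uY sq) touch1.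
have [[aB bB cB dB] P1B P2B P3B P4B] := body_sub a b c d P1 P2 P3 P4.
have xB : x \in B.
  move: xC; rewrite inE => /orP[xC|/set1P->]; last by apply: (subsetP bB); rewrite inE.
  by apply: (subsetP P1B); rewrite (split_eq sp) !inE xC orbT.
have deltaB : delta \notin B by apply: disjointN dZ; rewrite -out4_body.
have pB := subsetP P1B p pP; have qB := subsetP P3B q qP.
have dx : adj delta x = false by apply: contraNF xp => dx; rewrite (lo _ _ _ deltaB xB pB dx dp).
have dq : adj delta q = false.
  apply/negP => dq; have E := lo _ _ _ deltaB qB pB dq dp; move: qP; rewrite E.
  by case/and5P: (k4_dis k) => _ /disjointN/(_ pP)/negP.
have Z10 : (Z1 == set0) = false by rewrite -(split_uX sZ) touch1.
have oa : only B [set delta] [:: p].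
  by move=> z zB; rewrite touch1 inE => dz; rewrite (lo _ _ _ deltaB zB pB dz dp).
have dP3 : touch [set delta] P3 = false.
  apply: (only_touch oa P3B); rewrite /= orbF.
  by case/and5P: (k4_dis k) => _ /disjointN/(_ pP).
have Z20 : (Z2 == set0) = false by rewrite -(split_uY sZ).
have sZ1 : Z1 \subset Z by rewrite (split_eq sZ) -setUA subsetUl.
have sZ2 : Z2 \subset Z by rewrite (split_eq sZ) subsetUr.
have xP3 : x \notin P3.
  move: xC; rewrite inE => /orP[xC|/set1P->]; last by case/and4P: (k4_in3 k).
  have xP1 : x \in P1 by rewrite (split_eq sp) !inE xC orbT.
  by case/and5P: (k4_dis k) => _ /disjointN/(_ xP1).
have q3 z : z \in P3 -> touch Z [set z] -> z = q.
  move=> zP t; move: (oB z (subsetP P3B z zP) t); rewrite !inE => /or3P[]/eqP E //.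
    by move: zP; rewrite E; case/and5P: (k4_dis k) => _ /disjointN/(_ pP)/negP.
  by move: xP3; rewrite -E zP.
have Z2q : touch Z2 [set q].
  have /touchP[u [z [uZ zP uz]]] : touch Z2 P3 by rewrite (split_Y2 sZ) Z20.
  rewrite -(q3 z zP) //; last by apply/touchP; exists u, z; rewrite (subsetP sZ2) ?inE.
  by apply/touchP; exists u, z; rewrite inE.
have Z1q : touch Z1 [set q] = false by apply: ntouchS (subxx _) _ (split_Y1 sZ); rewrite sub1set.
have Z1x : touch Z1 [set x] by rewrite (split_X1 sZ) Z10.
have Z2x : touch Z2 [set x] = false := split_X2 sZ.
have o1 : only B Z1 [:: p; x].
  move=> z zB t; move: (onlyS sZ1 oB zB t); rewrite !inE => /or3P[->//|/eqP E|->]; last by rewrite orbT.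
  by move: t; rewrite E Z1q.
have o2 : only B Z2 [:: p; q].
  move=> z zB t; move: (onlyS sZ2 oB zB t); rewrite !inE => /or3P[->//|->|/eqP E]; first by rewrite orbT.
  by move: t; rewrite E Z2x.
have xx : touch Z1 (C2 :|: [set b]) by apply: (touchS (subxx _) _ Z1x); rewrite sub1set.
have C2B : C2 \subset B by rewrite (subset_trans _ P1B) // (split_eq sp) subsetUr.
have E1B : E1 \subset B by rewrite (subset_trans _ P3B) // (split_eq sq) -setUA subsetUl.
have t1 S (SB : S \subset B) (n : ~~ has (mem S) [:: p; x]) := only_touch o1 SB n.
have t2 S (SB : S \subset B) (n : ~~ has (mem S) [:: p; q]) := only_touch o2 SB n.
have xa : (x == a) = false.
  apply/negbTE; apply: contraTneq xC => ->; have H1 := k4_in1 k; have H2 := k4_ne k.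
  by rewrite (split_eq sp) in H1; atoms; solveb.
have xc : (x == c) = false.
  apply/negbTE; apply: contraTneq xC => ->; have H1 := k4_in1 k; have H2 := k4_ne k.
  by rewrite (split_eq sp) in H1; atoms; solveb.
have xE1 : x \notin E1.
  by apply: contra xP3 => xE1; rewrite (split_eq sq) !inE xE1.
have [pa' pb' pc'] : [/\ (p == a) = false, (p == b) = false & (p == c) = false].
  by case/and4P: (k4_in1 k) => n1 n2 n3 _; split; apply: contraTF pP => /eqP->.
have qb' : (q == b) = false by case/and4P: (k4_in3 k) => _ n _ _; apply: contraTF qP => /eqP->.
have pE1 : p \notin E1.
  apply: contraTN pP => pE; have pP3 : p \in P3 by rewrite (split_eq sq) !inE pE.
  by case/and5P: (k4_dis k) => _ d13 _ _ _; rewrite (disjointFl d13 pP3).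
have qC2 : q \notin C2.
  apply: contraTN qP => qC; have qP1 : q \in P1 by rewrite (split_eq sp) !inE qC orbT.
  by case/and5P: (k4_dis k) => _ d13 _ _ _; rewrite (disjointFr d13 qP1).
have f1 : touch Z1 [set a] = false by apply: (t1 _ aB); rewrite /= !inE; atoms; solveb.
have f2 : touch Z1 [set c] = false by apply: (t1 _ cB); rewrite /= !inE; atoms; solveb.
have f3 : touch Z1 E1 = false by apply: (t1 _ E1B); rewrite /=; atoms; solveb.
have f4 : touch Z2 [set b] = false by apply: (t2 _ bB); rewrite /= !inE; atoms; solveb.
have f5 : touch Z2 C2 = false.
  by apply: (t2 _ C2B); rewrite /=; have := split_u2 sp => ?; atoms; solveb.
have pZ : p \notin Z.
  by rewrite out4_body in oZ; apply: contraTN pB => /(disjointN oZ).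
rewrite /B /body in deltaB; clear t1 t2 oB o1 o2 oa aB bB cB dB P1B P2B P3B P4B lo xB pB qB C2B E1B q3 mZ.
have xZ1 : touch Z1 C2 \/ touch Z1 [set b] by apply/orP; rewrite -touchUr.
apply: (@goodF _ cG p delta (Z1 :|: (C2 :|: [set b])) (Z2 :|: [set q] :|: E1 :|: [set c] :|: [set a])).
  by clear xx; k4open k; destruct sp, sq, sZ; subst P1 P3 Z; case: xZ1 => xZ1; atoms; thetab.
by clear xx; k4open k; destruct sp, sq, sZ; subst P1 P3 Z; atoms; solveb.
Qed.
End Extra.

Section Extra.
Variable G : sgraph.
Hypothesis cG : core G.
Implicit Types (A B C D E K L M S T U V X Y Z P : {set G}) (a b c d p q r x y z u v w s t : G).

Let gG := core_good cG.

(** [Z] is a shortest connection from [x] to the far rim. If it avoids [p], it is a crossing from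
    [x] that contradicts [cross_type], or it meets an incompatible pair without meeting two opposite
    rims. If it meets [p], then [attach_delta] settles [x] in [C2] or equal to [b]. For the other
    [x] the part [K] of [Z] up to a node seeing [p] is used: incompatibility excludes [P2] and [P4],
    and for [x = a] the edge [ap] would be a unique chord. *)
Lemma attach_extra a b c d P1 P2 P3 P4 p q x U :
  k4 a b c d P1 P2 P3 P4 -> lonely a b c d P1 P2 P3 P4 ->
  p \in P1 -> q \in P3 -> adj p a -> adj q d ->
  conn U -> out4 a b c d P1 P2 P3 P4 U -> touch U [set q] -> touch U [set x] ->
  only (body a b c d P1 P2 P3 P4) U [:: p; q; x] ->
  x \in [set a] :|: [set b] :|: P1 :|: P2 :|: P4 -> x != p -> False.
Proof.
set B := body a b c d P1 P2 P3 P4.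
move=> k lo pP qP pa qd cU oU Uq Ux oB xin xp.
have [C1 [C2 sp]] := split_minlink (k4_m1 k) pP.
have [E1 [E2 sq]] := split_minlink (k4_m3 k) qP.
have C10 : C1 = set0 by apply/eqP; rewrite -(split_uX sp) touch1.
have [[aB bB cB dB] P1B P2B P3B P4B] := body_sub a b c d P1 P2 P3 P4.
rewrite -/B in aB bB cB dB P1B P2B P3B P4B.
have pB := subsetP P1B p pP; have qB := subsetP P3B q qP.
case/and5P: (k4_dis k) => d12 d13 d14 d23 /andP[d24 d34].
have n1 := k4_in1 k; have n2 := k4_in2 k; have n3 := k4_in3 k; have nn := k4_ne k.
have xP3 : x \notin P3.
  move: (xin); rewrite !in_setU !in_set1 => /orP[/orP[/orP[/orP[]|]|]|].
  - by move/eqP->; case/and4P: n3.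
  - by move/eqP->; case/and4P: n3.
  - by move/(disjointN d13).
  - by move/(disjointN d23).
  - by rewrite disjoint_sym in d34; move/(disjointN d34).
have xB : x \in B.
  have := xin; rewrite 4!in_setU !in_set1 => /orP[/orP[/orP[/orP[]|]|]|].
  - by move/eqP->; apply: (subsetP aB); rewrite inE.
  - by move/eqP->; apply: (subsetP bB); rewrite inE.
  - exact: (subsetP P1B).
  - exact: (subsetP P2B).
  - exact: (subsetP P4B).
have xq : x != q by apply: contraNneq xP3 => ->.
have UP3 : touch U P3 by apply: (touchS (subxx _) _ Uq); rewrite sub1set.
have [Z mZ sZU] := minlink_exists cU Ux UP3.
have /and3P[cZ Zx Z3] := minlink_links mZ.
have oZ : out4 a b c d P1 P2 P3 P4 Z by move: oU; rewrite !out4_body; exact: disjointWl sZU.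
have oBZ := onlyS sZU oB.
have Zq : touch Z [set q].
  have /touchP[u [z [uZ zP uz]]] := Z3.
  have tz : touch Z [set z] by apply/touchP; exists u, z; rewrite inE.
  move: (oBZ z (subsetP P3B z zP) tz); rewrite !inE => /or3P[]/eqP E; rewrite -?E //.
    by move: pP; rewrite -E => /(disjointN d13); rewrite zP.
  by move: xP3; rewrite -E zP.
have pq : p != q by apply: contraTneq pP => ->; rewrite disjoint_sym in d13; apply: disjointN d13 _.
have [pa' pb' pc' pd'] : [/\ (p == a) = false, (p == b) = false, (p == c) = false & (p == d) = false].
  by case/and4P: n1 => m1 m2 m3 m4; split; apply: contraTF pP => /eqP->.
have [qa' qb' qc' qd'] : [/\ (q == a) = false, (q == b) = false, (q == c) = false & (q == d) = false].
  by case/and4P: n3 => m1 m2 m3 m4; split; apply: contraTF qP => /eqP->.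
have p2 := disjointN d12 pP; have p3 := disjointN d13 pP; have p4 := disjointN d14 pP.
have q1 : q \notin P1 by rewrite disjoint_sym in d13; apply: disjointN d13 _.
have q2 : q \notin P2 by rewrite disjoint_sym in d23; apply: disjointN d23 _.
have q4 := disjointN d34 qP.
have C2x : x \in P1 -> x \in C2.
  by rewrite (split_eq sp) C10 !inE (negbTE xp).
have x4 : x \in P4 -> x \notin P2 by rewrite disjoint_sym in d24; exact: disjointN.
have x2 : x \in P2 -> x \notin P4 by exact: disjointN.
have x21 : x \in P2 -> x \notin P1 by rewrite disjoint_sym in d12; exact: disjointN.
have x41 : x \in P4 -> x \notin P1 by rewrite disjoint_sym in d14; exact: disjointN.
have [Zp|Zp] := boolP (touch Z [set p]); last first.
  have o2 : only B Z [:: q; x].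
    by move=> z zB t; move: (oBZ z zB t); rewrite !inE => /orP[/eqP E|//]; rewrite -E t in Zp.
  have [xP1|xP1] := boolP (x \in P1).
    have cr : cross a b c d P1 P2 P3 P4 x q Z.
      have [xa xb xc xd] : [/\ (x == a) = false, (x == b) = false, (x == c) = false & (x == d) = false].
        by case/and4P: n1 => m1 m2 m3 m4; split; apply: contraTF xP1 => /eqP->.
      have t S (SB : S \subset B) (n : ~~ has (mem S) [:: q; x]) := only_touch o2 SB n.
      have sB1 : P1 :\ x \subset B by apply: subset_trans (subD1set _ _) P1B.
      have sB3 : P3 :\ q \subset B by apply: subset_trans (subD1set _ _) P3B.
      have x22 := disjointN d12 xP1; have x42 := disjointN d14 xP1.
      split; rewrite ?Zx ?Zq // !t //= ?inE ?in_set1 ?qa' ?qb' ?qc' ?qd' ?xa ?xb ?xc ?xd ?eqxx ?(negbTE q1) ?(negbTE q2) ?(negbTE q4) ?(negbTE xP3) ?(negbTE x22) ?(negbTE x42) ?andbF //.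
    have /and3P[_ /eqP E _] := cross_type cG k cr.
    have /negbT/touchPn/(_ x a (C2x xP1)) := split_X2 sp.
    by rewrite inE eqxx E qd => /(_ isT).
  have [i [iI xi nc]] : exists i, [/\ i \in [:: 0; 1; 5; 7], x \in k4_phi a b c d P1 P2 P3 P4 i &
      ~~ compatible k4_ok i 6].
    move: xin; rewrite !in_setU (negbTE xP1) orbF => /orP[/orP[/orP[]|]|] H.
    - by exists 0.
    - by exists 1.
    - by exists 5.
    - by exists 7.
  have iI' : i \in k4_nodes by move: iI; rewrite !inE => /or4P[]/eqP->.
  have i6 : i != 6 by move: iI; rewrite !inE => /or4P[]/eqP->.
  have ti : touch Z (k4_phi a b c d P1 P2 P3 P4 i) by apply: (touchS (subxx _) _ Zx); rewrite sub1set.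
  have Z1 : touch Z P1 = false.
    by apply: (only_touch o2 P1B); rewrite /= (negbTE q1) (negbTE xP1).
  have := k4_cross cG k lo cZ oZ iI' (isT : 6 \in k4_nodes) i6 nc ti Z3.
  rewrite Z1 /= => /andP[T2 T4].
  have [xP2|xP2] := boolP (x \in P2).
    by move: T4; rewrite (only_touch o2 P4B) //= (negbTE q4) (negbTE (x2 xP2)).
  by move: T2; rewrite (only_touch o2 P2B) //= (negbTE q2) (negbTE xP2).
have /touchP[delta [p' [dZ /set1P-> dp]]] := Zp.
have [Z1 [Z2 sZ]] := split_minlink mZ dZ.
have [xC|xC] := boolP (x \in C2 :|: [set b]).
  exact: (attach_delta cG k lo pP qP pa qd sp sq mZ oZ oBZ Zq xC xp xq sZ dZ dp).
have xP1 : x \notin P1 by apply: contra xC => /C2x; rewrite inE => ->.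
have xb : x != b by apply: contra xC; rewrite !inE => ->; rewrite orbT.
have deltaB : delta \notin B by apply: disjointN dZ; rewrite -out4_body.
have dx : adj delta x = false by apply: contraNF xp => dx; rewrite (lo _ _ _ deltaB xB pB dx dp).
have dq : adj delta q = false by apply: contraNF pq => dq; rewrite (lo _ _ _ deltaB pB qB dp dq).
have Z10 : (Z1 == set0) = false by rewrite -(split_uX sZ) touch1.
pose K := Z1 :|: [set delta].
have sKZ : K \subset Z by rewrite (split_eq sZ) subsetUl.
have cK : conn K by apply: conn_touch (split_c1 sZ) (conn1 _) _; rewrite touchC (split_u1t sZ) Z10.
have oK : out4 a b c d P1 P2 P3 P4 K by move: oZ; rewrite !out4_body; exact: disjointWl sKZ.
have Kx : touch K [set x] by rewrite touchUl (split_X1 sZ) Z10.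
have Kp : touch K [set p] by rewrite touchUl touch1 dp orbT.
have Z1q : touch Z1 [set q] = false by apply: ntouchS (subxx _) _ (split_Y1 sZ); rewrite sub1set.
have oBK : only B K [:: p; x].
  move=> z zB t; move: (onlyS sKZ oBZ zB t); rewrite !inE => /or3P[->//|/eqP E|->]; last by rewrite orbT.
  by move: t; rewrite E touchUl Z1q touch1 dq.
have K3 : touch K P3 = false.
  by apply: (only_touch oBK P3B); rewrite /= (negbTE p3) (negbTE xP3).
have KP1 : touch K P1 by apply: (touchS (subxx _) _ Kp); rewrite sub1set.
have two i : i \in [:: 5; 7] -> x \in k4_phi a b c d P1 P2 P3 P4 i -> False.
  move=> iI xi; have iI' : i \in k4_nodes by move: iI; rewrite !inE => /orP[]/eqP->.
  have i4 : i != 4 by move: iI; rewrite !inE => /orP[]/eqP->.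
  have nc : ~~ compatible k4_ok i 4 by move: iI; rewrite !inE => /orP[]/eqP->.
  have ti : touch K (k4_phi a b c d P1 P2 P3 P4 i) by apply: (touchS (subxx _) _ Kx); rewrite sub1set.
  have := k4_cross cG k lo cK oK iI' (isT : 4 \in k4_nodes) i4 nc ti KP1.
  rewrite K3 andbF /= => /andP[T2 T4].
  have [xP2|xP2] := boolP (x \in P2).
    by move: T4; rewrite (only_touch oBK P4B) //= (negbTE p4) (negbTE (x2 xP2)).
  by move: T2; rewrite (only_touch oBK P2B) //= (negbTE p2) (negbTE xP2).
move: xin; rewrite !in_setU !in_set1 (negbTE xP1) (negbTE xb) !orbF => /orP[/orP[/eqP xa|]|].
- have sub : C2 :|: [set b] :|: P2 :|: [set c] \subset B.
    by rewrite !subUset bB P2B cB (subset_trans _ P1B) // (split_eq sp) subsetUr.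
  have xc : (x == c) = false by rewrite xa; apply/negbTE; case/and5P: nn => _ + _ _ _.
  apply: (goodF cG (x := a) (y := p) (A := K) (B := C2 :|: [set b] :|: P2 :|: [set c])).
    have aB' : a \in B by rewrite -xa.
    have aK : a \notin K by move: oK; rewrite out4_body => oK; apply: contraTN aB' => /(disjointN oK).
    have pK : p \notin K by move: oK; rewrite out4_body => oK; apply: contraTN pB => /(disjointN oK).
    have dK : [disjoint K & C2 :|: [set b] :|: P2 :|: [set c]].
      by move: oK; rewrite out4_body; apply: disjointWr.
    rewrite xa in Kx; clear -k sp pa Kx Kp aK pK dK cK pP C10 nn; clearbody K; subst C1.
    by k4open k; destruct sp; subst P1; atoms; thetab.
  apply: (only_touch oBK sub); rewrite /= !in_setU !in_set1 pb' pc' (negbTE p2) xc (negbTE xb).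
  rewrite (negbTE (split_u2 sp)) /= orbF !orbF; apply/norP; split; last by rewrite xa; case/and4P: n2.
  by apply: contra xC; rewrite inE => ->.
- exact: two 5 isT.
- exact: two 7 isT.
Qed.

End Extra.

(** * Excluding crossings in the lonely case *)

Section Lonely.
Variable G : sgraph.
Hypothesis cG : core G.
Implicit Types (A B C D E K L M S T U V X Y Z P : {set G}) (a b c d p q r x y z u v w s t : G).

Let gG := core_good cG.

(** The reflection exchanging [a] with [d], [b] with [c] and [P1] with [P3] brings the remaining
    positions of [x] under [attach_extra]. *)
Lemma attach_extra2 a b c d P1 P2 P3 P4 p q x U :
  k4 a b c d P1 P2 P3 P4 -> lonely a b c d P1 P2 P3 P4 ->
  p \in P1 -> q \in P3 -> adj p a -> adj q d ->
  conn U -> out4 a b c d P1 P2 P3 P4 U -> touch U [set p] -> touch U [set q] -> touch U [set x] ->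
  only (body a b c d P1 P2 P3 P4) U [:: p; q; x] ->
  x \in body a b c d P1 P2 P3 P4 -> x != p -> x != q -> False.
Proof.
move=> k lo pP qP pa qd cU oU Up Uq Ux oB xB xp xq.
have [xin|xin] := boolP (x \in [set a] :|: [set b] :|: P1 :|: P2 :|: P4).
  exact: (attach_extra cG k lo pP qP pa qd cU oU Uq Ux oB xin xp).
have bE : body d c b a P3 P2 P1 P4 = body a b c d P1 P2 P3 P4.
  by rewrite (body_flip c d a b) (body_rot b c d a) (body_rot a b c d).
have k' := k4_flip (k4_rot (k4_rot k)).
apply: (attach_extra cG k' (x := x) (U := U)  _ qP pP qd pa cU _ Up Ux _ _ xq).
- by rewrite /lonely bE.
- by rewrite out4_body bE -out4_body.
- by rewrite bE => z zB /(oB z zB); rewrite !inE orbCA.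
by move: xB xin; rewrite /body !in_setU; do !case: (_ \in _).
Qed.

(** Take a smallest connected [U] containing [E] that has a further contact. It consists of a set
    [K] without one and a last node [w], which sees only one node of the cycle; so [U] has exactly
    one further contact, and [attach_extra2] excludes it. *)
Lemma cross_only a b c d P1 P2 P3 P4 p q E D :
  k4 a b c d P1 P2 P3 P4 -> lonely a b c d P1 P2 P3 P4 ->
  cross a b c d P1 P2 P3 P4 p q E -> conn D -> out4 a b c d P1 P2 P3 P4 D -> E \subset D ->
  only (body a b c d P1 P2 P3 P4) D [:: p; q].
Proof.
set B := body a b c d P1 P2 P3 P4.
move=> k lo cr cD oD ED z0 z0B Dz; apply: contraT => z0n.
have [P1B P3B] : P1 \subset B /\ P3 \subset B by case: (body_sub a b c d P1 P2 P3 P4).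
have pB := subsetP P1B _ (cr_p cr); have qB := subsetP P3B _ (cr_q cr).
have oE : only B E [:: p; q].
  move=> z zB t; have {}t S : touch E S = false -> z \notin S.
    by move=> nt; apply: contraFN nt => zS; apply: (touchS (subxx _) _ t); rewrite sub1set.
  have := cr_n cr; case/and5P => /and4P[/negbTE/t na /negbTE/t nb /negbTE/t nc /negbTE/t nd].
  move=> /negbTE/t n2 /negbTE/t n4 /negbTE/t n1 /negbTE/t n3.
  rewrite !in_setD1 !negb_and !negbK in n1 n3.
  move: zB; rewrite /B /body !in_setU (negbTE na) (negbTE nb) (negbTE nc) (negbTE nd).
  rewrite (negbTE n2) (negbTE n4) !orbF /= !inE => /orP[zP|zP].
    by move: n1; rewrite zP orbF => ->.
  by move: n3; rewrite zP orbF => ->; rewrite orbT.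
pose ex U := touch U (B :\: [set p; q]).
have exP U : reflect (exists2 z, z \in B & (touch U [set z]) && (z \notin [:: p; q])) (ex U).
  apply: (iffP (touchP _ _)) => [[u [z [uU zn uz]]]|[z zB /andP[/touchP[u [z' [uU /set1P-> uz]]] zn]]].
    exists z; first by case/setDP: zn.
    apply/andP; split; first by apply/touchP; exists u, z; rewrite inE.
    by case/setDP: zn; rewrite !inE.
  by exists u, z; rewrite in_setD zB andbT; move: zn; rewrite !inE.
have exE : ~~ ex E by apply/exP => -[z zB /andP[/(oE z zB)->]].
have [U mU sU] : {U | minset (fun U => [&& conn U, E \subset U & ex U]) U & U \subset D}.
  apply: minset_exists; rewrite cD ED /=; apply/exP; exists z0 => //; by rewrite Dz.
have /and3P[cU EU exU] := minsetp mU.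
have [x xB /andP[Ux xn]] := exP _ exU.
have /touchP[w [x' [wU /set1P-> wx]]] := Ux.
have wE : w \notin E.
  apply: contra exE => wE; apply/exP; exists x; rewrite // xn andbT.
  by apply/touchP; exists w, x; rewrite inE.
have oU : out4 a b c d P1 P2 P3 P4 U by move: oD; rewrite !out4_body; exact: disjointWl sU.
have wB : w \notin B by apply: disjointN wU; rewrite -out4_body.
have [Ep Eq] := andP (cr_t cr).
have /touchP[e [_ [eE _ _]]] := Ep.
have eU : e \in U :\ w by rewrite !inE (subsetP EU) // andbT; apply: contraNneq wE => <-.
set K := comp (U :\ w) e.
have EK : E \subset K.
  apply: (conn_comp (cr_conn cr) _ eE (comp_refl _ _)); apply/subsetP => z zE.
  by rewrite !inE (subsetP EU) // andbT; apply: contraNneq wE => <-.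
have KU : K \subset U :\ w := comp_sub eU.
have KU' : K \subset U := subset_trans KU (subD1set _ _).
have exK : ~~ ex K.
  apply/negP => exK; have /minsetP[_ /(_ K)] := mU; rewrite comp_conn // EK exK => /(_ isT KU') KE.
  by move/subsetP/(_ w): KU; rewrite KE wU !inE eqxx => /(_ isT).
have Uw : K :|: [set w] = U.
  have /minsetP[_ H] := mU; apply: H; last by rewrite subUset KU' sub1set.
  apply/and3P; split; first exact: conn_touch (comp_conn eU) (conn1 _) (comp_touch cU wU eU).
    exact: subset_trans EK (subsetUl _ _).
  apply/exP; exists x; rewrite // xn andbT; apply/touchP; exists w, x.
  by rewrite !in_setU !set11 orbT wx.
have oB : only B U [:: p; q; x].
  move=> z zB t; have [zn|zn] := boolP (z \in [:: p; q]).
    by move: zn; rewrite !inE => /orP[]->; rewrite ?orbT.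
  have wz : adj w z.
    move: t; rewrite -Uw touchUl touch1 => /orP[t|//].
    by case/exP: exK; exists z; rewrite ?t.
  by rewrite (lo _ _ _ wB zB xB wz wx) !inE eqxx !orbT.
have Up : touch U [set p] by apply: touchS Ep.
have Uq : touch U [set q] by apply: touchS Eq.
have [xp xq] : x != p /\ x != q by move: xn; rewrite !inE negb_or => /andP[].
have /and3P[pbqd /eqP pa /eqP pb] := cross_type cG k cr.
have [qd|nqd] := boolP (adj q d).
  have pa' : adj p a by rewrite pa.
  by case: (attach_extra2 k lo (cr_p cr) (cr_q cr) pa' qd cU oU Up Uq Ux oB xB xp xq).
have pb' : adj p b by rewrite (negbTE nqd) orbF in pbqd.
have qc : adj q c by rewrite -pb.
have bE := body_flip a b c d P1 P2 P3 P4.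
exfalso; apply: (attach_extra2 (k4_flip k) (lonely_flip lo) (cr_p cr) (cr_q cr) pb' qc cU _ Up Uq Ux _ _ xp xq).
- exact: out4_flip.
- by rewrite bE.
- by rewrite bE.
Qed.

Lemma card3 (x y z : G) S : x \in S -> y \in S -> z \in S -> x != y -> x != z -> y != z -> 3 <= #|S|.
Proof.
move=> xS yS zS xy xz yz; apply: (@leq_size_card _ [:: x; y; z]).
  by rewrite /= !inE negb_or xy xz yz.
by move=> t; rewrite !inE => /or3P[]/eqP->.
Qed.

Lemma deg3 x S T U : touch [set x] S -> touch [set x] T -> touch [set x] U ->
  [disjoint S & T] -> [disjoint S & U] -> [disjoint T & U] -> 3 <= deg x.
Proof.
move=> /touch1P[s sS xs] /touch1P[t tT xt] /touch1P[u uU xu] ST SU TU.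
apply: (@card3 s t u); rewrite ?inE //.
- by apply: contraTneq tT => <-; rewrite (disjointFr ST sS).
- by apply: contraTneq uU => <-; rewrite (disjointFr SU sS).
- by apply: contraTneq uU => <-; rewrite (disjointFr TU tT).
Qed.

Lemma deg_corner a b c d P1 P2 P3 P4 : k4 a b c d P1 P2 P3 P4 -> 3 <= deg a.
Proof.
move=> k; apply: (@deg3 a [set c] P1 P4).
all: have k' := k4_links k; case: k => *; clear cG gG; atoms; solveb.
Qed.

Lemma deg_rim a b c d P1 P2 P3 P4 p D : k4 a b c d P1 P2 P3 P4 -> p \in P1 ->
  out4 a b c d P1 P2 P3 P4 D -> touch D [set p] -> 3 <= deg p.
Proof.
move=> k pP oD Dp; have [C1 [C2 sp]] := split_minlink (k4_m1 k) pP.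
apply: (@deg3 p (C1 :|: [set a]) (C2 :|: [set b]) D).
all: k4open k; destruct sp; subst P1; atoms; solveb.
Qed.

(** The whole component of [E] outside the cycle meets it in [p] and [q] only, so these two nodes
    would be a proper 2-cutset. *)
Lemma no_cross a b c d P1 P2 P3 P4 p q E :
  k4 a b c d P1 P2 P3 P4 -> lonely a b c d P1 P2 P3 P4 ->
  cross a b c d P1 P2 P3 P4 p q E -> False.
Proof.
move=> k lo cr; set B := body a b c d P1 P2 P3 P4.
have [[aB bB _ _] P1B _ P3B _] := body_sub a b c d P1 P2 P3 P4; rewrite -/B in aB bB P1B P3B.
have pB := subsetP P1B _ (cr_p cr); have qB := subsetP P3B _ (cr_q cr).
have [Ep Eq] := andP (cr_t cr); have /touchP[e [_ [eE _ _]]] := Ep.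
have EB : E \subset ~: B by rewrite subsets_disjoint setCK -out4_body; case: cr.
have eB := subsetP EB e eE; set D := comp (~: B) e.
have ED : E \subset D := conn_comp (cr_conn cr) EB eE (comp_refl _ _).
have oD : out4 a b c d P1 P2 P3 P4 D.
  by rewrite out4_body -/B -[B]setCK -subsets_disjoint; exact: comp_sub.
have oB := cross_only k lo cr (comp_conn eB) oD ED.
have Dp : touch D [set p] by apply: touchS Ep.
have Dq : touch D [set q] by apply: touchS Eq.
have DB u : u \in D -> u \notin B by apply: disjointN; rewrite -out4_body.
case/and5P: (k4_dis k) => _ d13 _ _ _.
have pq : p != q by apply: contraTneq (cr_q cr) => <-; rewrite (disjointFr d13 (cr_p cr)).
have [qp qpn] : adj p q = false /\ True.
  split=> //; case/and5P: (k4_tp k) => _ /touchPn H _ _ _; apply: H; [exact: cr_p cr | exact: cr_q cr].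
have pD : p \notin D by apply: contraTN pB => /DB.
have qD : q \notin D by apply: contraTN qB => /DB.
apply: (two_attach cG pq _ _ _ pD qD _ Dp Dq).
- by rewrite qp.
- exact: deg_rim k (cr_p cr) oD Dp.
- by apply: deg_rim (k4_rot (k4_rot k)) (cr_q cr) _ Dq; do 2 apply: out4_rot.
- move=> u w uD wD uw; have wB : w \in B.
    by apply: contraNT wD => wB; apply: (comp_closed eB uD _ uw); rewrite in_setC.
  have : w \in [:: p; q] by apply: oB => //; apply/touchP; exists u, w; rewrite inE.
  by rewrite !inE => /orP[]/eqP->; [left | right].
- by move=> u uD up uq; move: pq; rewrite (lo _ _ _ (DB u uD) pB qB up uq) eqxx.
have ab : a != b by case/andP: (k4_ne k).
apply: (@leq_size_card _ [:: a; b]); first by rewrite /= inE ab.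
case/and4P: (k4_in1 k) => ap bp _ _; case/and4P: (k4_in3 k) => aq bq _ _.
have nm z S s : z \notin S -> s \in S -> (z == s) = false.
  by move=> zS sS; apply: contraNF zS => /eqP->.
have [aB' bB'] : a \in B /\ b \in B by split; [apply: (subsetP aB) | apply: (subsetP bB)]; rewrite inE.
have [aD bD] : a \notin D /\ b \notin D by split; [apply: contraTN aB' | apply: contraTN bB'] => /DB.
move=> w; rewrite !in_cons in_nil orbF => /orP[]/eqP->; rewrite in_setC in_setU in_set2 !negb_or.
  by rewrite aD (nm _ _ _ ap (cr_p cr)) (nm _ _ _ aq (cr_q cr)).
by rewrite bD (nm _ _ _ bp (cr_p cr)) (nm _ _ _ bq (cr_q cr)).
Qed.

(** In a minimal link only one node meets a given rim, and being lonely it sees a single node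
    there. *)
Lemma link_cross a b c d P1 P2 P3 P4 E : k4 a b c d P1 P2 P3 P4 -> lonely a b c d P1 P2 P3 P4 ->
  out4 a b c d P1 P2 P3 P4 E -> minlink P1 P3 E ->
  [&& ~~ touch E [set a], ~~ touch E [set b], ~~ touch E [set c], ~~ touch E [set d],
      ~~ touch E P2 & ~~ touch E P4] ->
  exists p q, cross a b c d P1 P2 P3 P4 p q E.
Proof.
move=> k lo oE mE nE; have /and3P[cE E1 E3] := minlink_links mE.
have [_ P1B _ P3B _] := body_sub a b c d P1 P2 P3 P4.
have uni P Q : P \subset body a b c d P1 P2 P3 P4 -> minlink P Q E -> touch E P ->
    exists2 p, p \in P & touch E [set p] /\ ~~ touch E (P :\ p).
  move=> PB m /touchP[u [p [uE pP up]]]; exists p => //; split.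
    by apply/touchP; exists u, p; rewrite inE.
  have [A1 [A2 s]] := split_minlink m uE.
  have A10 : A1 = set0 by apply/eqP; rewrite -(split_uX s); apply/touch1P; exists p.
  rewrite (split_eq s) A10 set0U touchUl negb_or; apply/andP; split; last first.
    by rewrite (ntouchS (subxx _) (subD1set _ _) (split_X2 s)).
  apply/touchPn => u' p' /set1P->; rewrite !inE => /andP[pp p'P]; apply: contraNF pp => up'.
  have uB : u \notin body a b c d P1 P2 P3 P4 by apply: disjointN uE; rewrite -out4_body.
  by rewrite (lo _ _ _ uB (subsetP PB _ p'P) (subsetP PB _ pP) up' up).
have [p pP [Ep nEp]] := uni _ _ P1B mE E1.
have [q qP [Eq nEq]] := uni _ _ P3B (minlinkC mE) E3.
exists p, q; split => //; first by rewrite Ep.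
case/and5P: nE => -> -> -> -> /andP[-> ->]; by rewrite nEp nEq.
Qed.

(** [k4_attached] leaves only connections between opposite rims, and [no_cross] removes those. *)
Lemma comp_compatible a b c d P1 P2 P3 P4 D i j : k4 a b c d P1 P2 P3 P4 ->
  lonely a b c d P1 P2 P3 P4 -> conn D -> out4 a b c d P1 P2 P3 P4 D ->
  i \in k4_nodes -> j \in k4_nodes -> i != j ->
  touch D (k4_phi a b c d P1 P2 P3 P4 i) -> touch D (k4_phi a b c d P1 P2 P3 P4 j) ->
  compatible k4_ok i j.
Proof.
move=> k lo cD oD iI jI ij ti tj; apply: contraT => nc.
have [m [n [E [mn mE sE HE]]]] := k4_attached cG k lo cD oD iI jI ij nc ti tj.
have oE : out4 a b c d P1 P2 P3 P4 E by move: oD; rewrite !out4_body; exact: disjointWl sE.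
case: mn => -[? ?]; subst m n.
  have [|p [q cr]] := link_cross k lo oE mE; last by case: (no_cross k lo cr).
  by rewrite (HE 0) // (HE 1) // (HE 2) // (HE 3) // (HE 5) // (HE 7).
have [|p [q cr]] := link_cross (k4_rot k) (lonely_rot lo) (out4_rot oE) mE; last first.
  by case: (no_cross (k4_rot k) (lonely_rot lo) cr).
by rewrite (HE 0) // (HE 1) // (HE 2) // (HE 3) // (HE 4) // (HE 6).
Qed.

End Lonely.

(** * The lonely cycle is the whole graph *)

Section LonelyCase.
Variable G : sgraph.
Hypothesis cG : core G.
Implicit Types (A B C D E K L M S T U V X Y Z P : {set G}) (a b c d p q r x y z u v w s t : G).

Lemma comp_out a b c d P1 P2 P3 P4 u : u \notin body a b c d P1 P2 P3 P4 ->
  out4 a b c d P1 P2 P3 P4 (comp (~: body a b c d P1 P2 P3 P4) u).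
Proof.
move=> uB; rewrite out4_body; have uB' : u \in ~: body a b c d P1 P2 P3 P4 by rewrite in_setC.
by have := comp_sub uB'; rewrite subsets_disjoint setCK.
Qed.

(** [X] collects [P1] and all outside components meeting it. By compatibility these meet nothing of
    the cycle beyond [P1], [a] and [b], so [a] and [b] would be a proper 2-cutset if [X] had two
    nodes. *)
Lemma rim_single a b c d P1 P2 P3 P4 :
  k4 a b c d P1 P2 P3 P4 -> lonely a b c d P1 P2 P3 P4 ->
  (exists z, P1 = [set z]) /\
  forall u, u \notin body a b c d P1 P2 P3 P4 -> touch (comp (~: body a b c d P1 P2 P3 P4) u) P1 = false.
Proof.
set B := body a b c d P1 P2 P3 P4; move=> k lo.
have [[aB bB cB dB] P1B _ _ _] := body_sub a b c d P1 P2 P3 P4; rewrite -/B in aB bB cB dB P1B.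
rewrite !sub1set in aB bB cB dB.
pose X := P1 :|: [set z in ~: B | touch (comp (~: B) z) P1].
have ab : a != b by case/andP: (k4_ne k).
have nab : ~~ adj a b by case/and5P: (k4_adj k).
have inX z : z \in B -> z \notin P1 -> z \notin X by move=> zB zP; rewrite in_setU (negbTE zP) inE in_setC zB.
have [aX bX cX dX] : [/\ a \notin X, b \notin X, c \notin X & d \notin X].
  by case/and4P: (k4_in1 k) => *; split; apply: inX.
have tX : touch X (~: (X :|: [set a; b])) = false.
  apply/negbTE/touchPn => u w uX; rewrite in_setC in_setU in_set2 => /norP[wX /norP[wa wb]].
  apply/negP => uw; move: uX; rewrite in_setU => /orP[uP|].
    have wB : w \in B.
      apply: contraNT wX => wB; have wB' : w \in ~: B by rewrite in_setC.
      rewrite in_setU in_set wB' /=; apply/orP; right.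
      by apply/touchP; exists w, u; rewrite comp_refl adj_sym.
    have wP : w \notin P1 by apply: contra wX; rewrite in_setU => ->.
    have tP x : x \in P1 -> touch P1 [set w] by move=> xP; apply/touchP; exists u, w; rewrite inE.
    move: wB; rewrite /B /body !in_setU !in_set1 (negbTE wa) (negbTE wb) (negbTE wP) orbF /=.
    have tw S : w \in S -> touch P1 S by move=> wS; apply/touchP; exists u, w.
    case/and5P: (k4_tc k) => n1 n2 _ _ _; case/and5P: (k4_tp k) => m1 m2 m3 _ _.
    case/orP => [/orP[/orP[/orP[/eqP E|/eqP E]|/tw H]|/tw H]|/tw H].
    - by move: n1; rewrite -E (tP u).
    - by move: n2; rewrite -E (tP u).
    - by rewrite H in m1.
    - by rewrite H in m2.
    - by rewrite H in m3.
  rewrite inE => /andP[uB Cu]; set C := comp (~: B) u in Cu.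
  have oC : out4 a b c d P1 P2 P3 P4 C by apply: comp_out; rewrite -in_setC.
  have [wB|wB] := boolP (w \in B); last first.
    have wB' : w \in ~: B by rewrite in_setC.
    have wC : w \in C := comp_closed uB (comp_refl _ _) wB' uw.
    by case/negP: wX; rewrite in_setU in_set wB' -(comp_eq uB wC) Cu orbT.
  have [j jI wj] := bodyP _ _ _ _ _ _ _ _ _ wB.
  have tj : touch C (k4_phi a b c d P1 P2 P3 P4 j) by apply/touchP; exists u, w; rewrite comp_refl.
  have [j4|j4] := eqVneq 4 j.
    by move: wj; rewrite -j4 => wP; case/negP: wX; rewrite in_setU wP.
  have := comp_compatible cG k lo (comp_conn uB) oC (isT : 4 \in k4_nodes) jI j4 Cu tj.
  move: jI wj; rewrite !inE => /or4P[/eqP->|/eqP->|/eqP->|] //=.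
  - by rewrite inE (negbTE wa).
  - by rewrite inE (negbTE wb).
  by move=> /or4P[/eqP->|/eqP->|/eqP->|/orP[]/eqP->].
have cd : c != d by case/and5P: (k4_ne k) => _ _ _ _ /andP[].
have X1 : #|X| <= 1.
  rewrite leqNgt; apply/negP => X2; apply: (core_no2 cG ab nab _ _ aX bX tX X2).
  - exact: deg_corner k.
  - exact: deg_corner (k4_rot k).
  apply: (@leq_size_card _ [:: c; d]); first by rewrite /= inE cd.
  case/and5P: (k4_ne k) => _ ac ad bc /andP[bd _].
  move=> z; rewrite !in_cons in_nil orbF => /orP[]/eqP->; rewrite in_setC in_setU in_set2 !negb_or.
    by rewrite cX ![c == _]eq_sym ac bc.
  by rewrite dX ![d == _]eq_sym ad bd.
have P0 : P1 != set0 by case/and4P: (k4_links k) => /and4P[].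
have sP : P1 \subset X by apply: subsetUl.
have [z Pz] := card1_set1 P0 (leq_trans (subset_leq_card sP) X1).
split; first by exists z.
move=> u uB; apply: contraTF X1 => Cu; rewrite -ltnNge.
have uX : u \in X by rewrite in_setU in_set in_setC uB Cu orbT.
have zP : z \in P1 by rewrite Pz inE.
apply: (@leq_size_card _ [:: z; u]).
  by rewrite /= inE andbT; apply: contraNneq uB => <-; apply: (subsetP P1B).
by move=> w; rewrite !inE => /orP[]/eqP->; [rewrite zP | move: uX; rewrite !inE].
Qed.

(** Compatible corners are consecutive, so [D] would be attached at [a] and at most one of [b], [d],
    which gives a 2-cutset or a cutnode. *)
Lemma no_corner a b c d P1 P2 P3 P4 D :
  k4 a b c d P1 P2 P3 P4 -> lonely a b c d P1 P2 P3 P4 ->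
  conn D -> out4 a b c d P1 P2 P3 P4 D -> D != set0 ->
  (forall u w, u \in D -> w \notin D -> adj u w -> w \in [:: a; b; c; d]) ->
  touch D [set a] = false.
Proof.
move=> k lo cD oD D0 exit; apply/negbTE/negP => Da.
have oDB : [disjoint D & body a b c d P1 P2 P3 P4] by rewrite -out4_body.
have [[aB bB cB dB] _ _ _ _] := body_sub a b c d P1 P2 P3 P4; rewrite !sub1set in aB bB cB dB.
case/and5P: (oD) => /and4P[aD bD cD' dD] _ _ _ _.
case/and5P: (k4_ne k) => ab ac ad bc /andP[bd cd].
case/and5P: (k4_adj k) => _ _ nab _ /andP[_ nda].
have nc : touch D [set c] = false.
  by apply/negbTE/negP => Dc; have := comp_compatible cG k lo cD oD (isT : 0 \in k4_nodes) (isT : 2 \in k4_nodes) isT Da Dc.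
have nbd : ~~ (touch D [set b] && touch D [set d]).
  apply/negP => /andP[Db Dd].
  by have := comp_compatible cG k lo cD oD (isT : 1 \in k4_nodes) (isT : 3 \in k4_nodes) isT Db Dd.
have tD u w : u \in D -> adj u w -> touch D [set w].
  by move=> uD uw; apply/touchP; exists u, w; rewrite inE.
have two x : touch D [set x] -> x \in [:: b; d] -> False.
  move=> Dx xbd; have xbd' : (x == b) || (x == d) by move: xbd; rewrite !inE.
  have xB : x \in body a b c d P1 P2 P3 P4.
    by case/orP: xbd' => /eqP->.
  have xa : a != x by case/orP: xbd' => /eqP->.
  have xD : x \notin D by case/orP: xbd' => /eqP->.
  apply: (two_attach cG xa _ (deg_corner k) _ aD xD _ Da Dx).
  - by move: xbd; rewrite !inE => /orP[]/eqP->; rewrite // adj_sym.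
  - move: xbd; rewrite !inE => /orP[]/eqP->.
      exact: deg_corner (k4_rot k).
    exact: deg_corner (k4_rot (k4_rot (k4_rot k))).
  - move=> u w uD wD uw; have tw := tD u w uD uw.
    have := exit u w uD wD uw; rewrite !inE => /or4P[]/eqP E; subst w; first by left.
    + right; move: xbd; rewrite !inE => /orP[]/eqP // E; rewrite E in Dx.
      by rewrite tw Dx in nbd.
    + by rewrite nc in tw.
    + right; move: xbd; rewrite !inE => /orP[]/eqP // E; rewrite E in Dx.
      by rewrite tw Dx in nbd.
  - move=> u uD ua ux; move: xa; rewrite (lo _ _ _ (disjointN oDB uD) aB xB ua ux) eqxx //.
  move: xbd; rewrite !inE => xbd.
  have [y [yD ya yx yc]] : exists y, [/\ y \notin D, y != a, y != x & y != c].
    case/orP: xbd => /eqP->; [exists d | exists b]; by split => //; rewrite eq_sym.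
  apply: (@leq_size_card _ [:: c; y]); first by rewrite /= inE eq_sym yc.
  have cx : c != x by case/orP: xbd => /eqP->; rewrite // eq_sym.
  move=> z; rewrite !in_cons in_nil orbF => /orP[]/eqP->; rewrite in_setC in_setU in_set2 !negb_or.
    by rewrite cD' eq_sym ac cx.
  by rewrite yD ya yx.
have [Db|Db] := boolP (touch D [set b]); first by apply: (two b); rewrite ?inE ?eqxx.
have [Dd|Dd] := boolP (touch D [set d]); first by apply: (two d); rewrite ?inE ?eqxx ?orbT.
move/eqP: D0; apply; apply: (exit1 cG aD cD'); first by rewrite eq_sym.
move=> u w uD wD uw; have tw := tD u w uD uw.
have := exit u w uD wD uw; rewrite !inE => /or4P[]/eqP E; subst w => //.
- by rewrite tw in Db.
- by rewrite nc in tw.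
- by rewrite tw in Dd.
Qed.

(** Every rim is one node and nothing lies outside, so eight nodes remain: the Petersen graph
    without its adjacent nodes 6 and 7. *)
Lemma lonely_petersen a b c d P1 P2 P3 P4 :
  k4 a b c d P1 P2 P3 P4 -> lonely a b c d P1 P2 P3 P4 -> induced_subgraph_of G petersen.
Proof.
move=> k lo; set B := body a b c d P1 P2 P3 P4.
have k1 := k4_rot k; have k2 := k4_rot k1; have k3 := k4_rot k2.
have lo1 := lonely_rot lo; have lo2 := lonely_rot lo1; have lo3 := lonely_rot lo2.
have [[p1 E1] n1] := rim_single k lo; have [[p2 E2] n2] := rim_single k1 lo1.
have [[p3 E3] n3] := rim_single k2 lo2; have [[p4 E4] n4] := rim_single k3 lo3.
have bE1 : body b c d a P2 P3 P4 P1 = B by exact: body_rot.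
have bE2 : body c d a b P3 P4 P1 P2 = B by rewrite (body_rot b c d a).
have bE3 : body d a b c P4 P1 P2 P3 = B by rewrite (body_rot c d a b).
rewrite bE1 in n2; rewrite bE2 in n3; rewrite bE3 in n4.
have all u : u \in B.
  apply: contraT => uB; have oD := comp_out uB; set D := comp _ u in oD.
  have uB' : u \in ~: B by rewrite in_setC.
  have cD : conn D := comp_conn uB'; have uD : u \in D := comp_refl _ _.
  have D0 : D != set0 by apply/set0Pn; exists u.
  have exit v w : v \in D -> w \notin D -> adj v w -> w \in [:: a; b; c; d].
    move=> vD wD vw; have wB : w \in B.
      by apply: contraNT wD => wB; apply: (comp_closed uB' vD _ vw); rewrite in_setC.
    have tD S : w \in S -> touch D S by move=> wS; apply/touchP; exists v, w.
    move: wB; rewrite /B /body !in_setU !in_set1 !in_cons in_nil orbF -!orbA.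
    case/or4P => [->|->|->|/or4P[->|/tD|/tD|/orP[/tD|/tD]]]; rewrite ?orbT //.
    - by rewrite (n1 u).
    - by rewrite (n2 u).
    - by rewrite (n3 u).
    - by rewrite (n4 u).
  have ta : touch D [set a] = false := no_corner k lo cD oD D0 exit.
  have tb : touch D [set b] = false.
    apply: (no_corner k1 lo1 cD (out4_rot oD) D0) => v w vD wD vw.
    by have := exit v w vD wD vw; rewrite !inE => /or4P[]->; rewrite ?orbT.
  have tc : touch D [set c] = false.
    apply: (no_corner k2 lo2 cD (out4_rot (out4_rot oD)) D0) => v w vD wD vw.
    by have := exit v w vD wD vw; rewrite !inE => /or4P[]->; rewrite ?orbT.
  have td : touch D [set d] = false.
    apply: (no_corner k3 lo3 cD (out4_rot (out4_rot (out4_rot oD))) D0) => v w vD wD vw.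
    by have := exit v w vD wD vw; rewrite !inE => /or4P[]->; rewrite ?orbT.
  case/and5P: (oD) => /and4P[aD bD cD' dD] _ _ _ _.
  move/eqP: D0; case; apply: (exit1 cG aD cD').
    by rewrite eq_sym; case/and3P: (k4_ne k).
  move=> v w vD wD vw; have := exit v w vD wD vw.
  have tw : touch D [set w] by apply/touchP; exists v, w; rewrite inE.
  by rewrite !inE => /or4P[]/eqP E; subst w; rewrite ?ta ?tb ?tc ?td in tw.
pose nodes := [:: 0; 3; 1; 9; 4; 2; 8; 5].
pose f i := nth a [:: a; b; c; d; p1; p2; p3; p4] (index i nodes).
apply: (@embed_induced G petersen petersen_num petersen_adj 10 nodes f petersen_numE
  petersen_num_inj petersen_num_onto) => //.
  have k' := k4_links k; case: k => *; clear n1 n2 n3 n4 k1 k2 k3 all lo lo1 lo2 lo3; subst P1 P2 P3 P4; atoms.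
  split.
    move=> i j iN jN ij; apply/negbT; move: iN jN ij; rewrite /nodes !in_cons !in_nil !orbF.
    by do ![case/orP] => /eqP->; do ![case/orP] => /eqP-> //= _; rewrite /f /=; solveb.
  move=> i j; rewrite /nodes !in_cons !in_nil !orbF.
  by do ![case/orP] => /eqP->; do ![case/orP] => /eqP->; rewrite /f /=; evalb.
move=> v; have := all v; rewrite /B /body E1 E2 E3 E4 !in_setU !in_set1 -!orbA.
case/or4P => [/eqP->|/eqP->|/eqP->|/or4P[/eqP->|/eqP->|/eqP->|/orP[/eqP->|/eqP->]]].
- by exists 0.
- by exists 3.
- by exists 1.
- by exists 9.
- by exists 4.
- by exists 2.
- by exists 8.
- by exists 5.
Qed.

End LonelyCase.

(** * Nodes seeing two opposite rims *)

Section NotLonely.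
Variable G : sgraph.
Hypothesis cG : core G.
Implicit Types (A B C D E K L M S T U V X Y Z P : {set G}) (a b c d p q r x y z u v w s t : G).

Let gG := core_good cG.
Let c3 := core_c3 cG.
Let c4 := core_c4 cG.

Lemma touch_vtx u z S : z \in S -> adj u z -> touch [set u] S.
Proof. by move=> zS uz; apply/touch1P; exists z. Qed.

Lemma half_lonely a b c d P1 P2 P3 P4 u z z' : k4m a b c d P1 P2 P3 P4 ->
  out4 a b c d P1 P2 P3 P4 [set u] -> ~~ (touch [set u] P1 && touch [set u] P3) ->
  z \in a |: P1 -> z' \in body a b c d P1 P2 P3 P4 -> adj u z -> adj u z' -> z = z'.
Proof.
move=> k o n13; rewrite in_setU1 /body !in_setU !in_set1 => zz zz' uz uz'.
have tu S : z' \in S -> touch [set u] S by move=> zS; apply: touch_vtx zS uz'.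
case/orP: zz => [/eqP E|zP]; first subst z.
  have := vtx_a cG k o uz; case/and5P => nb nc nd n1 /and3P[n2 n3 n4].
  move: zz'; rewrite -!orbA => /or4P[/eqP->//|/eqP E|/eqP E|/or4P[/eqP E|/tu E|/tu E|/orP[/tu E|/tu E]]].
  - by rewrite -E uz' in nb.
  - by rewrite -E uz' in nc.
  - by rewrite -E uz' in nd.
  - by rewrite E in n1.
  - by rewrite E in n2.
  - by rewrite E in n3.
  - by rewrite E in n4.
have t1 : touch [set u] P1 := touch_vtx zP uz.
have := vtx_P1 cG k o t1; case/and5P => na nb nc nd /andP[n2 n4]; rewrite t1 /= in n13.
move: zz'; rewrite -!orbA => /or4P[/eqP E|/eqP E|/eqP E|/or4P[/eqP E|z'P|/tu E|/orP[/tu E|/tu E]]].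
- by rewrite -E uz' in na.
- by rewrite -E uz' in nb.
- by rewrite -E uz' in nc.
- by rewrite -E uz' in nd.
- by have := vtx_P1P1 cG k o zP z'P uz uz'.
- by rewrite E in n2.
- by rewrite E in n13.
- by rewrite E in n4.
Qed.

Lemma rim_lonely a b c d P1 P2 P3 P4 : k4m a b c d P1 P2 P3 P4 ->
  (forall u, out4 a b c d P1 P2 P3 P4 [set u] ->
    ~~ (touch [set u] P1 && touch [set u] P3) && ~~ (touch [set u] P2 && touch [set u] P4)) ->
  lonely a b c d P1 P2 P3 P4.
Proof.
move=> k H u z z' uB zB z'B uz uz'.
have o : out4 a b c d P1 P2 P3 P4 [set u] by rewrite out4_body disj1l.
have /andP[n13 n24] := H u o.
have k1 := k4m_rot k; have k2 := k4m_rot k1; have k3 := k4m_rot k2.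
have o1 := out4_rot o; have o2 := out4_rot o1; have o3 := out4_rot o2.
have bE1 := body_rot a b c d P1 P2 P3 P4.
have bE2 := body_rot b c d a P2 P3 P4 P1; rewrite bE1 in bE2.
have bE3 := body_rot c d a b P3 P4 P1 P2; rewrite bE2 in bE3.
have n31 : ~~ (touch [set u] P3 && touch [set u] P1) by rewrite andbC.
have n42 : ~~ (touch [set u] P4 && touch [set u] P2) by rewrite andbC.
have := zB; rewrite /body !in_setU !in_set1 -!orbA => zz.
have : [|| z \in a |: P1, z \in b |: P2, z \in c |: P3 | z \in d |: P4].
  by rewrite !in_setU1; case/or4P: zz => [->|->|->|/or4P[->|->|->|/orP[->|->]]]; rewrite ?orbT.
case/or4P => zi.
- exact: half_lonely k o n13 zi z'B uz uz'.
- by apply: (half_lonely k1 o1 n24 zi _ uz uz'); rewrite bE1.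
- by apply: (half_lonely k2 o2 n31 zi _ uz uz'); rewrite bE2.
- by apply: (half_lonely k3 o3 n42 zi _ uz uz'); rewrite bE3.
Qed.

Lemma vtx_cross a b c d P1 P2 P3 P4 v p q : k4m a b c d P1 P2 P3 P4 ->
  out4 a b c d P1 P2 P3 P4 [set v] -> p \in P1 -> q \in P3 -> adj v p -> adj v q ->
  cross a b c d P1 P2 P3 P4 p q [set v].
Proof.
move=> k o pP qP vp vq; have o2 := out4_rot (out4_rot o); have k2 := k4m_rot (k4m_rot k).
have /and5P[na nb nc nd /andP[n2 n4]] := vtx_P1 cG k o (touch_vtx pP vp).
split; rewrite ?conn1 ?touch1 ?vp ?na ?nb ?nc ?nd ?n2 ?n4 //=; apply/andP; split.
  apply/touchPn => u z /set1P->; rewrite !inE => /andP[zp zP]; apply: contraNF zp => vz.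
  by rewrite (vtx_P1P1 cG k o zP pP vz vp).
apply/touchPn => u z /set1P->; rewrite !inE => /andP[zq zP]; apply: contraNF zq => vz.
by rewrite (vtx_P1P1 cG k2 o2 zP qP vz vq).
Qed.

(** Two detours through [v]: one with chord [ac] leaves out [C2], one with chord [ap] leaves out
    [P2]. Each adds only the node [v], so each set left out has at most one node. *)
Lemma alpha_sizes a b c d P1 P2 P3 P4 v p q C1 C2 E1 E2 : k4m a b c d P1 P2 P3 P4 ->
  cross a b c d P1 P2 P3 P4 p q [set v] -> adj p a -> adj q d ->
  split_at [set a] [set b] P1 p C1 C2 -> split_at [set c] [set d] P3 q E1 E2 ->
  #|C2| <= 1 /\ #|P2| <= 1.
Proof.
case=> k m cr pa qd sp sq; have [cP cQ] := (split_card sp, split_card sq).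
have C10 : C1 = set0 by apply/eqP; rewrite -(split_uX sp) touch1.
have E20 : E2 = set0 by apply/eqP; rewrite -(split_uY sq) touch1.
have th1 : theta a c (P4 :|: [set d] :|: [set b] :|: P2) ([set p] :|: [set v] :|: [set q] :|: E1).
  case: cr => _ oD pP qP tD nD; rewrite (split_D1 sp) (split_D1 sq) in nD.
  clear cP cQ m; k4open k; destruct sp; subst P1; destruct sq; subst P3; subst C1 E2; atoms; thetab.
have th2 : theta a p ([set c] :|: E1 :|: [set q] :|: [set v]) (P4 :|: [set d] :|: [set b] :|: C2).
  case: cr => _ oD pP qP tD nD; rewrite (split_D1 sp) (split_D1 sq) in nD.
  clear cP cQ m; k4open k; destruct sp; subst P1; destruct sq; subst P3; subst C1 E2; atoms; thetab.
have := m _ _ _ _ th1; have := m _ _ _ _ th2; rewrite cP cQ C10 E20 !cards0 => l2 l1.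
split; [clear l2; card_lia l1 | clear l1; card_lia l2].
Qed.

End NotLonely.

(** * The Petersen and Heawood patterns around such a node *)

Section Alpha.
Variable G : sgraph.
Hypothesis cG : core G.
Implicit Types (A B C D E K L M S T U V X Y Z P : {set G}) (a b c d p q r x y z u v w s t : G).

Let gG := core_good cG.
Let c3 := core_c3 cG.
Let c4 := core_c4 cG.

Lemma model_embed (I : seq nat) (e : rel nat) (f : nat -> G) :
  model I e (fun i => [set f i]) -> all (fun i => ~~ e i i) I -> embed e I f.
Proof.
move=> m irr; split=> i j iI jI.
  by move=> /(model_dis m iI jI); rewrite disj1l inE.
have [->|ij] := eqVneq i j; first by rewrite adj_irr (negbTE (allP irr j jI)).
by rewrite -(model_touch m iI jI ij) touch1.
Qed.

(** The node [v] takes the place of node 7, so that only node 6 of the Petersen graph is missing. *)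
Lemma alpha_petersen a b c d p q r s v :
  k4 a b c d [set p] [set r] [set q] [set s] ->
  cross a b c d [set p] [set r] [set q] [set s] p q [set v] -> induced_subgraph_of G petersen.
Proof.
move=> k cr; pose f i := nth a [:: a; b; c; d; p; q; r; s; v] (index i pet9_nodes).
apply: (pet9_induced cG (f := f)); case: cr => _ oD _ _ tD nD; k4open k; split.
  move=> i j iN jN ij; apply/negbT; move: iN jN ij; rewrite /pet9_nodes !in_cons !in_nil !orbF.
  by do ![case/orP] => /eqP->; do ![case/orP] => /eqP-> //= _; rewrite /f /=; solveb.
move=> i j; rewrite /pet9_nodes !in_cons !in_nil !orbF.
by do ![case/orP] => /eqP->; do ![case/orP] => /eqP->; rewrite /f /=; evalb.
Qed.

(* The Heawood graph without the nodes 7, 11 and 12 (numbered as in [heawood_adj]),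
   in which a path [S] replaces the node 13. *)
Record hea0 a b c d p p' q q' r v S : Prop := Hea0 {
  h_k : k4m a b c d ([set p] :|: [set p']) [set r] ([set q'] :|: [set q]) S;
  h_adj : [&& adj p a, adj p p', adj p' b, adj q d, adj q q' & adj q' c];
  h_nadj : [&& ~~ adj p b, ~~ adj p' a, ~~ adj q c & ~~ adj q' d];
  h_ne : (p != p') && (q != q');
  h_cr : cross a b c d ([set p] :|: [set p']) [set r] ([set q'] :|: [set q]) S p q [set v]
}.

Definition hea0_phi a b c d p p' q q' r v S : nat -> {set G} :=
  nth set0 [:: [set a]; [set c]; [set r]; [set b]; [set d]; [set q]; [set q']; set0;
               [set p']; [set p]; [set v]; set0; set0; S].

Lemma hea0_model a b c d p p' q q' r v S : hea0 a b c d p p' q q' r v S ->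
  model hea11_nodes heawood_adj (hea0_phi a b c d p p' q q' r v S).
Proof.
case=> [[k _]] A N E [_ oD _ _ tD nD].
have nv : touch [set v] [set p'] = false /\ touch [set v] [set q'] = false.
  have [pp qq] := andP E; have [_ n1] := andP nD.
  have [_ /and3P[_ _ /andP[n2 n3]]] := andP nD.
  split; apply/negbTE; [apply: contra n2 | apply: contra n3]; apply: touchS => //;
    by rewrite sub1set !inE eqxx ?orbT ?andbT eq_sym.
have {}nD : touch [set v] [set a] || touch [set v] [set b] || touch [set v] [set c] ||
   touch [set v] [set d] || touch [set v] [set r] || touch [set v] S = false.
  case/and5P: nD => /and4P[/negbTE Ea /negbTE Eb /negbTE Ec /negbTE Ed] /negbTE Er /negbTE ES _ _.
  by rewrite Ea Eb Ec Ed Er ES.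
k4open k; split.
- move=> i; rewrite /hea11_nodes !in_cons !in_nil !orbF.
  by do ![case/orP] => /eqP->; rewrite /hea0_phi /= ?conn1.
- move=> i j; rewrite /hea11_nodes !in_cons !in_nil !orbF.
  by do ![case/orP] => /eqP->; do ![case/orP] => /eqP->; rewrite /hea0_phi //= => *; solveb.
- move=> i j; rewrite /hea11_nodes !in_cons !in_nil !orbF.
  by do ![case/orP] => /eqP->; do ![case/orP] => /eqP->; rewrite /hea0_phi //= => *; solveb.
Qed.

Lemma hea0_heawood a b c d p p' q q' r v s : hea0 a b c d p p' q q' r v [set s] ->
  induced_subgraph_of G heawood.
Proof.
move=> h; pose f := nth a [:: a; c; r; b; d; q; q'; a; p'; p; v; a; a; s].
apply: (hea11_induced cG (f := f)); apply: model_embed; last by [].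
have [m1 m2 m3] := hea0_model h; have phiE : {in hea11_nodes, forall i,
    [set f i] = hea0_phi a b c d p p' q q' r v [set s] i}.
  by move=> i; rewrite /hea11_nodes !in_cons !in_nil !orbF; do ![case/orP] => /eqP->.
split.
- by move=> i _; apply: conn1.
- by move=> i j iN jN; rewrite !phiE //; apply: m2.
- by move=> i j iN jN; rewrite !phiE //; apply: m3.
Qed.

(** [C2] and [E1] have at most one node each and are empty together by [cross_type]. If they are
    empty, the reflected bounds make [P4] a single node as well; otherwise [P1] and [P3] have two
    nodes each and the length of [P4] remains open. *)
Lemma cross_alpha a b c d P1 P2 P3 P4 p q v : k4m a b c d P1 P2 P3 P4 ->
  cross a b c d P1 P2 P3 P4 p q [set v] -> adj p a -> adj q d ->
  induced_subgraph_of G petersen \/ exists p' q' r, hea0 a b c d p p' q q' r v P4.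
Proof.
move=> k cr pa qd; have [k0 m] := k.
have [C1 [C2 sp]] := split_minlink (k4_m1 k0) (cr_p cr).
have [E1 [E2 sq]] := split_minlink (k4_m3 k0) (cr_q cr).
have C10 : C1 = set0 by apply/eqP; rewrite -(split_uX sp) touch1.
have E20 : E2 = set0 by apply/eqP; rewrite -(split_uY sq) touch1.
have [lC lP2] := alpha_sizes k cr pa qd sp sq.
have k' := k4m_flip (k4m_rot (k4m_rot k)).
have cr' : cross d c b a P3 P2 P1 P4 q p [set v].
  exact: cross_flip (cross_rot2 cr).
have [lE _] := alpha_sizes k' cr' qd pa (split_atC sq) (split_atC sp).
have /and3P[_ _ pbqc] := cross_type cG k0 cr.
have /and4P[_ /and4P[_ _ _ P20] _ /and4P[_ _ _ P40]] := k4_links k0.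
have [r rE] := card1_set1 P20 lP2.
have C2E1 : (C2 == set0) = (E1 == set0).
  by rewrite -(split_uY sp) -(split_uX sq) !touch1; apply/eqP.
have [C20|C20] := eqVneq C2 set0.
  have E10 : E1 = set0 by apply/eqP; rewrite -C2E1 C20.
  have pb : adj p b by rewrite -touch1 (split_uY sp) C20.
  have qc : adj q c by rewrite -touch1 (split_uX sq) E10.
  have [_ lP4] := alpha_sizes (k4m_flip k) (cross_flip cr) pb qc (split_atC sp) (split_atC sq).
  have [s sE] := card1_set1 P40 lP4.
  left; have PE := split_eq sp; have QE := split_eq sq.
  rewrite C10 C20 set0U setU0 in PE; rewrite E10 E20 set0U setU0 in QE.
  by apply: (@alpha_petersen a b c d p q r s v); rewrite -PE -QE -rE -sE.
have [p' Cp] := card1_set1 C20 lC.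
have E10 : E1 != set0 by rewrite -C2E1.
have [q' Eq] := card1_set1 E10 lE.
right; exists p', q', r; have PE := split_eq sp; have QE := split_eq sq.
rewrite C10 Cp set0U in PE; rewrite Eq E20 setU0 in QE.
have cp : conn P1 by case/and4P: (k4_links k0) => /andP[].
split; rewrite -?PE -?QE -?rE //.
- have := split_X1 sq; have := split_Y2 sp; have := split_u2t sp; have := split_u1t sq.
  by rewrite Cp Eq !touch1 pa qd -!Cp -!Eq C20 E10 => -> -> -> ->.
- have := split_uY sp; have := split_X2 sp; have := split_Y1 sq; have := split_uX sq.
  by rewrite !touch1 Cp Eq !touch1 -Cp -Eq (negbTE C20) (negbTE E10) => -> -> -> ->.
by have := split_u2 sp; have := split_u1 sq; rewrite Cp Eq !inE => -> ->.
Qed.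

End Alpha.

(** * The remaining path of the Heawood pattern is a single node *)

Section Hea0.
Variable G : sgraph.
Hypothesis cG : core G.
Implicit Types (A B C D E K L M S T U V X Y Z P : {set G}) (a b c d p q r x y z u v w s t : G).

Let gG := core_good cG.
Let c3 := core_c3 cG.
Let c4 := core_c4 cG.

Definition hea0_single := [:: 0; 1; 2; 3; 4; 5; 6; 8; 9; 10].

Lemma hea0_is_single a b c d p p' q q' r v S :
  is_single (hea0_phi a b c d p p' q q' r v S) hea0_single.
Proof.
move=> i; rewrite /hea0_single !in_cons !in_nil !orbF.
by do ![case/orP] => /eqP->; eexists.
Qed.

(** The cycle [p' b r c a p v q q' w] has the chord [pp']. Its ten nodes are too few for a shortest
    cycle when [S] has two nodes. *)
Lemma hea0_no_pq a b c d p p' q q' r v S w : hea0 a b c d p p' q q' r v S -> 2 <= #|S| ->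
  w \notin [set v] -> out4 a b c d ([set p] :|: [set p']) [set r] ([set q'] :|: [set q]) S [set w] ->
  adj w p' -> adj w q' -> False.
Proof.
move=> h S2 wv oW wp wq; have [[k m] A N E [_ oD _ _ tD nD]] := h.
have th : theta p' p ([set b] :|: [set r] :|: [set c] :|: [set a])
    ([set w] :|: [set q'] :|: [set q] :|: [set v]).
  have [_ mD mT] := hea0_model h.
  have e1 : adj v p' = false by rewrite -touch1; apply: (mT 10 8).
  have e2 : adj v q' = false by rewrite -touch1; apply: (mT 10 6).
  clear m mD mT h; case/and5P: nD => nD1 nD2 nD3 _ _; k4open k; thetab.
have := m _ _ _ _ th => le.
have pp : #|[set p] :|: [set p']| = 2 by rewrite cards2; case/andP: E => ->.
have qq : #|[set q'] :|: [set q]| = 2 by rewrite cards2 eq_sym; case/andP: E => _ ->.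
move: le S2; rewrite pp qq cards1 => le S2.
have : #|S| <= 1 by move: le; move: #|S| => n; card_lia I.
by clear -S2; lia.
Qed.

(** The same count for the cycle [v p p' b d q q' c r w] with chord [vq]. *)
Lemma hea0_no_rv a b c d p p' q q' r v S w : hea0 a b c d p p' q q' r v S -> 2 <= #|S| ->
  w \notin [set v] -> out4 a b c d ([set p] :|: [set p']) [set r] ([set q'] :|: [set q]) S [set w] ->
  adj w r -> adj w v -> False.
Proof.
move=> h S2 wv oW wr wv'; have [[k m] A N E [_ oD _ _ tD nD]] := h.
have th : theta v q ([set p] :|: [set p'] :|: [set b] :|: [set d])
    ([set w] :|: [set r] :|: [set c] :|: [set q']).
  have [_ mD mT] := hea0_model h.
  have e1 : adj v p' = false by rewrite -touch1; apply: (mT 10 8).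
  have e2 : adj v q' = false by rewrite -touch1; apply: (mT 10 6).
  clear m mD mT h; case/and5P: nD => nD1 nD2 nD3 _ _; k4open k; thetab.
have := m _ _ _ _ th => le.
have pp : #|[set p] :|: [set p']| = 2 by rewrite cards2; case/andP: E => ->.
have qq : #|[set q'] :|: [set q]| = 2 by rewrite cards2 eq_sym; case/andP: E => _ ->.
move: le S2; rewrite pp qq cards1 => le S2.
have : #|S| <= 1 by move: le; move: #|S| => n; card_lia I.
by clear -S2; lia.
Qed.

(** Suppose [w] sees both [P1] and [P3]: the pair [p], [q] closes a square with [v], mixed pairs
    contradict [cross_type], and [p'], [q'] fall under [hea0_no_pq]. Seeing [r] and [S] would make
    [S] a single node. What is left concerns [v]: the pair [r], [v] is excluded by length, all
    others by certificates. *)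
Lemma hea0_vtx a b c d p p' q q' r v S w : hea0 a b c d p p' q q' r v S -> 2 <= #|S| ->
  w \notin [set v] -> out4 a b c d ([set p] :|: [set p']) [set r] ([set q'] :|: [set q]) S [set w] ->
  {in hea11_nodes &, forall i j, touch [set w] (hea0_phi a b c d p p' q q' r v S i) ->
     touch [set w] (hea0_phi a b c d p p' q q' r v S j) -> i = j}.
Proof.
set P1 := [set p] :|: [set p']; set P3 := [set q'] :|: [set q].
move=> h S2 wv oW; have [km A N E cr] := h; have [k m] := km.
case/and5P: (A) => pa pp' p'b qd /andP[qq' q'c].
case/and4P: (N) => npb np'a nqc nq'd.
have [vp vq] : adj v p /\ adj v q by case: cr => _ _ _ _ /andP[]; rewrite !touch1.
have pq : p != q.
  case/and5P: (k4_dis k) => _ d13 _ _ _; have pP3 := disjointFr d13 (cr_p cr).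
  by apply: contraFneq pP3 => ->; exact: cr_q cr.
have n13 : ~~ (touch [set w] P1 && touch [set w] P3).
  apply/negP => /andP[/touch1P[x xP wx] /touch1P[y yP wy]].
  have crw := vtx_cross cG km oW xP yP wx wy.
  have /and3P[_ /eqP e1 _] := cross_type cG k crw.
  move: xP yP; rewrite !inE => /orP[]/eqP Ex /orP[]/eqP Ey; subst x y.
  - by move: e1; rewrite pa (negbTE nq'd).
  - by apply: (c4 wx _ vq _ _ pq); rewrite 1?adj_sym //; apply: contraNneq wv => ->; rewrite inE.
  - exact: hea0_no_pq h S2 wv oW wx wy.
  - by move: e1; rewrite qd (negbTE np'a).
have n24 : ~~ (touch [set w] [set r] && touch [set w] S).
  apply/negP => /andP[/touch1P[x xP wx] /touch1P[y yP wy]].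
  have crw := vtx_cross cG (k4m_rot km) (out4_rot oW) xP yP wx wy.
  have /and3P[_ e1 e2] := cross_type cG (k4_rot k) crw.
  have [S1 [S3 ss]] := split_minlink (k4_m4 k) yP.
  have /and4P[_ /and4P[_ rb rc _] _ _] := k4_links k; rewrite touch1 in rb; rewrite touch1 in rc.
  move: xP wx e1 e2 => /set1P-> wr; rewrite rb rc => /eqP/esym ya /eqP/esym yd.
  have S10 : S1 = set0 by apply/eqP; rewrite -(split_uX ss) touch1.
  have S30 : S3 = set0 by apply/eqP; rewrite -(split_uY ss) touch1.
  by move: S2; rewrite (split_card ss) S10 S30 cards0.
have one := half_lonely cG.
have bE1 := body_rot a b c d P1 [set r] P3 S.
have bE2 := body_rot b c d a [set r] P3 S P1; rewrite bE1 in bE2.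
have bE3 := body_rot c d a b P3 S P1 [set r]; rewrite bE2 in bE3.
have lo z z' : z \in body a b c d P1 [set r] P3 S -> z' \in body a b c d P1 [set r] P3 S ->
    adj w z -> adj w z' -> z = z'.
  move=> zB z'B wz wz'; have := zB; rewrite /body !in_setU !in_set1 -!orbA => zz.
  have n31 : ~~ (touch [set w] P3 && touch [set w] P1) by rewrite andbC.
  have n42 : ~~ (touch [set w] S && touch [set w] [set r]) by rewrite andbC.
  have : [|| z \in a |: P1, z \in b |: [set r], z \in c |: P3 | z \in d |: S].
    rewrite !in_setU1 !in_set1.
    by case/or4P: zz => [->|->|->|/or4P[->|->|->|/or4P[->|->|->|->]]]; rewrite ?orbT.
  have k1 := k4m_rot km; have o1 := out4_rot oW.
  have k2 := k4m_rot k1; have o2 := out4_rot o1; have k3 := k4m_rot k2; have o3 := out4_rot o2.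
  case/or4P => zi.
  - exact: (half_lonely cG km oW n13 zi z'B wz wz').
  - by apply: (half_lonely cG k1 o1 n24 zi _ wz wz'); rewrite bE1.
  - by apply: (half_lonely cG k2 o2 n31 zi _ wz wz'); rewrite bE2.
  - by apply: (half_lonely cG k3 o3 n42 zi _ wz wz'); rewrite bE3.
have mH := hea0_model h.
have inB i z : i \in hea11_nodes -> i != 10 -> z \in hea0_phi a b c d p p' q q' r v S i ->
    z \in body a b c d P1 [set r] P3 S.
  rewrite /body /P1 /P3 !in_setU; rewrite /hea11_nodes !in_cons !in_nil !orbF.
  by do ![case/orP] => /eqP-> //= _ ->; rewrite ?orbT.
have outH : outside hea11_nodes (hea0_phi a b c d p p' q q' r v S) [set w].
  move=> i iN; rewrite disj1l; have [->|i10] := eqVneq i 10; first exact: wv.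
  rewrite out4_body disj1l in oW; by apply: contra oW; apply: inB.
have loi i j : i \in hea11_nodes -> j \in hea11_nodes -> i != 10 -> j != 10 ->
    touch [set w] (hea0_phi a b c d p p' q q' r v S i) ->
    touch [set w] (hea0_phi a b c d p p' q q' r v S j) -> i = j.
  move=> iN jN i10 j10 /touch1P[z zi wz] /touch1P[z' zj wz'].
  have zz := lo z z' (inB i z iN i10 zi) (inB j z' jN j10 zj) wz wz'.
  apply/eqP; apply: contraT => ij; have := model_dis mH iN jN ij.
  by move=> /disjointFr/(_ zi); rewrite zz zj.
have no10 j : j \in hea11_nodes -> j != 10 -> touch [set w] [set v] ->
    touch [set w] (hea0_phi a b c d p p' q q' r v S j) -> False.
  move=> jN j10 wv' wj.
  have [j2|j2] := eqVneq j 2.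
    by move: wj wv'; rewrite j2 !touch1 => wr; apply: hea0_no_rv h S2 wv oW wr.
  apply: (@attach_node_false _ gG hea11_nodes hea0_single heawood_adj _ 14 w [:: j; 10] mH
    (@hea0_is_single _ _ _ _ _ _ _ _ _ _ _) _ isT outH).
  - by move=> i; rewrite /hea0_single /hea11_nodes !inE; do ![case/orP] => /eqP->.
  - move=> i iN; rewrite !inE; apply/idP/orP => [wi|[]/eqP-> //].
    have [->|i10] := eqVneq i 10; [by right | left]; exact/eqP/loi.
  have : has (refutes hea11_nodes (14 :: hea0_single) heawood_adj 14 [:: j; 10]) hea0_node_certs.
    by move: jN j10 j2 {wj}; rewrite /hea11_nodes !in_cons !in_nil !orbF;
      do ![case/orP] => /eqP-> // _ _; vm_compute.
  by case/hasP => cc _ H; exists cc.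
move=> i j iN jN wi wj; have [i10|i10] := eqVneq i 10; have [j10|j10] := eqVneq j 10.
- by rewrite i10 j10.
- by case: (no10 j jN j10 _ wj); move: wi; rewrite i10.
- by case: (no10 i iN i10 _ wi); move: wj; rewrite j10.
exact: loi.
Qed.

(** As in [rim_single]: [a] and [d] would separate [S], with all that is attached to it, from the
    rest. *)
Lemma hea0_single_rim a b c d p p' q q' r v S : hea0 a b c d p p' q q' r v S -> #|S| <= 1.
Proof.
move=> h; rewrite leqNgt; apply/negP => S2.
set phi := hea0_phi a b c d p p' q q' r v S; have mH := hea0_model h; rewrite -/phi in mH.
have [[k m] A N E cr] := h.
pose B := cup phi hea11_nodes.
have inB i z : i \in hea11_nodes -> z \in phi i -> z \in B by move=> iN zi; apply/cupP; exists i.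
pose X := S :|: [set z in ~: B | touch (comp (~: B) z) S].
have SB z : z \in S -> z \in B by apply: (inB 13).
have Ba : a \in B by apply: (inB 0); rewrite // inE.
have Bd : d \in B by apply: (inB 4); rewrite // inE.
have ok D i j : conn D -> [disjoint D & B] -> i \in hea11_nodes -> j \in hea11_nodes -> i != j ->
    touch D (phi i) -> touch D (phi j) -> compatible hea0_ok i j.
  move=> cD dD iN jN ij ti tj.
  have chk : conflicts_refuted hea11_nodes hea0_single heawood_adj 14 hea0_ok [::] hea0_certs by vm_compute.
  have sub : {subset hea0_single <= hea11_nodes}.
    by move=> l; rewrite /hea0_single /hea11_nodes !inE; do ![case/orP] => /eqP->.
  have oD l : l \in hea11_nodes -> [disjoint D & phi l].
    by move=> lN; apply: disjointWr dD; apply/subsetP => z; apply: inB.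
  have one : {in D, forall w, {in hea11_nodes &, forall i j, touch [set w] (phi i) -> touch [set w] (phi j) -> i = j}}.
    move=> w wD; have wn l : l \in hea11_nodes -> w \notin phi l.
      by move=> lN; apply: disjointN wD; apply: oD.
    apply: hea0_vtx h S2 (wn 10 isT) _; rewrite out4_body disj1l /body !in_setU.
    rewrite (negbTE (wn 0 isT)) (negbTE (wn 3 isT)) (negbTE (wn 1 isT)) (negbTE (wn 4 isT)).
    rewrite (negbTE (wn 9 isT)) (negbTE (wn 8 isT)) (negbTE (wn 2 isT)) (negbTE (wn 6 isT)).
    by rewrite (negbTE (wn 5 isT)) (negbTE (wn 13 isT)).
  have [[x [y [T [Q [[_ _ //]]]]]]|H] :=
    attached_compatible (k := 14) gG mH (@hea0_is_single _ _ _ _ _ _ _ _ _ _ _) sub isT chk cD oD one.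
  exact: H.
have inS i z : i \in hea11_nodes -> i != 13 -> z \in phi i -> z \notin S.
  by move=> iN i13 zi; rewrite (disjointFr (model_dis mH iN (isT : 13 \in hea11_nodes) i13) zi).
have aX : a \notin X by rewrite in_setU inE in_setC Ba negb_or (inS 0) // inE.
have dX : d \notin X by rewrite in_setU inE in_setC Bd negb_or (inS 4) // inE.
have ad : a != d by case/and3P: (k4_ne k) => _ _ /andP[].
have nad : ~~ adj a d by rewrite adj_sym; case/and5P: (k4_adj k) => _ _ _ _ /andP[].
apply: (core_no2 cG ad nad (deg_corner k) (deg_corner (k4_rot (k4_rot (k4_rot k)))) aX dX).
- apply/negbTE/touchPn => u w uX; rewrite in_setC in_setU in_set2 => /norP[wX /norP[wa wd]].
  apply/negP => uw; move: uX; rewrite in_setU => /orP[uS|].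
    have [wB|wB] := boolP (w \in B); last first.
      have wB' : w \in ~: B by rewrite in_setC.
      case/negP: wX; rewrite in_setU inE wB'; apply/orP; right.
      by apply/touchP; exists w, u; rewrite comp_refl adj_sym.
    have [j jN wj] := cupP _ _ _ wB.
    have [j13|j13] := eqVneq j 13; first by case/negP: wX; rewrite in_setU; move: wj; rewrite j13 => ->.
    have : touch (phi j) (phi 13) by apply/touchP; exists w, u; rewrite adj_sym.
    rewrite (model_touch mH jN) //; move: jN wj; rewrite /hea11_nodes !in_cons !in_nil !orbF.
    by do ![case/orP] => /eqP-> //=; rewrite inE ?(negbTE wa) ?(negbTE wd).
  rewrite inE => /andP[uB Cu]; set C := comp (~: B) u in Cu.
  have dC : [disjoint C & B] by have := comp_sub uB; rewrite subsets_disjoint setCK.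
  have [wB|wB] := boolP (w \in B); last first.
    have wB' : w \in ~: B by rewrite in_setC.
    have wC : w \in C := comp_closed uB (comp_refl _ _) wB' uw.
    by case/negP: wX; rewrite in_setU inE wB' -(comp_eq uB wC) Cu orbT.
  have [j jN wj] := cupP _ _ _ wB.
  have [j13|j13] := eqVneq j 13; first by case/negP: wX; rewrite in_setU; move: wj; rewrite j13 => ->.
  have tj : touch C (phi j) by apply/touchP; exists u, w; rewrite comp_refl.
  have := ok C j 13 (comp_conn uB) dC jN isT j13 tj Cu.
  move: jN wj; rewrite /hea11_nodes !in_cons !in_nil !orbF.
  by do ![case/orP] => /eqP-> //=; rewrite inE ?(negbTE wa) ?(negbTE wd).
- exact: leq_trans S2 (subset_leq_card (subsetUl _ _)).
case/and5P: (k4_ne k) => ab ac _ bc /andP[bd cd].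
apply: (@leq_size_card _ [:: b; c]); first by rewrite /= inE bc.
move=> z; rewrite !in_cons in_nil orbF => /orP[]/eqP->; rewrite in_setC in_setU in_set2 !negb_or.
  have [bS bB] : b \notin S /\ b \in B by split; [apply: (inS 3) | apply: (inB 3)]; rewrite ?inE.
  by rewrite in_setU inE in_setC (negbTE bS) bB /= eq_sym ab bd.
have [cS cB] : c \notin S /\ c \in B by split; [apply: (inS 1) | apply: (inB 1)]; rewrite ?inE.
by rewrite in_setU inE in_setC (negbTE cS) cB /= eq_sym ac cd.
Qed.

(** If some node sees two opposite rims, rotations and reflections bring it into the position of
    [cross_alpha]; otherwise the shortest cycle is lonely. *)
Theorem core_adjacent x y : adj x y -> 3 <= deg x -> 3 <= deg y ->
  induced_subgraph_of G petersen \/ induced_subgraph_of G heawood.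
Proof.
move=> xy dx dy; have [A [B th]] := theta_exists cG xy dx dy.
have [a [b [c [d [P1 [P2 [P3 [P4 [k m]]]]]]]]] : exists a b c d P1 P2 P3 P4, k4 a b c d P1 P2 P3 P4 /\
    minsize G (#|P1| + #|P2| + #|P3| + #|P4| + 2) by apply: (k4_exists cG); exists x, y, A, B.
have km : k4m a b c d P1 P2 P3 P4 by split.
have alpha a' b' c' d' Q1 Q2 Q3 Q4 p q v : k4m a' b' c' d' Q1 Q2 Q3 Q4 ->
    cross a' b' c' d' Q1 Q2 Q3 Q4 p q [set v] -> adj p a' -> adj q d' ->
    induced_subgraph_of G petersen \/ induced_subgraph_of G heawood.
  move=> k' cr pa qd; case: (cross_alpha cG k' cr pa qd) => [|[p' [q' [r h]]]]; first by left.
  have /and4P[_ _ _ /and4P[_ _ _ Q40]] := k4_links (proj1 k').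
  have [s sE] := card1_set1 Q40 (hea0_single_rim h).
  by right; rewrite sE in h; apply: hea0_heawood h.
have opp a' b' c' d' Q1 Q2 Q3 Q4 v : k4m a' b' c' d' Q1 Q2 Q3 Q4 ->
    out4 a' b' c' d' Q1 Q2 Q3 Q4 [set v] -> touch [set v] Q1 && touch [set v] Q3 ->
    induced_subgraph_of G petersen \/ induced_subgraph_of G heawood.
  move=> k' o /andP[/touch1P[p pP vp] /touch1P[q qP vq]].
  have cr := vtx_cross cG k' o pP qP vp vq.
  have /and3P[pbqd /eqP pa /eqP pb] := cross_type cG (proj1 k') cr.
  have [qd|nqd] := boolP (adj q d').
    have pa' : adj p a' by rewrite pa.
    exact: (alpha _ _ _ _ _ _ _ _ _ _ _ k' cr pa' qd).
  have pb' : adj p b' by rewrite (negbTE nqd) orbF in pbqd.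
  have qc' : adj q c' by rewrite -pb.
  exact: (alpha _ _ _ _ _ _ _ _ _ _ _ (k4m_flip k') (cross_flip cr) pb' qc').
have [/existsP[v /andP[o ]]|] := boolP [exists v, out4 a b c d P1 P2 P3 P4 [set v] &&
    (touch [set v] P1 && touch [set v] P3 || touch [set v] P2 && touch [set v] P4)].
  case/orP; first exact: (opp _ _ _ _ _ _ _ _ _ km o).
  exact: (opp _ _ _ _ _ _ _ _ _ (k4m_rot km) (out4_rot o)).
move=> /existsPn nv; left; apply: (lonely_petersen cG k); apply: (rim_lonely cG km) => u o.
by have := nv u; rewrite o /= negb_or.
Qed.

End Hea0.

Lemma conn_setT (G : sgraph) : conn [set: G] <-> connected G.
Proof.
have E : @connect G (adj_in [set: G]) =2 connect (@adj G).
  by apply: eq_connect => x y; rewrite /adj_in !inE !andbT.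
split=> [/connP c x y|c]; first by rewrite -E; apply: c; rewrite inE.
by apply/connP => x y _ _; rewrite E.
Qed.

(** * Cycles in graphs whose nodes all have degree 2 *)

Section Degree2.
Variable G : sgraph.
Implicit Types (c : seq G) (x y s t : G).

Lemma next_prev_neq c s : uniq c -> 3 <= size c -> s \in c -> next c s != prev c s.
Proof.
move=> uc sc xc; have [i c' rc] := rot_to xc.
have ur : uniq (s :: c') by rewrite -rc rot_uniq.
have : 3 <= size (s :: c') by rewrite -rc size_rot.
rewrite -(next_rot i) // -(prev_rot i) // rc; case: c' ur {rc} => [|t [|z c']] //= ur _.
rewrite !eqxx; have : forall y l, uniq (s :: y :: l) -> @prev_at G s s y l = last y l.
  move=> y l; elim: l y => [|w l IH] y /=; first by rewrite eqxx.
  rewrite !inE !negb_or => /andP[/and3P[sy sw sl] /andP[_ ul]].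
  rewrite (negbTE sw); apply: IH; by rewrite /= inE negb_or sw sl.
move=> H; have us : uniq (s :: z :: c').
  by move: ur => /and3P[/=]; rewrite !inE !negb_or => /and3P[_ -> ->] _ ->.
have sz : (s == z) = false.
  by apply/negbTE; move: us => /= /andP[]; rewrite inE negb_or => /andP[].
have st : (s == t) = false by apply/negbTE; move: ur => /= /andP[]; rewrite inE negb_or => /andP[].
rewrite st sz H //; move: ur => /= /and3P[_ tz _].
by apply: contraNneq tz => ->; apply: mem_last.
Qed.

Lemma nbh_cycle c s : (forall x, deg x = 2) -> is_cycle c -> s \in c ->
  nbh s = [set next c s; prev c s].
Proof.
move=> d2 [/andP[cc uc] sc] sC.
have sn : next c s \in nbh s by rewrite inE; exact: next_cycle cc sC.
have sp : prev c s \in nbh s by rewrite inE adj_sym; exact: prev_cycle cc sC.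
apply/eqP; rewrite eq_sym eqEcard subUset !sub1set sn sp /=.
by rewrite cards2 next_prev_neq // (d2 s : #|nbh s| = 2).
Qed.

Lemma cycle_adj c : (forall x, deg x = 2) -> is_cycle c -> {in c &, forall s t,
  adj s t = (t == next c s) || (s == next c t)}.
Proof.
move=> d2 cc s t sC tC; have uc : uniq c by case: cc => /andP[].
have -> : adj s t = (t \in nbh s) by rewrite inE.
rewrite (nbh_cycle d2 cc sC) !inE; congr (_ || _); apply/eqP/eqP => [->|->].
  by rewrite next_prev.
by rewrite prev_next.
Qed.

Lemma chords0 c : (forall x, deg x = 2) -> is_cycle c -> chords c = set0.
Proof.
move=> d2 cc; apply/setP => E; rewrite in_set0; apply/negP => /imsetP[[s t]].
rewrite inE => /and5P[/= sC tC]; rewrite (cycle_adj d2 cc sC tC).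
by case/orP => ->.
Qed.
End Degree2.

(** * Undecomposable graphs are basic *)

Section CoreBasic.
Variable G : sgraph.
Hypothesis cG : core G.
Implicit Types (A B C D E K L M S T U V X Y Z P : {set G}) (a b c d p q r x y z u v w s t : G).

Let gG := core_good cG.
Let c3 := core_c3 cG.
Let c4 := core_c4 cG.

(** A single neighbour [w] of [v] would be a cutnode unless there are no other nodes, and then the
    graph is a clique. *)
Lemma deg_ge2 : ~ is_clique G -> forall v, 2 <= deg v.
Proof.
move=> ncl v; rewrite leqNgt; apply/negP => dv; apply: ncl => x y xy.
have [w Hw] : exists w, forall z, adj v z -> z = w.
  have [H|/set0Pn[w vw]] := eqVneq (nbh v) set0.
    (* With no neighbour at all, [v] itself serves as default for [w]. *)
    by exists v => z vz; have : z \in nbh v by [rewrite inE]; rewrite H inE.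
  exists w => z vz; apply/eqP; apply: contraLR dv => zw; rewrite -leqNgt.
  apply: (@leq_size_card _ [:: z; w]); first by rewrite /= inE zw.
  by move=> u; rewrite !inE => /orP[]/eqP->; rewrite // -in_set.
have key z : z \in [set v; w].
  apply: contraT; rewrite in_set2 => /norP[zv zw]; have := @exit1 G cG [set v] w z.
  have [wv|wv] := eqVneq w v.
    have vz : v \in ~: [set z] by rewrite !inE eq_sym.
    have := conn_cross (core_conn cG) (in_setT v) (in_setT z) (set11 v).
    rewrite inE zv => /(_ isT)/touchP[a [b [/setIP[_ /set1P->] /setDP[_]]]].
    by rewrite inE => bv /Hw; rewrite wv => E; rewrite E eqxx in bv.
  rewrite !inE wv zv => /(_ isT isT zw) H; have /setP/(_ v) : [set v] = set0.
    by apply: H => u u' /set1P-> _ /Hw.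
  by rewrite !inE eqxx.
have wv : adj v w.
  have vw : v != w.
    apply: contraNneq xy => E; have := key x; have := key y.
    by rewrite -E !inE !orbb => /eqP-> /eqP->.
  have := conn_cross (core_conn cG) (in_setT v) (in_setT w) (set11 v).
  rewrite inE eq_sym vw => /(_ isT)/touchP[a' [b' [/setIP[_ /set1P->] _ vb]]].
  by rewrite -(Hw b').
move: (key x) (key y) xy; rewrite !inE => /orP[]/eqP-> /orP[]/eqP->; rewrite ?eqxx //.
by rewrite adj_sym.
Qed.

(** A node and a chordless path between its two neighbours form a cycle that no edge leaves, hence
    the whole graph. Lengths 3 and 4 are excluded, and cycles of length 5 and 6 are induced
    subgraphs of the Petersen graph. *)
Lemma all_deg2 : (forall x, deg x = 2) -> basic G.
Proof.
move=> d2; split; first by apply/conn_setT; exact: core_conn cG.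
(* The null graph falls under cliques. *)
have [x _|nx] := pickP (@predT G); last by constructor 1 => x; have := nx x.
have [y [z [yz nE]]] : exists y z, y != z /\ nbh x = [set y; z].
  by have /eqP/cards2P[y [z [yz ->]]] := d2 x; exists y, z.
have [xy xz] : adj x y /\ adj x z by split; rewrite -in_set -/(nbh x) nE !inE eqxx ?orbT.
have nyz : ~~ adj y z by apply/negP => yz'; apply: (c3 xy yz'); rewrite adj_sym.
have [yx zx] : y != x /\ z != x by rewrite eq_sym (adj_neq xy) eq_sym (adj_neq xz).
have [yM zM] : y \in ~: [set x] /\ z \in ~: [set x] by rewrite !inE.
have [L mL sL] := conn_minlink (core_conn1 cG x) yM zM yz nyz.
have [yL zL xL] : [/\ y \notin L, z \notin L & x \notin L].
  by split; apply/negP => /(subsetP sL); rewrite !inE eqxx ?orbT ?andbF.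
have [p [up pL pp _]] := minlink_path mL yL zL.
pose c := x :: y :: rcons p z.
have ccyc : is_cycle c.
  split; last by rewrite /= size_rcons.
  rewrite /ucycle /c /= rcons_path; move: pp; rewrite rcons_path => /andP[-> lz].
  rewrite !inE mem_rcons !inE rcons_uniq up pL pL last_rcons.
  rewrite (negbTE xL) (eq_sym x) (negbTE yx) (eq_sym x) (negbTE zx) mem_rcons !inE !pL.
  by rewrite (negbTE yL) (negbTE zL) (negbTE yz) xy lz adj_sym xz.
have cT v : v \in c.
  apply: contraT => vc.
  have xc : x \in [set u in c] by rewrite !inE eqxx.
  have vc' : v \notin [set u in c] by rewrite inE.
  have /touchP[s [t [/setIP[_ sc] /setDP[_ tc] st]]] :=
    conn_cross (core_conn cG) (in_setT x) (in_setT v) xc vc'.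
  rewrite inE in sc; have : t \in nbh s by rewrite inE.
  rewrite (nbh_cycle d2 ccyc sc); rewrite inE in tc.
  by move=> /set2P[E|E]; move: tc; rewrite E ?mem_next ?mem_prev sc.
have [c7|c7] := leqP 7 (size c).
  constructor 2; exists c; split => //; split => //; [exact: chords0 | exact: leq_trans c7].
constructor 4; left.
have emb (A : seq nat) (f : nat -> G) : all (fun i => i < 10) A -> embed petersen_adj A f -> onto A f ->
    induced_subgraph_of G petersen.
  exact: embed_induced petersen_numE petersen_num_inj petersen_num_onto.
have uc : uniq c by case: ccyc => /andP[].
have cyc : cycle (@adj G) c by case: ccyc => /andP[].
have fO (nodes : seq nat) : size nodes = size c -> uniq nodes -> onto nodes (fun i => nth x c (index i nodes)).
  move=> sn un v; exists (nth 0 nodes (index v c)).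
    by apply: mem_nth; rewrite sn index_mem.
  by rewrite index_uniq ?sn ?index_mem // nth_index.
have cadj := cycle_adj d2 ccyc; have p4 : size p < 4 by move: c7; rewrite /c /= size_rcons.
clear ccyc cT pL pp up c7; move: uc cyc p4 fO cadj; rewrite {}/c.
case: p => [|u [|w [|t [|t' p]]]] // uc cyc _ fO cadj.
- by move: cyc; rewrite /= (negbTE nyz) andbF.
- move: cyc uc; rewrite /= => /and5P[c1 c2 c3' c4' _]; rewrite !inE !negb_or => /andP[/and3P[_ xu _] _].
  by case: (c4 c1 c2 c3' c4').
- apply: (emb [:: 0; 1; 2; 3; 4] _ isT _ (fO [:: 0; 1; 2; 3; 4] erefl isT)).
  move: uc; rewrite /= !inE => uc; clear emb fO cyc; atoms; split.
    move=> i j iN jN ij; apply/negbT; move: iN jN ij; rewrite !in_cons !in_nil !orbF.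
    by do ![case/orP] => /eqP->; do ![case/orP] => /eqP-> //= _; evalb.
  move=> i j; rewrite !in_cons !in_nil !orbF.
  by do ![case/orP] => /eqP->; do ![case/orP] => /eqP->;
    rewrite cadj /= ?in_cons ?eqxx ?orbT //; evalb; evalb.
- apply: (emb [:: 2; 3; 9; 8; 7; 6] _ isT _ (fO [:: 2; 3; 9; 8; 7; 6] erefl isT)).
  move: uc; rewrite /= !inE => uc; clear emb fO cyc; atoms; split.
    move=> i j iN jN ij; apply/negbT; move: iN jN ij; rewrite !in_cons !in_nil !orbF.
    by do ![case/orP] => /eqP->; do ![case/orP] => /eqP-> //= _; evalb.
  move=> i j; rewrite !in_cons !in_nil !orbF.
  by do ![case/orP] => /eqP->; do ![case/orP] => /eqP->;
    rewrite cadj /= ?in_cons ?eqxx ?orbT //; evalb; evalb.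
Qed.

Section Independent.
Hypothesis ind : forall x y, adj x y -> 3 <= deg x -> 3 <= deg y -> False.
Hypothesis ge2 : forall x, 2 <= deg x.

Definition exits D := [set e : G * G | [&& e.1 \in D, e.2 \notin D & adj e.1 e.2]].

(* Adding to [D] a node of degree 2 at the end of an exit creates at most one
   exit and removes one. *)
Lemma exits_add D a w : a \in D -> w \notin D -> adj a w -> deg w = 2 ->
  #|exits (w |: D)| <= #|exits D|.
Proof.
move=> aD wD aw dw; have awF : (a, w) \in exits D by rewrite inE /= aD wD.
rewrite (cardsD1 (a, w) (exits D)) awF addnC.
pose N := nbh w :\ a.
have N1 : #|N| = 1 by move: dw; rewrite /deg (cardsD1 a) inE adj_sym aw => -[].
apply: leq_trans (_ : #|(exits D :\ (a, w)) :|: [set (w, z) | z in N]| <= _).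
  apply: subset_leq_card; apply/subsetP => -[s t]; rewrite !inE /= negb_or.
  move=> /and3P[/orP[/eqP->|sD] /andP[tw tD] st].
    apply/orP; right; apply/imsetP; exists t => //; rewrite !inE st andbT.
    by apply: contraNneq tD => ->.
  by rewrite sD tD st !andbT xpair_eqE (negbTE tw) andbF.
rewrite cardsU; apply: leq_trans (leq_subr _ _) _; rewrite leq_add2l.
by apply: leq_trans (leq_imset_card _ _) _; rewrite N1.
Qed.

(** A maximal set [D] of degree-2 nodes that contains [x], [y] and has at most two exits can be left
    only towards nodes of degree at least 3. If there is one such node it is a cutnode; if there are
    two they are nonadjacent by [ind] and form a proper 2-cutset. *)
Lemma stable2 x y : deg x = 2 -> deg y = 2 -> (exists z, 3 <= deg z) -> ~~ adj x y.
Proof.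
move=> dx dy [z0 dz0]; apply/negP => xy.
pose P D := [&& [set x; y] \subset D, D \subset [set z | deg z == 2] & #|exits D| <= 2].
have Pxy : P [set x; y].
  rewrite /P subxx subUset !sub1set !inE dx dy /=.
  have -> : [set x; y] = y |: [set x] by rewrite setUC.
  apply: leq_trans (exits_add _ _ xy dy) _; rewrite ?inE ?eqxx //; first by rewrite eq_sym adj_neq.
  apply: leq_trans (_ : #|[set (x, z) | z in nbh x]| <= 2).
    apply: subset_leq_card; apply/subsetP => -[s t]; rewrite !inE /= => /and3P[/eqP-> _ xt].
    by apply/imsetP; exists t; rewrite ?inE.
  by apply: leq_trans (leq_imset_card _ _) _; rewrite -/(deg x) dx.
have [D mD _] := maxset_exists Pxy; have /and3P[xyD D2 F2] := maxsetp mD.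
have D_deg u : u \in D -> deg u = 2 by move=> /(subsetP D2); rewrite inE => /eqP.
have D_exit u w : u \in D -> w \notin D -> adj u w -> 3 <= deg w.
  move=> uD wD uw; rewrite ltn_neqAle ge2 andbT; apply/eqP => dw.
  have /maxsetP[_ /(_ (w |: D))] := mD; rewrite subsetUr => H.
  have /setP/(_ w) : w |: D = D.
    apply: H => //; rewrite /P (subset_trans xyD (subsetUr _ _)) subUset D2 sub1set inE -dw eqxx /=.
    exact: leq_trans (exits_add uD wD uw (esym dw)) F2.
  by rewrite !inE eqxx (negbTE wD).
have nD w : 3 <= deg w -> w \notin D by move=> dw; apply: contraTN dw => /D_deg->.
have xD : x \in D by apply: (subsetP xyD); rewrite !inE eqxx.
(* A node of degree at least 3 with all its neighbours in [D] would account for three exits. *)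
have outn s : 3 <= deg s -> exists2 z, z \notin D & z != s.
  move=> ds; have [/subsetP sub|/subsetPn[z zs zD]] := boolP (nbh s \subset D).
    have : #|[set (z, s) | z in nbh s]| <= 2.
      apply: leq_trans F2; apply: subset_leq_card; apply/subsetP => e /imsetP[z zs ->].
      by move: (zs); rewrite !inE /= (sub z zs) (nD s ds) adj_sym.
    by rewrite card_imset => [|u v [->]] //; rewrite leqNgt ds.
  by exists z => //; move: zs; rewrite inE => /adj_neq; rewrite eq_sym.
have one s : 3 <= deg s -> (forall u w, u \in D -> w \notin D -> adj u w -> w = s) -> False.
  move=> ds H; have [z zD zs] := outn s ds.
  by have /setP/(_ x) := exit1 cG (nD s ds) zD zs H; rewrite xD inE.
have [F0|[[a s] eF]] := set_0Vmem (exits D).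
  apply: (one z0 dz0) => u w uD wD uw; have /setP/(_ (u, w)) := F0.
  by rewrite !inE /= uD wD uw.
move: (eF); rewrite inE /= => /and3P[aD sD as']; have ds := D_exit a s aD sD as'.
have [b [t [bF all2]]] : exists b t, (b, t) \in exits D /\
    forall u w, u \in D -> w \notin D -> adj u w -> (u, w) = (a, s) \/ (u, w) = (b, t).
  have [/subsetP F1|/subsetPn[[b t] bF bas]] := boolP (exits D \subset [set (a, s)]).
    exists a, s; split=> // u w uD wD uw; left; apply/set1P/F1; by rewrite inE /= uD wD uw.
  exists b, t; split=> // u w uD wD uw.
  suff /orP[/eqP|/eqP] : ((u, w) == (a, s)) || ((u, w) == (b, t)) by [left | right].
  apply: contraT; rewrite negb_or => /andP[n1 n2].
  have : 3 <= #|exits D|.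
    apply: (@leq_size_card _ [:: (a, s); (b, t); (u, w)]).
      rewrite /= !inE negb_or eq_sym -in_set1 bas eq_sym n1 eq_sym n2 //.
    move=> e; rewrite !in_cons in_nil orbF => /or3P[]/eqP->; rewrite // inE /= uD wD uw //.
  by rewrite leqNgt ltnS F2.
move: (bF); rewrite inE /= => /and3P[bD tD bt]; have dt := D_exit b t bD tD bt.
have [ts|ts] := eqVneq s t.
  by apply: (one s ds) => u w uD wD uw; case: (all2 u w uD wD uw) => -[_ ->].
have nst : ~~ adj s t by apply/negP => st; apply: ind st ds dt.
apply: (core_no2 cG ts nst ds dt sD tD).
- apply/negbTE/touchPn => u w uD; rewrite in_setC in_setU in_set2 !negb_or => /and3P[wD ws wt].
  apply/negP => uw; case: (all2 u w uD wD uw) => -[_ E]; [move: ws | move: wt]; by rewrite E eqxx.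
- apply: (@leq_size_card _ [:: x; y]); first by rewrite /= inE adj_neq.
  by move=> u; rewrite !inE => /orP[]/eqP->; rewrite // (subsetP xyD) // !inE eqxx orbT.
apply: leq_trans (_ : #|nbh s :\ a| <= _).
  by move: ds; rewrite /deg (cardsD1 a); case: (a \in _) => /=; [|move/ltnW]; rewrite ?add1n ?add0n.
apply: subset_leq_card; apply/subsetP => w; rewrite in_setD1 inE => /andP[wa sw].
rewrite in_setC in_setU in_set2 !negb_or (eq_sym w s) adj_neq //=.
rewrite (_ : w != t) ?andbT; last by apply: contraNneq nst => <-.
apply: contra wa => wD; rewrite adj_sym in sw.
by case: (all2 w s wD sD sw) => [[->]|[_ E]] //; case/eqP: ts.
Qed.
End Independent.

(** When nodes of degree at least 3 are pairwise nonadjacent and exist, the degree-2 nodes are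
    stable too, which is the strongly 2-bipartite case. *)
Theorem core_basic : basic G.
Proof.
have cn : connected G by apply/conn_setT; exact: core_conn cG.
have [/forallP cl|ncl] := boolP [forall x : G, [forall y, (x != y) ==> adj x y]].
  by split=> //; constructor 1 => x y xy; move/forallP/(_ y)/implyP: (cl x); apply.
have {}ncl : ~ is_clique G.
  move=> cl; case/negP: ncl; apply/forallP => x; apply/forallP => y; apply/implyP; exact: cl.
have ge2 := deg_ge2 ncl.
have [/existsP[x /existsP[y /and3P[xy dx dy]]]|] :=
    boolP [exists x : G, [exists y, [&& adj x y, 3 <= deg x & 3 <= deg y]]].
  by split=> //; constructor 4; have := core_adjacent cG xy dx dy.
move=> /existsPn ind.
have {}ind x y : adj x y -> 3 <= deg x -> 3 <= deg y -> False.
  by move=> xy dx dy; have /existsPn/(_ y) := ind x; rewrite xy dx dy.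
have [/existsP big|/existsPn small] := boolP [exists x : G, 3 <= deg x]; last first.
  apply: all_deg2 => x; apply/eqP; rewrite eqn_leq ge2 andbT; by have := small x; rewrite -leqNgt.
split=> //; constructor 3; split.
  move=> c [[[/andP[cc uc] _] _ _] s4].
  case: c s4 cc uc => [|x [|y [|z [|t [|? ?]]]]] //= _ /and5P[c1 c2 c3' c4' _].
  by rewrite !inE !negb_or => /and3P[/and3P[_ xz _] /andP[_ yt] _]; apply: c4 c1 c2 c3' c4' xz yt.
split.
- apply/setP => x; rewrite !inE; have := ge2 x; by rewrite leq_eqVlt eq_sym.
- by apply/setP => x; rewrite !inE; case: eqP => [->|].
- by move=> x y; rewrite !inE => /eqP dx /eqP dy; apply: (stable2 ind ge2).
by move=> x y; rewrite !inE => dx dy; apply/negP => xy; apply: ind xy dx dy.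
Qed.
End CoreBasic.

(** * Transfer of the property between graphs *)

(** The alternative [f a = f b] allows contractions, needed when a whole side of a decomposition
    goes to one node. *)
Lemma conn_image (G H : sgraph) (f : G -> H) (A : {set G}) : conn A ->
  {in A &, forall a b, adj a b -> f a = f b \/ adj (f a) (f b)} -> conn (f @: A).
Proof.
move=> /connP cA fA; apply/connP => _ _ /imsetP[a aA ->] /imsetP[b bA ->].
have /connectP[p] := cA a b aA bA; elim: p a aA => [|c p IH] a aA /=; first by move=> _ ->.
move=> /andP[/and3P[ac _ cA'] pp] E; have := IH c cA' pp E.
case: (fA a c aA cA' ac) => [->//|fac]; apply: connect_trans; apply: connect1.
by rewrite /adj_in fac !imset_f.
Qed.

(** Nodes of degree at most 2 are never ends of a chord of a cycle, so a contraction may freely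
    create them. *)
Lemma theta_deg (G : sgraph) (x y : G) A B : theta x y A B -> 3 <= deg x /\ 3 <= deg y.
Proof.
move=> th; rewrite /theta in th; atoms.
split; [apply: (@deg3 _ x [set y] A B) | apply: (@deg3 _ y [set x] A B)]; solveb.
Qed.

Section Minor.
Variables (G H : sgraph) (phi : H -> {set G}).
Hypothesis phi_conn : forall x, conn (phi x).
Hypothesis phi_dis : forall x y, x != y -> [disjoint phi x & phi y].
Hypothesis phi_touch : forall x y, x != y -> touch (phi x) (phi y) = adj x y.
Hypothesis phi_single : forall x, 3 <= deg x -> exists z, phi x = [set z].

Let F (A : {set H}) := \bigcup_(x in A) phi x.

Lemma union_conn (A : {set H}) : conn A -> conn (F A).
Proof.
move=> /connP cA; apply/connP => s t /bigcupP[a aA sa] /bigcupP[b bA tb].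
have sub x : x \in A -> phi x \subset F A by move=> xA; apply: bigcup_sup.
have inF x u v : x \in A -> u \in phi x -> v \in phi x -> connect (adj_in (F A)) u v.
  move=> xA ux vx; apply: connect_inS (sub x xA) _; exact: (connP _ (phi_conn x)).
have /connectP[p] := cA a b aA bA; elim: p a s aA sa => [|c p IH] a s aA sa /=.
  by move=> _ E; apply: inF aA sa _; rewrite -E.
move=> /andP[/and3P[ac _ cA'] pp] E.
have : touch (phi a) (phi c) by rewrite phi_touch ?adj_neq.
move=> /touchP[u [v [ua vc uv]]]; apply: connect_trans (inF a s u aA sa ua) _.
apply: connect_trans (IH c v cA' vc pp E); apply: connect1.
by rewrite /adj_in uv (subsetP (sub a aA)) // (subsetP (sub c cA')).
Qed.

Lemma union_dis (A B : {set H}) : [disjoint A & B] -> [disjoint F A & F B].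
Proof.
move=> dAB; apply: disjointI => z /bigcupP[a aA za]; apply/negP => /bigcupP[b bB zb].
have ab : a != b by apply: contraTneq bB => <-; rewrite (disjointFr dAB aA).
by rewrite (disjointFr (phi_dis ab) za) in zb.
Qed.

Lemma union_touch (A B : {set H}) : [disjoint A & B] -> touch (F A) (F B) = touch A B.
Proof.
move=> dAB; have ab a b : a \in A -> b \in B -> a != b.
  by move=> aA bB; apply: contraTneq bB => <-; rewrite (disjointFr dAB aA).
apply/touchP/touchP => [[s [t [/bigcupP[a aA sa] /bigcupP[b bB tb] st]]]|[a [b [aA bB]]]].
  exists a, b; split=> //; rewrite -phi_touch ?ab //; by apply/touchP; exists s, t.
rewrite -phi_touch ?ab // => /touchP[s [t [sa tb st]]].
by exists s, t; split=> //; apply/bigcupP; [exists a | exists b].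
Qed.

(** [H] is an induced minor with branch sets [phi x]. The ends of a chord have degree at least 3, so
    their branch sets are single nodes and the configuration lifts to [G]. *)
Lemma good_minor : good G -> good H.
Proof.
move=> gG x y A B th; have [dx dy] := theta_deg th.
have [[x' Ex] [y' Ey]] := (phi_single dx, phi_single dy).
have Fx z : F [set z] = phi z by rewrite /F big_set1.
case/and5P: th => xy /and3P[cA cB dAB] /and4P[xA yA xB yB] /andP[tx ty] /andP[sx sy].
have xy' := adj_neq xy.
have [dxA dyA dxB dyB] : [/\ [disjoint [set x] & A], [disjoint [set y] & A],
    [disjoint [set x] & B] & [disjoint [set y] & B]] by rewrite !disj1l.
rewrite -(union_touch dAB); apply: (gG x' y').
have nin (z : H) z' (D : {set H}) : phi z = [set z'] -> [disjoint [set z] & D] -> z' \notin F D.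
  by move=> Ez /union_dis; rewrite Fx Ez disj1l.
rewrite /theta !union_conn ?union_dis // -!touch1 -Ex -Ey phi_touch // xy.
rewrite !(nin x x') ?(nin y y') //= -!Fx !union_touch // tx ty sx sy //.
Qed.
End Minor.

Lemma good_embed (G H : sgraph) (f : H -> G) : injective f ->
  (forall x y, adj (f x) (f y) = adj x y) -> good G -> good H.
Proof.
move=> fI fE; apply: (@good_minor G H (fun x => [set f x])) => [x|x y xy|x y xy|x _].
- exact: conn1.
- by rewrite disj1l inE (inj_eq fI).
- by rewrite touch1.
- by exists (f x).
Qed.

Lemma iso_good (G H : sgraph) : iso G H -> good H -> good G.
Proof. by case=> f /bij_inj fI fE; apply: good_embed fI fE. Qed.

(** * Basic graphs *)

Section PathSearch.
Variables (e : rel nat) (n : nat).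

Fixpoint closure k (R F : seq nat) : seq nat :=
  if k is k'.+1 then closure k' R [seq z <- R | (z \in F) || has (e z) F] else F.

(** [A] is the interior of a path from [x] to [y]; the test asks that no second connection avoids
    the path and all neighbours of its interior. *)
Definition separated x y A :=
  let R := [seq z <- iota 0 n | (z \notin [:: x, y & A]) && ~~ has (e z) A] in
  ~~ has (e y) (closure n R [seq z <- R | e x z]).

(* Extends the induced path [u :: A], which leads from a neighbour of [x] to
   [u], in all possible ways until it reaches a neighbour of [y].  The [if] keeps
   the evaluation of excluded branches lazy. *)
Fixpoint search k x y u A : bool :=
  if e u y then separated x y (u :: A) else
  if k is k'.+1 then
    all (fun w => if [|| w \in [:: x, y, u & A], ~~ e u w, e x w | has (e w) A] then true
      else search k' x y w (u :: A)) (iota 0 n)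
  else false.

Definition theta_free : bool :=
  all (fun x => all (fun y => if e x y then
    all (fun a => if e x a && (a != y) then search n x y a [::] else true) (iota 0 n)
    else true) (iota 0 n)) (iota 0 n).

Variables (G : sgraph) (num : G -> nat).
Hypothesis num_adj : forall x y, adj x y = e (num x) (num y).
Hypothesis num_inj : injective num.
Hypothesis num_lt : forall x, num x < n.

Lemma closure_sub k R F : {subset F <= R} -> {subset F <= closure k R F}.
Proof.
elim: k F => [|k IH] F FR z zF //=; apply: IH; last by rewrite mem_filter zF FR.
by move=> t; rewrite mem_filter => /andP[].
Qed.

(** Either a round adds a node, so that one round fewer suffices from there on, or the set is
    already stable. *)
Lemma closure_closed k R F : {subset F <= R} -> uniq R -> size R <= size (undup F) + k ->
  {in R, forall z, has (e z) (closure k R F) -> z \in closure k R F}.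
Proof.
elim: k F => [|k IH] F FR uR sz z zR /=.
  move=> _; have : {subset R <= undup F}.
    move=> t tR; apply: contraT => tF; move: sz; rewrite addn0 leqNgt => /negP[].
    have : size (t :: undup F) <= size R.
      apply: uniq_leq_size; first by rewrite /= tF undup_uniq.
      by move=> s; rewrite inE mem_undup => /orP[/eqP->|/FR].
    by [].
  by move=> /(_ z zR); rewrite mem_undup.
set F' := [seq t <- R | (t \in F) || has (e t) F].
have F'R : {subset F' <= R} by move=> t; rewrite mem_filter => /andP[].
have FF' : {subset F <= F'} by move=> t tF; rewrite mem_filter tF FR.
have [/allP st|/allPn[t tF' tF]] := boolP (all (mem F) F').
  have E1 : F' =i F by move=> t; apply/idP/idP => [/st|/FF'].
  have E : [seq t <- R | (t \in F') || has (e t) F'] = F'.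
    apply: eq_in_filter => s _; rewrite E1; congr (_ || _).
    by apply/hasP/hasP => -[r rF er]; exists r; rewrite // ?E1 // -E1.
  have cst m : closure m R F' = F' by elim: m => //= m IHm; rewrite E.
  rewrite cst => /hasP[s]; rewrite E1 => sF ezs.
  by rewrite mem_filter zR andbT; apply/orP; right; apply/hasP; exists s.
apply: IH => //; rewrite addnS in sz; apply: leq_trans sz _.
rewrite -addSn leq_add2r; have : size (t :: undup F) <= size (undup F').
  apply: uniq_leq_size; first by rewrite /= mem_undup tF undup_uniq.
  by move=> s; rewrite inE !mem_undup => /orP[/eqP->|/FF'].
by [].
Qed.

Implicit Types (x y u : G) (A B S : {set G}).

Lemma separatedP x y (A : seq G) B : separated (num x) (num y) [seq num z | z <- A] ->
  conn B -> x \notin B -> y \notin B -> touch B [set x] -> touch B [set y] ->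
  [disjoint B & [set z in A]] -> touch B [set z in A].
Proof.
move=> sp cB xB yB /touchP[b [x' [bB /set1P-> bx]]] /touchP[b' [y' [bB' /set1P-> by']]] dBA.
apply: contraT => nt; case/negP: sp.
set R := [seq z <- iota 0 n | _]; set F := [seq z <- R | e (num x) z].
have inR z : z \in B -> num z \in R.
  move=> zB; rewrite mem_filter mem_iota num_lt leq0n !andbT !inE !negb_or !(inj_eq num_inj).
  rewrite (memPn xB z zB) (memPn yB z zB) (mem_map num_inj) /=; apply/andP; split.
    by have := disjointFr dBA zB; rewrite inE => ->.
  apply/hasPn => _ /mapP[a aA ->]; rewrite -num_adj.
  by rewrite (touchPn _ _ nt) ?inE.
have FR : {subset F <= R} by move=> z; rewrite mem_filter => /andP[].
have uR : uniq R by rewrite filter_uniq ?iota_uniq.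
have sR : size R <= size (undup F) + n.
  by rewrite (leq_trans _ (leq_addl _ _)) // size_filter (leq_trans (count_size _ _)) // size_iota.
have cl := closure_closed FR uR sR.
have bF : num b \in closure n R F.
  by apply: closure_sub FR _ _; rewrite mem_filter inR // -num_adj adj_sym bx.
apply/hasP; exists (num b'); last by rewrite -num_adj adj_sym.
have /connectP[p] := connP _ cB b b' bB bB'.
elim: p b bB bF {bx} => [|c p IH] b bB bF /=; first by move=> _ ->.
move=> /andP[/and3P[bc _ cB'] pp] E; apply: (IH c cB' _ pp E).
by apply: cl; [exact: (inR c cB') | apply/hasP; exists (num b); rewrite // -num_adj adj_sym].
Qed.

(** [u :: A] is the travelled part of a minimal link and [S] the part still ahead. Each step moves
    the node of [S] next to [u] to the path, along a branch that the search has checked. *)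
Lemma searchP k x y u (A : seq G) S B : search k (num x) (num y) (num u) [seq num z | z <- A] ->
  (S == set0) = adj u y -> (S != set0 -> minlink [set u] [set y] S) ->
  touch S ([set x] :|: [set z in A]) = false -> [disjoint S & [set z in [:: x, y, u & A]]] ->
  conn B -> x \notin B -> y \notin B -> touch B [set x] -> touch B [set y] ->
  [disjoint B & S :|: [set z in u :: A]] -> touch B (S :|: [set z in u :: A]).
Proof.
move=> + + + + + cB xB yB Bx By.
elim: k u A S => [|k IH] u A S sr S0 Sm St Sd dB; have [uy|nuy] := boolP (adj u y).
- move: sr S0 dB; rewrite /= -num_adj uy => sr /eqP->; rewrite !set0U.
  exact: (@separatedP x y (u :: A)).
- by move: sr; rewrite /= -num_adj (negbTE nuy).
- move: sr S0 dB; rewrite /= -num_adj uy => sr /eqP->; rewrite !set0U.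
  exact: (@separatedP x y (u :: A)).
move: sr; rewrite /= -num_adj (negbTE nuy) => /allP sr; rewrite (negbTE nuy) in S0.
have mS := Sm (negbT S0); have /and3P[_ /touchP[w [u' [wS /set1P-> wu]]] _] := minlink_links mS.
have [S1 [S2 s]] := split_minlink mS wS.
have S10 : S1 = set0 by apply/eqP; rewrite -(split_uX s) touch1.
have SE := split_eq s; rewrite S10 set0U in SE.
have S2S : S2 \subset S by rewrite SE subsetUr.
have wA : w \notin [:: x, y, u & A] by have := disjointFr Sd wS; rewrite inE => ->.
have StP z : z \in S -> forall t, t \in [set x] :|: [set t in A] -> adj z t = false.
  by move=> zS t tA; apply: (touchPn _ _ (negbT St)).
have xw : adj x w = false by rewrite adj_sym StP // !inE eqxx.
have hw : has (e (num w)) [seq num z | z <- A] = false.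
  apply/hasPn => _ /mapP[t tA ->]; by rewrite -num_adj StP // !inE tA orbT.
have := sr (num w); rewrite mem_iota num_lt => /(_ isT).
have -> : (num w \in [:: num x, num y, num u & [seq num z | z <- A]]) = false.
  by rewrite (mem_map num_inj [:: x, y, u & A] w) (negbTE wA).
rewrite -!num_adj adj_sym wu xw hw /= => srw.
have E : S :|: [set z in u :: A] = S2 :|: [set z in [:: w, u & A]].
  by apply/setP => z; rewrite SE !inE; case: (z == w); rewrite ?orbT.
rewrite E in dB *; apply: (IH w (u :: A) S2 srw _ _ _ _ dB).
- by rewrite -(split_uY s) touch1.
- exact: split_m2 s.
- apply/negbTE/touchPn => z t zS; rewrite !inE => /or3P[/eqP->|/eqP->|tA].
  + by rewrite StP ?(subsetP S2S) // !inE eqxx.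
  + by have /negbT/touchPn H := split_X2 s; rewrite H ?inE.
  + by rewrite StP ?(subsetP S2S) // !inE tA orbT.
apply: disjointI => z zS; have := disjointFr Sd (subsetP S2S z zS); rewrite !inE => /negbT.
rewrite !negb_or => /and4P[-> -> -> ->]; rewrite !andbT /=.
by apply: contraNneq (split_u2 s) => <-.
Qed.

Lemma theta_free_good : theta_free -> good G.
Proof.
move=> /allP tf x y A B th; case/and5P: (th) => xy /and3P[cA cB dAB] /and4P[xA yA xB yB].
rewrite ![touch [set _] _]touchC => /andP[Ax Ay] /andP[Bx By].
have [L mL LA] := minlink_exists cA Ax Ay.
have /and3P[_ /touchP[a [x' [aL /set1P-> ax]]] _] := minlink_links mL.
have [L1 [L2 s]] := split_minlink mL aL.
have L10 : L1 = set0 by apply/eqP; rewrite -(split_uX s) touch1.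
have LE := split_eq s; rewrite L10 set0U in LE.
have L2A : L2 \subset A by apply: subset_trans LA; rewrite LE subsetUr.
have inV z : num z \in iota 0 n by rewrite mem_iota num_lt.
have := allP (tf _ (inV x)) _ (inV y); rewrite -num_adj xy => /allP/(_ _ (inV a)).
have ay : a != y by apply: contraNneq yA => <-; apply: (subsetP LA).
rewrite -num_adj adj_sym ax (inj_eq num_inj) ay /= => sr.
have LA' : L2 :|: [set z in [:: a]] = L by rewrite LE setUC; congr (_ :|: _); apply/setP => z; rewrite !inE.
have dB : [disjoint B & L2 :|: [set z in [:: a]]].
  by rewrite LA' disjoint_sym; apply: disjointWl LA dAB.
have H : touch B (L2 :|: [set z in [:: a]]).
  apply: (@searchP n x y a [::] L2 B sr) => //.
  - by rewrite -(split_uY s) touch1.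
  - exact: split_m2 s.
  - rewrite (_ : [set z in [::]] = set0) ?setU0; last by apply/setP => z; rewrite !inE.
    exact: split_X2 s.
  apply: disjointI => z zL; have zA := subsetP L2A z zL; rewrite !inE !negb_or.
  apply/and3P; split; [by apply: contraNneq xA => <- | by apply: contraNneq yA => <- |].
  by apply: contraNneq (split_u2 s) => <-.
by rewrite touchC; apply: touchS H; rewrite // LA'.
Qed.
End PathSearch.

Lemma petersen_good : good petersen.
Proof.
have tf : theta_free petersen_adj 10 by vm_compute.
apply: (theta_free_good petersen_numE petersen_num_inj _ tf) => -[i|i].
  by apply: leq_trans (ltn_ord i) _.
by rewrite -[10]/(5 + 5) ltn_add2l ltn_ord.
Qed.

Lemma heawood_good : good heawood.
Proof.
have tf : theta_free heawood_adj 14 by vm_compute.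
exact: (theta_free_good heawood_numE val_inj (@ltn_ord 14) tf).
Qed.

(** In a clique [A] and [B] touch because they are nonempty and disjoint. Holes and strongly
    2-bipartite graphs have no two adjacent nodes of degree at least 3, so [theta] never holds. The
    two exceptional graphs are settled by computation. *)
Lemma basic_good (G : sgraph) : basic G -> good G.
Proof.
case=> _ [cl|[c [[cc ch _] cT _]]|[_ [_ _ _ st]]|].
- move=> x y A B /and5P[_ /and3P[_ _ dAB] _ /andP[/touch1P[a aA _] _] /andP[/touch1P[b bB _] _]].
  apply/touchP; exists a, b; split=> //; apply: cl.
  by apply: contraTneq bB => <-; rewrite (disjointFr dAB aA).
- move=> x y A B /theta_deg[dx _]; exfalso; move: dx; rewrite ltnNge => /negP; apply.
  apply: leq_trans (_ : #|[set next c x; prev c x]| <= 2); last by rewrite cards2; case: (_ != _).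
  apply: subset_leq_card; apply/subsetP => t; rewrite !inE => xt; apply: contraT; rewrite negb_or.
  move=> /andP[n1 n2]; have /setP/(_ [set x; t]) := ch; rewrite in_set0 => /negbT/negP[].
  apply/imsetP; exists (x, t); rewrite // inE /chordal_pair /= !cT xt n1 /=.
  by case: cc => /andP[_ uc] _; apply: contraNneq n2 => ->; rewrite prev_next.
- move=> x y A B th; have [dx dy] := theta_deg th; case/andP: th => xy _.
  by have := st x y; rewrite !inE dx dy xy => /(_ isT isT).
by case=> -[A [f fb fE]]; [have gH := petersen_good | have gH := heawood_good];
  apply: (@good_embed _ _ (fun x => val (f x))) gH => // x y /val_inj /(bij_inj fb).
Qed.

(** * The operations preserve the property *)

Section Side.
Variables (G H : sgraph) (W M : {set G}) (f : G -> H).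
Hypothesis exitW : forall a r, a \in W -> r \notin W -> adj a r -> a \in M.
Hypothesis stM : {in M &, forall a b, ~~ adj a b}.
Hypothesis finj : {in W &, injective f}.
Hypothesis fadj : {in W &, forall a b, adj (f a) (f b) = adj a b}.
(** [M] is the set shared by the two sides: empty for [O0], one node for [O1], two for [O3]. Only
    two nodes call for a hub, the deleted degree-2 node, which stands for a connection through the
    other side. *)
Hypothesis hub : {in M &, forall m m', m != m' -> exists u, [/\ u \notin f @: W, M = [set m; m'] &
  {in W, forall a, adj u (f a) = (a \in M)}]}.
Implicit Types (A B S : {set G}) (x y a b s t : G).

(* The part of [S] outside [W] is contracted to the hub [u] if it may be needed to
   link the two nodes of [M], and dropped otherwise. *)
Lemma piece S x y : conn S -> x \in W -> y \in W -> adj x y -> x \notin S -> y \notin S ->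
  touch [set x] S -> touch [set y] S ->
  exists S' : {set H}, [/\ conn S', touch [set f x] S', touch [set f y] S' &
    S' = f @: (S :&: W) \/ exists u, [/\ S' = u |: f @: (S :&: W), u \notin f @: W,
      {subset M <= [predU S & [set x; y]]}, (exists2 m, m \in S & m \in M) &
      {in W, forall a, adj u (f a) = (a \in M)}]].
Proof.
move=> cS xW yW xy xS yS /touch1P[sx sxS xs] /touch1P[sy syS ys].
have [S_W|/subsetPn[r rS rW]] := boolP (S \subset W).
  exists (f @: S); split.
  - apply: conn_image cS _ => a b aS bS ab; right.
    by rewrite fadj ?(subsetP S_W).
  - by apply/touch1P; exists (f sx); rewrite ?imset_f // fadj // (subsetP S_W).
  - by apply/touch1P; exists (f sy); rewrite ?imset_f // fadj // (subsetP S_W).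
  by left; rewrite (setIidPl S_W).
(* The stable set [M] contains at most one of [x], [y]; a neighbour in [S] of the other one lies in
   [W]. *)
have [z [zS zW]] : exists z, z \in S /\ z \in W.
  have [xM|xM] := boolP (x \in M).
    have yM : y \notin M by apply/negP => yM; have := stM xM yM; rewrite xy.
    exists sy; split=> //; apply: contraNT yM => sW; exact: exitW yW sW ys.
  exists sx; split=> //; apply: contraNT xM => sW; exact: exitW xW sW xs.
have /touchP[m [r' [/setIP[mS mW] /setDP[r'S r'W] mr]]] := conn_cross cS zS rS zW rW.
have mM := exitW mW r'W mr.
have [/existsP[m' /and3P[m'M m'S mm']]|/existsPn only] :=
    boolP [exists m', [&& m' \in M, (m' \in S) || (m' \in [set x; y]) & m != m']].
  have [u [uW ME ua]] := hub mM m'M mm'.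
  pose g z := if z \in W then f z else u.
  have gS : g @: S = u |: f @: (S :&: W).
    apply/setP => h; rewrite in_setU1; apply/imsetP/orP => [[s sS ->]|[/eqP->|/imsetP[s /setIP[sS sW] ->]]].
    - rewrite /g; case: ifP => sW; last by left.
      by right; apply: imset_f; rewrite inE sS.
    - by exists r; rewrite // /g (negbTE rW).
    - by exists s; rewrite // /g sW.
  exists (g @: S); have tg t s : t \in W -> s \in S -> adj t s -> touch [set f t] (g @: S).
    move=> tW sS ts; apply/touch1P; exists (g s); first exact: imset_f.
    rewrite /g; case: ifP => sW; first by rewrite fadj.
    by rewrite adj_sym ua // (exitW tW (negbT sW) ts).
  split; [|exact: tg xs|exact: tg ys|right; exists u; split => //]; last by exists m.
  - apply: conn_image cS _ => a b aS bS ab; rewrite /g; case: ifP => aW; case: ifP => bW.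
    + by right; rewrite fadj.
    + by right; rewrite adj_sym ua // (exitW aW (negbT bW) ab).
    + by right; rewrite ua // (exitW bW (negbT aW)) // adj_sym.
    + by left.
  - by move=> t; rewrite ME => /set2P[]->; rewrite inE /= ?mS.
have {}only t : t \in M -> (t \in S) || (t \in [set x; y]) -> t = m.
  by move=> tM tS; apply/eqP; have := only t; rewrite tM tS /= negbK eq_sym.
(* The outside part of [S] hangs on [m] alone and is collapsed onto it. *)
pose g z := if z \in W then f z else f m.
have gS : g @: S = f @: (S :&: W).
  apply/setP => h; apply/imsetP/imsetP => [[s sS ->]|[s /setIP[sS sW] ->]].
    by rewrite /g; case: ifP => sW; [exists s | exists m]; rewrite // inE ?sS ?mS.
  by exists s; rewrite // /g sW.
exists (g @: S); have tg t s : t \in [set x; y] -> t \notin S -> t \in W -> s \in S -> adj t s ->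
    touch [set f t] (g @: S).
  move=> txy tS tW sS ts; apply/touch1P; exists (g s); first exact: imset_f.
  rewrite /g; case: ifP => sW; first by rewrite fadj.
  by move: tS; rewrite (only t) ?mS // ?txy ?orbT // (exitW tW (negbT sW) ts).
split; [| apply: tg xs | apply: tg ys | by left] => //; rewrite ?inE ?eqxx ?orbT //.
apply: conn_image cS _ => a b aS bS ab; rewrite /g; case: ifP => aW; case: ifP => bW.
- by right; rewrite fadj.
- by left; rewrite (only a) ?aS // (exitW aW (negbT bW) ab).
- by left; rewrite (only b) ?bS // (exitW bW (negbT aW)) // adj_sym.
- by left.
Qed.

(** Both pieces cannot need the hub: each would contain a node of [M], while [M] lies in the union
    of the other piece with [x] and [y], against disjointness. *)
Lemma side_good : good H -> forall x y A B, theta x y A B -> x \in W -> y \in W -> touch A B.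
Proof.
move=> gH x y A B th xW yW.
case/and5P: (th) => xy /and3P[cA cB dAB] /and4P[xA yA xB yB] /andP[Ax Ay] /andP[Bx By].
have nin S t : t \in W -> t \notin S -> f t \notin f @: (S :&: W).
  move=> tW tS; apply/imsetP => -[s /setIP[sS sW] E].
  by move: tS; rewrite (finj tW sW E) sS.
have dis (S T : {set G}) : [disjoint S & T] -> [disjoint f @: (S :&: W) & f @: (T :&: W)].
  move=> dST; apply: disjointI => _ /imsetP[s /setIP[sS sW] ->]; apply: nin => //.
  by rewrite (disjointFr dST sS).
have tch S T : touch (f @: (S :&: W)) (f @: (T :&: W)) -> touch S T.
  move=> /touchP[_ [_ [/imsetP[s /setIP[sS sW] ->] /imsetP[t /setIP[tT tW] ->]]]].
  by rewrite fadj // => st; apply/touchP; exists s, t.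
have sub S : f @: (S :&: W) \subset f @: W by apply: imsetS; apply: subsetIr.
have fneq u t : u \notin f @: W -> t \in W -> f t != u.
  by move=> uW tW; apply: contraNneq uW => <-; apply: imset_f.
have full (S T : {set G}) (S' : {set H}) u : theta x y S T -> conn S' -> touch [set f x] S' -> touch [set f y] S' ->
    S' = u |: f @: (S :&: W) -> u \notin f @: W -> {subset M <= [predU S & [set x; y]]} ->
    {in W, forall a, adj u (f a) = (a \in M)} ->
    forall T' : {set H}, conn T' -> touch [set f x] T' -> touch [set f y] T' -> T' = f @: (T :&: W) -> touch S T.
  move=> thS cS' Sx Sy SE uW Msub ua T' cT' Tx Ty TE.
  case/and5P: (thS) => _ /and3P[_ _ dST] /and4P[xS yS xT yT] _ _.
  have : touch S' T'.
    apply: (gH (f x) (f y)); rewrite /theta fadj // xy cS' cT' Sx Sy Tx Ty SE TE.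
    rewrite !in_setU1 !negb_or !fneq // !nin // disjUl disj1l dis // andbT /= andbT.
    by apply: contra uW; apply: (subsetP (sub T)).
  rewrite SE TE touchUl => /orP[|/tch //].
  move=> /touch1P[_ /imsetP[t /setIP[tT tW] ->]]; rewrite ua // => /Msub; rewrite !inE.
  by case/or3P => [tS|/eqP E|/eqP E]; [rewrite (disjointFr dST tS) in tT | rewrite -E tT in xT | rewrite -E tT in yT].
have [A' [cA' A'x A'y [AE|[u [AE uW MA [mA mAA mAM] uA]]]]] := piece cA xW yW xy xA yA Ax Ay;
have [B' [cB' B'x B'y [BE|[v [BE vW MB [mB mBB mBM] vB]]]]] := piece cB xW yW xy xB yB Bx By.
- apply: tch; rewrite -AE -BE; apply: (gH (f x) (f y)).
  by rewrite /theta fadj // xy cA' cB' A'x A'y B'x B'y AE BE dis // !nin.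
- by rewrite touchC; apply: (full _ _ _ _ (thetaX th) cB' B'x B'y BE vW MB vB _ cA' A'x A'y AE).
- exact: (full _ _ _ _ th cA' A'x A'y AE uW MA uA _ cB' B'x B'y BE).
have := MB _ mAM; rewrite !inE => /or3P[h|/eqP E|/eqP E].
- by rewrite (disjointFr dAB mAA) in h.
- by rewrite -E mAA in xA.
- by rewrite -E mAA in yA.
Qed.
End Side.

(** * Two sides joined by a complete bipartite set of edges *)

Section Join.
Variables (G H : sgraph) (X N N' : {set G}) (f : G -> H) (u : H).
Hypothesis NX : N \subset X.
Hypothesis NX' : {in N', forall b, b \notin X}.
Hypothesis crossE : forall a b, a \in X -> b \notin X -> adj a b = (a \in N) && (b \in N').
Hypothesis stN : {in N &, forall a b, ~~ adj a b}.
Hypothesis finj : {in X &, injective f}.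
Hypothesis fadj : {in X &, forall a b, adj (f a) (f b) = adj a b}.
Hypothesis uX : u \notin f @: X.
Hypothesis uadj : {in X, forall a, adj u (f a) = (a \in N)}.
Hypothesis gH : good H.
Implicit Types (A B S T : {set G}) (x y a b s t : G).

Lemma join_edge a b : a \in N -> b \in N' -> adj a b.
Proof. by move=> aN bN; rewrite crossE ?aN ?bN //; [apply: (subsetP NX) | apply: NX']. Qed.

Let g z := if z \in X then f z else u.

Lemma join_adj a b : adj a b -> g a = g b \/ adj (g a) (g b).
Proof.
rewrite /g; case: ifP => aX; case: ifP => bX ab.
- by right; rewrite fadj.
- by right; rewrite adj_sym uadj //; move: ab; rewrite crossE ?bX // => /andP[].
- by right; rewrite uadj //; move: ab; rewrite adj_sym crossE ?aX // => /andP[].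
- by left.
Qed.

Lemma join_adjX a b : a \in X -> adj a b -> adj (g a) (g b).
Proof.
move=> aX ab; case: (join_adj ab) => //; rewrite /g aX; case: ifP => bX E.
  by move: ab; rewrite (finj aX bX E) adj_irr.
by case/imsetP: uX; exists a.
Qed.

Lemma join_touch t S : t \in X -> touch [set t] S -> touch [set f t] (g @: S).
Proof.
move=> tX /touch1P[s sS ts]; apply/touch1P; exists (g s); first exact: imset_f.
by have := join_adjX tX ts; rewrite {1}/g tX.
Qed.

Lemma join_conn S : conn S -> conn (g @: S).
Proof. by move=> cS; apply: conn_image cS _ => a b _ _; apply: join_adj. Qed.

Lemma join_nin S t : t \in X -> t \notin S -> f t \notin g @: S.
Proof.
move=> tX tS; apply/imsetP => -[s sS]; rewrite /g; case: ifP => sX E.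
  by move: tS; rewrite (finj tX sX E) sS.
by case/imsetP: uX; exists t.
Qed.

Lemma join_dis S T : T \subset X -> [disjoint S & T] -> [disjoint g @: S & g @: T].
Proof.
move=> TX dST; rewrite disjoint_sym; apply: disjointI => _ /imsetP[t tT ->].
have tX := subsetP TX t tT; rewrite {1}/g tX; apply: join_nin => //.
by rewrite (disjointFl dST tT).
Qed.

Lemma join_cross_edge S : conn S -> ~~ (S \subset X) -> ~~ [disjoint S & X] ->
  (exists2 s, s \in S & s \in N) /\ (exists2 s, s \in S & s \in N').
Proof.
move=> cS /subsetPn[r rS rX]; rewrite -setI_eq0 => /set0Pn[z /setIP[zS zX]].
have /touchP[s [t [/setIP[sS sX] /setDP[tS tX]]]] := conn_cross cS zS rS zX rX.
by rewrite crossE // => /andP[sN tN]; split; [exists s | exists t].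
Qed.

(** [g] contracts the other side to [u]. If only one of the sets leaves [X], an edge at [u] between
    the images is replaced by an edge at a node of [N'] in that set. If both leave [X], one contains
    a node of [N] and the other a node of [N']. *)
Lemma join_side x y A B : theta x y A B -> x \in X -> y \in X -> touch A B.
Proof.
move=> th xX yX.
have meets S T : theta x y S T -> S \subset X \/
    (exists2 s, s \in S & s \in N) /\ (exists2 s, s \in S & s \in N').
  case/and5P=> xy /and3P[cS _ _] _ /andP[/touch1P[s sS xs] /touch1P[t tS yt]] _.
  have [SX|SX] := boolP (S \subset X); [by left | right].
  apply: join_cross_edge => //; apply/negP => dSX.
  have [sX tX] : s \notin X /\ t \notin X by rewrite (disjointFr dSX sS) (disjointFr dSX tS).
  by move: xs yt; rewrite !crossE // => /andP[xN _] /andP[yN _]; have := stN xN yN; rewrite xy.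
have main S T : theta x y S T -> T \subset X -> touch S T.
  move=> thS TX; case/and5P: (thS) => xy /and3P[cS cT dST] /and4P[xS yS xT yT] /andP[Sx Sy] /andP[Tx Ty].
  have : touch (g @: S) (g @: T).
    apply: (gH (x := f x) (y := f y)).
    by rewrite /theta fadj // xy !join_conn // join_dis // !join_nin // !join_touch.
  move=> /touchP[_ [_ [/imsetP[s sS ->] /imsetP[t tT ->]]]].
  have tX := subsetP TX t tT; rewrite /g tX; case: ifP => sX st.
    by apply/touchP; exists s, t; rewrite -fadj.
  case: (meets _ _ thS) => [SX|[_ [s' s'S s'N]]]; first by rewrite (subsetP SX) in sX.
  by apply/touchP; exists s', t; split=> //; rewrite adj_sym join_edge // -uadj.
case: (meets _ _ (thetaX th)) => [BX|[_ [b bB bN]]]; first exact: main th BX.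
case: (meets _ _ th) => [AX|[[a aA aN] _]]; first by rewrite touchC; apply: main (thetaX th) AX.
by apply/touchP; exists a, b; split=> //; apply: join_edge.
Qed.

(** The end [y] lies across the join and is represented by [u]. *)
Lemma join_same x y A B : theta x y A B -> A \subset X -> B \subset X -> x \in N -> y \in N' ->
  touch A B.
Proof.
move=> th AX BX xN yN.
case/and5P: (th) => xy /and3P[cA cB dAB] /and4P[xA yA xB yB] /andP[Ax Ay] /andP[Bx By].
have xX := subsetP NX x xN; have yX := NX' yN.
have tu S : S \subset X -> touch [set y] S -> touch [set u] (g @: S).
  move=> SX /touch1P[s sS ys]; have sX := subsetP SX s sS.
  apply/touch1P; exists (g s); first exact: imset_f.
  by move: ys; rewrite /g sX uadj // adj_sym crossE // => /andP[].
have nu S : S \subset X -> u \notin g @: S.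
  move=> SX; apply: contra uX => /imsetP[s sS ->]; have sX := subsetP SX s sS.
  by rewrite /g sX imset_f.
have : touch (g @: A) (g @: B).
  apply: (gH (x := f x) (y := u)).
  by rewrite /theta adj_sym uadj // xN !join_conn // join_dis // !join_nin // !nu // !join_touch // !tu.
move=> /touchP[_ [_ [/imsetP[s sS ->] /imsetP[t tT ->]]]].
have tX := subsetP BX t tT; have sX := subsetP AX s sS; rewrite /g tX sX fadj // => st.
by apply/touchP; exists s, t.
Qed.
End Join.

Lemma join_good (G H1 H2 : sgraph) (X N N' : {set G}) (f1 : G -> H1) (f2 : G -> H2) u1 u2 :
  N \subset X -> {in N', forall b, b \notin X} ->
  (forall a b, a \in X -> b \notin X -> adj a b = (a \in N) && (b \in N')) ->
  {in N &, forall a b, ~~ adj a b} -> {in N' &, forall a b, ~~ adj a b} ->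
  {in X &, injective f1} -> {in ~: X &, injective f2} ->
  {in X &, forall a b, adj (f1 a) (f1 b) = adj a b} ->
  {in ~: X &, forall a b, adj (f2 a) (f2 b) = adj a b} ->
  u1 \notin f1 @: X -> u2 \notin f2 @: (~: X) ->
  {in X, forall a, adj u1 (f1 a) = (a \in N)} ->
  {in ~: X, forall a, adj u2 (f2 a) = (a \in N')} -> good H1 -> good H2 -> good G.
Proof.
move=> NX NX' cr st st' i1 i2 a1 a2 nu1 nu2 ua1 ua2 g1 g2.
have NX2 : N' \subset ~: X by apply/subsetP => z zN; rewrite in_setC NX'.
have NX2' : {in N, forall b, b \notin ~: X} by move=> z zN; rewrite in_setC negbK (subsetP NX).
have cr2 a b : a \in ~: X -> b \notin ~: X -> adj a b = (a \in N') && (b \in N).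
  by rewrite !in_setC negbK adj_sym andbC => aX bX; apply: cr.
(* The chord crosses the join. Each of [A] and [B] lies in [X] or meets [N'], and lies outside [X]
   or meets [N]. Unless one meets [N] and the other [N'], both lie on the same side and [join_same]
   applies. *)
have crossing x y A B : theta x y A B -> x \in X -> y \notin X -> touch A B.
  move=> th xX yX; have xy : adj x y by case/and5P: th.
  move: xy; rewrite cr // => /andP[xN yN].
  case/and5P: (th) => _ /and3P[cA cB _] _ /andP[/touch1P[ax axA xa] /touch1P[ay ayA ya]].
  move=> /andP[/touch1P[bx bxB xb] /touch1P[by' byB yb]].
  have inX (S : {set G}) s t : conn S -> s \in S -> adj x s -> t \in S -> adj y t ->
      S \subset X \/ exists2 z, z \in S & z \in N'.
    move=> cS sS xs tS yt; have [SX|/subsetPn[r rS rX]] := boolP (S \subset X); [by left | right].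
    have [dSX|dSX] := boolP [disjoint S & X].
      by exists s => //; move: xs; rewrite cr ?(disjointFr dSX sS) // => /andP[].
    have nSX : ~~ (S \subset X) by apply/subsetPn; exists r.
    by have [_ h] := join_cross_edge cr cS nSX dSX.
  have inX' (S : {set G}) s t : conn S -> s \in S -> adj x s -> t \in S -> adj y t ->
      S \subset ~: X \/ exists2 z, z \in S & z \in N.
    move=> cS sS xs tS yt; have [SX|/subsetPn[r rS rX]] := boolP (S \subset ~: X); [by left | right].
    have [dSX|dSX] := boolP [disjoint S & ~: X].
      have tX : t \in X by have := disjointFr dSX tS; rewrite in_setC => /negbFE.
      by exists t => //; move: yt; rewrite adj_sym cr // => /andP[].
    have nSX : ~~ (S \subset ~: X) by apply/subsetPn; exists r.
    by have [_ h] := join_cross_edge cr2 cS nSX dSX.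
  have nn a b : a \in A -> b \in B -> (a \in N) && (b \in N') || (a \in N') && (b \in N) -> touch A B.
    move=> aA bB /orP[/andP[aN bN]|/andP[aN bN]]; apply/touchP; exists a, b; split=> //.
      exact: (join_edge NX NX' cr).
    by rewrite adj_sym; apply: (join_edge NX NX' cr).
  have hA := inX _ _ _ cA axA xa ayA ya; have hA' := inX' _ _ _ cA axA xa ayA ya.
  have hB := inX _ _ _ cB bxB xb byB yb; have hB' := inX' _ _ _ cB bxB xb byB yb.
  case: hA' => [AX|[a aA aN]]; last first.
    case: hB => [BX|[b bB bN]]; last by apply: (nn a b) => //; rewrite aN bN.
    case: hA => [AX|[a' a'A a'N]]; first exact: (join_same NX NX' cr i1 a1 nu1 ua1 g1 th AX BX xN yN).
    case: hB' => [BX'|[b' b'B b'N]]; last by apply: (nn a' b') => //; rewrite a'N b'N orbT.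
    by have := subsetP BX' _ bxB; rewrite in_setC (subsetP BX).
  case: hA => [AX'|[a aA aN]]; first by have := subsetP AX _ axA; rewrite in_setC (subsetP AX').
  case: hB' => [BX|[b bB bN]]; last by apply: (nn a b) => //; rewrite aN bN orbT.
  exact: (join_same NX2 NX2' cr2 i2 a2 nu2 ua2 g2 (thetaC th) AX BX yN xN).
move=> x y A B th.
have [xX|xX] := boolP (x \in X); have [yX|yX] := boolP (y \in X).
- exact: (join_side NX NX' cr st i1 a1 nu1 ua1 g1 th).
- exact: crossing th xX yX.
- exact: crossing (thetaC th) yX xX.
by apply: (join_side NX2 NX2' cr2 st' i2 a2 nu2 ua2 g2 th); rewrite in_setC.
Qed.

(** * The four operations *)

Lemma union_adj (G1 G2 : sgraph) (x y : disjoint_union G1 G2) : adj x y =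
  match x, y with inl a, inl b => adj a b | inr a, inr b => adj a b | _, _ => false end.
Proof.
rewrite /= /sym_adj; case: x y => a [] b //=; rewrite (adj_sym b a) orbb; case: eqP => // -[->];
  by rewrite adj_irr.
Qed.

Lemma node_adj (G : sgraph) (S : {set G}) (x y : add_node S) : adj x y =
  match x, y with
  | Some a, Some b => adj a b | None, Some b => b \in S | Some a, None => a \in S | _, _ => false
  end.
Proof.
rewrite /= /sym_adj; case: x y => [a|] [b|] //=; last by rewrite orbF.
by rewrite (adj_sym b a) orbb; case: eqP => // -[->]; rewrite adj_irr.
Qed.

Lemma edges_adj (G : sgraph) (A B : {set G}) (x y : add_all_edges A B) : [disjoint A & B] ->
  adj x y = @adj G x y || (x \in A) && (y \in B) || (y \in A) && (x \in B).
Proof.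
move=> dAB; rewrite /= /sym_adj (@adj_sym G y x); case: eqVneq => [->|_] /=.
  by rewrite adj_irr; case yA: (y \in A); rewrite // (disjointFr dAB yA).
by rewrite orbACA orbb orbA.
Qed.

Lemma remainder_adj (G1 G2 : sgraph) (S1 : {set G1}) (S2 : {set G2}) (x y : remainder S1 S2) :
  adj x y = match x, y with
    inl a, inl b => adj (val a) (val b) | inr a, inr b => adj (val a) (val b) | _, _ => false end.
Proof. by rewrite union_adj. Qed.

Lemma O0_good (G1 G2 G : sgraph) : O0 G1 G2 G -> good G1 -> good G2 -> good G.
Proof.
move=> /iso_good iG g1 g2; apply: iG => x y A B th.
have xy : adj x y by case/and5P: th.
case: x y th xy => [x|x] [y|y] th; rewrite union_adj // => xy.
  pose W : {set disjoint_union G1 G2} := [set z | if z is inl _ then true else false].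
  apply: (@side_good _ G1 W set0 (fun z => if z is inl a then a else x) _ _ _ _ _ g1 _ _ _ _ th).
  - by move=> [a|a] [b|b]; rewrite ?inE // union_adj.
  - by move=> ? ?; rewrite inE.
  - by move=> [a|a] [b|b]; rewrite !inE // => _ _ ->.
  - by move=> [a|a] [b|b]; rewrite !inE // union_adj.
  - by move=> ? ?; rewrite inE.
  - by rewrite inE.
  by rewrite inE.
pose W : {set disjoint_union G1 G2} := [set z | if z is inr _ then true else false].
apply: (@side_good _ G2 W set0 (fun z => if z is inr a then a else x) _ _ _ _ _ g2 _ _ _ _ th).
- by move=> [a|a] [b|b]; rewrite ?inE // union_adj.
- by move=> ? ?; rewrite inE.
- by move=> [a|a] [b|b]; rewrite !inE // => _ _ ->.
- by move=> [a|a] [b|b]; rewrite !inE // union_adj.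
- by move=> ? ?; rewrite inE.
- by rewrite inE.
by rewrite inE.
Qed.

(** Every edge lies within one side, the merged node belonging to both, so the chord does too. With
    [M] a single node, the condition on hubs is vacuous. *)
Lemma O1_good (G1 G2 G : sgraph) : O1 G1 G2 G -> good G1 -> good G2 -> good G.
Proof.
move=> [u [w /iso_good iG]] g1 g2; apply: iG; set R := remainder [set u] [set w].
set K := add_node _; pose M : {set K} := [set None].
have neU (a : {x | x \in ~: [set u]}) : val a != u by have := valP a; rewrite !inE.
have neW (a : {x | x \in ~: [set w]}) : val a != w by have := valP a; rewrite !inE.
pose W1 : {set K} := [set z : K | if z is Some (inr _) then false else true].
pose W2 : {set K} := [set z : K | if z is Some (inl _) then false else true].
pose f1 (z : K) := if z is Some (inl a) then val a else u.
pose f2 (z : K) := if z is Some (inr a) then val a else w.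
have side1 (x y : K) A B : theta x y A B -> x \in W1 -> y \in W1 -> touch A B.
  apply: (@side_good _ G1 W1 M f1) => //.
  - by move=> [[a|a]|] [[b|b]|]; rewrite !inE // node_adj // remainder_adj.
  - by move=> a b /set1P-> /set1P->; rewrite adj_irr.
  - move=> [[a|a]|] [[b|b]|]; rewrite !inE //= => _ _ E.
    + by rewrite (val_inj E).
    + by case/eqP: (neU a).
    by case/eqP: (neU b).
  - move=> [[a|a]|] [[b|b]|]; rewrite !inE // => _ _; rewrite node_adj ?remainder_adj ?adj_irr //.
      by rewrite !inE /= orbF adj_sym.
    by rewrite !inE /= orbF.
  by move=> m m' /set1P-> /set1P->; rewrite eqxx.
have side2 (x y : K) A B : theta x y A B -> x \in W2 -> y \in W2 -> touch A B.
  apply: (@side_good _ G2 W2 M f2) => //.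
  - by move=> [[a|a]|] [[b|b]|]; rewrite !inE // node_adj // remainder_adj.
  - by move=> a b /set1P-> /set1P->; rewrite adj_irr.
  - move=> [[a|a]|] [[b|b]|]; rewrite !inE //= => _ _ E.
    + by rewrite (val_inj E).
    + by case/eqP: (neW a).
    by case/eqP: (neW b).
  - move=> [[a|a]|] [[b|b]|]; rewrite !inE // => _ _; rewrite node_adj ?remainder_adj ?adj_irr //.
      by rewrite !inE /= adj_sym.
    by rewrite !inE.
  by move=> m m' /set1P-> /set1P->; rewrite eqxx.
move=> x y A B th; have xy : adj x y by case/and5P: th.
case: x y th xy => [[x|x]|] [[y|y]|] th xy;
  by [apply: (side1 _ _ _ _ th); rewrite inE | apply: (side2 _ _ _ _ th); rewrite inE
     | move: xy; rewrite node_adj remainder_adj].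
Qed.

Lemma O2_good (G1 G2 G : sgraph) : O2 G1 G2 G -> good G1 -> good G2 -> good G.
Proof.
move=> [u [w [[st1 _] [st2 _] /iso_good iG]]] g1 g2; apply: iG; set K := add_all_edges _ _.
have neU (a : {x | x \in ~: [set u]}) : val a != u by have := valP a; rewrite !inE.
have neW (a : {x | x \in ~: [set w]}) : val a != w by have := valP a; rewrite !inE.
have dis : [disjoint fromL [set u] [set w] (nbh u) & fromR [set u] [set w] (nbh w)].
  by apply: disjointI => -[a|a]; rewrite !inE.
pose X : {set K} := [set z : K | if z is inl _ then true else false].
pose f1 (z : K) := if z is inl a then val a else u.
pose f2 (z : K) := if z is inr a then val a else w.
apply: (@join_good K G1 G2 X (fromL [set u] [set w] (nbh u)) (fromR [set u] [set w] (nbh w)) f1 f2 u w) => //.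
- by apply/subsetP => -[a|a]; rewrite !inE.
- by move=> [a|a]; rewrite !inE.
- by move=> [a|a] [b|b]; rewrite ?inE // => _ _; rewrite edges_adj // remainder_adj !inE ?andbF ?orbF.
- move=> [a|a] [b|b]; rewrite ?inE // => ua ub; rewrite edges_adj // remainder_adj !inE ?andbF ?orbF.
  by apply: st1; rewrite inE.
- move=> [a|a] [b|b]; rewrite ?inE // => ua ub; rewrite edges_adj // remainder_adj !inE ?andbF ?orbF.
  by apply: st2; rewrite inE.
- by move=> [a|a] [b|b]; rewrite ?inE // => _ _ /val_inj->.
- by move=> [a|a] [b|b]; rewrite ?inE // => _ _ /val_inj->.
- by move=> [a|a] [b|b]; rewrite ?inE // => _ _; rewrite edges_adj // remainder_adj !inE ?andbF ?orbF.
- by move=> [a|a] [b|b]; rewrite ?inE // => _ _; rewrite edges_adj // remainder_adj !inE ?andbF ?orbF.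
- by apply/imsetP => -[[a|a]]; rewrite inE // => _ E; case/eqP: (neU a).
- by apply/imsetP => -[[a|a]]; rewrite ?inE // => _ E; case/eqP: (neW a).
- by move=> [a|a]; rewrite !inE.
- by move=> [a|a]; rewrite !inE.
Qed.

(** As for [O1], with the two new nodes as [M]. The hubs are [u] and [v], the degree-2 nodes removed
    by the operation. *)
Lemma O3_good (G1 G2 G : sgraph) : O3 G1 G2 G -> good G1 -> good G2 -> good G.
Proof.
move=> [u [u1 [u2 [v [v1 [v2 [[du nu nu12 _] [dv nv nv12 _] _ _ /iso_good iG]]]]]]] g1 g2.
apply: iG; rewrite /O3_graph; set K := add_node _.
have u12 : u1 != u2 by move: du; rewrite /deg nu cards2; case: (u1 != u2).
have v12 : v1 != v2 by move: dv; rewrite /deg nv cards2; case: (v1 != v2).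
have uadj a : adj u a = (a == u1) || (a == u2) by rewrite -in_set2 -nu inE.
have vadj a : adj v a = (a == v1) || (a == v2) by rewrite -in_set2 -nv inE.
have neU (a : {x | x \in ~: [set u; u1; u2]}) : [/\ val a != u, val a != u1 & val a != u2].
  by have := valP a; rewrite !inE !negb_or -andbA => /and3P.
have neV (a : {x | x \in ~: [set v; v1; v2]}) : [/\ val a != v, val a != v1 & val a != v2].
  by have := valP a; rewrite !inE !negb_or -andbA => /and3P.
pose M : {set K} := [set None; Some None].
pose W1 : {set K} := [set z : K | if z is Some (Some (inr _)) then false else true].
pose W2 : {set K} := [set z : K | if z is Some (Some (inl _)) then false else true].
(* [Some None] is the inner new node and stands for [u1]; [None] is the outer one and stands for
   [u2]. The value on the other side is a default. *)
pose f1 (z : K) := match z with Some (Some (inl a)) => val a | None => u2 | _ => u1 end.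
pose f2 (z : K) := match z with Some (Some (inr a)) => val a | None => v2 | _ => v1 end.
have M2 (m m' : K) : m \in M -> m' \in M -> m != m' -> M = [set m; m'].
  by move=> /set2P[]-> /set2P[]->; rewrite ?eqxx // => _; exact: setUC.
have imS (z : remainder [set u; u1; u2] [set v; v1; v2]) (S : {set _}) :
    (Some z \in Some @: S) = (z \in S) by rewrite mem_imset // => ? ? [].
have noN (G' : finType) (S : {set G'}) : (None \in Some @: S) = false by apply/negbTE/imsetP => -[].
have stM : {in M &, forall a b : K, ~~ adj a b}.
  by move=> a b /set2P[]-> /set2P[]->; rewrite ?adj_irr // node_adj noN.
have [uu1 uu2] : u1 != u /\ u2 != u.
  by split; apply: (contraFneq _ (adj_irr u)) => E; rewrite uadj -E eqxx ?orbT.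
have [vv1 vv2] : v1 != v /\ v2 != v.
  by split; apply: (contraFneq _ (adj_irr v)) => E; rewrite vadj -E eqxx ?orbT.
have side1 (x y : K) A B : theta x y A B -> x \in W1 -> y \in W1 -> touch A B.
  apply: (@side_good _ G1 W1 M f1) => //.
  - by move=> [[[a|a]|]|] [[[b|b]|]|]; rewrite !inE // !node_adj // remainder_adj.
  - move=> [[[a|a]|]|] [[[b|b]|]|]; rewrite !inE // => _ _ E;
      try (have [n0 n1 n2] := neU a); try (have [m0 m1 m2] := neU b).
    + by rewrite (val_inj E).
    + by case/eqP: n1.
    + by case/eqP: n2.
    + by case/eqP: m1.
    + by case/eqP: u12.
    + by case/eqP: m2.
    by case/eqP: u12.
  - move=> [[[a|a]|]|] [[[b|b]|]|]; rewrite !inE // => _ _;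
      try (have [n0 n1 n2] := neU a); try (have [m0 m1 m2] := neU b);
      rewrite !node_adj ?remainder_adj ?adj_irr ?noN ?imS //.
    + by rewrite /O3_nbh !inE /= n0 orbF adj_sym.
    + by rewrite /O3_nbh !inE /= n0 orbF adj_sym.
    + by rewrite /O3_nbh !inE /= m0 orbF.
    + exact: negbTE.
    + by rewrite /O3_nbh !inE /= m0 orbF.
    + by rewrite adj_sym; apply: negbTE.
  move=> m m' mM m'M mm'; exists u; split; last 2 first.
  - exact: M2.
  - move=> [[[a|a]|]|]; rewrite !inE // => _; rewrite /= uadj ?eqxx ?orbT //.
    by have [_ /negbTE-> /negbTE->] := neU a.
  apply/imsetP => -[[[[a|a]|]|]]; rewrite ?inE // => _ E.
  - by have [/eqP[]] := neU a.
  - by case/eqP: uu1.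
  - by case/eqP: uu2.
have side2 (x y : K) A B : theta x y A B -> x \in W2 -> y \in W2 -> touch A B.
  apply: (@side_good _ G2 W2 M f2) => //.
  - by move=> [[[a|a]|]|] [[[b|b]|]|]; rewrite !inE // !node_adj // remainder_adj.
  - move=> [[[a|a]|]|] [[[b|b]|]|]; rewrite !inE // => _ _ E;
      try (have [n0 n1 n2] := neV a); try (have [m0 m1 m2] := neV b).
    + by rewrite (val_inj E).
    + by case/eqP: n1.
    + by case/eqP: n2.
    + by case/eqP: m1.
    + by case/eqP: v12.
    + by case/eqP: m2.
    by case/eqP: v12.
  - move=> [[[a|a]|]|] [[[b|b]|]|]; rewrite !inE // => _ _;
      try (have [n0 n1 n2] := neV a); try (have [m0 m1 m2] := neV b);
      rewrite !node_adj ?remainder_adj ?adj_irr ?noN ?imS //.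
    + by rewrite /O3_nbh !inE /= n0 adj_sym.
    + by rewrite /O3_nbh !inE /= n0 adj_sym.
    + by rewrite /O3_nbh !inE /= m0.
    + exact: negbTE.
    + by rewrite /O3_nbh !inE /= m0.
    + by rewrite adj_sym; apply: negbTE.
  move=> m m' mM m'M mm'; exists v; split; last 2 first.
  - exact: M2.
  - move=> [[[a|a]|]|]; rewrite !inE // => _; rewrite /= vadj ?eqxx ?orbT //.
    by have [_ /negbTE-> /negbTE->] := neV a.
  apply/imsetP => -[[[[a|a]|]|]]; rewrite ?inE // => _ E.
  - by have [/eqP[]] := neV a.
  - by case/eqP: vv1.
  - by case/eqP: vv2.
move=> x y A B th; have xy : adj x y by case/and5P: th.
case: x y th xy => [[[x|x]|]|] [[[y|y]|]|] th xy;
  by [apply: (side1 _ _ _ _ th); rewrite inE | apply: (side2 _ _ _ _ th); rewrite inE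
     | move: xy; rewrite !node_adj remainder_adj].
Qed.

Theorem obtained_good (G : sgraph) : obtained_from_basic G -> good G.
Proof.
elim=> {G} [G /basic_good //|G1 G2 G _ g1 _ g2|G1 G2 G _ g1 _ g2|G1 G2 G _ g1 _ g2|G1 G2 G _ g1 _ g2] o.
- exact: O0_good o g1 g2.
- exact: O1_good o g1 g2.
- exact: O2_good o g1 g2.
- exact: O3_good o g1 g2.
Qed.

(** * Decompositions *)

Lemma bij_iso (G H : sgraph) (f : H -> G) : injective f -> (forall z, exists h, f h = z) ->
  (forall x y, adj (f x) (f y) = adj x y) -> iso G H.
Proof.
move=> fI fO fE; have gP z : exists h, f h == z by have [h <-] := fO z; exists h.
pose g z := xchoose (gP z); have gK : cancel g f by move=> z; apply/eqP/(xchooseP (gP z)).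
have fK : cancel f g by move=> h; apply: fI; rewrite gK.
by exists g => [|x y]; [exists f | rewrite -fE !gK].
Qed.

(** * Recognising a graph as a composition of its parts *)

Section Splits.
Variable G : sgraph.
Implicit Types (A X Y N : {set G}) (s t u v x y z : G).

Lemma inducedK A z : z \in A -> exists z' : induced A, val z' = z.
Proof. by move=> zA; exists (exist _ z zA). Qed.

Lemma good_induced A : good G -> good (induced A).
Proof. by apply: (@good_embed G (induced A) val) => // ? ?; apply: val_inj. Qed.

Lemma card_induced A : #|induced A| = #|A|.
Proof. by rewrite card_sig; apply: eq_card => z; rewrite !inE. Qed.

Lemma induced_small A z : z \notin A -> #|induced A| < #|G|.
Proof.
move=> zA; rewrite card_induced -cardsT; apply: proper_card; rewrite properT.
by apply: contraNneq zA => ->; rewrite inE.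
Qed.

Lemma conn_induced A : conn A -> connected (induced A).
Proof.
move=> /connP cA x y; have /connectP[p] := cA _ _ (valP x) (valP y).
elim: p x => [|z p IH] x /=; first by move=> _ /val_inj->; apply: connect0.
move=> /andP[/and3P[xz _ zA] pp] E; have [z' zz] := inducedK zA.
by apply: (@connect_trans _ _ z'); [apply: connect1; rewrite /= /induced_adj zz | apply: IH; rewrite zz].
Qed.

Lemma split_O0 X : touch X (~: X) = false -> O0 (induced X) (induced (~: X)) G.
Proof.
move=> /negbT/touchPn tX; apply: (bij_iso (f := fun z : disjoint_union (induced X) (induced (~: X)) =>
  match z with inl a => val a | inr a => val a end)).
- move=> [a|a] [b|b] E; try (by rewrite (val_inj E)).
    by have := valP a; rewrite E => H; have := valP b; rewrite /= in_setC H.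
  by have := valP b; rewrite -E => H; have := valP a; rewrite /= in_setC H.
- move=> z; have [zX|zX] := boolP (z \in X).
    by have [z' <-] := inducedK zX; exists (inl z').
  by rewrite -in_setC in zX; have [z' <-] := inducedK zX; exists (inr z').
move=> [a|a] [b|b]; rewrite union_adj //; first by rewrite tX ?(valP a) ?(valP b).
by rewrite adj_sym tX ?(valP a) ?(valP b).
Qed.

Lemma split_O1 v X Y : v \notin X -> v \notin Y -> (forall z, z != v -> (z \in X) = (z \notin Y)) ->
  touch X Y = false -> O1 (induced (v |: X)) (induced (v |: Y)) G.
Proof.
move=> vX vY XY /negbT/touchPn tX.
have [u uE] := inducedK (setU11 v X); have [w wE] := inducedK (setU11 v Y).
exists u, w; set K := add_node _.
pose f (z : K) := match z with None => v | Some (inl a) => val (val a) | Some (inr a) => val (val a) end.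
have inX (a : {x | x \in ~: [set u]}) : val (val a) \in X /\ val (val a) != v.
  have av : val (val a) != v.
    have := valP a; rewrite !inE; apply: contraNN => /eqP E; apply/eqP/val_inj; by rewrite E uE.
  by have := valP (val a); rewrite /= in_setU1 (negbTE av).
have inY (a : {x | x \in ~: [set w]}) : val (val a) \in Y /\ val (val a) != v.
  have av : val (val a) != v.
    have := valP a; rewrite !inE; apply: contraNN => /eqP E; apply/eqP/val_inj; by rewrite E wE.
  by have := valP (val a); rewrite /= in_setU1 (negbTE av).
have fX a : f (Some (inl a)) \in X /\ f (Some (inl a)) != v by exact: inX.
have fY a : f (Some (inr a)) \in Y /\ f (Some (inr a)) != v by exact: inY.
apply: (bij_iso (f := f)).
- move=> [[a|a]|] [[b|b]|] // E.
  + by congr (Some (inl _)); do 2 apply: val_inj.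
  + by have [aX av] := fX a; have [bY _] := fY b; rewrite E in aX av; rewrite XY // bY in aX.
  + by have [_ /eqP[]] := fX a.
  + by have [bX bv] := fX b; have [aY _] := fY a; rewrite -E in bX bv; rewrite XY // aY in bX.
  + by congr (Some (inr _)); do 2 apply: val_inj.
  + by have [_ /eqP[]] := fY a.
  + by have [_ /eqP[]] := fX b.
  by have [_ /eqP[]] := fY b.
- move=> z; have [->|zv] := eqVneq z v; first by exists None.
  have [zY|zY] := boolP (z \in Y).
    have [z1 E1] := inducedK (setU1r v zY); have zu : z1 \in ~: [set w].
      by rewrite !inE; apply: contraNneq zv => E; rewrite -E1 E wE.
    by exists (Some (inr (exist _ z1 zu))); rewrite /f /= E1.
  have zX : z \in X by rewrite XY.
  have [z1 E1] := inducedK (setU1r v zX); have zu : z1 \in ~: [set u].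
    by rewrite !inE; apply: contraNneq zv => E; rewrite -E1 E uE.
  by exists (Some (inl (exist _ z1 zu))); rewrite /f /= E1.
move=> [[a|a]|] [[b|b]|]; rewrite node_adj ?remainder_adj //.
- by have [aX _] := inX a; have [bY _] := inY b; rewrite /= tX.
- by rewrite !inE /= orbF /induced_adj uE adj_sym.
- by have [aX _] := inX b; have [bY _] := inY a; rewrite /= adj_sym tX.
- by rewrite !inE /= /induced_adj wE adj_sym.
- by rewrite !inE /= orbF /induced_adj uE.
- by rewrite !inE /= /induced_adj wE.
by rewrite /= adj_irr.
Qed.

(** Any [b] in [N'] sees exactly [N] within [X] and can serve as marker node for that side; likewise
    [a] for the other. Both parts are therefore induced subgraphs of [G]. *)
Lemma split_O2 X (N N' : {set G}) a b : N \subset X -> {in N', forall z, z \notin X} ->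
  (forall z z', z \in X -> z' \notin X -> adj z z' = (z \in N) && (z' \in N')) ->
  {in N &, forall z z', ~~ adj z z'} -> {in N' &, forall z z', ~~ adj z z'} ->
  2 <= #|N| -> 2 <= #|N'| -> a \in N -> b \in N' ->
  O2 (induced (b |: X)) (induced (a |: ~: X)) G.
Proof.
move=> NX NX' cr st st' N2 N2' aN bN.
have aX := subsetP NX a aN; have bX := NX' b bN.
have [u uE] := inducedK (setU11 b X); have [w wE] := inducedK (setU11 a (~: X)).
have uadj (z : induced (b |: X)) : adj u z = (val z \in N).
  rewrite /= /induced_adj uE; have := valP z; rewrite /= in_setU1 => /orP[/eqP E|zX].
    by rewrite E adj_irr; apply/esym/negbTE; apply: contra bX; apply: (subsetP NX).
  by rewrite adj_sym cr // bN andbT.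
have wadj (z : induced (a |: ~: X)) : adj w z = (val z \in N').
  rewrite /= /induced_adj wE; have := valP z; rewrite /= in_setU1 in_setC => /orP[/eqP E|zX].
    by rewrite E adj_irr; apply/esym/negbTE; apply/negP => /NX'; rewrite aX.
  by rewrite cr // aN.
exists u, w; split.
- split; first by move=> z z'; rewrite !inE !uadj; apply: st.
  apply: leq_trans N2 _; apply: leq_trans (leq_imset_card val _); apply: subset_leq_card.
  apply/subsetP => z zN; have [z' E] := inducedK (setU1r b (subsetP NX z zN)).
  by apply/imsetP; exists z'; rewrite // inE uadj E.
- split; first by move=> z z'; rewrite !inE !wadj; apply: st'.
  apply: leq_trans N2' _; apply: leq_trans (leq_imset_card val _); apply: subset_leq_card.
  apply/subsetP => z zN; have zX : z \in ~: X by rewrite in_setC NX'.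
  have [z' E] := inducedK (setU1r a zX).
  by apply/imsetP; exists z'; rewrite // inE wadj E.
set K := add_all_edges _ _.
pose f (z : K) := match z with inl c => val (val c) | inr c => val (val c) end.
have inX (c : {x | x \in ~: [set u]}) : val (val c) \in X.
  have cb : val (val c) != b.
    have := valP c; rewrite !inE; apply: contraNN => /eqP E; apply/eqP/val_inj; by rewrite E uE.
  by have := valP (val c); rewrite /= in_setU1 (negbTE cb).
have inY (c : {x | x \in ~: [set w]}) : val (val c) \notin X.
  have cb : val (val c) != a.
    have := valP c; rewrite !inE; apply: contraNN => /eqP E; apply/eqP/val_inj; by rewrite E wE.
  by have := valP (val c); rewrite /= in_setU1 (negbTE cb) in_setC.
have dis : [disjoint fromL [set u] [set w] (nbh u) & fromR [set u] [set w] (nbh w)].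
  by apply: disjointI => -[c|c]; rewrite !inE.
have fX c : f (inl c) \in X by exact: inX.
have fY c : f (inr c) \notin X by exact: inY.
apply: (bij_iso (f := f)).
- move=> [c|c] [e|e] // E.
  + by congr (inl _); do 2 apply: val_inj.
  + by have := fY e; rewrite -E fX.
  + by have := fY c; rewrite E fX.
  by congr (inr _); do 2 apply: val_inj.
- move=> z; have [zX|zX] := boolP (z \in X).
    have [z1 E1] := inducedK (setU1r b zX); have zu : z1 \in ~: [set u].
      by rewrite !inE; apply: contraNneq bX => E; rewrite -uE -E E1.
    by exists (inl (exist _ z1 zu)); rewrite /f /= E1.
  have zY : z \in ~: X by rewrite in_setC.
  have [z1 E1] := inducedK (setU1r a zY); have zu : z1 \in ~: [set w].
    by rewrite !inE; apply: contraNneq zX => E; rewrite -E1 E wE.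
  by exists (inr (exist _ z1 zu)); rewrite /f /= E1.
move=> [c|c] [e|e]; rewrite edges_adj // remainder_adj !in_set ?andbF ?andbT ?orbF //.
- by rewrite !uadj !wadj /= cr ?inX ?inY.
by rewrite !uadj !wadj /= adj_sym cr ?inX ?inY // andbC.
Qed.

(** The block of a 2-cutset decomposition; the new node [None] is the marker for the other side. *)
Definition block X s t : sgraph :=
  @add_node (induced (X :|: [set s; t])) [set z | val z \in [set s; t]].

(** The value at the marker is a default. *)
Definition block_val X s t (x : block X s t) : G := if x is Some z then val z else s.

Lemma block_small X s t y y' : y \notin X :|: [set s; t] -> y' \notin X :|: [set s; t] -> y != y' ->
  #|block X s t| < #|G|.
Proof.
move=> yX yX' yy; rewrite card_option (card_induced (X :|: [set s; t])).
rewrite -(cardsC (X :|: [set s; t])) -addn2 leq_add2l.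
by apply: (@leq_size_card _ [:: y; y']); rewrite /= ?inE ?yy //; move=> z; rewrite !in_cons in_nil orbF => /orP[]/eqP->; rewrite in_setC.
Qed.

(** Contracting [D] to the marker exhibits the block as an induced minor. The marker has only two
    neighbours, so its branch set may have several nodes. *)
Lemma block_good X s t (D : {set G}) : good G -> s != t -> conn D ->
  [disjoint D & X :|: [set s; t]] -> touch D X = false -> touch D [set s] -> touch D [set t] ->
  good (block X s t).
Proof.
move=> gG st cD dD DX Ds Dt.
pose phi (x : block X s t) := if x is Some z then [set val z] else D.
have Dz (z : induced (X :|: [set s; t])) : touch D [set val z] = (val z \in [set s; t]).
  have := valP z; rewrite /= in_setU => /orP[zX|zst]; last first.
    by rewrite zst; move: zst => /set2P[]->.
  have -> : touch D [set val z] = false by apply: ntouchS (subxx _) _ DX; rewrite sub1set.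
  apply/esym/negbTE/negP => zst; have : touch D X; last by rewrite DX.
  by move: zst zX => /set2P[]-> zX; [apply: touchS Ds | apply: touchS Dt]; rewrite // sub1set.
apply: (@good_minor G _ phi) => // [[z|]|[z|] [z'|]|[z|] [z'|]|[z|]] //.
- exact: conn1.
- by move=> zz; rewrite /phi disj1l inE; apply: contraNneq zz => /val_inj->.
- by move=> _; rewrite /phi disjoint_sym; apply: disjointWr dD; rewrite sub1set (valP z).
- by move=> _; rewrite /phi; apply: disjointWr dD; rewrite sub1set (valP z').
- by move=> _; rewrite node_adj; exact: touch1.
- by move=> _; rewrite node_adj [RHS]in_set -Dz; exact: touchC.
- by move=> _; rewrite node_adj [RHS]in_set -Dz.
- by exists (val z).
move=> d3; exfalso; move: d3; rewrite ltnNge => /negP; apply.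
have sX : s \in X :|: [set s; t] by rewrite !inE eqxx !orbT.
have tX : t \in X :|: [set s; t] by rewrite !inE eqxx !orbT.
apply: leq_trans (_ : #|[set Some (exist _ s sX : induced _); Some (exist _ t tX)]| <= 2); last first.
  by rewrite cards2; case: (_ != _).
apply: subset_leq_card; apply/subsetP => -[z|]; rewrite in_set node_adj // inE => zst.
rewrite in_set2; move: zst => /set2P[E|E]; apply/orP; [left | right]; apply/eqP; congr Some; exact: val_inj.
Qed.

Section BlockFacts.
Variables (X : {set G}) (s t : G).
Hypotheses (st : s != t) (nst : ~~ adj s t) (sX : s \notin X) (tX : t \notin X).
Variables (s' t' : induced (X :|: [set s; t])).
Hypotheses (s'E : val s' = s) (t'E : val t' = t).

Let u : block X s t := None.
Let u1 : block X s t := Some s'.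
Let u2 : block X s t := Some t'.

Lemma block_nbh : nbh u = [set u1; u2].
Proof.
apply/setP => -[z|]; rewrite in_set node_adj ?in_set2 // !inE /u1 /u2.
have H (z1 z2 : induced (X :|: [set s; t])) : (Some z1 == Some z2 :> block X s t) = (val z1 == val z2).
  by apply/eqP/eqP => [[->]|/val_inj->].
by rewrite !H s'E t'E.
Qed.

Lemma block_deg : deg u = 2.
Proof.
rewrite /deg block_nbh cards2 (_ : u1 != u2) //; apply: contraNneq st => -[E].
by rewrite -s'E E t'E.
Qed.

Lemma block_nonadj : ~~ adj u1 u2.
Proof. by rewrite node_adj /= /induced_adj s'E t'E. Qed.

Lemma block_no_cutset : conn (X :|: [set s; t]) -> ~ one_cutset u.
Proof.
move=> cX [_ []]; apply/conn_setT.
have gP (z : induced (X :|: [set s; t])) : (Some z : block X s t) \in ~: [set u] by rewrite !inE.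
pose g (z : induced (X :|: [set s; t])) : delete [set u] := exist _ (Some z : block X s t) (gP z).
have -> : [set: delete [set u]] = g @: [set: induced (X :|: [set s; t])].
  apply/setP => -[[z|] zP]; rewrite inE; apply/esym.
    by apply/imsetP; exists z; rewrite ?inE //; apply: val_inj.
  by exfalso; move: zP; rewrite !inE eqxx.
apply: conn_image; first by apply/conn_setT/conn_induced.
move=> z z' _ _ zz; right; change (@adj (block X s t) (Some z) (Some z')).
by rewrite node_adj.
Qed.

Lemma block_deg1 : #|nbh s :&: X| <= deg u1 - 1.
Proof.
have uN : u \in nbh u1 by rewrite in_set node_adj /= in_set s'E set21.
have -> : deg u1 - 1 = #|nbh u1 :\ u| by rewrite /deg (cardsD1 u) uN addKn.
apply: leq_trans (leq_imset_card (@block_val X s t) _); apply: subset_leq_card.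
apply/subsetP => z /setIP[sz zX]; have zA : z \in X :|: [set s; t] by rewrite in_setU zX.
have [z' E] := inducedK zA; apply/imsetP; exists (Some z') => //.
by rewrite in_setD1 in_set node_adj /= /induced_adj s'E E; move: sz; rewrite inE.
Qed.

Lemma block_deg2 : #|nbh t :&: X| <= deg u2 - 1.
Proof.
have uN : u \in nbh u2 by rewrite in_set node_adj /= in_set t'E set22.
have -> : deg u2 - 1 = #|nbh u2 :\ u| by rewrite /deg (cardsD1 u) uN addKn.
apply: leq_trans (leq_imset_card (@block_val X s t) _); apply: subset_leq_card.
apply/subsetP => z /setIP[sz zX]; have zA : z \in X :|: [set s; t] by rewrite in_setU zX.
have [z' E] := inducedK zA; apply/imsetP; exists (Some z') => //.
by rewrite in_setD1 in_set node_adj /= /induced_adj t'E E; move: sz; rewrite inE.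
Qed.

Lemma block_rest (a : {x | x \in ~: [set u; u1; u2]}) : exists2 z, val a = Some z & val z \in X.
Proof.
case: a => -[z|] zP /=; last by exfalso; move: zP; rewrite !inE eqxx.
exists z => //; have := valP z; rewrite /= in_setU => /orP[//|/set2P[E|E]]; exfalso; move: zP.
  by rewrite (_ : z = s') ?inE ?eqxx ?orbT //; apply: val_inj; exact: (etrans E (esym s'E)).
by rewrite (_ : z = t') ?inE ?eqxx ?orbT //; apply: val_inj; exact: (etrans E (esym t'E)).
Qed.

Lemma block_restK z : z \in X -> exists a : {x | x \in ~: [set u; u1; u2]}, block_val (val a) = z.
Proof.
move=> zX; have zA : z \in X :|: [set s; t] by rewrite in_setU zX.
have [z' E] := inducedK zA; have zP : (Some z' : block X s t) \in ~: [set u; u1; u2].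
  rewrite !inE; apply/norP; split; [apply: contraNneq sX | apply: contraNneq tX] => -[E2].
    by rewrite -s'E -E2 E.
  by rewrite -t'E -E2 E.
by exists (exist (fun x : block X s t => x \in ~: [set u; u1; u2]) (Some z') zP).
Qed.
End BlockFacts.

(** The neighbours of [s] are distributed over [X] and [Y], so degree at least 3 in [G] gives the
    degree condition of the operation; likewise for [t]. *)
Lemma split_O3 X Y s t : s != t -> ~~ adj s t -> s \notin X -> t \notin X -> s \notin Y -> t \notin Y ->
  (forall z, z != s -> z != t -> (z \in X) = (z \notin Y)) -> touch X Y = false ->
  conn (X :|: [set s; t]) -> conn (Y :|: [set s; t]) -> 3 <= deg s -> 3 <= deg t ->
  O3 (block X s t) (block Y s t) G.
Proof.
move=> st nst sX tX sY tY XY /negbT/touchPn nXY cX cY ds dt.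
have sXA : s \in X :|: [set s; t] by rewrite in_setU set21 orbT.
have tXA : t \in X :|: [set s; t] by rewrite in_setU set22 orbT.
have sYA : s \in Y :|: [set s; t] by rewrite in_setU set21 orbT.
have tYA : t \in Y :|: [set s; t] by rewrite in_setU set22 orbT.
have [s1 s1E] := inducedK sXA; have [t1 t1E] := inducedK tXA.
have [s2 s2E] := inducedK sYA; have [t2 t2E] := inducedK tYA.
have degXY z : (forall w, adj z w -> (w != s) && (w != t)) ->
    deg z <= #|nbh z :&: X| + #|nbh z :&: Y|.
  move=> nz; apply: leq_trans (_ : #|(nbh z :&: X) :|: (nbh z :&: Y)| <= _).
    apply: subset_leq_card; apply/subsetP => w zw; have := zw; rewrite inE => /nz/andP[ws wt].
    by rewrite in_setU !in_setI zw /= XY //; case: (w \in Y).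
  by rewrite cardsU leq_subr.
have dsXY := degXY s; have dtXY := degXY t.
have {}dsXY : deg s <= #|nbh s :&: X| + #|nbh s :&: Y|.
  apply: dsXY => w sw; rewrite eq_sym (adj_neq sw) /=; by apply: contraNneq nst => <-.
have {}dtXY : deg t <= #|nbh t :&: X| + #|nbh t :&: Y|.
  apply: dtXY => w tw; rewrite [w == t]eq_sym (adj_neq tw) andbT.
  by apply: contraNneq nst => <-; rewrite adj_sym.
exists None, (Some s1), (Some t1), None, (Some s2), (Some t2); split.
- by split; [have := block_deg st s1E t1E | have := block_nbh s1E t1E | have := block_nonadj nst s1E t1E | apply: block_no_cutset].
- by split; [have := block_deg st s2E t2E | have := block_nbh s2E t2E | have := block_nonadj nst s2E t2E | apply: block_no_cutset].
- by apply: leq_trans ds _; apply: leq_trans dsXY _; apply: leq_add; apply: block_deg1.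
- by apply: leq_trans dt _; apply: leq_trans dtXY _; apply: leq_add; apply: block_deg2.
set K := O3_graph _ _ _ _ _ _.
pose f (z : K) := match z with None => t | Some None => s
  | Some (Some (inl a)) => block_val (val a) | Some (Some (inr a)) => block_val (val a) end.
have fX a : exists2 z, val a = Some z & f (Some (Some (inl a))) = val z /\ val z \in X.
  by have [z E zX] := block_rest s1E t1E a; exists z => //; rewrite /f E.
have fY a : exists2 z, val a = Some z & f (Some (Some (inr a))) = val z /\ val z \in Y.
  by have [z E zX] := block_rest s2E t2E a; exists z => //; rewrite /f E.
have neX z : z \in X -> z <> s /\ z <> t.
  by move=> zX; split=> E; [move: sX | move: tX]; rewrite -E zX.
have neY z : z \in Y -> z <> s /\ z <> t.
  by move=> zY; split=> E; [move: sY | move: tY]; rewrite -E zY.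
have nXnY z : z \in X -> z \in Y -> False.
  move=> zX zY; have [/eqP zs /eqP zt] := neX z zX; by move: zX; rewrite XY // zY.
apply: (bij_iso (f := f)).
- move=> [[[a|a]|]|] [[[b|b]|]|] // E;
    try (have [za Ea [fa aX]] := fX a); try (have [za Ea [fa aY]] := fY a);
    try (have [zb Eb [fb bX]] := fX b); try (have [zb Eb [fb bY]] := fY b).
  + congr (Some (Some (inl _))); apply: val_inj; rewrite Ea Eb; congr Some; apply: val_inj.
    by rewrite -fa -fb.
  + by case: (nXnY (val za)) => //; rewrite -fa E fb.
  + by case: (neX (val za) aX) => H _; case: H; rewrite -fa.
  + by case: (neX (val za) aX) => _ H; case: H; rewrite -fa.
  + by case: (nXnY (val zb)) => //; rewrite -fb -E fa.
  + congr (Some (Some (inr _))); apply: val_inj; rewrite Ea Eb; congr Some; apply: val_inj.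
    by rewrite -fa -fb.
  + by case: (neY (val za) aY) => H _; case: H; rewrite -fa.
  + by case: (neY (val za) aY) => _ H; case: H; rewrite -fa.
  + by case: (neX (val zb) bX) => H _; case: H; rewrite -fb.
  + by case: (neY (val zb) bY) => H _; case: H; rewrite -fb.
  + by case/eqP: st.
  + by case: (neX (val zb) bX) => _ H; case: H; rewrite -fb.
  + by case: (neY (val zb) bY) => _ H; case: H; rewrite -fb.
  by case/eqP: st.
- move=> z; have [->|zs] := eqVneq z s; first by exists (Some None).
  have [->|zt] := eqVneq z t; first by exists None.
  have [zY|zY] := boolP (z \in Y).
    by have [a <-] := block_restK sY tY s2E t2E zY; exists (Some (Some (inr a))).
  have zX : z \in X by rewrite XY.
  by have [a <-] := block_restK sX tX s1E t1E zX; exists (Some (Some (inl a))).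
have noN (G' : finType) (S : {set G'}) : (None \in Some @: S) = false by apply/negbTE/imsetP => -[].
have imS (G' : finType) (z : G') (S : {set G'}) : (Some z \in Some @: S) = (z \in S).
  by rewrite mem_imset // => ? ? [].
move=> [[[a|a]|]|] [[[b|b]|]|]; rewrite !node_adj ?remainder_adj ?noN ?imS ?adj_irr //;
  try (have [za Ea [fa aX]] := fX a); try (have [za Ea [fa aY]] := fY a);
  try (have [zb Eb [fb bX]] := fX b); try (have [zb Eb [fb bY]] := fY b).
- by rewrite fa fb Ea Eb node_adj.
- by rewrite fa fb nXY.
- by rewrite fa /O3_nbh in_setU !in_set orbF !Ea in_set1 node_adj /= /induced_adj s1E adj_sym.
- by rewrite fa /O3_nbh in_setU !in_set orbF !Ea in_set1 node_adj /= /induced_adj t1E adj_sym.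
- by rewrite fa fb adj_sym nXY.
- by rewrite fa fb Ea Eb node_adj.
- by rewrite fa /O3_nbh in_setU !in_set orFb !Ea in_set1 node_adj /= /induced_adj s2E adj_sym.
- by rewrite fa /O3_nbh in_setU !in_set orFb !Ea in_set1 node_adj /= /induced_adj t2E adj_sym.
- by rewrite fb /O3_nbh in_setU !in_set orbF !Eb in_set1 node_adj /= /induced_adj s1E.
- by rewrite fb /O3_nbh in_setU !in_set orFb !Eb in_set1 node_adj /= /induced_adj s2E.
- exact: negbTE.
- by rewrite fb /O3_nbh in_setU !in_set orbF !Eb in_set1 node_adj /= /induced_adj t1E.
- by rewrite fb /O3_nbh in_setU !in_set orFb !Eb in_set1 node_adj /= /induced_adj t2E.
by rewrite /= adj_sym; apply: negbTE.
Qed.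
End Splits.

(** * Finding decompositions of good graphs *)

Section Decompose.
Variable G : sgraph.
Hypothesis gG : good G.
Hypothesis c1G : forall v : G, conn (~: [set v]).
Implicit Types (A B D K L Q S X Y N : {set G}) (a b c d k q s t u v w x y z : G).

Lemma two_exits S v z : v \notin S -> z \notin S -> z != v -> S != set0 ->
  exists u w, [/\ u \in S, w \notin S, w != v & adj u w].
Proof.
move=> vS zS zv /set0Pn[u uS].
have uv : u \in ~: [set v] by rewrite !inE; apply: contraNneq vS => <-.
have zv' : z \in ~: [set v] by rewrite !inE.
have /touchP[s [t [/setIP[_ sS] /setDP[tv tS] st]]] := conn_cross (c1G v) uv zv' uS zS.
by exists s, t; split=> //; move: tv; rewrite !inE.
Qed.

Lemma comp_notin K w : w \notin K -> [disjoint comp (~: K) w & K].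
Proof. by rewrite -in_setC => wK; have := comp_sub wK; rewrite subsets_disjoint setCK. Qed.

Lemma comp_exit K w u z : w \notin K -> u \in comp (~: K) w -> z \notin comp (~: K) w -> adj u z -> z \in K.
Proof.
move=> wK uC zC uz; rewrite -in_setC in wK; apply: contraNT zC => zK.
by apply: (comp_closed wK uC _ uz); rewrite in_setC.
Qed.

(** Let [K] be a maximal clique containing the triangle. A node outside sees at most one node of
    [K], since two nodes that it sees and one that it does not would violate goodness. If there are
    nodes outside, the absence of cutnodes gives a connected set outside meeting two nodes of [K].
    In a minimal one goodness forces a contact with a third, and cutting there gives a smaller
    one. *)
Lemma triangle_clique x y z : adj x y -> adj y z -> adj z x -> is_clique G.
Proof.
move=> xy yz zx.
pose P K := [forall a in K, forall b in K, (a != b) ==> adj a b].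
have PP K : reflect {in K &, forall a b, a != b -> adj a b} (P K).
  apply: (iffP forall_inP) => [H a b aK bK ab|H a aK].
    by move/forall_inP: (H a aK) => /(_ b bK)/implyP; apply.
  by apply/forall_inP => b bK; apply/implyP; apply: H.
have P3 : P [set x; y; z].
  apply/PP => a b; rewrite !inE -!orbA => /or3P[]/eqP-> /or3P[]/eqP->; rewrite ?eqxx //;
    by rewrite adj_sym.
have [K mK K3] := maxset_exists P3; have /PP KK := maxsetp mK.
have [xK yK zK] : [/\ x \in K, y \in K & z \in K].
  by split; apply: (subsetP K3); rewrite !inE eqxx ?orbT.
have [/subsetP KT|/subsetPn[w0 _ w0K]] := boolP ([set: G] \subset K).
  by move=> a b ab; apply: KK; rewrite ?KT ?inE.
have one w k k' : w \notin K -> k \in K -> k' \in K -> adj w k -> adj w k' -> k = k'.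
  move=> wK kK k'K wk wk'; apply/eqP; apply: contraT => kk'; exfalso; case/negP: (wK).
  have /maxsetP[_ /(_ (w |: K)) H] := mK; rewrite -H ?setU11 ?subsetUr //.
  have al k2 : k2 \in K -> adj w k2.
    move=> k2K; apply: contraT => n2.
    have [e1 e2] : k2 != k /\ k2 != k' by split; apply: contraNneq n2 => ->.
    have : touch [set w] [set k2].
      have [f1 f2 f3] : [/\ k != w, k' != w & w != k2].
        by split; [apply: contraNneq wK => <- | apply: contraNneq wK => <- | apply: contraNneq wK => ->].
      have [e3 e4] : k != k2 /\ k' != k2 by rewrite !(eq_sym _ k2).
      apply: (gG (x := k) (y := k')); rewrite /theta !conn1 disj1l !touch1 !in_set1 f1 f2 f3 e3 e4.
      by rewrite (KK k k') // (KK k k2) // (KK k' k2) // adj_sym wk adj_sym wk'.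
    by rewrite touch1 (negbTE n2).
  apply/PP => a b /setU1P[->|aK] /setU1P[->|bK]; rewrite ?eqxx // => ab; try exact: al.
    by rewrite adj_sym; apply: al.
  exact: KK.
pose R Q := [&& conn Q, Q \subset ~: K & [exists k in K, exists k' in K,
  [&& k != k', touch Q [set k] & touch Q [set k']]]].
have RI Q k k' : conn Q -> Q \subset ~: K -> k \in K -> k' \in K -> k != k' ->
    touch Q [set k] -> touch Q [set k'] -> R Q.
  move=> cQ QK kK k'K kk' Qk Qk'; rewrite /R cQ QK /=; apply/exists_inP; exists k => //.
  by apply/exists_inP; exists k'; rewrite // kk' Qk.
pose D := comp (~: K) w0; have w0K' : w0 \in ~: K by rewrite in_setC.
have DK : D \subset ~: K := comp_sub w0K'.
have nD k : k \in K -> k \notin D by move=> kK; apply: contraTN kK => /(subsetP DK); rewrite in_setC.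
have D0 : D != set0 by apply/set0Pn; exists w0; apply: comp_refl.
have xy' := adj_neq xy.
have [u [k [uD kD _ uk]]] : exists u w, [/\ u \in D, w \notin D, w != x & adj u w].
  by apply: (two_exits (nD x xK) (nD y yK) _ D0); rewrite eq_sym.
have kK := comp_exit w0K uD kD uk.
have [k2 k2K k2k] : exists2 k2, k2 \in K & k2 != k.
  by have [<-|xk] := eqVneq x k; [exists y; rewrite // eq_sym | exists x].
have [u' [k' [u'D k'D k'k u'k']]] := two_exits (nD k kK) (nD k2 k2K) k2k D0.
have k'K := comp_exit w0K u'D k'D u'k'.
have RD : R D.
  apply: (RI D k' k) => //; first exact: comp_conn.
    by apply/touchP; exists u', k'; rewrite inE.
  by apply/touchP; exists u, k; rewrite inE.
have [Q mQ _] := minset_exists RD; have /and3P[cQ QK /exists_inP[h hK /exists_inP[h' h'K]]] := minsetp mQ.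
case/and3P=> hh' Qh Qh'.
have [L mL LQ] := minlink_exists cQ Qh Qh'.
have LE : L = Q.
  have /and3P[cL Lh Lh'] := minlink_links mL.
  have /minsetP[_ H] := mQ; apply: H => //; apply: (RI L h h') => //; exact: subset_trans LQ QK.
rewrite LE in mL.
have [h3 h3K /andP[h3h h3h']] : exists2 h3, h3 \in K & (h3 != h) && (h3 != h').
  have [yz' zx'] := (adj_neq yz, adj_neq zx).
  have := @leq_size_card _ [:: x; y; z] K; rewrite /= !inE negb_or xy' yz' (eq_sym x) zx' => /(_ isT) H.
  have : 3 <= #|K| by apply: H => a; rewrite !inE => /or3P[]/eqP->.
  rewrite (cardsD1 h) hK (cardsD1 h') in_setD1 eq_sym hh' h'K !add1n !ltnS card_gt0 => /set0Pn[h3].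
  by rewrite !in_setD1 => /and3P[a1 a2 a3]; exists h3; rewrite ?a1 ?a2.
have [Qh3|Qh3] := boolP (touch Q [set h3]).
  have /touchP[q [h3' [qQ /set1P-> qh3]]] := Qh3.
  have qK : q \notin K by have := subsetP QK q qQ; rewrite in_setC.
  have nq k0 : k0 \in K -> h3 != k0 -> adj q k0 = false.
    by move=> k0K ne; apply: contraNF ne => qk0; rewrite (one q h3 k0).
  have [Q1 [Q2 s]] := split_minlink mL qQ.
  have Q10 : (Q1 == set0) = false by rewrite -(split_uX s) touch1 nq.
  have Q20 : Q2 != set0 by rewrite -(split_uY s) touch1 nq.
  have QE : Q1 :|: [set q] = Q.
    have /minsetP[_ H] := mQ; apply: H; last by rewrite (split_eq s) subsetUl.
    apply: (RI _ h h3) => //; rewrite 1?eq_sym //.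
    - by apply: conn_touch (split_c1 s) (conn1 _) _; rewrite touchC (split_u1t s) Q10.
    - by apply: subset_trans QK; rewrite (split_eq s) subsetUl.
    - by rewrite touchUl (split_X1 s) Q10.
    by rewrite touchUl !touch1 qh3 orbT.
  have /set0Pn[z0 z0Q] := Q20; exfalso.
  have : z0 \in Q1 :|: [set q] by rewrite QE (split_eq s) in_setU z0Q orbT.
  case/setUP => [z1|/set1P z0q]; first by move: (disjointFr (split_dis s) z1); rewrite z0Q.
  by move: (split_u2 s); rewrite -z0q z0Q.
exfalso; case/negP: Qh3; have nQ k0 : k0 \in K -> k0 \notin Q.
  by move=> k0K; apply: contraTN k0K => /(subsetP QK); rewrite in_setC.
apply: (gG (x := h) (y := h')).
have [e1 e2] : h != h3 /\ h' != h3 by rewrite !(eq_sym _ h3).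
rewrite /theta (KK h h') // cQ conn1 disj1r !nQ // !in_set1 e1 e2 !touch1.
by rewrite ![touch [set _] Q]touchC Qh Qh' (KK h h3) // (KK h' h3).
Qed.

Definition complete A B := [forall a in A, forall b in B, adj a b].

Lemma completeP A B : reflect {in A & B, forall a b, adj a b} (complete A B).
Proof.
apply: (iffP forall_inP) => [H a b aA bB|H a aA]; first by move/forall_inP: (H a aA); apply.
by apply/forall_inP => b bB; apply: H.
Qed.

(** [A] and [B] form a complete pair with as many nodes as possible. A minimal connection [L]
    between them misses some [a'] in [A] and some [b'] in [B], as its end nodes could otherwise be
    added to the pair. Then [L] and the set of [a'] and [b'] would make the edge [a1 b1] between its
    contacts a unique chord. So every outside component belongs to one side of the join. *)
Lemma square_O2 a b c d : (forall x y z, adj x y -> adj y z -> adj z x -> False) ->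
  adj a b -> adj b c -> adj c d -> adj d a -> a != c -> b != d ->
  exists G1 G2, [/\ good G1, good G2, #|G1| < #|G|, #|G2| < #|G| & O2 G1 G2 G].
Proof.
move=> c3 ab bc cd da ac bd.
pose P (q : {set G} * {set G}) := [&& complete q.1 q.2, 2 <= #|q.1| & 2 <= #|q.2|].
have P0 : P ([set a; c], [set b; d]).
  rewrite /P /= !cards2 ac bd andbT; apply/completeP => x y /set2P[]-> /set2P[]-> //; by rewrite adj_sym.
case: (arg_maxnP (fun q : {set G} * {set G} => #|q.1| + #|q.2|) P0) => -[A B] /= /and3P[/completeP AB A2 B2] max.
have [a0 a0A] : exists a0, a0 \in A by apply/set0Pn; rewrite -card_gt0 (ltn_trans _ A2).
have [b0 b0B] : exists b0, b0 \in B by apply/set0Pn; rewrite -card_gt0 (ltn_trans _ B2).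
have stA : {in A &, forall x y, ~~ adj x y}.
  by move=> x y xA yA; apply/negP => xy; apply: (c3 x y b0 xy); [apply: AB | rewrite adj_sym; apply: AB].
have stB : {in B &, forall x y, ~~ adj x y}.
  by move=> x y xB yB; apply/negP => xy; apply: (c3 x y a0 xy); [rewrite adj_sym; apply: AB | apply: AB].
have dAB x : x \in A -> x \notin B by move=> xA; apply/negP => xB; have := AB x x xA xB; rewrite adj_irr.
pose K := A :|: B.
have key w : w \notin K -> touch (comp (~: K) w) A -> touch (comp (~: K) w) B = false.
  move=> wK tA; apply/negbTE/negP => tB; have wK' : w \in ~: K by rewrite in_setC.
  have dK := comp_notin wK.
  have [L mL LD] := minlink_exists (comp_conn wK') tA tB.
  have LK z : z \in L -> (z \notin A) && (z \notin B).
    by move=> zL; have := disjointFr dK (subsetP LD z zL); rewrite in_setU => /negbT; rewrite negb_or.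
  have far (S T : {set G}) s0 : minlink S T L -> s0 \in S -> (forall q, q \in L -> {in S, forall s, adj q s} -> False) ->
      touch L S -> exists s1 s', [/\ s1 \in S, touch L [set s1], s' \in S & touch L [set s'] = false].
    move=> mST s0S nall /touchP[q [s1 [qL s1S qs1]]].
    have [L1 [L2 s]] := split_minlink mST qL.
    have L10 : L1 = set0 by apply/eqP; rewrite -(split_uX s); apply/touch1P; exists s1.
    have [/forall_inP H|] := boolP [forall s in S, adj q s]; first by case: (nall q qL).
    move=> /forall_inPn[s' s'S qs']; exists s1, s'; split=> //; first by apply/touchP; exists q, s1; rewrite inE.
    rewrite (split_eq s) L10 set0U touchUl touch1 (negbTE qs') /=.
    by apply: ntouchS (subxx _) _ (split_X2 s); rewrite sub1set.
  have /and3P[cL LA LB] := minlink_links mL.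
  have [a1 [a' [a1A La1 a'A La']]] : exists s1 s', [/\ s1 \in A, touch L [set s1], s' \in A & touch L [set s'] = false].
    apply: (far A B a0 mL a0A) => // q qL qA; have /andP[_ qB] := LK q qL.
    have : P (A, q |: B).
      rewrite /P /= A2 (leq_trans B2) ?subset_leq_card ?subsetUr // !andbT; apply/completeP => x y xA.
      by move=> /setU1P[->|yB]; [rewrite adj_sym; apply: qA | apply: AB].
    by move=> /max /=; rewrite cardsU1 qB; clear; lia.
  have [b1 [b' [b1B Lb1 b'B Lb']]] : exists s1 s', [/\ s1 \in B, touch L [set s1], s' \in B & touch L [set s'] = false].
    apply: (far B A b0 (minlinkC mL) b0B) => // q qL qB; have /andP[qA _] := LK q qL.
    have : P (q |: A, B).
      rewrite /P /= B2 (leq_trans A2) ?subset_leq_card ?subsetUr // !andbT; apply/completeP => x y.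
      by move=> /setU1P[->|xA] yB; [apply: qB | apply: AB].
    by move=> /max /=; rewrite cardsU1 qA; clear; lia.
  have : touch L ([set a'] :|: [set b']).
    have nL z : z \in K -> z \notin L.
      by rewrite in_setU; apply: contraTN => /LK/andP[/negbTE-> /negbTE->].
    have nA z : z \in A -> z \notin L by move=> zA; apply: nL; rewrite in_setU zA.
    have nB z : z \in B -> z \notin L by move=> zB; apply: nL; rewrite in_setU zB orbT.
    have [aa bb] : a1 != a' /\ b1 != b'.
      by split; [apply: contraTneq La1 => -> | apply: contraTneq Lb1 => ->]; rewrite ?La' ?Lb'.
    have nab x y : x \in A -> y \in B -> x != y by move=> xA yB; apply: contraTneq yB => <-; apply: dAB.
    apply: (gG (x := a1) (y := b1)); rewrite /theta AB // cL conn_touch ?conn1 ?touch1 ?AB //.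
    rewrite disjUr !disj1r (nA a1) // (nB b1) // (nA a') // (nB b') // !in_setU !in_set1 !negb_or.
    rewrite aa bb (nab a1 b') // (eq_sym b1 a') (nab a' b1) //= ![touch [set _] L]touchC La1 Lb1.
    by rewrite !touchUr !touch1 (AB a1 b') // (adj_sym b1 a') (AB a' b1) // orbT.
  by rewrite touchUr La' Lb'.
pose X := A :|: [set z in ~: K | touch (comp (~: K) z) A].
have inX z : z \notin K -> (z \in X) = touch (comp (~: K) z) A.
  move=> zK; rewrite in_setU in_set in_setC zK /=; case zA: (z \in A) => //.
  by rewrite in_setU zA in zK.
have BX : {in B, forall z, z \notin X}.
  move=> z zB; rewrite in_setU in_set in_setC negb_or in_setU zB orbT /= andbT.
  by apply: contraTN zB; apply: dAB.
have AX : A \subset X by apply: subsetUl.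
have cross z z' : z \in X -> z' \notin X -> adj z z' = (z \in A) && (z' \in B).
  move=> zX z'X; apply/idP/andP => [zz|[zA z'B]]; last exact: AB.
  have z'A : z' \notin A by apply: contra z'X; apply: (subsetP AX).
  have [zK|zK] := boolP (z \in K).
    have zA : z \in A by move: zK; rewrite in_setU => /orP[//|/BX]; rewrite zX.
    split=> //; apply: contraNT z'X => z'B.
    have z'K : z' \notin K by rewrite in_setU negb_or z'A.
    by rewrite inX //; apply/touchP; exists z', z; rewrite comp_refl adj_sym.
  have tz : touch (comp (~: K) z) A by rewrite -inX.
  have zK' : z \in ~: K by rewrite in_setC.
  have [z'K|z'K] := boolP (z' \in K).
    have z'B : z' \in B by move: z'K; rewrite in_setU (negbTE z'A).
    by have := key z zK tz; move/negbT/touchPn/(_ z z' (comp_refl _ _) z'B); rewrite zz.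
  case/negP: z'X; rewrite inX // -(comp_eq zK') //; apply: (comp_closed zK' (comp_refl _ _) _ zz).
  by rewrite in_setC.
have [b1 b1B b10] : exists2 b1, b1 \in B & b1 != b0 by apply: exists_other.
have [a1 a1A a10] : exists2 a1, a1 \in A & a1 != a0 by apply: exists_other.
exists (induced (b0 |: X)), (induced (a0 |: ~: X)); split.
- exact: good_induced.
- exact: good_induced.
- by apply: (@induced_small _ _ b1); rewrite in_setU1 negb_or b10 BX.
- by apply: (@induced_small _ _ a1); rewrite in_setU1 negb_or a10 in_setC negbK (subsetP AX).
exact: (split_O2 AX BX cross stA stB A2 B2 a0A b0B).
Qed.

(** A block is good because a component of the other side meets both [s] and [t] and can be
    contracted to the marker; it is smaller than [G] because the other side has two nodes. *)
Lemma cutset_O3 s t X : s != t -> ~~ adj s t -> 3 <= deg s -> 3 <= deg t -> s \notin X -> t \notin X ->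
  touch X (~: (X :|: [set s; t])) = false -> 2 <= #|X| -> 2 <= #|~: (X :|: [set s; t])| ->
  exists G1 G2, [/\ good G1, good G2, #|G1| < #|G|, #|G2| < #|G| & O3 G1 G2 G].
Proof.
move=> st nst ds dt sX tX; set Y := ~: _ => XY X2 Y2.
have [sY tY] : s \notin Y /\ t \notin Y by rewrite !in_setC !in_setU !in_set1 !eqxx !orbT.
have cov z : z != s -> z != t -> (z \in X) = (z \notin Y).
  by move=> zs zt; rewrite in_setC negbK in_setU in_set2 (negbTE zs) (negbTE zt) !orbF.
have YX : touch Y X = false by rewrite touchC.
(* A component seeing only one of [s] and [t] would make it a cutnode. *)
have sideP (S T : {set G}) z : s \notin S -> t \notin S -> s \notin T -> t \notin T ->
    (forall w, w != s -> w != t -> (w \in S) = (w \notin T)) -> touch S T = false -> z \in S ->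
    [/\ conn (comp S z), comp S z \subset S, touch (comp S z) [set s] & touch (comp S z) [set t]].
  move=> sS tS sT tT cv nt zS; have cS := comp_sub zS.
  have [sC tC] : s \notin comp S z /\ t \notin comp S z by split; apply: subset_notin cS _.
  have C0 : comp S z != set0 by apply/set0Pn; exists z; apply: comp_refl.
  have exit u w : u \in comp S z -> w \notin comp S z -> adj u w -> (w == s) || (w == t).
    move=> uC wC uw; apply: contraT; rewrite negb_or => /andP[ws wt].
    have [wS|wS] := boolP (w \in S); first by rewrite (comp_closed zS uC wS uw) in wC.
    have wT : w \in T by apply: contraNT wS; rewrite (cv w ws wt).
    by move/negbT/touchPn: nt => /(_ u w (subsetP cS u uC) wT); rewrite uw.
  split=> //; first exact: comp_conn.
    have [u [w [uC wC wt uw]]] := two_exits tC sC st C0.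
    have := exit u w uC wC uw; rewrite (negbTE wt) orbF => /eqP ws.
    by rewrite ws in uw; apply/touchP; exists u, s; rewrite inE.
  have [u [w [uC wC wt uw]]] : exists u w, [/\ u \in comp S z, w \notin comp S z, w != s & adj u w].
    by apply: (two_exits sC tC _ C0); rewrite eq_sym.
  have := exit u w uC wC uw; rewrite (negbTE wt) /= => /eqP ws.
  by rewrite ws in uw; apply/touchP; exists u, t; rewrite inE.
have sideX z := sideP X Y z sX tX sY tY cov XY.
have cov' z : z != s -> z != t -> (z \in Y) = (z \notin X) by move=> zs zt; rewrite cov // negbK.
have sideY z := sideP Y X z sY tY sX tX cov' YX.
have connS (S : {set G}) : (exists z, z \in S) -> (forall z, z \in S ->
    [/\ conn (comp S z), comp S z \subset S, touch (comp S z) [set s] & touch (comp S z) [set t]]) ->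
    conn (S :|: [set s; t]).
  move=> [z0 z0S] H; have sS : s \in S :|: [set s; t] by rewrite in_setU set21 orbT.
  have toS z : z \in S -> connect (adj_in (S :|: [set s; t])) s z.
    move=> zS; have [cC CS Cs _] := H z zS.
    have cCs : conn (comp S z :|: [set s]) by apply: conn_touch (conn1 s) Cs.
    apply: connect_inS (_ : comp S z :|: [set s] \subset _) _; last first.
      by apply: (connP _ cCs); rewrite in_setU ?set11 ?orbT ?comp_refl.
    by rewrite subUset (subset_trans CS (subsetUl _ _)) sub1set.
  apply: (conn_hub sS) => y; rewrite in_setU => /orP[/toS //|/set2P[->|->]]; first exact: connect0.
  have [_ CS _ /touchP[u [t' [uC /set1P-> ut]]]] := H z0 z0S.
  have uS := subsetP CS u uC; apply: connect_trans (toS u uS) (connect1 _).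
  by rewrite /adj_in ut !in_setU uS !in_set1 eqxx !orbT.
have [x0 x0X] : exists x0, x0 \in X by apply/set0Pn; rewrite -card_gt0 (ltn_trans _ X2).
have [y0 y0Y] : exists y0, y0 \in Y by apply/set0Pn; rewrite -card_gt0 (ltn_trans _ Y2).
have [x1 x1X x10] := exists_other x0 X2; have [y1 y1Y y10] := exists_other y0 Y2.
have nX z : z \in X -> z \notin Y :|: [set s; t].
  move=> zX; have [zs zt] : z != s /\ z != t by split; apply: contraTneq zX => ->.
  by rewrite in_setU in_set2 (negbTE zs) (negbTE zt) !orbF -cov.
have nY z : z \in Y -> z \notin X :|: [set s; t] by rewrite in_setC.
exists (block X s t), (block Y s t); split.
- have [cD DS Ds Dt] := sideY y0 y0Y; apply: block_good gG st cD _ _ Ds Dt.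
    by apply: disjointI => z /(subsetP DS)/nY.
  exact: ntouchS DS (subxx _) YX.
- have [cD DS Ds Dt] := sideX x0 x0X; apply: block_good gG st cD _ _ Ds Dt.
    by apply: disjointI => z /(subsetP DS)/nX.
  exact: ntouchS DS (subxx _) XY.
- exact: block_small (nY y1 y1Y) (nY y0 y0Y) y10.
- exact: block_small (nX x1 x1X) (nX x0 x0X) x10.
apply: split_O3 => //; apply: connS => //; [by exists x0 | by exists y0].
Qed.
End Decompose.

(** The order of the tests matters: the absence of cutnodes turns a graph with a triangle into a
    clique and makes the components at a 2-cutset meet both of its nodes, and the join at a square
    needs that there are no triangles. *)
Theorem good_obtained (G : sgraph) : good G -> obtained_from_basic G.
Proof.
have [n] := ubnP #|G|; elim: n G => // n IH G lt gG.
have {}IH (H : sgraph) : #|H| < #|G| -> good H -> obtained_from_basic H.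
  by move=> HG; apply: IH; apply: leq_trans HG _; rewrite -ltnS.
have [cG|ncG] := boolP (conn [set: G]); last first.
  have [x [y xy]] : exists x y : G, ~~ connect (adj_in [set: G]) x y.
    move: ncG => /forall_inPn[x _ /forall_inPn[y _ xy]]; by exists x, y.
  set C := comp setT x; have xC : x \in C := comp_refl _ _; have yC : y \notin C by rewrite inE.
  have tC : touch C (~: C) = false by rewrite -setTD; apply: comp_anti; rewrite inE.
  apply: obtained_O0 (split_O0 tC); apply: IH; try exact: good_induced.
    exact: induced_small yC.
  by apply: (@induced_small _ _ x); rewrite in_setC negbK.
have [/forallP c1|/forallPn[v nv]] := boolP [forall v : G, conn (~: [set v])]; last first.
  move: nv => /forall_inPn[x xv /forall_inPn[y yv xy]].
  set C := comp (~: [set v]) x; have xC : x \in C := comp_refl _ _; have yC : y \notin C by rewrite inE.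
  have Cv : C \subset ~: [set v] := comp_sub xv.
  have vC : v \notin C by apply/negP => /(subsetP Cv); rewrite !inE eqxx.
  have vD : v \notin ~: [set v] :\: C by rewrite !inE eqxx andbF.
  have [xv' yv'] : x != v /\ y != v by move: xv yv; rewrite !inE.
  have O : O1 (induced (v |: C)) (induced (v |: (~: [set v] :\: C))) G.
    apply: split_O1 => //; last exact: comp_anti.
    by move=> z zv; rewrite in_setD in_setC in_set1 zv andbT negbK.
  apply: obtained_O1 O; apply: IH; try exact: good_induced.
    by apply: (@induced_small _ _ y); rewrite in_setU1 negb_or yv'.
  by apply: (@induced_small _ _ x); rewrite in_setU1 negb_or xv' in_setD negb_and xC.
have [/existsP[x /existsP[y /existsP[z /and3P[xy yz zx]]]]|no3] :=
    boolP [exists x : G, exists y : G, exists z : G, [&& adj x y, adj y z & adj z x]].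
  apply: obtained_basic; split; first by apply/conn_setT.
  by constructor 1; exact: (triangle_clique gG c1 xy yz zx).
have c3 (x y z : G) : adj x y -> adj y z -> adj z x -> False.
  by move=> xy yz zx; case/negP: no3; do 3 apply/existsP; exists x; apply/existsP; exists y; apply/existsP; exists z; rewrite xy yz.
have [/existsP[[[[a b] c] d] /and5P[/= ab bc cd da /andP[ac bd]]]|no4] :=
    boolP [exists q : G * G * G * G, [&& adj q.1.1.1 q.1.1.2, adj q.1.1.2 q.1.2, adj q.1.2 q.2,
      adj q.2 q.1.1.1 & (q.1.1.1 != q.1.2) && (q.1.1.2 != q.2)]].
  have [G1 [G2 [g1 g2 l1 l2 o]]] := square_O2 gG c3 ab bc cd da ac bd.
  exact: obtained_O2 (IH _ l1 g1) (IH _ l2 g2) o.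
have c4 (x y z w : G) : adj x y -> adj y z -> adj z w -> adj w x -> x != z -> y != w -> False.
  move=> xy yz zw wx xz yw; case/negP: no4; apply/existsP; exists (x, y, z, w).
  by rewrite /= xy yz zw wx xz.
have [/existsP[[[s t] X] /and5P[/= st nst ds dt /and5P[sX tX XY X2 Y2]]]|no2] :=
    boolP [exists q : G * G * {set G}, [&& q.1.1 != q.1.2, ~~ adj q.1.1 q.1.2, 3 <= deg q.1.1,
      3 <= deg q.1.2 & [&& q.1.1 \notin q.2, q.1.2 \notin q.2,
        ~~ touch q.2 (~: (q.2 :|: [set q.1.1; q.1.2])), 2 <= #|q.2| &
        2 <= #|~: (q.2 :|: [set q.1.1; q.1.2])|]]].
  have [G1 [G2 [g1 g2 l1 l2 o]]] := cutset_O3 gG c1 st nst ds dt sX tX (negbTE XY) X2 Y2.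
  exact: obtained_O3 (IH _ l1 g1) (IH _ l2 g2) o.
apply/obtained_basic/core_basic; split=> // s t X st nst ds dt sX tX XY X2 Y2.
by case/negP: no2; apply/existsP; exists (s, t, X); rewrite /= st nst ds dt sX tX XY X2.
Qed.

Theorem theorem4p2 (G : sgraph) :
  (no_cycle_with_unique_chord G -> basic G \/ obtained_from_basic G) /\
  (obtained_from_basic G -> no_cycle_with_unique_chord G).
Proof.
split=> [/good_of_C/good_obtained|/obtained_good/C_of_good //].
by right.
Qed.
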